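(* Let $\lambda$ be a dominant coweight, let $\gamma_\lambda=\gamma_{\omega_{i_1}}*\cdots*\gamma_{\omega_{i_s}}$ be a concatenation of fundamental galleries with $\sum_{j=1}^s\omega_{i_j}=\lambda$, and let $V(\lambda)$ be the irreducible representation of highest weight $\lambda$ of the Lie algebra $\mathfrak g^\vee$ of the Langlands dual group $G^\vee$ of $G$. Then $$\mathrm{Char}\,V(\lambda)=\sum_\delta e^{\mathrm{target}(\delta)},$$ where the sum runs over all LS-galleries $\delta$ of the same type as $\gamma_\lambda$.
   Context: **Root data and apartment.** $G$ is a connected complex semisimple group with maximal torus $T$, roots $\Phi$, positive roots $\Phi^+$, simple roots $\alpha_1,\dots,\alpha_n$, $\rho$ half the sum of the positive roots, Weyl group $W$ (Bruhat order). $\mathbb A=X^\vee\otimes\mathbb R$ with origin $\mathfrak o$, $X^\vee$ the cocharacter group; the fundamental coweights $\omega_i\in\mathbb A$ satisfy $\langle\omega_i,\alpha_j\rangle=\delta_{ij}$. For $\alpha\in\Phi,n\in\mathbb Z$: $H_{\alpha,n}=\{x:\langle\alpha,x\rangle+n=0\}$, $H^\pm_{\alpha,n}$ the closed half-spaces $\pm(\langle\alpha,x\rangle+n)\ge0$, $s_{\alpha,n}$ the affine reflection $x\mapsto x-(\langle\alpha,x\rangle+n)\alpha^\vee$, $W^{\mathfrak a}$ the group they generate. Faces of $\mathbb A$ are the closed faces of this hyperplane arrangement; vertices and edges are faces of dimension $0$ and $1$; $F^o$ is the open face. A vertex is special if for every root $\alpha$ it lies on some $H_{\alpha,n}$. $C^+$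 is the closed dominant Weyl chamber, $C^-=-C^+$. The type of a face is the unique face of the fundamental alcove $\{0\le\langle\alpha,x\rangle\le1\ \forall\alpha\in\Phi^+\}$ which is $W^{\mathfrak a}$-conjugate to it. A sector with vertex $V$ is $\mathfrak s=V+\tau(C^+)$, $\tau\in W$; $-\mathfrak s=V-\tau(C^+)$; its class $\underline{\mathfrak s}$ is given by $\tau$, and classes are ordered by the Bruhat order on the $\tau$'s. A wall separates $\Omega$ from a face $F$ if $\Omega$ lies in a closed half-space of it and $F^o$ in the opposite open half-space. **Galleries.** A combinatorial one-skeleton gallery is a sequence $(V_0\subset E_0\supset V_1\subset\cdots\subset E_r\supset V_{r+1})$ of vertices $V_i$ and edges $E_i$ of $\mathbb A$ with $V_0$ (source) and $V_{r+1}$ (target) special. Its type is the sequence of types of its faces; galleries ''of the same type as $\gamma_\lambda$'' are taken to start in $\mathfrak o$. $\gamma*\gamma'$ denotes concatenation, after translating $\gamma'$ so that its source is the target of $\gamma$. For a fundamental coweight $\omega$, the fundamental gallery $\gamma_\omega$ is the gallery of consecutive vertices and edges on the segment from $\mathfrak o$ to $\omega$. **Positively folded.** $(E\supset V\subset F)$ is minimal if there is a sector $\mathfrak s$ with vertex $V$ with $E\subset\mathfrak s$, $F\subset-\mathfrak s$. $(E\supset V\subset F')$ is obtained from $(E\supset V\subset F)$ by a positive folding if there is $(\beta,n)$ with $V\in H_{\beta,n}$, $F'=s_{\beta,n}(F)$ and $H_{\beta,n}$ separates $F\cup(V+C^-)$ from $F'$. $(E\supset V\subset F)$ is positively folded if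 it is minimal or obtained from a minimal $(E\supset V\subset F_0)$ by a finite sequence of positive foldings. A gallery is positively folded if every $(E_{i-1}\supset V_i\subset E_i)$ is positively folded and there are sectors $\mathfrak s_i$ with vertex $V_i$, $E_i\subset\mathfrak s_i$ ($0\le i\le r$), and $\underline{\mathfrak s}_0\ge\cdots\ge\underline{\mathfrak s}_r$. **LS-galleries.** For a vertex $V$ of an edge $E$ and a wall $H_{\alpha,n}\ni V$, $\alpha>0$, $(V,E)$ crosses $H_{\alpha,n}$ positively if $E\not\subset H^-_{\alpha,n}$. $\sharp^+\delta$ is the total number, over $i=0,\dots,r$, of positive wall crossings of $(V_i,E_i)$. An LS-gallery of the same type as $\gamma_\lambda$ is a positively folded combinatorial gallery $\delta$ of this type with $\sharp^+\delta=\langle\lambda+\mu,\rho\rangle$, $\mu$ the target of $\delta$. *)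

(* Defs.v *)
From HB Require Import structures.
From mathcomp Require Import all_boot all_order all_algebra.
From mathcomp Require Import boolp classical_sets functions cardinality fsbigop.
From mathcomp Require Import reals complex monalg.
From Stdlib Require Import Relation_Operators.

Set Implicit Arguments.
Unset Strict Implicit.
Unset Printing Implicit Defensive.

Import Order.TTheory GRing.Theory Num.Theory.
Local Open Scope classical_set_scope.
Local Open Scope ring_scope.

Definition dot (K : pzRingType) (n : nat) (x y : 'rV[K]_n) : K :=
  \sum_(i < n) x 0 i * y 0 i.

(* A root datum (X, Phi, X^vee, Phi^vee) of rank n.  Dual Z-bases of X and X^vee
   are fixed, so both lattices are 'rV[int]_n and the pairing between them is
   [dot].  The finite sets Phi and Phi^vee are given together with the bijection
   alpha |-> alpha^vee, as two injective families over the same index type. *)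
Record rootDatum (n : nat) := RootDatum {
  Phi : finType;
  root_of : Phi -> 'rV[int]_n;
  coroot_of : Phi -> 'rV[int]_n;
  root_of_inj : injective root_of;
  coroot_of_inj : injective coroot_of;
  root_coroot : forall a, dot (root_of a) (coroot_of a) = 2;
  root_reflection : forall a b, exists c,
    root_of c = root_of b - dot (root_of b) (coroot_of a) *: root_of a;
  coroot_reflection : forall a b, exists c,
    coroot_of c = coroot_of b - dot (coroot_of b) (root_of a) *: coroot_of a
}.

Lemma dotC (n : nat) (x y : 'rV[int]_n) : dot x y = dot y x.
Proof. by apply: eq_bigr => i _; rewrite mulrC. Qed.

Lemma dual_root_coroot (n : nat) (D : rootDatum n) (a : Phi D) :
  dot (coroot_of a) (root_of a) = 2.
Proof. by rewrite dotC root_coroot. Qed.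

(* The root datum of the Langlands dual group. *)
Definition dual_datum (n : nat) (D : rootDatum n) : rootDatum n :=
  RootDatum (@coroot_of_inj n D) (@root_of_inj n D) (@dual_root_coroot n D)
    (@coroot_reflection n D) (@root_reflection n D).

(* Connected complex semisimple groups with a maximal torus correspond to the
   root data that are reduced and semisimple. *)
Definition reduced_datum (n : nat) (D : rootDatum n) : Prop :=
  forall (a b : Phi D) (p q : int), p != 0 ->
    p *: root_of b = q *: root_of a ->
    root_of b = root_of a \/ root_of b = - root_of a.

Definition semisimple_datum (n : nat) (D : rootDatum n) : Prop :=
  <<[seq map_mx intr (root_of a) | a <- enum (Phi D)]>>%VS
  = fullv :> {vspace 'rV[rat]_n}.

Section Base.
Variables (n : nat) (D : rootDatum n) (S : 'I_n -> Phi D).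

Definition positive_root (a : Phi D) : bool :=
  `[< exists c : 'I_n -> nat, root_of a = \sum_i root_of (S i) *+ c i >].

Definition is_base : Prop :=
  free [seq map_mx intr (root_of (S i)) : 'rV[rat]_n | i <- enum 'I_n] /\
  forall a : Phi D, positive_root a \/
    exists c : 'I_n -> nat, root_of a = - \sum_i root_of (S i) *+ c i.

End Base.

Section Apartment.
Variables (R : realType) (n : nat) (D : rootDatum n).
Local Notation A := 'rV[R]_n.

Definition pair (a : Phi D) (x : A) : R := dot (map_mx intr (root_of a)) x.

Definition wall (a : Phi D) (k : int) : set A :=
  [set x | pair a x + k%:~R = 0].
Definition halfpos (a : Phi D) (k : int) : set A :=
  [set x | 0 <= pair a x + k%:~R].
Definition halfneg (a : Phi D) (k : int) : set A :=
  [set x | pair a x + k%:~R <= 0].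

Definition arefl (a : Phi D) (k : int) (x : A) : A :=
  x - (pair a x + k%:~R) *: map_mx intr (coroot_of a).

(* Reflections are involutions, so their products already form a group. *)
Inductive affine_weyl : (A -> A) -> Prop :=
| affine_weyl_id : affine_weyl id
| affine_weyl_refl a k w : affine_weyl w -> affine_weyl (arefl a k \o w).

Inductive weyl : (A -> A) -> Prop :=
| weyl_id : weyl id
| weyl_refl a w : weyl w -> weyl (arefl a 0 \o w).

(* The smallest closed face containing x. *)
Definition closed_face (x : A) : set A :=
  [set y | forall a k, (halfpos a k x -> halfpos a k y) /\
                       (halfneg a k x -> halfneg a k y)].

Definition is_face (F : set A) : Prop := exists x, F = closed_face x.

Definition open_face (F : set A) : set A := [set x | closed_face x = F].

(* The direction space of the affine span of F has dimension d. *)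
Definition aff_dim (F : set A) (d : nat) : Prop :=
  exists U : {vspace A},
    [/\ \dim U = d, forall x y, F x -> F y -> x - y \in U
      & forall U' : {vspace A},
          (forall x y, F x -> F y -> x - y \in U') -> (U <= U')%VS].

Definition is_vertex (v : A) : Prop := is_face [set v].

Definition is_edge (E : set A) : Prop := is_face E /\ aff_dim E 1.

Definition special (v : A) : Prop :=
  is_vertex v /\ forall a, exists k, wall a k v.

Definition segment (x y : A) : set A :=
  [set (1 - t) *: x + t *: y | t in [set t : R | 0 <= t <= 1]].

(* V_0 together with the list of the (E_i, V_{i+1}); an empty list is the
   trivial gallery, the empty concatenation obtained for lambda = 0. *)
Definition gallery : Type := (A * seq (set A * A))%type.

Definition vertices (g : gallery) : seq A := g.1 :: [seq p.2 | p <- g.2].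
Definition edges (g : gallery) : seq (set A) := [seq p.1 | p <- g.2].
Definition vtx (g : gallery) (i : nat) : A := nth 0 (vertices g) i.
Definition edg (g : gallery) (i : nat) : set A := nth set0 (edges g) i.
Definition source (g : gallery) : A := g.1.
Definition target (g : gallery) : A := last 0 (vertices g).

Definition combinatorial (g : gallery) : Prop :=
  [/\ special (source g), special (target g),
      forall i, (i <= size g.2)%N -> is_vertex (vtx g i)
    & forall i, (i < size g.2)%N ->
        [/\ is_edge (edg g i), edg g i (vtx g i) & edg g i (vtx g i.+1)]].

Definition translate (t : A) (g : gallery) : gallery :=
  (g.1 + t, [seq ([set x + t | x in p.1], p.2 + t) | p <- g.2]).

Definition gal_cat (g g' : gallery) : gallery :=
  (g.1, g.2 ++ (translate (target g - source g') g').2).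

Definition gal_concat (gs : seq gallery) : gallery :=
  foldl gal_cat (0, [::]) gs.

(* Strictly increasing parameters: the gallery runs along the segment from 0 to
   om through consecutive vertices, without backtracking. *)
Definition fundamental_gallery (om : A) (g : gallery) : Prop :=
  [/\ combinatorial g, source g = 0, target g = om,
      forall i, (i < size g.2)%N -> edg g i `<=` segment 0 om
    & exists t : nat -> R,
        (forall i, (i <= size g.2)%N -> vtx g i = t i *: om) /\
        (forall i, (i < size g.2)%N -> t i < t i.+1)].

Definition separates (a : Phi D) (k : int) (Om F : set A) : Prop :=
  (Om `<=` halfpos a k /\ open_face F `<=` ~` halfpos a k) \/
  (Om `<=` halfneg a k /\ open_face F `<=` ~` halfneg a k).

Variable S : 'I_n -> Phi D.

Definition Cplus : set A := [set x | forall i, 0 <= pair (S i) x].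

Definition dominant_coweight (la : A) : Prop :=
  Cplus la /\ forall a, pair a la \is a Num.int.

Definition fund_alcove : set A :=
  [set x | forall a, positive_root S a -> 0 <= pair a x <= 1].

Definition face_type (F : set A) : set A :=
  xget set0 [set T | [/\ is_face T, T `<=` fund_alcove
                       & exists2 w, affine_weyl w & w @` F = T]].

Definition gallery_type (g : gallery) : seq (set A) * seq (set A) :=
  ([seq face_type [set v] | v <- vertices g],
   [seq face_type E | E <- edges g]).

Definition word (s : seq 'I_n) : A -> A :=
  foldr (fun i w => arefl (S i) 0 \o w) id s.

Definition weyl_length (w : A -> A) (l : nat) : Prop :=
  (exists2 s, word s = w & size s = l) /\
  forall s, word s = w -> (l <= size s)%N.

Definition bruhat_step (u v : A -> A) : Prop :=
  exists a lu lv, [/\ v = u \o arefl a 0, weyl_length u lu, weyl_length v lv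
                    & (lu < lv)%N].

(* bruhat u v means u <= v. *)
Definition bruhat : (A -> A) -> (A -> A) -> Prop := clos_refl_trans _ bruhat_step.

Definition sector (v : A) (tau : A -> A) : set A :=
  [set v + tau x | x in Cplus].
Definition opp_sector (v : A) (tau : A -> A) : set A :=
  [set v - tau x | x in Cplus].

Definition minimal_at (E : set A) (v : A) (F : set A) : Prop :=
  exists2 tau, weyl tau & E `<=` sector v tau /\ F `<=` opp_sector v tau.

(* [opp_sector v id] is v + C^-. *)
Definition positive_folding (v : A) (F F' : set A) : Prop :=
  exists b k, [/\ wall b k v, F' = arefl b k @` F
                & separates b k (F `|` opp_sector v id) F'].

Definition positively_folded_at (E : set A) (v : A) (F : set A) : Prop :=
  exists F0, [/\ is_edge F0, F0 v, minimal_at E v F0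
               & clos_refl_trans _ (positive_folding v) F0 F].

Definition positively_folded (g : gallery) : Prop :=
  (forall i, (i.+1 < size g.2)%N ->
     positively_folded_at (edg g i) (vtx g i.+1) (edg g i.+1)) /\
  exists tau : nat -> A -> A,
    (forall i, (i < size g.2)%N ->
       weyl (tau i) /\ edg g i `<=` sector (vtx g i) (tau i)) /\
    (forall i, (i.+1 < size g.2)%N -> bruhat (tau i.+1) (tau i)).

(* For each positive root a, at most one wall of direction a contains a given
   vertex, so positive crossings at (V_i, E_i) are counted by such roots. *)
Definition crossings (g : gallery) : nat :=
  (\sum_(i < size g.2)
     #|[pred a : Phi D | positive_root S a &&
         `[< exists k, wall a k (vtx g i) /\
                       ~ (edg g i `<=` halfneg a k) >]]|)%N.

Definition half_sum : 'rV[R]_n :=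
  2^-1 *: \sum_(a | positive_root S a) map_mx intr (root_of a).

Definition LS_galleries (la : A) (gla : gallery) : set gallery :=
  [set d | [/\ combinatorial d, source d = 0,
               gallery_type d = gallery_type gla, positively_folded d
             & (crossings d)%:R = dot half_sum (la + target d)]].

End Apartment.

Record lieAlgebra (K : fieldType) := LieAlgebra {
  lie_sort :> vectType K;
  ad : 'Hom(lie_sort, 'End(lie_sort));
  ad_alt : forall x, ad x x = 0;
  ad_jacobi : forall x y z,
    ad x (ad y z) + ad y (ad z x) + ad z (ad x y) = 0
}.

Definition lie (K : fieldType) (g : lieAlgebra K) (x y : g) : g := ad g x y.

Section LieTheory.
Variables (K : fieldType) (g : lieAlgebra K).

Definition derived (U : {vspace g}) : {vspace g} :=
  <<[seq lie x y | x <- vbasis U, y <- vbasis U]>>%VS.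

Definition solvable_sub (U : {vspace g}) : Prop :=
  exists k, iter k derived U = 0%VS.

Definition ideal (I : {vspace g}) : Prop := forall x, (ad g x @: I <= I)%VS.

Definition semisimple_lie : Prop :=
  forall I, ideal I -> solvable_sub I -> I = 0%VS.

Definition is_rep (V : vectType K) (rho : 'Hom(g, 'End(V))) : Prop :=
  forall x y v, rho (lie x y) v = rho x (rho y v) - rho y (rho x v).

Definition irreducible_rep (V : vectType K) (rho : 'Hom(g, 'End(V))) : Prop :=
  (fullv : {vspace V}) != 0%VS /\
  forall U : {vspace V}, (forall x, (rho x @: U <= U)%VS) ->
    U = 0%VS \/ U = fullv.

Variables (n : nat) (iota : 'Hom('rV[K]_n, g)).

(* iota embeds the Cartan subalgebra; a weight m is the linear form [dot m] on
   it.  By linearity the weight condition is tested on the standard basis. *)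
Definition weight_space (V : vectType K) (rho : 'Hom(g, 'End(V))) (m : 'rV[K]_n) :
    {vspace V} :=
  (\bigcap_(i < n) passmx.leigenspace (rho (iota (delta_mx 0%R i))) (m 0%R i))%VS.

(* g is the Lie algebra of the semisimple group with root datum D: its Cartan
   subalgebra Lie(T) is X^vee (x) K, embedded by iota, and its roots are Phi. *)
Definition is_lie_algebra_of (D : rootDatum n) : Prop :=
  [/\ semisimple_lie,
      lker iota = 0%VS,
      limg iota = weight_space (ad g) 0,
      forall b : 'rV[K]_n,
        (b != 0 /\ weight_space (ad g) b != 0%VS) <->
        exists a : Phi D, b = map_mx intr (root_of a)
    & (limg iota + \sum_(a : Phi D) weight_space (ad g) (map_mx intr (root_of a)))%VS
      = fullv].

Definition has_highest_weight (D : rootDatum n) (S : 'I_n -> Phi D)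
    (V : vectType K) (rho : 'Hom(g, 'End(V))) (la : 'rV[K]_n) : Prop :=
  exists v, [/\ v != 0, v \in weight_space rho la
    & forall (a : Phi D) x, positive_root S a ->
        x \in weight_space (ad g) (map_mx intr (root_of a)) -> rho x v = 0].

(* An element of the group ring of the additive group of weights: << k *g m >>
   stands for k e^m.  The sum has finite support as V has finite dimension. *)
Definition character (V : vectType K) (rho : 'Hom(g, 'End(V))) :
    {malg int['rV[K]_n]} :=
  \sum_(m \in [set: 'rV[K]_n]) << (\dim (weight_space rho m))%:Z *g m >>.

End LieTheory.

(* X^vee (x) R inside X^vee (x) C, the weights of the Cartan subalgebra of the
   dual Lie algebra. *)
Definition complexify (R : realType) (n : nat) (x : 'rV[R]_n) : 'rV[R[i]]_n :=
  map_mx (real_complex R) x.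

(* Main.v *)
Require Import Defs.
From mathcomp Require Import all_boot all_order all_algebra.
From mathcomp Require Import boolp classical_sets functions cardinality fsbigop.
From mathcomp Require Import reals complex monalg.
From mathcomp Require Import ring lra zify.
From Stdlib Require Import Relation_Operators.
From Stdlib Require Operators_Properties.

Set Implicit Arguments.
Unset Strict Implicit.
Unset Printing Implicit Defensive.

Import Order.TTheory GRing.Theory Num.Theory.
Local Open Scope classical_set_scope.
Local Open Scope ring_scope.

(** Both sides are shown to satisfy the same identity of Weyl type.

    Galleries.  A gallery of the type of [gamma_lambda] is determined by the directions
    of its edges, each of which is a Weyl conjugate of a fundamental coweight.  At a
    vertex reached after the fraction [t] of a fundamental coweight, a positive folding
    replaces the direction [nu] by [s_b nu], where [<b, nu> < 0] and [t <b, nu>] is an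
    integer; at a special vertex positive foldedness is the Bruhat condition on the
    sectors.  Counting crossings edge by edge, [crossings_excess] shows that the number
    of positive crossings is [<lambda + mu, rho>] plus one local term for each bend.
    The local term is a difference of values of [defect], and no positive folding
    decreases the defect ([defect_mono]).  Hence a gallery is LS if and only if all its
    bends are tight, and LS-galleries correspond to the sequences of directions
    satisfying [model] ([gal_of_LS] and its converse [LS_model]).

    Paths.  For a simple root [alpha], the height of such a path over the [alpha]-walls
    attains its minimum on a wall, because a tight folding cannot make [alpha] increase
    from a negative value away from its walls ([tfold_sign_int]).  Root operators, which
    reflect the stretch between the minimal wall and the next one, therefore exist and
    cut the set of paths into strings that are symmetric under [s_alpha].  The proof
    that a reflected path is again a folded path rests on the lifting property of the
    Bruhat order and its analogue for local foldings.  Reversing the part of a string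
    below its top is an involution on the paths that leave the dominant chamber; it
    cancels their contributions to the alternating sum, and a path that stays in the
    chamber is not folded at all.  This is Weyl's formula for the multiplicities of the
    end points ([path_character]).

    Representations.  A subalgebra spanned by root vectors and without Cartan part is
    solvable by an argument of Engel type ([graded_solvable]), so semisimplicity makes
    the Killing form nondegenerate ([kap_nondeg]).  This gives one-dimensional root
    spaces, normalized root vectors and dual bases, hence a Casimir operator, which
    acts by a scalar on an irreducible representation with a highest weight
    ([casimir_scalar]).  Taking traces on weight spaces ([trace_equation]) and
    multiplying by the Weyl denominator turns the multiplicities into an antisymmetric
    eigenfunction of the Laplacian, and comparing lengths on the dominant chamber leaves
    the exponent [lambda + rho] only: this is Weyl's character formula
    ([weyl_character]).

    Multiplication by the Weyl denominator is injective on finitely supported functions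
    ([alt_rho_inj]), so weight multiplicities and end point multiplicities coincide.

    Finally, an affine Weyl group element carrying an edge to another one of the same
    type also matches their end points, because the fundamental alcove is a strict
    fundamental domain ([alcove_strict]). *)

(** * Roots and coroots in the apartment *)

Section Pairing.
Variables (R : realType) (n : nat) (D : rootDatum n).
Local Notation A := 'rV[R]_n.
Implicit Types (a b : Phi D) (x y : A).

Definition coroot a : A := map_mx intr (coroot_of a).

Definition refl a x : A := x - pair a x *: coroot a.

Lemma pairD a x y : pair a (x + y) = pair a x + pair a y.
Proof.
by rewrite /pair /dot -big_split; apply: eq_bigr => i _; rewrite !mxE mulrDr.
Qed.

Lemma pairZ a c x : pair a (c *: x) = c * pair a x.
Proof.
by rewrite /pair /dot mulr_sumr; apply: eq_bigr => i _; rewrite !mxE mulrCA.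
Qed.

Lemma pairN a x : pair a (- x) = - pair a x.
Proof. by rewrite -scaleN1r pairZ mulN1r. Qed.

Lemma pairB a x y : pair a (x - y) = pair a x - pair a y.
Proof. by rewrite pairD pairN. Qed.

Lemma pair0 a : pair a (0 : A) = 0.
Proof. by rewrite -(scale0r (0 : A)) pairZ mul0r. Qed.

Lemma pair_sum a (I : Type) (s : seq I) (P : pred I) (F : I -> A) :
  pair a (\sum_(i <- s | P i) F i) = \sum_(i <- s | P i) pair a (F i).
Proof.
exact: (big_morph (pair a) (pairD a) (pair0 a)).
Qed.

Lemma pair_coroot a b :
  pair a (coroot b) = (dot (root_of a) (coroot_of b))%:~R.
Proof.
by rewrite /pair /dot rmorph_sum; apply: eq_bigr => i _; rewrite !mxE rmorphM.
Qed.

Lemma pair_coroot_diag a : pair a (coroot a) = 2.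
Proof. by rewrite pair_coroot root_coroot. Qed.

Lemma pair_refl a x : pair a (refl a x) = - pair a x.
Proof. by rewrite /refl pairB pairZ pair_coroot_diag; lra. Qed.

Lemma reflD a x y : refl a (x + y) = refl a x + refl a y.
Proof. by rewrite /refl pairD scalerDl opprD addrACA. Qed.

Lemma reflZ a c x : refl a (c *: x) = c *: refl a x.
Proof. by rewrite /refl pairZ scalerBr scalerA. Qed.

Lemma reflN a x : refl a (- x) = - refl a x.
Proof. by rewrite -scaleN1r reflZ scaleN1r. Qed.

Lemma reflB a x y : refl a (x - y) = refl a x - refl a y.
Proof. by rewrite reflD reflN. Qed.

Lemma refl0 a : refl a 0 = 0.
Proof. by rewrite -(scale0r (0 : A)) reflZ !scale0r. Qed.

Lemma refl_sum a (I : Type) (s : seq I) (P : pred I) (F : I -> A) :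
  refl a (\sum_(i <- s | P i) F i) = \sum_(i <- s | P i) refl a (F i).
Proof. exact: (big_morph (refl a) (reflD a) (refl0 a)). Qed.

Lemma reflK a : involutive (refl a).
Proof.
by move=> x; rewrite {1}/refl pair_refl scaleNr opprK /refl subrK.
Qed.

Lemma refl_fix a x : pair a x = 0 -> refl a x = x.
Proof. by move=> h; rewrite /refl h scale0r subr0. Qed.

Lemma arefl0 a x : arefl a 0 x = refl a x.
Proof. by rewrite /arefl addr0. Qed.

Lemma arefl0E a : arefl a 0 = refl a :> (A -> A).
Proof. by apply/funext => x; rewrite arefl0. Qed.

Lemma pair_delta a i : pair a (delta_mx 0 i : A) = (root_of a 0 i)%:~R.
Proof.
rewrite /pair /dot (bigD1 i) //= big1 ?addr0 => [|j /negPf ji].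
  by rewrite !mxE !eqxx mulr1.
by rewrite !mxE ji andbF mulr0.
Qed.

Lemma pair_inj_root a b : (forall x, pair a x = pair b x) -> a = b.
Proof.
move=> h; apply: root_of_inj; apply/rowP => i.
by apply: (@intr_inj R); rewrite -!pair_delta.
Qed.

(** The datum only asserts that the reflected vector is a root; this chooses its index. *)
Definition root_refl a b : Phi D := projT1 (cid (root_reflection a b)).

Lemma pair_root_refl a b x : pair (root_refl a b) x = pair b (refl a x).
Proof.
rewrite /root_refl; case: cid => c hc /=; rewrite /refl pairB pairZ pair_coroot /pair hc /dot mulrC.
rewrite mulr_sumr -sumrB; apply: eq_bigr => i _.
rewrite !mxE rmorphB rmorphM /=; ring.
Qed.

Lemma root_reflK a : involutive (root_refl a).
Proof. by move=> b; apply: pair_inj_root => x; rewrite !pair_root_refl reflK. Qed.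

Definition opp_root a : Phi D := root_refl a a.

Lemma pair_opp a x : pair (opp_root a) x = - pair a x.
Proof. by rewrite pair_root_refl pair_refl. Qed.

Lemma opp_rootK : involutive opp_root.
Proof. by move=> b; apply: pair_inj_root => x; rewrite !pair_opp opprK. Qed.

Lemma root_refl_opp a b : root_refl a (opp_root b) = opp_root (root_refl a b).
Proof.
by apply: pair_inj_root => x; rewrite !(pair_root_refl, pair_opp).
Qed.

Lemma root_refl_diag a : root_refl a a = opp_root a. Proof. by []. Qed.

(** Invariant under the Weyl group because reflections permute the roots; it serves
    wherever some invariant scalar product is needed. *)
Definition form x y : R := \sum_(a : Phi D) pair a x * pair a y.

Lemma formC x y : form x y = form y x.
Proof. by apply: eq_bigr => a _; rewrite mulrC. Qed.

Lemma formDl x y z : form (x + y) z = form x z + form y z.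
Proof. by rewrite -big_split; apply: eq_bigr => a _; rewrite pairD mulrDl. Qed.

Lemma formZl c x z : form (c *: x) z = c * form x z.
Proof. by rewrite mulr_sumr; apply: eq_bigr => a _; rewrite pairZ mulrA. Qed.

Lemma formNl x z : form (- x) z = - form x z.
Proof. by rewrite -scaleN1r formZl mulN1r. Qed.

Lemma formBl x y z : form (x - y) z = form x z - form y z.
Proof. by rewrite formDl formNl. Qed.

Lemma formBr x y z : form z (x - y) = form z x - form z y.
Proof. by rewrite formC formBl !(formC z). Qed.

Lemma formDr x y z : form z (x + y) = form z x + form z y.
Proof. by rewrite formC formDl !(formC z). Qed.

Lemma formZr c x z : form z (c *: x) = c * form z x.
Proof. by rewrite formC formZl formC. Qed.

Lemma form_ge0 x : 0 <= form x x.
Proof. by apply: sumr_ge0 => a _; rewrite -expr2 sqr_ge0. Qed.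

Lemma form_refl a x y : form (refl a x) (refl a y) = form x y.
Proof.
rewrite /form [RHS](reindex_inj (inv_inj (root_reflK a))).
by apply: eq_bigr => b _; rewrite !pair_root_refl.
Qed.

Lemma form_coroot a y :
  2 * form (coroot a) y = form (coroot a) (coroot a) * pair a y.
Proof.
have h : refl a (coroot a) = - coroot a :> A.
  by rewrite /refl pair_coroot_diag scaler_nat mulr2n opprD addrA subrr add0r.
have := form_refl a (coroot a) y; rewrite h formNl /refl formBr formZr; lra.
Qed.

End Pairing.

Arguments formC {R n D}.
Arguments formDl {R n D}.
Arguments formZl {R n D}.
Arguments formNl {R n D}.
Arguments formBl {R n D}.
Arguments formBr {R n D}.
Arguments formDr {R n D}.
Arguments formZr {R n D}.
Arguments form_ge0 {R n D}.

Arguments coroot {R n D}.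

(** * Weights of representations *)

Section Dot.
Variables (K : comPzRingType) (n : nat).
Implicit Types x y z : 'rV[K]_n.

Lemma dot_sym x y : dot x y = dot y x.
Proof. by apply: eq_bigr => i _; rewrite mulrC. Qed.

Lemma dotDl x y z : dot (x + y) z = dot x z + dot y z.
Proof. by rewrite /dot -big_split; apply: eq_bigr => i _; rewrite !mxE mulrDl. Qed.

Lemma dotDr x y z : dot z (x + y) = dot z x + dot z y.
Proof. by rewrite dot_sym dotDl !(dot_sym z). Qed.

Lemma dotZl c x z : dot (c *: x) z = c * dot x z.
Proof. by rewrite /dot mulr_sumr; apply: eq_bigr => i _; rewrite !mxE mulrA. Qed.

Lemma dotZr c x z : dot z (c *: x) = c * dot z x.
Proof. by rewrite dot_sym dotZl dot_sym. Qed.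

Lemma dotNl x z : dot (- x) z = - dot x z.
Proof. by rewrite -scaleN1r dotZl mulN1r. Qed.

Lemma dotBl x y z : dot (x - y) z = dot x z - dot y z.
Proof. by rewrite dotDl dotNl. Qed.

Lemma dot0l z : dot 0 z = 0.
Proof. by apply: big1 => i _; rewrite mxE mul0r. Qed.

Lemma dot_suml I (s : seq I) (P : pred I) (F : I -> 'rV[K]_n) z :
  dot (\sum_(i <- s | P i) F i) z = \sum_(i <- s | P i) dot (F i) z.
Proof. by apply: (big_morph (fun x => dot x z) (fun x y => dotDl x y z) (dot0l z)). Qed.

Lemma dot_delta x i : dot x (delta_mx 0 i) = x 0 i.
Proof.
rewrite /dot (bigD1 i) //= mxE !eqxx mulr1 big1 ?addr0 // => j ji.
by rewrite mxE (negPf ji) andbF mulr0.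
Qed.

Lemma dot_inj x y : (forall z, dot x z = dot y z) -> x = y.
Proof. by move=> h; apply/rowP => i; rewrite -!dot_delta h. Qed.

Lemma dot_sep x y : x != y -> exists z, dot x z != dot y z.
Proof.
move=> ne; apply: contrapT => h; move/eqP: ne; apply; apply: dot_inj => z.
by apply/eqP/negPn/negP => e; apply: h; exists z.
Qed.

End Dot.

Lemma free_subspan (K : fieldType) (V : vectType K) (l : seq V) :
  exists l', [/\ {subset l' <= l}, free l' & <<l'>>%VS = <<l>>%VS].
Proof.
elim: l => [|v l [l' [h1 h2 h3]]]; first by exists [::]; rewrite nil_free.
case: (boolP (v \in <<l>>%VS)) => hv.
  exists l'; split=> // [x /h1 xl|]; first by rewrite inE xl orbT.
  by rewrite h3 span_cons; apply/esym/addv_idPr; rewrite -memvE.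
exists (v :: l'); rewrite free_cons h3 hv h2 !span_cons h3; split=> // x.
by rewrite !inE => /orP[->|/h1->]; rewrite ?orbT.
Qed.

(** A finite subfamily whose span has maximal dimension absorbs all the others. *)
Lemma span_pred (K : fieldType) (V : vectType K) (Q : V -> Prop) :
  exists l : seq V, (forall v, v \in l -> Q v) /\ forall v, Q v -> v \in <<l>>%VS.
Proof.
pose X d := exists l : seq V, (forall v, v \in l -> Q v) /\ \dim <<l>>%VS = d.
have Xb d : `[< X d >] -> (d <= \dim {:V})%N.
  by move=> /asboolP[l [_ <-]]; apply/dimvS/subvf.
have X0 : exists d, `[< X d >] by exists 0%N; apply/asboolP; exists [::]; rewrite span_nil dimv0.
have [m /asboolP[l [hl hd]] hm] := ex_maxnP X0 Xb.
exists l; split=> // v Qv; apply: contraT => nv.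
have sub : (<<l>> <= <<v :: l>>)%VS by rewrite span_cons addvSr.
have le : (\dim <<v :: l>>%VS <= \dim <<l>>%VS)%N.
  rewrite hd; apply: hm; apply/asboolP; exists (v :: l); split=> // x.
  by rewrite inE => /predU1P[->|/hl].
have e : <<v :: l>>%VS = <<l>>%VS by apply/eqP; rewrite eq_sym eqEdim sub.
by rewrite -e memv_span ?inE ?eqxx in nv.
Qed.

Section Weights.
Variables (K : numClosedFieldType) (n : nat) (g : lieAlgebra K).
Variable io : 'Hom('rV[K]_n, g).
Implicit Types (x y z : g) (h : 'rV[K]_n).

Lemma lieDl x y z : lie (x + y) z = lie x z + lie y z.
Proof. by rewrite /lie linearD lfun_simp. Qed.
Lemma lieDr x y z : lie z (x + y) = lie z x + lie z y.
Proof. by rewrite /lie linearD. Qed.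
Lemma lie_anti x y : lie x y = - lie y x.
Proof.
apply/eqP; rewrite -addr_eq0; apply/eqP; have : lie (x + y) (x + y) = 0 := ad_alt _.
have [h1 h2] : lie x x = 0 /\ lie y y = 0 by split; apply: ad_alt.
by rewrite lieDl !lieDr h1 h2 add0r addr0.
Qed.

Lemma lieZl c x z : lie (c *: x) z = c *: lie x z.
Proof. by rewrite /lie linearZ lfun_simp. Qed.
Lemma lieZr c x z : lie z (c *: x) = c *: lie z x.
Proof. by rewrite /lie linearZ. Qed.

Lemma ad_rep : is_rep (ad g).
Proof.
move=> x y z; have := ad_jacobi x y z; rewrite -/(lie _ _) -/(lie _ _).
rewrite -![ad g _ _]/(lie _ _) (lie_anti z (lie x y)) (lie_anti z x) => /eqP.
rewrite subr_eq0 => /eqP <-; congr (_ + _).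
by rewrite -scaleN1r lieZr scaleN1r.
Qed.

Section WeightSpace.
Variables (V : vectType K) (rho : 'Hom(g, 'End(V))).
Local Notation wsp := (weight_space io rho).

Lemma weightP m (v : V) :
  reflect (forall h, rho (io h) v = dot m h *: v) (v \in wsp m).
Proof.
have mem : (v \in wsp m) = [forall i, rho (io (delta_mx 0 i)) v == m 0 i *: v].
  rewrite /weight_space memvE; apply/subv_bigcapP/forallP => h i.
    by have := h i isT; rewrite -memvE /passmx.leigenspace memv_ker !lfun_simp /= subr_eq0.
  by move=> _; rewrite -memvE /passmx.leigenspace memv_ker !lfun_simp /= subr_eq0; apply: h.
rewrite mem; apply: (iffP forallP) => hv h; last by rewrite hv dot_delta.
rewrite {1}(row_sum_delta h) !linear_sum sum_lfunE /= /dot scaler_suml.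
apply: eq_bigr => i _; rewrite !linearZ /= lfun_simp (eqP (hv i)) scalerA mulrC.
by [].
Qed.

End WeightSpace.

Section Rep.
Variables (V : vectType K) (rho : 'Hom(g, 'End(V))).
Hypothesis V_rep : is_rep rho.
Local Notation wsp := (weight_space io rho).

Lemma rep_comm x y (v : V) : rho x (rho y v) = rho (lie x y) v + rho y (rho x v).
Proof. by rewrite V_rep subrK. Qed.

Lemma repZl c x (v : V) : rho (c *: x) v = c *: rho x v.
Proof. by rewrite linearZ lfun_simp. Qed.

Lemma weight_act a m x (v : V) : x \in weight_space io (ad g) a -> v \in wsp m ->
  rho x v \in wsp (a + m).
Proof.
move=> /weightP hx /weightP hv; apply/weightP => h.
have e : lie (io h) x = dot a h *: x := hx h.
by rewrite rep_comm e hv repZl linearZ dotDl scalerDl.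
Qed.

(** Components of different weights are separated by elements of the Cartan
    subalgebra that kill all components but one. *)
Lemma weight_split (U : {vspace V}) (I : Type) (w : I -> 'rV[K]_n) i0 (s : seq I) (P : pred I) (x : I -> V) :
  (forall h v, v \in U -> rho (io h) v \in U) ->
  (forall i, x i \in wsp (w i)) -> (forall i, P i -> w i != w i0) ->
  x i0 + \sum_(i <- s | P i) x i \in U -> x i0 \in U.
Proof.
move=> hU + hP; elim: s x => [|i1 s IH] x hx; first by rewrite big_nil addr0.
rewrite big_cons; case: ifP => [/hP ne hsum|_]; last exact: IH.
rewrite eq_sym in ne; have [h hh] := dot_sep ne.
have hw i : rho (io h) (x i) = dot (w i) h *: x i by apply/weightP.
pose y i := (dot (w i) h - dot (w i1) h) *: x i.
have : y i0 \in U.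
  apply: IH => // [i|]; first by apply: memvZ.
  have := memvB (hU h _ hsum) (memvZ (dot (w i1) h) hsum).
  have -> : rho (io h) (x i0 + (x i1 + \sum_(i <- s | P i) x i)) =
    dot (w i0) h *: x i0 + (dot (w i1) h *: x i1 + \sum_(i <- s | P i) dot (w i) h *: x i).
    rewrite !(linearD (rho (io h))) linear_sum /= !hw; do 2!congr (_ + _).
    by apply: eq_bigr => i _; apply: hw.
  rewrite !scalerDr scaler_sumr.
  rewrite opprD addrACA -scalerBl opprD addrACA subrr add0r.
  have -> // : \sum_(i <- s | P i) dot (w i) h *: x i - \sum_(i <- s | P i) dot (w i1) h *: x i = \sum_(i <- s | P i) y i.
  by rewrite -sumrB; apply: eq_bigr => i _; rewrite -scalerBl.
by rewrite /y rpredZeq subr_eq0 (negPf hh).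
Qed.

Lemma weighted_basis (Q : 'rV[K]_n -> Prop) (l : seq V) : <<l>>%VS = fullv ->
  (forall v, v \in l -> exists m, Q m /\ v \in wsp m) ->
  exists N (b : N.-tuple V) (wt : 'I_N -> 'rV[K]_n),
    basis_of fullv b /\ forall i : 'I_N, b`_i \in wsp (wt i) /\ Q (wt i).
Proof.
move=> hl hQ; have [l' [h1 h2 h3]] := free_subspan l.
have /choice[wt hwt] (i : 'I_(size l')) : exists m, l'`_i \in wsp m /\ Q m.
  have [m [h4 h5]] := hQ _ (h1 _ (mem_nth 0 (ltn_ord i))).
  by exists m.
exists (size l'), (in_tuple l'), wt; split=> //.
by rewrite /basis_of h3 hl eqxx h2.
Qed.

End Rep.

Section Basis.
Variables (V : vectType K) (rho : 'Hom(g, 'End(V))).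
Hypothesis V_rep : is_rep rho.
Local Notation wsp := (weight_space io rho).
Variables (N : nat) (b : N.-tuple V) (wt : 'I_N -> 'rV[K]_n).
Hypothesis b_basis : basis_of fullv b.
Hypothesis b_wt : forall i : 'I_N, b`_i \in wsp (wt i).

Lemma coord_expand (v : V) : v = \sum_i coord b i v *: b`_i.
Proof. by apply: (coord_basis b_basis); rewrite memvf. Qed.

Lemma coord_weight (v : V) m i : v \in wsp m -> wt i != m -> coord b i v = 0.
Proof.
move=> /weightP hv ne; have [h hh] := dot_sep ne.
have e : coord b i (rho (io h) v) = dot (wt i) h * coord b i v.
  rewrite {1}(coord_expand v) linear_sum /=.
  under eq_bigr do rewrite linearZ /= (elimT (weightP _ _ _) (b_wt _)) scalerA.
  by rewrite coord_sum_free ?(basis_free b_basis) // mulrC.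
move/eqP: e; rewrite hv linearZ /= -subr_eq0 -mulrBl mulf_eq0 subr_eq0 eq_sym (negPf hh).
by move/eqP.
Qed.

Lemma weight_occurs (v : V) m : v \in wsp m -> v != 0 -> exists i, wt i = m.
Proof.
move=> hv; apply: contraNP => h; rewrite (coord_expand v) big1 // => i _.
by rewrite (coord_weight hv) ?scale0r //; apply: contra_notN h => /eqP <-; exists i.
Qed.

Lemma weight_spaceE m : wsp m = <<[seq b`_(i : 'I_N) | i : 'I_N <- enum 'I_N & wt i == m]>>%VS.
Proof.
apply/eqP; rewrite eqEsubv; apply/andP; split; apply/subvP => v.
  move=> hv; rewrite (coord_expand v); apply: memv_suml => i _; case: (eqVneq (wt i) m) => e.
    by apply/memvZ/memv_span/map_f; rewrite mem_filter e eqxx mem_enum.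
  by rewrite (coord_weight hv e) scale0r mem0v.
suff: (<<[seq b`_(i : 'I_N) | i : 'I_N <- enum 'I_N & wt i == m]>> <= wsp m)%VS by move/subvP; apply.
apply/span_subvP => u /seq.mapP[j]; rewrite mem_filter => /andP[/eqP <- _] ->.
exact: b_wt.
Qed.

Lemma weight_dim m : \dim (wsp m) = #|[pred i | wt i == m]|.
Proof.
have hu : uniq b := free_uniq (basis_free b_basis).
have hf : free [seq b`_(i : 'I_N) | i : 'I_N <- enum 'I_N & wt i == m].
  have e : [seq b`_(i : 'I_N) | i : 'I_N <- enum 'I_N & wt i == m] =
           [seq x <- b | x \in [seq b`_(i : 'I_N) | i : 'I_N <- enum 'I_N & wt i == m]].
    have eb : tval b = [seq b`_(i : 'I_N) | i <- enum 'I_N].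
      have es : size [seq b`_(i : 'I_N) | i <- enum 'I_N] = N by rewrite size_map -cardE card_ord.
      apply: (@eq_from_nth _ 0); rewrite size_tuple ?es // => i iN.
      by rewrite (nth_map (Ordinal iN)) ?size_enum_ord //= nth_enum_ord.
    rewrite [X in _ = filter _ X]eb filter_map; apply: congr1; apply: eq_in_filter => i _ /=.
    apply/idP/mapP => [h|[j]]; first by exists i; rewrite // mem_filter h mem_enum.
    rewrite mem_filter => /andP[/eqP h _] /eqP; rewrite nth_uniq ?size_tuple // => /eqP.
    by move=> /val_inj ->; rewrite h.
  by rewrite e; apply: filter_free; apply: basis_free b_basis.
rewrite weight_spaceE (eqP hf) size_map cardE size_filter -size_filter.
by rewrite /enum_mem -enumT -filter_predI; congr size; rewrite enumT; apply: eq_filter => i; rewrite !inE andbT.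
Qed.

Lemma act_nilpotent a x (v : V) m : a != 0 -> x \in weight_space io (ad g) a ->
  v \in wsp m -> exists k, iter k (rho x) v = 0.
Proof.
move=> a0 hx hv; apply: contrapT => h.
have hk k : iter k (rho x) v \in wsp (m + a *+ k).
  elim: k => [|k IH]; first by rewrite addr0.
  by rewrite iterS mulrS addrCA; apply: weight_act.
have /choice[F hF] k : exists i, wt i = m + a *+ k.
  by apply: weight_occurs (hk k) _; apply/eqP => e; apply: h; exists k.
have : injective (fun k : 'I_N.+1 => F k).
  move=> k k' e; apply/val_inj; have := hF k; rewrite e hF => /addrI/eqP.
  rewrite -![a *+ _]scaler_nat -subr_eq0 -scalerBl scaler_eq0 (negPf a0) orbF subr_eq0.
  by rewrite eqr_nat => /eqP.
by move/leq_card; rewrite !card_ord ltnn.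
Qed.

Definition trace (f : V -> V) : K := \sum_i coord b i (f b`_i).

Lemma traceC (f f' : 'End(V)) : trace (f \o f') = trace (f' \o f).
Proof.
have e (u w : 'End(V)) : trace (u \o w) = \sum_i \sum_(j < N) coord b i (u b`_j) * coord b j (w b`_i).
  apply: eq_bigr => i _ /=; rewrite {1}(coord_expand (w b`_i)) !linear_sum.
  by apply: eq_bigr => j _; rewrite !linearZ /= mulrC.
by rewrite !e exchange_big; do 2!(apply: eq_bigr => ? _); rewrite mulrC.
Qed.

End Basis.

Lemma vspace_pred (V : vectType K) (Q : V -> Prop) : Q 0 ->
  (forall c u v, Q u -> Q v -> Q (c *: u + v)) ->
  exists U : {vspace V}, forall v, v \in U <-> Q v.
Proof.
move=> Q0 QD; have [l [h1 h2]] := span_pred Q; exists <<l>>%VS => v; split; last exact: h2.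
rewrite -[l]/(tval (in_tuple l)) => /coord_span ->.
apply: (big_ind Q) => // [x y Qx Qy|i _]; first by rewrite -[x]scale1r; apply: QD.
by rewrite -[_ *: _]addr0; apply: QD => //; apply/h1/mem_nth.
Qed.

(** Induction on [k]: the commutator of [e] with one more [f] contributes the eigenvalue
    [p - 2 k] of [h], and these add up to [(k + 1) (p - k)]. *)
Lemma sl2_ladder (V : vectType K) (e f h : 'End(V)) p (u : V) :
  (forall v, e (f v) = f (e v) + h v) -> (forall v, h (f v) = f (h v) - f v *+ 2) ->
  h u = p *: u ->
  forall k, e (iter k.+1 f u) = iter k.+1 f (e u) + (k.+1%:R * (p - k%:R)) *: iter k f u.
Proof.
move=> ef hf hu.
have hk k : h (iter k f u) = (p - (2 * k)%:R) *: iter k f u.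
  elim: k => [|k IH]; first by rewrite muln0 subr0.
  rewrite !iterS hf IH linearZ /= -scaler_nat -scalerBl mulnS; congr (_ *: _).
  by rewrite natrD; ring.
elim=> [|k IH]; first by rewrite /= ef hu subr0 mul1r.
rewrite iterS ef IH linearD linearZ hk -addrA -scalerDl; congr (_ + _ *: _).
by rewrite -[k.+2%:R]natr1 -[k.+1%:R]natr1 natrM; ring.
Qed.

(** Applying the ladder formula at the last nonzero [f^k u] gives [(k + 1) (p - k) = 0]. *)
Lemma sl2_highest_weight (V : vectType K) (e f h : 'End(V)) p (u : V) :
  (forall v, e (f v) = f (e v) + h v) -> (forall v, h (f v) = f (h v) - f v *+ 2) ->
  e u = 0 -> h u = p *: u -> u != 0 -> (exists k, iter k f u = 0) -> exists k : nat, p = k%:R.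
Proof.
move=> ef hf eu hu u0 hk; have hex : exists k, iter k f u == 0 by case: hk => k /eqP; exists k.
case: (ex_minnP hex) => -[|k] hm min; first by rewrite /= (negPf u0) in hm.
have f0 m : iter m f 0 = 0 by elim: m => //= m ->; rewrite linear0.
have := sl2_ladder ef hf hu k; rewrite eu f0 add0r (eqP hm) linear0 => /esym/eqP.
rewrite scaler_eq0 mulf_eq0 pnatr_eq0 subr_eq0 => /orP[/eqP ->|]; first by exists k.
by move=> /min; rewrite ltnn.
Qed.

End Weights.

(** * The Killing form and the root vectors *)

Lemma sum_option (V : nmodType) (I : finType) (F : option I -> V) :
  \sum_o F o = F None + \sum_i F (Some i).
Proof.
rewrite (bigD1 None) //=; congr (_ + _); rewrite (reindex_omap Some id) /=; last by case.
by apply: eq_bigl => i; rewrite eqxx.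
Qed.

Section Structure.
Variables (R : realType) (n : nat) (D : rootDatum n).
Local Notation K := (R[i]).
Variables (g : lieAlgebra K) (io : 'Hom('rV[K]_n, g)).
Hypothesis gP : is_lie_algebra_of io (dual_datum D).
Local Notation cr b := (map_mx intr (coroot_of b) : 'rV[K]_n).
Local Notation rt b := (map_mx intr (root_of b) : 'rV[K]_n).
Hypothesis cr_sep : forall x : 'rV[K]_n, (forall b : Phi D, dot (cr b) x = 0) -> x = 0.
Hypothesis coroot_opp_root : forall b : Phi D, coroot_of (opp_root b) = - coroot_of b.
Local Notation gsp := (weight_space io (ad g)).
Local Notation grep := (@ad_rep K g).
Local Notation dual := (dual_datum D).
Local Notation rdot := (form dual).
Local Notation rcr b := (map_mx intr (coroot_of b) : 'rV[R]_n).
Local Notation rrt b := (map_mx intr (root_of b) : 'rV[R]_n).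
Local Notation cx := (@complexify R n).
Implicit Types (a b : Phi D) (h : 'rV[K]_n) (x y z : g).

Lemma lin_delta (F : 'rV[K]_n -> K) h : (forall u v, F (u + v) = F u + F v) ->
  (forall c u, F (c *: u) = c * F u) -> F h = \sum_i h 0 i * F (delta_mx 0 i).
Proof.
move=> FD FZ; have F0 : F 0 = 0 by rewrite -(scale0r 0) FZ mul0r.
rewrite {1}(row_sum_delta h) (big_morph F FD F0); apply: eq_bigr => i _.
exact: FZ.
Qed.

Lemma dot_intr (u v : 'rV[int]_n) : dot (map_mx intr u : 'rV[K]_n) (map_mx intr v) = (dot u v)%:~R.
Proof. by rewrite /dot rmorph_sum; apply: eq_bigr => i _; rewrite !mxE rmorphM. Qed.

Lemma cr_rt b : dot (cr b) (rt b) = 2.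
Proof. by rewrite dot_intr dot_sym root_coroot. Qed.

Lemma cr_neq0 b : cr b != 0.
Proof. by apply/eqP => e; have := cr_rt b; rewrite e dot0l => /esym/eqP; rewrite pnatr_eq0. Qed.

Lemma cr_inj : injective (fun b => cr b).
Proof.
move=> a b e; apply: (@coroot_of_inj _ D); apply/rowP => i; have /rowP/(_ i) := e; rewrite !mxE.
by move/intr_inj.
Qed.

Lemma cr_opp b : cr (opp_root b) = - cr b.
Proof. by rewrite coroot_opp_root; apply/rowP => i; rewrite !mxE rmorphN. Qed.

Lemma rt_opp b : rt (opp_root b) = - rt b.
Proof.
have e : root_of (opp_root b) = - root_of b.
  rewrite /opp_root /root_refl; case: cid => c /= ->.
  by rewrite root_coroot; apply/rowP => i; rewrite !mxE; ring.
by rewrite e; apply/rowP => i; rewrite !mxE rmorphN.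
Qed.

Lemma grep_comm x y z : lie x (lie y z) = lie (lie x y) z + lie y (lie x z).
Proof. by rewrite {3}/lie grep subrK. Qed.

Lemma weight_lie m x h : x \in gsp m -> lie (io h) x = dot m h *: x.
Proof. by move/weightP => /(_ h). Qed.

Lemma io_weight h : io h \in gsp 0.
Proof. by have [_ _ <- _ _] := gP; apply/memv_img/memvf. Qed.

Lemma weight0_io x : x \in gsp 0 -> exists h, x = io h.
Proof. by have [_ _ <- _ _] := gP => /memv_imgP[h _ ->]; exists h. Qed.

Definition rweight (o : option (Phi D)) : 'rV[K]_n := if o is Some b then cr b else 0.

Lemma rweight_inj : injective rweight.
Proof.
move=> [a|] [b|] //= e; first by rewrite (cr_inj e).
  by have := cr_neq0 a; rewrite e eqxx.
by have := cr_neq0 b; rewrite -e eqxx.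
Qed.

Lemma root_decomp x : exists X : option (Phi D) -> g,
  (forall o, X o \in gsp (rweight o)) /\ x = \sum_o X o.
Proof.
have [_ _ _ _ hsum] := gP; have : x \in fullv by apply: memvf.
rewrite -hsum => /memv_addP[_ /memv_imgP[h _ ->] [y /memv_sumP[Y hY ->] ->]].
exists (fun o => if o is Some b then Y b else io h); split=> [[b|]|]; first exact: hY.
  exact: io_weight.
by rewrite sum_option.
Qed.

Lemma weight_rweight m x : x \in gsp m -> x != 0 -> exists o, m = rweight o.
Proof.
move=> hx x0; case: (eqVneq m 0) => [->|m0]; first by exists None.
have [_ _ _ /(_ m)[/(_ _)h _] _] := gP; case: h => [|b ->]; last by exists (Some b).
by split=> //; apply: contra_neq x0 => e; rewrite e memv0 in hx; apply/eqP.
Qed.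

Lemma root_space_neq0 b : exists2 x, x \in gsp (cr b) & x != 0.
Proof.
have [_ _ _ /(_ (cr b))[_ h] _] := gP; have [|_ h0] := h; first by exists b.
by exists (vpick (gsp (cr b))); rewrite ?memv_pick ?vpick0.
Qed.

Lemma lie_component (U : {vspace g}) (X : option (Phi D) -> g) o :
  (forall h x, x \in U -> lie (io h) x \in U) -> (forall o, X o \in gsp (rweight o)) ->
  \sum_o X o \in U -> X o \in U.
Proof.
move=> hU hX; rewrite (bigD1 o) //=.
apply: (weight_split (w := rweight) hU hX) => o' ne.
by rewrite (inj_eq rweight_inj).
Qed.

Lemma lie_basis : exists N (E : N.-tuple g) (w : 'I_N -> 'rV[K]_n),
  basis_of fullv E /\ forall i : 'I_N, E`_i \in gsp (w i) /\ exists o, w i = rweight o.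
Proof.
have [l [h1 h2]] := span_pred (fun x => exists o, x \in gsp (rweight o)).
apply: (weighted_basis (Q := fun m => exists o, m = rweight o) (l := l)) => [|x /h1[o ho]];
  last by exists (rweight o); split=> //; exists o.
apply/eqP; rewrite eqEsubv subvf /=; apply/subvP => x _; have [X [hX ->]] := root_decomp x.
by apply: memv_suml => o _; apply: h2; exists o.
Qed.

(** ** Graded subalgebras without weight zero are solvable *)

Lemma derived_mem (U : {vspace g}) x y : x \in U -> y \in U -> lie x y \in derived U.
Proof.
move=> /coord_vbasis -> /coord_vbasis ->.
have -> : forall F F' : 'I_(\dim U) -> g, lie (\sum_i F i) (\sum_i F' i) = \sum_i \sum_j lie (F i) (F' j).
  move=> F F'; rewrite /lie [ad g _]linear_sum sum_lfunE; apply: eq_bigr => i _.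
  by rewrite linear_sum.
apply: memv_suml => i _; apply: memv_suml => j _; rewrite lieZl lieZr !memvZ //.
by apply/memv_span/allpairsP; exists ((vbasis U)`_i, (vbasis U)`_j); rewrite !mem_nth ?size_tuple.
Qed.

Lemma derived_sub (U W : {vspace g}) :
  (forall x y, x \in U -> y \in U -> lie x y \in W) -> (derived U <= W)%VS.
Proof.
move=> h; apply/span_subvP => _ /allpairsP[[x y] /= [hx hy ->]].
by apply: h; apply: vbasis_mem.
Qed.

Lemma solvable_mono k (U W : {vspace g}) : (U <= W)%VS ->
  (iter k (@derived _ g) U <= iter k (@derived _ g) W)%VS.
Proof.
move=> h; elim: k => //= k /subvP IH; apply: derived_sub => x y hx hy.
by apply: derived_mem; apply: IH.
Qed.

Section Engel.
Variable J : {vspace g}.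
Hypothesis J_lie : forall x y, x \in J -> y \in J -> lie x y \in J.
Hypothesis J_io : forall h, io h \in J -> h = 0.

Definition homog x := x \in J /\ exists b, x \in gsp (cr b).

Definition graded_sub (U : {vspace g}) :=
  (exists l : seq g, (forall x, x \in l -> homog x) /\ U = <<l>>%VS) /\
  forall x y, x \in U -> y \in U -> lie x y \in U.

Lemma homog_lie x y : homog x -> homog y -> lie x y != 0 -> homog (lie x y).
Proof.
move=> [xJ [a hx]] [yJ [b hy]] nz; split; first exact: J_lie.
have hxy : lie x y \in gsp (cr a + cr b) by apply: (weight_act grep hx hy).
have [[c|] e] := weight_rweight hxy nz; first by exists c; rewrite e in hxy.
have [h eh] : exists h, lie x y = io h by apply: weight0_io; rewrite e in hxy.
have h0 : h = 0 by apply: J_io; rewrite -eh; apply: J_lie.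
by rewrite eh h0 linear0 eqxx in nz.
Qed.

Lemma homog_nilpotent x y : homog x -> homog y -> exists k, iter k (ad g x) y = 0.
Proof.
move=> [_ [a hx]] [_ [b hy]]; have [N [E [w [E_basis E_wt]]]] := lie_basis.
by apply: (act_nilpotent grep E_basis (fun i => (E_wt i).1) (cr_neq0 a) hx hy).
Qed.

Lemma graded0 : graded_sub 0%VS.
Proof.
split=> [|x y]; first by exists [::]; rewrite span_nil.
by rewrite !memv0 => /eqP -> _; rewrite /lie linear0 lfunE.
Qed.

Lemma max_graded U : graded_sub U -> U != 0%VS -> exists U',
  [/\ graded_sub U', (U' <= U)%VS, (\dim U' < \dim U)%N
    & forall W, graded_sub W -> (W <= U)%VS -> (\dim U' < \dim W)%N -> W = U].
Proof.
move=> gU U0; pose X d := exists W, [/\ graded_sub W, (W <= U)%VS, \dim W = d & (d < \dim U)%N].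
have Xb d : `[< X d >] -> (d <= \dim U)%N by move=> /asboolP[W [_ _ _ /ltnW]].
have X0 : exists d, `[< X d >].
  exists 0%N; apply/asboolP; exists 0%VS; split; rewrite ?sub0v ?dimv0 ?lt0n ?dimv_eq0 //.
  exact: graded0.
have [m /asboolP[W [h1 h2 h3 h4]] hm] := ex_maxnP X0 Xb.
exists W; split=> //; first by rewrite h3.
move=> W' g1 g2 g3; apply/eqP; rewrite eqEdim g2 /= leqNgt; apply/negP => h5.
have : (\dim W' <= m)%N by apply: hm; apply/asboolP; exists W'.
by rewrite leqNgt -h3 g3.
Qed.

Lemma graded_proper U U' : graded_sub U -> (\dim U' < \dim U)%N -> exists2 x, homog x & x \in U /\ x \notin U'.
Proof.
move=> [[l [hl eU]] _] hd; apply: contrapT => h; move: hd; rewrite ltnNge => /negP; apply.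
apply: dimvS; rewrite eU; apply/span_subvP => x xl; apply: contraT => nx; case: h.
by exists x; [exact: hl|rewrite eU memv_span].
Qed.

(** A proper inclusion of modules over a graded subalgebra admits a homogeneous
    vector annihilated modulo the smaller one; the proof is that of Engel's theorem,
    nilpotency being automatic because root vectors shift weights. *)
Lemma engel m U (M M' : {vspace g}) : (\dim U <= m)%N -> graded_sub U ->
  (forall x y, x \in U -> y \in M -> lie x y \in M) ->
  (forall x y, x \in U -> y \in M' -> lie x y \in M') ->
  (exists2 y, homog y & y \in M /\ y \notin M') ->
  exists2 y, homog y & [/\ y \in M, y \notin M' & forall x, x \in U -> lie x y \in M'].
Proof.
elim: m U M M' => [|m IH] U M M' hd gU hM hM' [y0 hy0 [y0M y0M']].
  exists y0 => //; split=> // x; move: hd; rewrite leqn0 dimv_eq0 => /eqP ->.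
  by rewrite memv0 => /eqP ->; rewrite /lie linear0 lfunE mem0v.
case: (eqVneq U 0%VS) => [U0|U0].
  exists y0 => //; split=> // x; rewrite U0 memv0 => /eqP ->.
  by rewrite /lie linear0 lfunE mem0v.
have [U' [gU' sU' dU' mU']] := max_graded gU U0; have sub := subvP sU'.
have dm : (\dim U' <= m)%N by rewrite -ltnS (leq_trans dU').
have [z hz [zU zU' zn]] : exists2 z, homog z & [/\ z \in U, z \notin U' & forall x, x \in U' -> lie x z \in U'].
  apply: (IH U' U U') => // [x y /sub xU yU|x y|]; [exact: gU.2|exact: gU'.2|exact: graded_proper].
have eU : U = (<[z]> + U')%VS.
  apply/esym/mU'.
  - split.
      have [[l [hl ->]] _] := gU'; exists (z :: l); rewrite span_cons; split=> // x.
      by rewrite inE => /predU1P[->|/hl].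
    move=> _ _ /memv_addP[_ /vlineP[c ->] [x xU ->]] /memv_addP[_ /vlineP[d ->] [y yU ->]].
    rewrite lieDl !lieDr !lieZl !lieZr; have -> : lie z z = 0 by apply: ad_alt.
    rewrite !scaler0 add0r addrA memvD // ?(subvP (addvSr _ _)) //; last exact: gU'.2.
    by rewrite memvD ?memvZ // ?(lie_anti z) ?memvN; apply/zn.
  - by rewrite subv_add -memvE zU.
  rewrite ltn_neqAle dimvS ?addvSr // andbT; apply: contraNneq zU' => e.
  have /eqP -> : U' == (<[z]> + U')%VS by rewrite eqEdim addvSr /= e.
  by rewrite memvE addvSl.
have [y1 hy1 [y1M y1M' y1n]] : exists2 y, homog y & [/\ y \in M, y \notin M' & forall x, x \in U' -> lie x y \in M'].
  apply: (IH U' M M') => // [x y /sub|x y /sub|]; [exact: hM|exact: hM'|by exists y0].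
have good k : iter k (ad g z) y1 \notin M' -> homog (iter k (ad g z) y1) /\
    [/\ iter k (ad g z) y1 \in M & forall x, x \in U' -> lie x (iter k (ad g z) y1) \in M'].
  elim: k => [|k IHk] //=; set yk := iter k _ _ => nk.
  have ykM' : yk \notin M' by apply: contra nk; apply: hM'.
  have [h1 [h2 h3]] := IHk ykM'; split; last split; last first.
  - move=> x xU; rewrite -[ad g z yk]/(lie z yk) [lie x _]grep_comm.
    by apply: memvD; [apply/h3/zn|apply: hM' => //; apply: h3].
  - exact: hM.
  by apply: homog_lie => //; apply: contraNneq nk => e; rewrite -[ad g z yk]/(lie z yk) e mem0v.
have [k0 hk0] := homog_nilpotent hz hy1.
have hex : exists k, iter k (ad g z) y1 \in M' by exists k0; rewrite hk0 mem0v.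
case: (ex_minnP hex) => -[|k] hk kmin; first by rewrite (negPf y1M') in hk.
have nk : iter k (ad g z) y1 \notin M' by apply/negP => /kmin; rewrite ltnn.
have [h1 [h2 h3]] := good k nk; exists (iter k (ad g z) y1) => //; split=> // x.
rewrite eU => /memv_addP[_ /vlineP[c ->] [x' x'U ->]]; rewrite lieDl lieZl memvD ?memvZ //.
exact: h3.
Qed.

(** Engel applied to a maximal proper graded subalgebra [U'] gives [z] normalizing it, so
    [U = <z> + U'] by maximality and [U'] contains the derived algebra. *)
Lemma graded_solvable m U : (\dim U <= m)%N -> graded_sub U -> solvable_sub U.
Proof.
elim: m U => [|m IH] U hd gU.
  by exists 0%N; apply/eqP; rewrite -dimv_eq0 -leqn0.
case: (eqVneq U 0%VS) => [U0|U0]; first by exists 0%N.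
have [U' [gU' sU' dU' mU']] := max_graded gU U0; have sub := subvP sU'.
have dm : (\dim U' <= m)%N by rewrite -ltnS (leq_trans dU').
have [z hz [zU zU' zn]] : exists2 z, homog z & [/\ z \in U, z \notin U' & forall x, x \in U' -> lie x z \in U'].
  apply: (engel (leqnn _) gU') => [x y /sub xU yU|x y|]; [exact: gU.2|exact: gU'.2|exact: graded_proper].
have zz : lie z z = 0 by apply: ad_alt.
have hzU : forall x y, x \in (<[z]> + U')%VS -> y \in (<[z]> + U')%VS -> lie x y \in U'.
  move=> _ _ /memv_addP[_ /vlineP[c ->] [x xU ->]] /memv_addP[_ /vlineP[d ->] [y yU ->]].
  rewrite lieDl !lieDr !lieZl !lieZr zz !scaler0 add0r addrA memvD //; last exact: gU'.2.
  by rewrite memvD ?memvZ // ?(lie_anti z) ?memvN; apply/zn.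
have eU : U = (<[z]> + U')%VS.
  apply/esym/mU'.
  - split=> [|x y hx hy]; last by apply: (subvP (addvSr _ _)); apply: hzU.
    have [[l [hl ->]] _] := gU'; exists (z :: l); rewrite span_cons; split=> // x.
    by rewrite inE => /predU1P[->|/hl].
  - by rewrite subv_add -memvE zU.
  rewrite ltn_neqAle dimvS ?addvSr // andbT; apply: contraNneq zU' => e.
  have /eqP -> : U' == (<[z]> + U')%VS by rewrite eqEdim addvSr /= e.
  by rewrite memvE addvSl.
have dU : (derived U <= U')%VS by apply: derived_sub; rewrite eU.
have [k hk] := IH U' dm gU'; exists k.+1; rewrite iterSr; apply/eqP; rewrite -subv0 -hk.
exact: solvable_mono.
Qed.

End Engel.

Section Killing.
Variables (N : nat) (E : N.-tuple g) (w : 'I_N -> 'rV[K]_n).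
Hypothesis E_basis : basis_of fullv E.
Hypothesis E_wt : forall i : 'I_N, E`_i \in gsp (w i).
Hypothesis w_root : forall i, exists o, w i = rweight o.

Definition kap : g -> g -> K := locked (fun x y => trace E (ad g x \o ad g y)).

Lemma kapE x y : kap x y = trace E (ad g x \o ad g y).
Proof. by rewrite /kap -lock. Qed.

Lemma kapC x y : kap x y = kap y x.
Proof. by rewrite !kapE; apply: traceC. Qed.

Lemma kapDl x y z : kap (x + y) z = kap x z + kap y z.
Proof.
rewrite !kapE /trace -big_split; apply: eq_bigr => i _ /=.
by rewrite -linearD -[ad g (x + y) _]/(lie _ _) lieDl.
Qed.

Lemma kapZl c x z : kap (c *: x) z = c * kap x z.
Proof.
rewrite !kapE /trace mulr_sumr; apply: eq_bigr => i _ /=.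
by rewrite -[ad g (c *: x) _]/(lie _ _) lieZl linearZ.
Qed.

Lemma kapDr x y z : kap z (x + y) = kap z x + kap z y.
Proof. by rewrite kapC kapDl !(kapC z). Qed.

Lemma kapZr c x z : kap z (c *: x) = c * kap z x.
Proof. by rewrite kapC kapZl kapC. Qed.

Lemma kap0l z : kap 0 z = 0.
Proof. by rewrite -(scale0r 0) kapZl mul0r. Qed.

Lemma kap0r z : kap z 0 = 0.
Proof. by rewrite kapC kap0l. Qed.

Lemma kapNr x z : kap z (- x) = - kap z x.
Proof. by rewrite -scaleN1r kapZr mulN1r. Qed.

Lemma kapNl x z : kap (- x) z = - kap x z.
Proof. by rewrite kapC kapNr kapC. Qed.

Lemma kap_sumr z (I : finType) (F : I -> g) : kap z (\sum_i F i) = \sum_i kap z (F i).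
Proof. by apply: (big_morph (kap z) (fun x y => kapDr x y z) (kap0r z)). Qed.

Lemma kap_inv x y z : kap (lie x y) z = kap x (lie y z).
Proof.
have tB (f f' f'' : g -> g) : (forall v, f v = f' v - f'' v) -> trace E f = trace E f' - trace E f''.
  move=> hf; rewrite /trace -sumrB; apply: eq_bigr => i _.
  by rewrite hf linearB.
rewrite !kapE (tB _ ((ad g x \o ad g y)%VF \o ad g z) (ad g y \o (ad g x \o ad g z)%VF)); last first.
  by move=> v /=; rewrite grep !lfun_simp.
rewrite (tB (ad g x \o ad g (lie y z)) ((ad g x \o ad g y)%VF \o ad g z) ((ad g x \o ad g z)%VF \o ad g y)).
  by congr (_ - _); apply: traceC.
by move=> v /=; rewrite grep !lfun_simp /= linearB.
Qed.

Lemma kap_weight m m' x y : x \in gsp m -> y \in gsp m' -> kap x y != 0 -> m + m' = 0.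
Proof.
move=> /weightP hx /weightP hy; apply: contraNeq => ne; have [h hh] := dot_sep ne.
have h1 : kap (lie (io h) x) y = - kap x (lie (io h) y).
  by rewrite -kap_inv lie_anti kapNl.
have {h1} : kap (dot m h *: x) y = - kap x (dot m' h *: y) by rewrite -hx -hy.
rewrite kapZl kapZr => /eqP; rewrite -subr_eq0 opprK -mulrDl -dotDl mulf_eq0.
by rewrite dot0l in hh; rewrite (negPf hh).
Qed.

Lemma kap_io h h' : kap (io h) (io h') = \sum_i dot (w i) h * dot (w i) h'.
Proof.
rewrite kapE; apply: eq_bigr => i _ /=; have /weightP hw := E_wt i.
by rewrite hw linearZ /= hw !linearZ /= coord_free ?(basis_free E_basis) // eqxx mulr1 mulrC.
Qed.

Local Notation cj h := (map_mx Num.conj h).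

Lemma dot_conj i h : dot (w i) (cj h) = (dot (w i) h)^*.
Proof.
have [o ->] := w_root i; rewrite /dot rmorph_sum; apply: eq_bigr => j _.
rewrite rmorphM !mxE; congr (_ * _); case: o => [b|] /=; rewrite !mxE ?rmorph0 //.
by rewrite rmorph_int.
Qed.

(** On the Cartan subalgebra the roots are rational, so the Killing form is
    [sum_i |w_i(h)|^2] when [h] is paired with its conjugate; this replaces the usual
    appeal to the real form. *)
Lemma kap_conj_eq0 h : kap (io h) (io (cj h)) = 0 -> h = 0.
Proof.
rewrite kap_io; under eq_bigr do rewrite dot_conj -normCK.
move/eqP; rewrite psumr_eq0 => [/allP hz|i _]; last exact: exprn_ge0.
apply: cr_sep => b; have [x hx x0] := root_space_neq0 b.
have [i <-] := weight_occurs E_basis E_wt hx x0.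
by have := hz i (mem_index_enum _); rewrite /= sqrf_eq0 normr_eq0 => /eqP.
Qed.

Lemma kap_io_nondeg h : (forall h', kap (io h) (io h') = 0) -> h = 0.
Proof. by move=> hz; apply: kap_conj_eq0. Qed.

(** The radical of the Killing form is an ideal without weight zero, hence solvable. *)
Lemma kap_nondeg x : (forall y, kap x y = 0) -> x = 0.
Proof.
move=> hx; have [J hJ] := @vspace_pred K g (fun x => forall y, kap x y = 0)
  (fun y => kap0l y) (fun c u v hu hv y => etrans (kapDl _ _ _)
     (etrans (congr2 +%R (etrans (kapZl _ _ _) (etrans (congr1 _ (hu y)) (mulr0 _))) (hv y)) (addr0 0))).
have hI u v : v \in J -> lie u v \in J.
  by move=> /hJ hv; apply/hJ => y; rewrite lie_anti kapNl kap_inv hv oppr0.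
have J_lie u v : u \in J -> v \in J -> lie u v \in J by move=> _; apply: hI.
have J_io h : io h \in J -> h = 0.
  by move=> /hJ hh; apply: kap_io_nondeg => h'; apply: hh.
have gJ : graded_sub J J.
  split=> //; have [l [h1 h2]] := span_pred (homog J); exists l; split=> //.
  apply/eqP; rewrite eqEsubv; apply/andP; split; apply/subvP => v; last first.
    by move: v; apply/subvP/span_subvP => v /h1[].
  move=> vJ; have [X [hX e]] := root_decomp v.
  have hXJ o : X o \in J by apply: (lie_component (U := J) (X := X)); [move=> h u; apply: hI|exact: hX|rewrite -e].
  rewrite e; apply: memv_suml => -[b|] _; first by apply: h2; split=> //; exists b; apply: (hX (Some b)).
  have [h eh] := weight0_io (hX None); have := hXJ None; rewrite eh => /J_io ->.
  by rewrite linear0 mem0v.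
have sJ := graded_solvable J_lie J_io (leqnn _) gJ.
have [hss _ _ _ _] := gP; have J0 : J = 0%VS.
  by apply: hss sJ => u; apply/subvP => _ /memv_imgP[v vJ ->]; apply: hI.
by apply/eqP; rewrite -memv0 -J0; apply/hJ.
Qed.

Lemma root_pair b : exists e f, [/\ e \in gsp (cr b), f \in gsp (- cr b) & kap e f = 1].
Proof.
have [e he e0] := root_space_neq0 b.
have [y hy] : exists y, kap e y != 0.
  apply: contrapT => h; move/eqP: e0; apply; apply: kap_nondeg => y.
  by apply/eqP/negPn/negP => ne; apply: h; exists y.
have [X [hX ey]] := root_decomp y; have [o ho] : exists o, kap e (X o) != 0.
  apply: contrapT => h; move: hy; rewrite ey kap_sumr big1 ?eqxx // => o _.
  by apply/eqP/negPn/negP => ne; apply: h; exists o.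
exists e, ((kap e (X o))^-1 *: X o); split; [exact: he| |by rewrite kapZr mulVf].
apply: memvZ; have /eqP := kap_weight he (hX o) ho.
by rewrite addrC addr_eq0 => /eqP <-; apply: hX.
Qed.

Lemma lie_pair b e f : e \in gsp (cr b) -> f \in gsp (- cr b) -> exists t, lie e f = io t /\
  forall h, kap (io t) (io h) = kap e f * dot (cr b) h.
Proof.
move=> he hf; have : lie e f \in gsp 0 by rewrite -(subrr (cr b)); apply: (weight_act grep he hf).
move=> /weight0_io[t et]; exists t; split=> // h.
rewrite -et kap_inv lie_anti kapNr (weight_lie _ hf).
by rewrite dotNl scaleNr kapNr opprK kapZr mulrC.
Qed.

(** The vector dual to a root is fixed by conjugation, so its square length is a sum of
    squared absolute values. *)
Lemma pair_vector_real t b : (forall h, kap (io t) (io h) = dot (cr b) h) -> dot (cr b) t != 0.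
Proof.
move=> ht; have kB (u v : 'rV[K]_n) h : kap (io (u - v)) (io h) = kap (io u) (io h) - kap (io v) (io h).
  by rewrite linearB kapDl kapNl.
have kc (u v : 'rV[K]_n) : kap (io (cj u)) (io (cj v)) = (kap (io u) (io v))^*.
  rewrite !kap_io rmorph_sum; apply: eq_bigr => i _.
  by rewrite !dot_conj rmorphM.
have dc (v : 'rV[K]_n) : dot (cr b) (cj v) = (dot (cr b) v)^*.
  rewrite /dot rmorph_sum; apply: eq_bigr => i _; rewrite rmorphM !mxE.
  by rewrite rmorph_int.
have cjK (v : 'rV[K]_n) : cj (cj v) = v by apply/rowP => i; rewrite !mxE conjCK.
have e : cj t = t.
  apply/eqP; rewrite -subr_eq0; apply/eqP/kap_io_nondeg => h; rewrite kB ht.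
  by rewrite -(cjK h) kc ht [X in _ - X]dc subrr.
rewrite -ht -{2}e; apply/eqP => /kap_conj_eq0 t0.
by have := ht (rt b); rewrite t0 linear0 kap0l cr_rt => /eqP; rewrite eq_sym pnatr_eq0.
Qed.

(** A second root vector could be corrected to one killed by the raising operator; as its
    [h]-eigenvalue is [-2], this contradicts integrality and positivity of highest
    weights for sl2. *)
Lemma root_line b : exists2 f, f \in gsp (- cr b) & forall y, y \in gsp (- cr b) -> exists c, y = c *: f.
Proof.
have [e [f [he hf ef]]] := root_pair b; exists f => // y hy; exists (kap e y).
have [t [et ht]] := lie_pair he hf; have ht' h : kap (io t) (io h) = dot (cr b) h by rewrite ht ef mul1r.
have s0 := pair_vector_real ht'; set s := dot (cr b) t in s0.
pose z := y - kap e y *: f; have hz : z \in gsp (- cr b) := memvB hy (memvZ _ hf).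
have ez : lie e z = 0.
  have [t' [-> ht0]] := lie_pair he hz; suff -> : t' = 0 by rewrite linear0.
  by apply: kap_io_nondeg => h; rewrite ht0 /z kapDr kapNr kapZr ef mulr1 subrr mul0r.
apply/eqP; rewrite -subr_eq0 -/z; apply/negPn/negP => z0.
(* A vector of weight -2 killed by the raising operator. *)
pose f' := (2 / s) *: f; pose h' := (2 / s) *: io t.
have hf' : f' \in gsp (- cr b) by apply: memvZ.
have [k hk] : exists k : nat, -2 = k%:R :> K.
  apply: (@sl2_highest_weight K g (ad g e) (ad g f') (ad g h') _ z) => //.
  - move=> v; rewrite -[LHS]/(lie e (lie f' v)) grep_comm addrC; congr (_ + lie _ v).
    by rewrite lieZr et.
  - move=> v; rewrite -[LHS]/(lie h' (lie f' v)) grep_comm addrC; congr (_ + _).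
    rewrite lieZl (weight_lie _ hf') scalerA dotNl mulrN mulfVK // lieZl.
    by rewrite scaleNr scaler_nat.
  - rewrite -[LHS]/(lie h' z) lieZl (weight_lie _ hz).
    by rewrite scalerA dotNl mulrN mulfVK.
  have [N' [E' [w' [hE hw]]]] := lie_basis.
  apply: (act_nilpotent grep hE (fun i => (hw i).1) _ hf' hz).
  by rewrite oppr_eq0 cr_neq0.
have /eqP : (2 + k)%:R = 0 :> K by rewrite natrD -hk subrr.
by rewrite pnatr_eq0.
Qed.

Lemma root_space_dim b : \dim (gsp (cr b)) = 1%N.
Proof.
have [f hf hl] := root_line (opp_root b); rewrite cr_opp opprK in hf hl.
have [x hx x0] := root_space_neq0 b.
have -> : gsp (cr b) = <[f]>%VS.
  apply/eqP; rewrite eqEsubv -memvE hf andbT; apply/subvP => y /hl[c ->].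
  by rewrite memvZ ?memv_line.
rewrite dim_vline; case: eqP => // f0; have [c] := hl _ hx; rewrite f0 scaler0 => e.
by rewrite e eqxx in x0.
Qed.

Lemma kap_io_roots h h' : kap (io h) (io h') = \sum_(b : Phi D) dot (cr b) h * dot (cr b) h'.
Proof.
have e b : \sum_i (if w i == cr b then dot (w i) h * dot (w i) h' else 0) = dot (cr b) h * dot (cr b) h'.
  rewrite -big_mkcond /= (eq_bigr (fun _ => dot (cr b) h * dot (cr b) h')) => [|i /eqP -> //].
  rewrite sumr_const; have := weight_dim E_basis E_wt (cr b); rewrite root_space_dim => <-.
  by rewrite mulr1n.
rewrite kap_io -(eq_bigr _ (fun b _ => e b)) exchange_big /=; apply: eq_bigr => i _.
have [[b|] eo] := w_root i; rewrite /= in eo.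
  rewrite (bigD1 b) //= eo eqxx big1 ?addr0 // => b' bb'.
  by rewrite (inj_eq cr_inj) eq_sym (negPf bb').
by rewrite eo dot0l mul0r big1 // => b _; case: ifP.
Qed.

(** ** The dual form on the weights *)

Lemma dot_cx (u v : 'rV[R]_n) : dot (cx u) (cx v) = (dot u v)%:C%C.
Proof. by rewrite /dot rmorph_sum; apply: eq_bigr => i _; rewrite !mxE rmorphM. Qed.

Lemma cx_rcr b : cx (rcr b) = cr b.
Proof. by apply/rowP => i; rewrite !mxE rmorph_int. Qed.

Lemma cx_rrt b : cx (rrt b) = rt b.
Proof. by apply/rowP => i; rewrite !mxE rmorph_int. Qed.

Lemma cx_delta i : cx (delta_mx 0 i) = delta_mx 0 i.
Proof. by apply/rowP => j; rewrite !mxE rmorph_nat. Qed.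

Lemma rdot_cx (u v : 'rV[R]_n) : (rdot u v)%:C%C = \sum_(b : Phi D) dot (cr b) (cx u) * dot (cr b) (cx v).
Proof.
rewrite /form rmorph_sum; apply: eq_bigr => b _; rewrite rmorphM /= -!cx_rcr !dot_cx.
by [].
Qed.

Lemma rdot_eq0 (u : 'rV[R]_n) : rdot u u = 0 -> u = 0.
Proof.
move/eqP; rewrite psumr_eq0 => [/allP hz|b _]; last exact: sqr_ge0.
have h0 : cx u = 0.
  apply: cr_sep => b; have := hz b (mem_index_enum _); rewrite /= mulf_eq0 orbb => /eqP hb.
  by rewrite -cx_rcr dot_cx -[dot _ u]/(pair (D := dual) b u) hb.
apply/rowP => i; have /rowP/(_ i) := h0; rewrite !mxE => /eqP.
by rewrite fmorph_eq0 => /eqP.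
Qed.

Lemma rdot_inj (u v : 'rV[R]_n) : (forall z : 'rV[R]_n, rdot u z = rdot v z) -> u = v.
Proof.
move=> hz; apply/eqP; rewrite -subr_eq0; apply/eqP/rdot_eq0.
by rewrite formBl hz subrr.
Qed.

Definition rnorm b : R := rdot (rrt b) (rrt b).

Lemma rdot_rrt b (u : 'rV[R]_n) : 2 * rdot (rrt b) u = rnorm b * dot (rcr b) u.
Proof. exact: (form_coroot (D := dual_datum D) b u). Qed.

Lemma rnorm_gt0 b : 0 < rnorm b.
Proof.
rewrite lt_def form_ge0 andbT; apply/eqP => /rdot_eq0 e.
have := cr_rt b; rewrite -cx_rrt e /complexify map_mx0 dot_sym dot0l => /eqP.
by rewrite eq_sym pnatr_eq0.
Qed.

Lemma rnorm_opp b : rnorm (opp_root b) = rnorm b.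
Proof.
rewrite /rnorm; have -> : rrt (opp_root b) = - rrt b.
  have := rt_opp b; rewrite -!cx_rrt => /rowP h; apply/rowP => i; have := h i.
  by rewrite !mxE -rmorphN => /complexI.
by rewrite formNl formC formNl opprK.
Qed.

Lemma inv_gram_ex : exists M : 'M[R]_n, forall u v, rdot (u *m M) v = dot u v.
Proof.
pose Gm : 'M[R]_n := \sum_(b : Phi D) (rcr b)^T *m rcr b.
have hG (u v : 'rV[R]_n) : dot (u *m Gm) v = rdot u v.
  rewrite /Gm mulmx_sumr dot_suml; apply: eq_bigr => b _; rewrite mulmxA.
  have -> : u *m (rcr b)^T *m rcr b = dot (rcr b) u *: rcr b.
    apply/rowP => i; rewrite !mxE big_ord1 !mxE; congr (_ * _).
    by apply: eq_bigr => j _; rewrite !mxE mulrC.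
  by rewrite dotZl.
have hu : Gm \in unitmx.
  rewrite -row_free_unit -kermx_eq0; apply/rowV0P => u /sub_kermxP uG.
  by apply: rdot_eq0; rewrite -hG uG dot0l.
by exists (invmx Gm) => u v; rewrite -hG mulmxKV.
Qed.

Definition inv_gram : 'M[R]_n := projT1 (cid inv_gram_ex).

Lemma inv_gramP (u v : 'rV[R]_n) : rdot (u *m inv_gram) v = dot u v.
Proof. by rewrite /inv_gram; case: cid. Qed.

(** The form on weights dual to the Killing form on the Cartan subalgebra, whose Gram
    matrix is that of [rdot]. *)
Definition wform (u v : 'rV[R]_n) : R := rdot (u *m inv_gram) (v *m inv_gram).

Lemma wformE (u v : 'rV[R]_n) : wform u v = dot u (v *m inv_gram).
Proof. exact: inv_gramP. Qed.

Lemma wform_rcr (u : 'rV[R]_n) b : wform u (rcr b) = 2 / rnorm b * dot u (rrt b).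
Proof.
have e : rcr b *m inv_gram = (2 / rnorm b) *: rrt b.
  apply: rdot_inj => v; rewrite inv_gramP formZl.
  apply: (mulfI (lt0r_neq0 (rnorm_gt0 b))); rewrite -rdot_rrt mulrA [rnorm b * _]mulrC.
  by rewrite mulfVK // gt_eqF // rnorm_gt0.
by rewrite wformE e dotZr.
Qed.

(** ** Normalized root vectors *)

Section Triples.
Variable p : pred (Phi D).
Hypothesis p_opp : forall b, p (opp_root b) = ~~ p b.

(** The choice is made on the roots in [p] and transported to their opposites, so that
    exchanging [e] and [f] corresponds to [b |-> -b]. *)
Lemma root_vectors : exists e f : Phi D -> g, forall b,
  [/\ e b \in gsp (cr b), f b \in gsp (- cr b), lie (e b) (f b) = io (rt b),
      kap (e b) (f b) = (rnorm b / 2)%:C%C & e (opp_root b) = f b /\ f (opp_root b) = e b].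
Proof.
have base b : exists ef : g * g, [/\ ef.1 \in gsp (cr b), ef.2 \in gsp (- cr b),
    lie ef.1 ef.2 = io (rt b) & kap ef.1 ef.2 = (rnorm b / 2)%:C%C].
  have [e [f [he hf ef]]] := root_pair b; pose c : K := (rnorm b / 2)%:C%C.
  exists (e, c *: f); split=> /=; [exact: he|exact: memvZ|  |by rewrite kapZr ef mulr1].
  have hcf : c *: f \in gsp (- cr b) by apply: memvZ.
  have [t [-> ht]] := lie_pair he hcf; congr (io _); apply/eqP; rewrite -subr_eq0; apply/eqP.
  apply: kap_io_nondeg => h; rewrite linearB kapDl kapNl ht kapZr ef mulr1.
  suff -> : kap (io (rt b)) (io h) = c * dot (cr b) h by rewrite subrr.
  rewrite (lin_delta (F := fun u => kap (io (rt b)) (io u))); first last.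
  - by move=> a x; rewrite linearZ kapZr.
  - by move=> x y; rewrite linearD kapDr.
  rewrite (lin_delta (F := fun u => c * dot (cr b) u)); first last.
  - by move=> a x; rewrite dotZr mulrCA.
  - by move=> x y; rewrite dotDr mulrDr.
  apply: eq_bigr => i _; congr (_ * _).
  rewrite kap_io_roots -cx_delta -cx_rrt -rdot_cx -cx_rcr dot_cx /c -rmorphM; congr (_%:C)%C.
  have := rdot_rrt b (delta_mx 0 i); lra.
have /choice[ef hef] := base.
exists (fun b => if p b then (ef b).1 else (ef (opp_root b)).2),
       (fun b => if p b then (ef b).2 else (ef (opp_root b)).1) => b.
have ob : opp_root (opp_root b) = b := opp_rootK R b.
have [h1 h2 h3 h4] := hef b; have := hef (opp_root b); rewrite cr_opp opprK rt_opp rnorm_opp.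
move=> [k1 k2 k3 k4]; rewrite p_opp ob; case: (p b) => /=.
  by split; [exact: h1|exact: h2|exact: h3|exact: h4|split].
split; [exact: k2|exact: k1| |by rewrite kapC|by split].
by rewrite lie_anti k3 linearN opprK.
Qed.

End Triples.

Section Casimir.
Variables (e f : Phi D -> g).
Hypothesis efP : forall b, [/\ e b \in gsp (cr b), f b \in gsp (- cr b),
  lie (e b) (f b) = io (rt b) & kap (e b) (f b) = (rnorm b / 2)%:C%C].
Local Notation c b := ((2 / rnorm b)%:C%C : K).

Lemma root_space_line b y : y \in gsp (cr b) -> exists d, y = d *: e b.
Proof.
have [he _ _ hk] := efP b; have e0 : e b != 0.
  apply/eqP => eb; move: hk; rewrite eb kap0l => /esym/eqP; rewrite fmorph_eq0 => /eqP h.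
  by have := rnorm_gt0 b; lra.
have -> : gsp (cr b) = <[e b]>%VS.
  by apply/eqP; rewrite eq_sym eqEdim -memvE he root_space_dim dim_vline e0.
by move/vlineP.
Qed.

Definition dual_l (t : 'I_n + Phi D) : g :=
  match t with inl i => io (delta_mx 0 i) | inr b => e b end.
Definition dual_r (t : 'I_n + Phi D) : g :=
  match t with inl i => io (cx (delta_mx 0 i *m inv_gram)) | inr b => c b *: f b end.

Lemma lie_expand x : exists (h : 'rV[K]_n) (d : Phi D -> K), x = io h + \sum_b d b *: e b.
Proof.
have [X [hX ->]] := root_decomp x; rewrite sum_option; have [h ->] := weight0_io (hX None).
have /choice[d hd] b := root_space_line (hX (Some b)); exists h, d; congr (_ + _).
by apply: eq_bigr.
Qed.

Lemma kap_neq m m' x y : x \in gsp m -> y \in gsp m' -> m + m' != 0 -> kap x y = 0.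
Proof. by move=> hx hy ne; apply: contraNeq ne => /(kap_weight hx hy) ->. Qed.

Lemma dual_pair (h : 'rV[K]_n) (d : Phi D -> K) t :
  kap (io h + \sum_b d b *: e b) (dual_r t) =
  match t with inl i => h 0 i | inr b => d b end.
Proof.
rewrite kapDl kapC -(kapC (dual_r t)) kap_sumr; case: t => [i|b] /=.
  rewrite big1 ?addr0 => [|b _]; last first.
    rewrite kapZr; have [he _ _ _] := efP b.
    by rewrite (kap_neq (io_weight _) he) ?mulr0 // add0r cr_neq0.
  rewrite (lin_delta (F := fun u => kap (io (cx (delta_mx 0 i *m inv_gram))) (io u))); first last.
  - by move=> a u; rewrite linearZ kapZr.
  - by move=> u v; rewrite linearD kapDr.
  rewrite (eq_bigr (fun j => h 0 j * (i == j)%:R)) => [|j _]; last first.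
    by rewrite kap_io_roots -cx_delta -rdot_cx inv_gramP dot_delta mxE eqxx eq_sym rmorph_nat.
  rewrite (bigD1 i) //= eqxx mulr1 big1 ?addr0 // => j ji.
  by rewrite eq_sym (negPf ji) mulr0.
have [heb hfb _ hk] := efP b; rewrite kapZl (kap_neq hfb (io_weight h)) ?addr0 ?oppr_eq0 ?cr_neq0 //.
rewrite mulr0 add0r (bigD1 b) //= big1 ?addr0 => [|b' ne]; last first.
  have [he' _ _ _] := efP b'; rewrite kapZl kapZr (kap_neq hfb he') ?mulr0 //.
  by rewrite addrC subr_eq0 (inj_eq cr_inj).
rewrite kapZl kapZr [kap (f b) _]kapC hk mulrCA -rmorphM.
have -> : 2 / rnorm b * (rnorm b / 2) = 1 by field; rewrite gt_eqF // rnorm_gt0.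
by rewrite mulr1.
Qed.

Lemma dual_expand_l x : x = \sum_t kap x (dual_r t) *: dual_l t.
Proof.
have [h [d ->]] := lie_expand x; rewrite big_sumType /=; congr (_ + _).
  rewrite {1}(row_sum_delta h) linear_sum; apply: eq_bigr => i _.
  by rewrite (dual_pair h d (inl i)) linearZ.
by apply: eq_bigr => b _; rewrite (dual_pair h d (inr b)).
Qed.

Lemma dual_expand_r x : x = \sum_t kap x (dual_l t) *: dual_r t.
Proof.
apply/eqP; rewrite -subr_eq0; apply/eqP/kap_nondeg => y; rewrite kapDl kapNl.
rewrite {1}(dual_expand_l y) kap_sumr -(kapC y) kap_sumr; apply/eqP; rewrite subr_eq0; apply/eqP.
by apply: eq_bigr => t _; rewrite !kapZr mulrC.
Qed.

Section CasimirRep.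
Variables (V : vectType K) (rho : 'Hom(g, 'End(V))).
Hypothesis V_rep : is_rep rho.

Definition casimir (v : V) : V := \sum_t rho (dual_l t) (rho (dual_r t) v).

Lemma rho_sum (F : 'I_n + Phi D -> g) (v : V) : rho (\sum_t F t) v = \sum_t rho (F t) v.
Proof. by rewrite linear_sum sum_lfunE. Qed.

(** Dual bases make the two contributions of a commutator cancel. *)
Lemma casimir_comm z (v : V) : casimir (rho z v) = rho z (casimir v).
Proof.
apply/esym/eqP; rewrite -subr_eq0 /casimir linear_sum -sumrB; apply/eqP.
transitivity (\sum_t (rho (lie z (dual_l t)) (rho (dual_r t) v) + rho (dual_l t) (rho (lie z (dual_r t)) v))).
  apply: eq_bigr => t _ /=; rewrite (rep_comm V_rep z (dual_l t)) (rep_comm V_rep z (dual_r t)).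
  by rewrite linearD addrA addrK.
rewrite big_split /=.
have -> : \sum_t rho (lie z (dual_l t)) (rho (dual_r t) v) =
    \sum_t \sum_u kap (lie z (dual_l t)) (dual_r u) *: rho (dual_l u) (rho (dual_r t) v).
  apply: eq_bigr => t _; rewrite {1}(dual_expand_l (lie z _)) rho_sum.
  by apply: eq_bigr => u _; rewrite repZl.
have -> : \sum_t rho (dual_l t) (rho (lie z (dual_r t)) v) =
    \sum_t \sum_u kap (lie z (dual_r t)) (dual_l u) *: rho (dual_l t) (rho (dual_r u) v).
  apply: eq_bigr => t _; rewrite {1}(dual_expand_r (lie z _)) rho_sum linear_sum.
  by apply: eq_bigr => u _; rewrite repZl linearZ.
rewrite exchange_big -big_split big1 //= => t _; rewrite -big_split big1 //= => u _.
rewrite -scalerDl; suff -> : kap (lie z (dual_l u)) (dual_r t) + kap (lie z (dual_r t)) (dual_l u) = 0 by rewrite scale0r.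
have -> : kap (lie z (dual_l u)) (dual_r t) = - kap (dual_l u) (lie z (dual_r t)).
  by rewrite lie_anti kapNl kap_inv.
rewrite [X in _ + X]kapC.
by rewrite addNr.
Qed.

End CasimirRep.

(** ** Highest weight representations *)

Section HighestWeight.
Variables (V : vectType K) (rho : 'Hom(g, 'End(V))).
Hypothesis V_rep : is_rep rho.
Hypothesis V_irr : irreducible_rep rho.
Variable p : pred (Phi D).
Hypothesis p_opp : forall b, p (opp_root b) = ~~ p b.
Hypothesis ef_opp : forall b, e (opp_root b) = f b /\ f (opp_root b) = e b.
Variables (la : 'rV[R]_n) (v0 : V).
Hypothesis la_int : forall b : Phi D, dot la (rrt b) \is a Num.int.
Hypothesis v0_neq0 : v0 != 0.
Hypothesis v0_wt : v0 \in weight_space io rho (cx la).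
Hypothesis v0_hw : forall b x, p b -> x \in gsp (cr b) -> rho x v0 = 0.
(* A height, used to see that no nonempty sum of positive coroots vanishes. *)
Variable hgt : 'rV[R]_n.
Hypothesis hgt_gt0 : forall b, p b -> 0 < dot (rcr b) hgt.
Local Notation wsp := (weight_space io rho).
Implicit Types (l : seq (Phi D)) (v : V) (mu : 'rV[R]_n).

Definition lowered l : V := foldr (fun b v => rho (f b) v) v0 l.
Definition lowered_wt l : 'rV[R]_n := la - \sum_(b <- l) rcr b.

Lemma e_in b : e b \in gsp (cr b). Proof. by have [h _ _ _] := efP b; exact: h. Qed.
Lemma f_in b : f b \in gsp (- cr b). Proof. by have [_ h _ _] := efP b; exact: h. Qed.
Lemma ef_in b : lie (e b) (f b) = io (rt b). Proof. by have [_ _ h _] := efP b; exact: h. Qed.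

Lemma cxB (u v : 'rV[R]_n) : cx (u - v) = cx u - cx v.
Proof. by apply/rowP => i; rewrite !mxE rmorphB. Qed.
Lemma cxD (u v : 'rV[R]_n) : cx (u + v) = cx u + cx v.
Proof. by apply/rowP => i; rewrite !mxE rmorphD. Qed.

Lemma rep_weight m h v : v \in wsp m -> rho (io h) v = dot m h *: v.
Proof. by move/weightP => /(_ h). Qed.

Lemma f_weight b v mu : v \in wsp (cx mu) -> rho (f b) v \in wsp (cx (mu - rcr b)).
Proof.
have [_ hf _ _] := efP b => hv; have := weight_act V_rep hf hv.
by rewrite cxB cx_rcr addrC.
Qed.

Lemma e_weight b v mu : v \in wsp (cx mu) -> rho (e b) v \in wsp (cx (mu + rcr b)).
Proof.
have [he _ _ _] := efP b => hv; have := weight_act V_rep he hv.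
by rewrite cxD cx_rcr addrC.
Qed.

Lemma ef_comm b v mu : v \in wsp (cx mu) ->
  rho (e b) (rho (f b) v) = rho (f b) (rho (e b) v) + (dot mu (rrt b))%:C%C *: v.
Proof.
move=> hv; have [_ _ h _] := efP b.
by rewrite (rep_comm V_rep) h (rep_weight _ hv) -cx_rrt dot_cx addrC.
Qed.

Lemma lowered_weight l : lowered l \in wsp (cx (lowered_wt l)).
Proof.
elim: l => [|b l IH]; first by rewrite /lowered_wt big_nil subr0.
have := f_weight b IH; rewrite /lowered_wt big_cons; congr (_ \in wsp (cx _)).
by rewrite opprD addrA addrAC.
Qed.

(** Since [e] commutes past a lowering operator up to elements of the Lie algebra, the span
    of the lowered vectors is a submodule; irreducibility does the rest. *)
Lemma lowered_span (U : {vspace V}) : (forall l, all p l -> lowered l \in U) -> U = fullv.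
Proof.
move=> hU; have [L [hL1 hL2]] := span_pred (fun v => exists2 l, all p l & v = lowered l).
pose Y := <<L>>%VS; have hY l : all p l -> lowered l \in Y by move=> hl; apply: hL2; exists l.
have stab x : (forall l, all p l -> rho x (lowered l) \in Y) -> forall v, v \in Y -> rho x v \in Y.
  move=> hx v vY; have : (rho x @: Y <= Y)%VS.
    rewrite /Y limg_span; apply/span_subvP => _ /seq.mapP[u /hL1[l hl ->] ->].
    exact: hx.
  by move/subvP; apply; apply: memv_img.
have stabf b v : p b -> v \in Y -> rho (f b) v \in Y.
  by move=> pb; apply: stab => l hl; apply: (hY (b :: l)); rewrite /= pb.
have hv0 : v0 \in Y by apply: (hY [::]).
have act l x : all p l -> rho x (lowered l) \in Y.
  elim: l x => [|b l IH] x; last first.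
    move=> /= /andP[pb pl]; rewrite (rep_comm V_rep) memvD //; first exact: IH.
    by apply: stabf => //; apply: IH.
  move=> _ /=; have [h [d ->]] := lie_expand x.
  rewrite linearD lfun_simp (rep_weight _ v0_wt) memvD ?memvZ //.
  rewrite linear_sum sum_lfunE; apply: memv_suml => b _; rewrite linearZ lfun_simp memvZ //.
  case: (boolP (p b)) => pb; first by have [he _ _ _] := efP b; rewrite (v0_hw pb he) mem0v.
  by rewrite -(opp_rootK R b) (ef_opp _).1 stabf // p_opp.
have [_ /(_ Y)] := V_irr; case=> [x|Y0|Yf].
- by apply/subvP => _ /memv_imgP[v vY ->]; apply: stab => // l; apply: act.
- by rewrite Y0 memv0 (negPf v0_neq0) in hv0.
apply/eqP; rewrite eqEsubv subvf /= -Yf; apply/span_subvP => v /hL1[l hl ->].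
exact: hU.
Qed.

Lemma lowered_basis : exists N' (b : N'.-tuple V) (l : 'I_N' -> seq (Phi D)),
  basis_of fullv b /\ forall i : 'I_N', all p (l i) /\ b`_i = lowered (l i).
Proof.
have [L [hL1 hL2]] := span_pred (fun v => exists2 l, all p l & v = lowered l).
have [L' [h1 h2 h3]] := free_subspan L.
have /choice[l hl] (i : 'I_(size L')) : exists l, all p l /\ L'`_i = lowered l.
  by have [l hl e'] := hL1 _ (h1 _ (mem_nth 0 (ltn_ord i))); exists l.
exists (size L'), (in_tuple L'), l; split=> //; rewrite /basis_of h2 andbT.
apply/eqP; rewrite [LHS]h3; apply: lowered_span => l0 hl0.
by apply: hL2; exists l0.
Qed.

Lemma lowered_wt_top l : all p l -> lowered_wt l = la -> l = [::].
Proof.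
move=> hl; rewrite /lowered_wt => /eqP; rewrite -subr_eq0 addrAC subrr add0r oppr_eq0 => /eqP hs.
case: l hl hs => // b l /= /andP[pb pl] hs; have := congr1 (fun u : 'rV[R]_n => dot u hgt) hs.
rewrite big_cons dotDl dot0l dot_suml => hs'.
have h1 := hgt_gt0 pb; have : 0 <= \sum_(b <- l) dot (rcr b) hgt.
  elim: l pl {hs hs'} => [|c l IH] /=; first by rewrite big_nil.
  by move=> /andP[pc /IH h]; rewrite big_cons addr_ge0 // ltW // hgt_gt0.
by move=> h2; have := ltr_pwDl h1 h2; rewrite hs' ltxx.
Qed.

Section WithBasis.
Variables (N' : nat) (b : N'.-tuple V) (l_ : 'I_N' -> seq (Phi D)).
Hypothesis b_basis : basis_of fullv b.
Hypothesis b_low : forall i : 'I_N', all p (l_ i) /\ b`_i = lowered (l_ i).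
Local Notation wt i := (lowered_wt (l_ i)).

Lemma b_wt (i : 'I_N') : b`_i \in wsp (cx (wt i)).
Proof. by have [_ ->] := b_low i; apply: lowered_weight. Qed.

Lemma cx_inj : injective cx.
Proof. by move=> u v /rowP h; apply/rowP => i; have := h i; rewrite !mxE => /complexI. Qed.

Definition mult mu : nat := #|[pred i | wt i == mu]|.

Lemma mult_dim mu : \dim (wsp (cx mu)) = mult mu.
Proof.
rewrite (weight_dim b_basis b_wt (cx mu)); apply: eq_card => i; rewrite !inE.
by rewrite (inj_eq cx_inj).
Qed.

Lemma weight_real m : wsp m != 0%VS -> exists i, m = cx (wt i).
Proof.
rewrite -vpick0 => h; have [i <-] := weight_occurs b_basis b_wt (memv_pick (wsp m)) h.
by exists i.
Qed.

Lemma mult_wt mu : mult mu != 0%N -> exists i, wt i = mu.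
Proof.
rewrite -lt0n => /card_gt0P[j]; rewrite inE => /eqP <-.
by exists j.
Qed.

Lemma mult_top : mult la = 1%N.
Proof.
have [i0 hi0] := weight_occurs b_basis b_wt v0_wt v0_neq0; have {}hi0 := cx_inj hi0.
transitivity #|pred1 i0|; last exact: card1.
apply: eq_card => i; rewrite !inE; apply/eqP/eqP => [h|-> //].
have e0 j : wt j = la -> b`_j = v0.
  by move=> hj; have [hp ->] := b_low j; rewrite (lowered_wt_top hp hj).
apply/val_inj/eqP; rewrite -(nth_uniq 0 _ _ (free_uniq (basis_free b_basis))) ?size_tuple ?ltn_ord //.
by rewrite !e0.
Qed.

Lemma wt_int i a : dot (wt i) (rrt a) \is a Num.int.
Proof.
rewrite /lowered_wt dotBl rpredB // dot_suml rpred_sum // => c _.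
rewrite /dot rpred_sum // => j _; rewrite !mxE -rmorphM.
exact: intr_int.
Qed.

(** *** The Casimir operator is a scalar *)

Lemma casimir_lin c' u v : casimir rho (c' *: u + v) = c' *: casimir rho u + casimir rho v.
Proof.
rewrite /casimir scaler_sumr -big_split; apply: eq_bigr => t _ /=.
by rewrite !(linearD, linearZ).
Qed.

Lemma casimir_cartan mu v : v \in wsp (cx mu) ->
  casimir rho v = (wform mu mu)%:C%C *: v + \sum_a c a *: rho (e a) (rho (f a) v).
Proof.
move=> hv; rewrite /casimir big_sumType /=; congr (_ + _); last first.
  by apply: eq_bigr => a _; rewrite linearZ lfun_simp linearZ.
have -> : wform mu mu = \sum_i mu 0 i * dot mu (delta_mx 0 i *m inv_gram).
  rewrite wformE {2}(row_sum_delta mu) mulmx_suml dot_sym dot_suml.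
  by apply: eq_bigr => i _; rewrite -scalemxAl dotZl dot_sym.
rewrite rmorph_sum scaler_suml; apply: eq_bigr => i _.
rewrite (rep_weight _ hv) linearZ /= (rep_weight _ hv) scalerA -cx_delta !dot_cx dot_delta.
by rewrite rmorphM mulrC.
Qed.

Definition cas : R := wform la la + \sum_(a | p a) wform la (rcr a).

Lemma casimir_v0 : casimir rho v0 = cas%:C%C *: v0.
Proof.
rewrite (casimir_cartan v0_wt) /cas rmorphD scalerDl; congr (_ + _).
rewrite (bigID p) /= [X in _ + X]big1 ?addr0 => [|a pa]; last first.
  rewrite -(opp_rootK R a) (ef_opp _).2 (v0_hw _ (e_in _)) ?p_opp //.
  by rewrite linear0 scaler0.
rewrite rmorph_sum scaler_suml; apply: eq_bigr => a pa.
rewrite (ef_comm a v0_wt) (v0_hw pa (e_in a)).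
by rewrite linear0 add0r scalerA wform_rcr -rmorphM.
Qed.

(** [casimir] commutes with the action, so its value on the highest weight vector
    propagates to all lowered vectors. *)
Lemma casimir_scalar v : casimir rho v = cas%:C%C *: v.
Proof.
have Q0 : casimir rho 0 = cas%:C%C *: (0 : V).
  by rewrite scaler0 /casimir big1 // => t _; rewrite !linear0.
have QD c' u u' : casimir rho u = cas%:C%C *: u -> casimir rho u' = cas%:C%C *: u' ->
    casimir rho (c' *: u + u') = cas%:C%C *: (c' *: u + u').
  by move=> hu hw; rewrite casimir_lin hu hw scalerDr !scalerA mulrC.
have [U hU] := vspace_pred Q0 QD.
apply/hU; rewrite (lowered_span (U := U)) ?memvf // => l _; apply/hU.
elim: l => [|a l IH]; first exact: casimir_v0.
by rewrite /= (casimir_comm V_rep) IH linearZ.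
Qed.

(** *** Traces on weight spaces *)

Definition wtrace (F : V -> V) mu : K := \sum_(i | wt i == mu) coord b i (F b`_i).

Definition root_trace a mu : K := c a * wtrace (fun v => rho (f a) (rho (e a) v)) mu.

Lemma wtrace_ef a mu : c a * wtrace (fun v => rho (e a) (rho (f a) v)) mu =
  root_trace a mu + (wform mu (rcr a))%:C%C * (mult mu)%:R.
Proof.
have -> : wtrace (fun v => rho (e a) (rho (f a) v)) mu =
    wtrace (fun v => rho (f a) (rho (e a) v)) mu + (dot mu (rrt a))%:C%C * (mult mu)%:R.
  rewrite /wtrace /mult -sum1_card natr_sum mulr_sumr -big_split /=.
  apply: eq_bigr => i /eqP hi; have hb := b_wt i; rewrite hi in hb.
  by rewrite (ef_comm a hb) linearD linearZ /= coord_free ?(basis_free b_basis) // eqxx.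
have -> : (wform mu (rcr a))%:C%C = c a * (dot mu (rrt a))%:C%C by rewrite wform_rcr -rmorphM.
by rewrite mulrDr mulrA.
Qed.

(** The trace of a product does not depend on the order, and root vectors shift
    weights. *)
Lemma root_trace_shift a mu :
  root_trace a mu = root_trace a (mu + rcr a) + (wform (mu + rcr a) (rcr a))%:C%C * (mult (mu + rcr a))%:R.
Proof.
rewrite -wtrace_ef; congr (_ * _).
have coord0 i v m : v \in wsp (cx m) -> wt i != m -> coord b i v = 0.
  by move=> hv ne; apply: (coord_weight b_basis b_wt hv); rewrite (inj_eq cx_inj).
transitivity (\sum_(i | wt i == mu) \sum_(j | wt j == mu + rcr a)
    coord b j (rho (e a) b`_i) * coord b i (rho (f a) b`_j)).
  apply: eq_bigr => i /eqP hi; have hb := b_wt i; rewrite hi in hb.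
  rewrite {1}(coord_expand b_basis (rho (e a) b`_i)) !linear_sum /= [RHS]big_mkcond.
  apply: eq_bigr => j _; rewrite !linearZ /=; case: eqP => // /eqP hj.
  by rewrite (coord0 _ _ _ (e_weight a hb) hj) mul0r.
rewrite exchange_big; apply: eq_bigr => j /eqP hj; have hb := b_wt j; rewrite hj in hb.
rewrite {2}(coord_expand b_basis (rho (f a) b`_j)) !linear_sum /= big_mkcond.
apply: eq_bigr => i _; rewrite !linearZ /=; case: eqP => [_|/eqP hi]; first by rewrite mulrC.
have hb' := f_weight a hb; rewrite addrK in hb'.
by rewrite (coord0 _ _ _ hb' hi) mul0r.
Qed.

(** The trace of the scalar Casimir operator on one weight space.  Opposite root vectors
    contribute equally up to the commutator [io (rt a)], which acts by a scalar. *)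
Lemma trace_equation mu : cas%:C%C * (mult mu)%:R = (wform mu mu)%:C%C * (mult mu)%:R +
  \sum_(a | p a) (root_trace a mu *+ 2 + (wform mu (rcr a))%:C%C * (mult mu)%:R).
Proof.
transitivity (wtrace (casimir rho) mu).
  rewrite /wtrace /mult -sum1_card natr_sum mulr_sumr; apply: eq_bigr => i _.
  by rewrite casimir_scalar linearZ /= coord_free ?(basis_free b_basis) // eqxx.
have -> : wtrace (casimir rho) mu = (wform mu mu)%:C%C * (mult mu)%:R +
    \sum_a c a * wtrace (fun v => rho (e a) (rho (f a) v)) mu.
  rewrite /wtrace /mult -sum1_card natr_sum mulr_sumr.
  under [X in _ + X]eq_bigr do rewrite mulr_sumr.
  rewrite exchange_big -big_split /=; apply: eq_bigr => i /eqP hi.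
  have hb := b_wt i; rewrite hi in hb.
  rewrite (casimir_cartan hb) linearD linearZ /= coord_free ?(basis_free b_basis) // eqxx.
  by congr (_ + _); rewrite linear_sum; apply: eq_bigr => a _; rewrite linearZ.
congr (_ + _); rewrite (bigID p) /= [X in _ + X](reindex_inj (inv_inj (opp_rootK R (D := D)))) /=.
rewrite [X in _ + X](eq_bigl p) => [|a]; last by rewrite p_opp negbK.
rewrite -big_split; apply: eq_bigr => a pa /=; rewrite wtrace_ef.
rewrite (ef_opp a).1 (ef_opp a).2 rnorm_opp -/(root_trace a mu) addrC addrA mulr2n.
by [].
Qed.

(** *** Weight multiplicities are invariant under reflections *)

Lemma ladder a mu v k : v \in wsp (cx mu) ->
  rho (e a) (iter k.+1 (rho (f a)) v) = iter k.+1 (rho (f a)) (rho (e a) v) +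
    (k.+1%:R * (dot mu (rrt a) - k%:R))%:C%C *: iter k (rho (f a)) v.
Proof.
move=> hv; rewrite rmorphM rmorphB /= !rmorph_nat.
apply: (@sl2_ladder K V (rho (e a)) (rho (f a)) (rho (io (rt a)))) => [u|u|].
- by rewrite (rep_comm V_rep) ef_in addrC.
- rewrite (rep_comm V_rep) (weight_lie _ (f_in a)) addrC; congr (_ + _).
  by rewrite dotNl cr_rt scaleNr (linearN rho) opp_lfunE linearZ lfun_simp scaler_nat.
by rewrite (rep_weight _ hv) -cx_rrt dot_cx.
Qed.

Lemma iter_e_weight a mu v k : v \in wsp (cx mu) ->
  iter k (rho (e a)) v \in wsp (cx (mu + k%:R *: rcr a)).
Proof.
move=> hv; elim: k => [|k IH]; first by rewrite scale0r addr0.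
by rewrite iterS -natr1 scalerDl scale1r addrA; apply: e_weight.
Qed.

(** Take [u] killed by the least possible power [j + 1] of [e].  Minimality forces [f e]
    to act on [u] by the scalar [q <= 0]; the ladder formula along the descending string
    of [u] then has only negative scalars, so the string could not stop. *)
Lemma raising_inj a mu v k : v \in wsp (cx mu) -> dot mu (rrt a) = - k%:R ->
  iter k (rho (e a)) v = 0 -> v = 0.
Proof.
move=> hv hk ek; apply/eqP/negPn/negP => vn0.
pose P j := exists u, [/\ u \in wsp (cx mu), u != 0 & iter j (rho (e a)) u = 0].
have hex : exists j, `[< P j >] by exists k; apply/asboolP; exists v.
case: (ex_minnP hex) => -[|j] /asboolP[u [hu u0 hj]] jmin.
  by rewrite /= in hj; rewrite hj eqxx in u0.
have jk : (j.+1 <= k)%N by apply: jmin; apply/asboolP; exists v.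
have oe : e (opp_root a) = f a := (ef_opp a).1; have of_ : f (opp_root a) = e a := (ef_opp a).2.
have ro : rrt (opp_root a) = - rrt a.
  by apply: cx_inj; rewrite cx_rrt rt_opp -cx_rrt; apply/rowP => i; rewrite !mxE rmorphN.
have iter_lin m (x : g) (s : R) (y z : V) : iter m (rho x) (s%:C%C *: y + z) = s%:C%C *: iter m (rho x) y + iter m (rho x) z.
  by elim: m => //= m ->; rewrite linearD linearZ.
(* The product f e acts on u by a scalar. *)
pose q : R := j%:R * (j.+1%:R - k%:R).
have fe : rho (f a) (rho (e a) u) = q%:C%C *: u.
  apply/eqP; rewrite -subr_eq0; apply/negPn/negP => w0.
  have : (j.+1 <= j)%N; last by rewrite ltnn.
  apply: jmin; apply/asboolP; exists (rho (f a) (rho (e a) u) - q%:C%C *: u).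
  split; [|exact: w0|].
    by have h := f_weight a (e_weight a hu); rewrite addrK in h; apply: memvB h (memvZ _ hu).
  rewrite -scaleNr -rmorphN addrC iter_lin; case: j hj jk @q w0 => [|j] hj jk q w0.
    by rewrite /= in hj *; rewrite hj linear0 addr0 /q mul0r oppr0 rmorph0 scale0r.
  have := ladder (opp_root a) j (e_weight a hu); rewrite oe of_ -iterSr hj linear0.
  move/esym/eqP; rewrite addr_eq0 => /eqP ->; rewrite -iterSr -scaleNr -rmorphN -scalerDl.
  rewrite -rmorphD (_ : _ + _ = 0) ?rmorph0 ?scale0r //.
  rewrite ro /q dot_sym dotNl dotDr dot_sym hk; have -> : dot (rrt a) (rcr a) = 2.
    by apply: complexI; rewrite -dot_cx cx_rrt cx_rcr dot_sym cr_rt rmorph_nat.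
  by rewrite -[j.+2%:R]natr1 -[j.+1%:R]natr1; ring.
(* Comparison with the last nonzero vector of the descending string. *)
have hfn : exists i, iter i (rho (f a)) u == 0.
  have a0 : - cr a != 0 by rewrite oppr_eq0 cr_neq0.
  have [i hi] := act_nilpotent V_rep b_basis b_wt a0 (f_in a) hu.
  by exists i; apply/eqP.
case: (ex_minnP hfn) => -[|i] hi imin; first by rewrite /= (negPf u0) in hi.
have wn0 : iter i (rho (f a)) u != 0 by apply/negP => /imin; rewrite ltnn.
have := ladder a i hu; rewrite (eqP hi) linear0 iterSr fe.
have -> : iter i (rho (f a)) (q%:C%C *: u) = q%:C%C *: iter i (rho (f a)) u.
  have z0 m : iter m (rho (f a)) 0 = 0 by elim: m => //= m ->; rewrite linear0.
  by have := iter_lin i (f a) q u 0; rewrite !addr0 z0 addr0.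
rewrite -scalerDl -rmorphD => /esym/eqP; rewrite scaler_eq0 (negPf wn0) orbF fmorph_eq0 hk.
apply/negP; rewrite lt_eqF // /q.
have h1 : 0 <= (j%:R : R) by apply: ler0n.
have h2 : (j.+1%:R : R) <= k%:R by rewrite ler_nat.
have h3 : 0 <= (i%:R : R) by apply: ler0n.
rewrite -natr1 in h2 *; rewrite -[i.+1%:R]natr1; nra.
Qed.

Lemma mult_le_raise a mu k : dot mu (rrt a) = - k%:R -> (mult mu <= mult (mu + k%:R *: rcr a))%N.
Proof.
move=> hk; pose F m := iter m (fun h : 'End(V) => (rho (e a) \o h)%VF) \1%VF.
have FE m v : F m v = iter m (rho (e a)) v.
  by elim: m => [|m IH]; rewrite /= ?id_lfunE // comp_lfunE IH.
have hd : \dim (F k @: wsp (cx mu))%VS = \dim (wsp (cx mu)); last first.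
  have sub : (F k @: wsp (cx mu) <= wsp (cx (mu + k%:R *: rcr a)))%VS.
    apply/subvP => _ /memv_imgP[v hv ->].
    by rewrite FE; apply: iter_e_weight.
  have e1 := etrans hd (mult_dim mu); have e2 := mult_dim (mu + k%:R *: rcr a).
  exact: (leq_trans (eq_leq (esym e1)) (leq_trans (dimvS sub) (eq_leq e2))).
apply: limg_dim_eq; apply/eqP; rewrite -subv0; apply/subvP => v; rewrite memv_cap memv_ker FE => /andP[hv /eqP h0].
by rewrite (raising_inj hv hk h0) mem0v.
Qed.

(** Half of each string suffices, by symmetry: [e^k] is injective on the weight spaces of
    negative weight, so neither multiplicity exceeds the other. *)
Lemma mult_refl a mu : mult (mu - dot mu (rrt a) *: rcr a) = mult mu.
Proof.
have le a' nu : (mult nu <= mult (nu - dot nu (rrt a') *: rcr a'))%N.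
  case: (posnP (mult nu)) => [-> //|m0]; have [i hi] : exists i, wt i = nu by apply: mult_wt; rewrite -lt0n.
  have /intrP[z hz] : dot nu (rrt a') \is a Num.int by rewrite -hi wt_int.
  case: z hz => k hk.
    have ro : rrt (opp_root a') = - rrt a'.
      by apply: cx_inj; rewrite cx_rrt rt_opp -cx_rrt; apply/rowP => j; rewrite !mxE rmorphN.
    have co : rcr (opp_root a') = - rcr a'.
      by apply: cx_inj; rewrite cx_rcr cr_opp -cx_rcr; apply/rowP => j; rewrite !mxE rmorphN.
    have := @mult_le_raise (opp_root a') nu k; rewrite ro co dot_sym dotNl dot_sym hk => /(_ erefl).
    by rewrite scalerN.
  have := @mult_le_raise a' nu k.+1; rewrite hk NegzE rmorphN => /(_ erefl).
  by rewrite scaleNr opprK.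
apply/eqP; rewrite eqn_leq le andbT; apply: leq_trans (le a _) _.
rewrite dotBl dotZl; have -> : dot (rcr a) (rrt a) = 2.
  by apply: complexI; rewrite -dot_cx cx_rrt cx_rcr cr_rt rmorph_nat.
set t := dot mu (rrt a); have -> : t - t * 2 = - t by ring.
by rewrite scaleNr opprK subrK.
Qed.

End WithBasis.

(** What the character computation uses of the representation, over the reals: [m]
    gives the weight multiplicities and [T a] the traces of the products of opposite
    root vectors on the weight spaces. *)
Definition multiplicity_data (m : 'rV[R]_n -> nat) (T : Phi D -> 'rV[R]_n -> R) : Prop :=
  [/\ (forall mu, \dim (wsp (cx mu)) = m mu) /\
      (forall M, wsp M != 0%VS -> exists mu, M = cx mu),
      m la = 1%N /\ (forall mu, m mu != 0%N ->
        exists2 l, all p l & mu = la - \sum_(b <- l) rcr b),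
      (forall a mu, m (mu - dot mu (rrt a) *: rcr a) = m mu) /\
      (exists s : seq 'rV[R]_n, forall mu, m mu != 0%N -> mu \in s),
      (forall mu, (wform la la + \sum_(a | p a) wform la (rcr a)) * (m mu)%:R =
         wform mu mu * (m mu)%:R + \sum_(a | p a) (T a mu *+ 2 + wform mu (rcr a) * (m mu)%:R))
    & forall a mu, T a mu = T a (mu + rcr a) + wform (mu + rcr a) (rcr a) * (m (mu + rcr a))%:R].

Lemma multiplicities : exists m T, multiplicity_data m T.
Proof.
have [N' [b [l_ [b_basis b_low]]]] := lowered_basis.
have natC k : (k%:R : K) = (k%:R : R)%:C%C by rewrite rmorph_nat.
pose re := @complex.Re R.
have reD (x y : K) : re (x + y) = re x + re y by case: x y => [? ?] [? ?].
have re_sum (I : finType) (P : pred I) (F : I -> K) : re (\sum_(i | P i) F i) = \sum_(i | P i) re (F i).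
  exact: (big_morph re reD (erefl : re 0 = 0)).
have reC (x y : R) : re (x%:C%C * y%:C%C) = x * y by rewrite -rmorphM.
exists (mult l_), (fun a mu => re (root_trace b l_ a mu)); split; last 1 first.
- move=> a mu.
  by rewrite (root_trace_shift b_basis b_low) reD natC reC.
- split=> [mu|M hM]; first exact: (mult_dim b_basis b_low).
  by have [j ->] := weight_real b_basis b_low hM; eexists.
- split=> [|mu /mult_wt[j <-]]; first exact: (mult_top b_basis b_low).
  by exists (l_ j); first by have [] := b_low j.
- split=> [a mu|]; first exact: (mult_refl b_basis b_low).
  exists [seq lowered_wt (l_ j) | j <- enum 'I_N'] => mu /mult_wt[j <-].
  by apply/seq.mapP; exists j; rewrite // mem_enum.
move=> mu; have := congr1 re (trace_equation b_basis b_low mu).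
rewrite reD re_sum natC !reC => ->; congr (_ + _); apply: eq_bigr => a _.
by rewrite reD reC mulr2n reD.
Qed.

End HighestWeight.
End Casimir.

End Killing.

Lemma multiplicities_exist (V : vectType K) (rho : 'Hom(g, 'End(V))) (p : pred (Phi D))
    (la hgt : 'rV[R]_n) (v0 : V) :
  is_rep rho -> irreducible_rep rho -> (forall b, p (opp_root b) = ~~ p b) ->
  (forall b, dot la (rrt b) \is a Num.int) -> v0 != 0 ->
  v0 \in weight_space io rho (cx la) ->
  (forall b x, p b -> x \in gsp (cr b) -> rho x v0 = 0) ->
  (forall b, p b -> 0 < dot (rcr b) hgt) ->
  exists m T, multiplicity_data rho p la m T.
Proof.
move=> V_rep V_irr p_opp la_int v0n v0w v0h hh.
have [N [E [w [E_basis hw]]]] := lie_basis.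
have E_wt i := (hw i).1; have w_root i := (hw i).2.
have [e [f hef]] := root_vectors E_basis E_wt w_root p_opp.
have efP b : [/\ e b \in gsp (cr b), f b \in gsp (- cr b), lie (e b) (f b) = io (rt b)
    & kap E (e b) (f b) = (rnorm b / 2)%:C%C] by have [h1 h2 h3 h4 _] := hef b.
have ef_opp b : e (opp_root b) = f b /\ f (opp_root b) = e b by have [_ _ _ _ h] := hef b.
exact: (multiplicities E_basis E_wt w_root efP V_rep V_irr p_opp ef_opp la_int v0n v0w v0h hh).
Qed.

End Structure.

(** * First and last visits, profiles, strings *)

Section Indices.
Variable N : nat.
Implicit Types (P : pred nat) (k : nat).

Definition first_index P := find P (iota 0 N.+1).
Definition last_index P := \max_(k < N.+1 | P k) k.

Lemma first_indexP P k : (k <= N)%N -> P k ->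
  [/\ (first_index P <= k)%N, P (first_index P)
    & forall j, (j < first_index P)%N -> ~~ P j].
Proof.
move=> kN Pk; have h : has P (iota 0 N.+1) by apply/hasP; exists k; rewrite // mem_iota.
have h2 : forall j, (j < first_index P)%N -> ~~ P j.
  move=> j hj; have hN : (j < N.+1)%N.
    by apply: (leq_trans hj); apply: leq_trans (find_size _ _) _; rewrite size_iota.
  by have := before_find 0%N hj; rewrite nth_iota // => ->.
split=> //; first by rewrite leqNgt; apply/negP => /h2; rewrite Pk.
have := nth_find 0%N h; rewrite nth_iota //.
by rewrite -{2}(size_iota 0 N.+1) -has_find.
Qed.

Lemma first_indexE P k : (k <= N)%N -> P k -> (forall j, (j < k)%N -> ~~ P j) ->
  first_index P = k.
Proof.
move=> kN Pk h; have [h1 h2 h3] := first_indexP kN Pk.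
apply/eqP; rewrite eqn_leq h1 leqNgt; apply/negP => /h; by rewrite h2.
Qed.

Lemma last_indexP P k : (k <= N)%N -> P k ->
  [/\ (k <= last_index P <= N)%N, P (last_index P)
    & forall j, (last_index P < j <= N)%N -> ~~ P j].
Proof.
move=> kN Pk; have kN1 : (k < N.+1)%N by [].
have [j Pj e] : {j : 'I_N.+1 | P j & last_index P = j}.
  apply: eq_bigmax_cond; apply/card_gt0P; by exists (Ordinal kN1).
have hle i : (i <= N)%N -> P i -> (i <= last_index P)%N.
  rewrite -ltnS => iN Pi; exact: (@leq_bigmax_cond _ (fun i : 'I_N.+1 => P i)
    (fun i => i : nat) (Ordinal iN)).
split; first by rewrite hle // e -ltnS ltn_ord.
  by rewrite e.
move=> i /andP[h1 h2]; apply/negP => Pi.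
by have := hle _ h2 Pi; rewrite leqNgt h1.
Qed.

Lemma last_indexE P k : (k <= N)%N -> P k -> (forall j, (k < j <= N)%N -> ~~ P j) ->
  last_index P = k.
Proof.
move=> kN Pk h; have [/andP[h1 h2] h3 _] := last_indexP kN Pk.
apply/eqP; rewrite eqn_leq h1 andbT leqNgt; apply/negP => h4.
by have := h (last_index P); rewrite h4 h2 h3 => /(_ isT).
Qed.

End Indices.

(** The combinatorial shape of the reference gallery: its [k]-th edge runs along
    the fundamental coweight [pdir k] from parameter [ptime k] to
    [ptime k + plen k], the parameter being reset to [0] at each junction. *)
Record profile (R : realType) (n : nat) := Profile {
  psize : nat;
  pdir : nat -> 'rV[R]_n;
  ptime : nat -> R;
  plen : nat -> R
}.

(** A finite set cut into finite strings by partially inverse operators carries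
    the involution that reverses every string. *)
Section Strings.
Variables (R : realType) (n : nat) (T : eqType) (L : seq T).
Variables (f e : T -> T) (ep ph : T -> nat) (wt : T -> 'rV[R]_n) (c : 'rV[R]_n).
Hypothesis L_uniq : uniq L.
Hypothesis f_spec : forall x, x \in L -> (0 < ph x)%N ->
  [/\ f x \in L, e (f x) = x, ep (f x) = (ep x).+1, ph (f x) = (ph x).-1
    & wt (f x) = wt x - c].
Hypothesis e_spec : forall x, x \in L -> (0 < ep x)%N ->
  [/\ e x \in L, f (e x) = x, ep (e x) = (ep x).-1, ph (e x) = (ph x).+1
    & wt (e x) = wt x + c].

Lemma iter_f_spec k x : x \in L -> (k <= ph x)%N ->
  [/\ iter k f x \in L, iter k e (iter k f x) = x, ep (iter k f x) = (ep x + k)%N,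
      ph (iter k f x) = (ph x - k)%N & wt (iter k f x) = wt x - k%:R *: c].
Proof.
move=> xL; elim: k => [|k IH] hk; first by rewrite /= addn0 subn0 scale0r subr0.
have [h1 h2 h3 h4 h5] := IH (ltnW hk).
have hp : (0 < ph (iter k f x))%N by rewrite h4 subn_gt0.
have [g1 g2 g3 g4 g5] := f_spec h1 hp.
split=> //; first by rewrite iterSr iterS g2.
- by rewrite iterS g3 h3 addnS.
- by rewrite iterS g4 h4 subnS.
- by rewrite iterS g5 h5 -natr1 scalerDl scale1r opprD addrA.
Qed.

Lemma iter_e_spec k x : x \in L -> (k <= ep x)%N ->
  [/\ iter k e x \in L, iter k f (iter k e x) = x, ep (iter k e x) = (ep x - k)%N,
      ph (iter k e x) = (ph x + k)%N & wt (iter k e x) = wt x + k%:R *: c].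
Proof.
move=> xL; elim: k => [|k IH] hk; first by rewrite /= addn0 subn0 scale0r addr0.
have [h1 h2 h3 h4 h5] := IH (ltnW hk).
have hp : (0 < ep (iter k e x))%N by rewrite h3 subn_gt0.
have [g1 g2 g3 g4 g5] := e_spec h1 hp.
split=> //; first by rewrite iterSr iterS g2.
- by rewrite iterS g3 h3 subnS.
- by rewrite iterS g4 h4 addnS.
- by rewrite iterS g5 h5 -natr1 scalerDl scale1r addrA.
Qed.

Definition string_rev x :=
  if (ep x <= ph x)%N then iter (ph x - ep x) f x else iter (ep x - ph x) e x.

Lemma string_rev_spec x : x \in L ->
  [/\ string_rev x \in L, string_rev (string_rev x) = x
    & wt (string_rev x) = wt x - ((ph x)%:R - (ep x)%:R) *: c].
Proof.
move=> xL; rewrite {1 3 4}/string_rev; case: leqP => hle.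
  have [h1 h2 h3 h4 h5] := iter_f_spec xL (leq_subr (ep x) (ph x)).
  split=> //; last by rewrite h5 natrB.
  rewrite /string_rev h3 h4 subKn // subnKC //.
  case: leqP => h6; last by rewrite h2.
  have e1 : (ep x - ph x = 0)%N by apply/eqP; rewrite subn_eq0.
  have e2 : (ph x - ep x = 0)%N by apply/eqP; rewrite subn_eq0.
  by rewrite e1 e2.
have [h1 h2 h3 h4 h5] := iter_e_spec xL (leq_subr (ph x) (ep x)).
split=> //; last by rewrite h5 natrB ?(ltnW hle) // -scaleNr opprB.
rewrite /string_rev h3 h4 subKn ?(ltnW hle) // subnKC ?(ltnW hle) //.
Qed.

Lemma string_sum (V : zmodType) (F : 'rV[R]_n -> V) (g : 'rV[R]_n -> 'rV[R]_n) :
  (forall x, x \in L -> g (wt x) = wt x - ((ph x)%:R - (ep x)%:R) *: c) ->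
  \sum_(x <- L) F (wt x) = \sum_(x <- L) F (g (wt x)).
Proof.
move=> hg; have hp : perm_eq [seq string_rev x | x <- L] L.
  apply: uniq_perm => //.
    rewrite map_inj_in_uniq // => x y xL yL exy.
    have [_ <- _] := string_rev_spec xL; have [_ <- _] := string_rev_spec yL.
    by rewrite exy.
  move=> x; apply/mapP/idP => [[y yL ->]|xL]; first by case: (string_rev_spec yL).
  by exists (string_rev x); case: (string_rev_spec xL).
rewrite -(perm_big _ hp) big_map /= big_seq [RHS]big_seq; apply: eq_bigr => x xL.
by rewrite hg //; case: (string_rev_spec xL) => _ _ ->.
Qed.

End Strings.

(** * Roots and the Weyl group on the apartment *)

Section Apartment.
Variables (R : realType) (n : nat) (D : rootDatum n) (S : 'I_n -> Phi D).
Hypothesis D_reduced : reduced_datum D.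
Hypothesis S_base : is_base S.
Variable omega : 'I_n -> 'rV[R]_n.
Hypothesis omegaP : forall i j, pair (S j) (omega i) = (i == j)%:R.
Local Notation A := 'rV[R]_n.
Local Notation form := (@form R n D).

Section Roots.
Implicit Types (a b : Phi D) (x y z : A).
Lemma omega_decomp x : x = \sum_i pair (S i) x *: omega i.
Proof.
pose M : 'M[R]_n := \matrix_(i, j) (map_mx intr (root_of (S i)) : A) 0 j.
pose Om : 'M[R]_n := \matrix_(i, j) omega i 0 j.
have h1 : Om *m M^T = 1%:M.
  apply/matrixP => i j; rewrite !mxE -omegaP /pair /dot.
  by apply: eq_bigr => k _; rewrite !mxE mulrC.
have h2 : M^T *m Om = 1%:M by apply: mulmx1C.
rewrite -{1}[x]mulmx1 -h2 mulmxA; apply/rowP => k.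
rewrite mxE summxE; apply: eq_bigr => i _.
rewrite !mxE; congr (_ * _); rewrite /pair /dot.
by apply: eq_bigr => l _; rewrite !mxE mulrC.
Qed.

Lemma pairS_inj x y : (forall i, pair (S i) x = pair (S i) y) -> x = y.
Proof.
move=> h; rewrite (omega_decomp x) (omega_decomp y).
by apply: eq_bigr => i _; rewrite h.
Qed.

Definition rho_v : A := \sum_i omega i.
Local Notation r := rho_v.

Lemma pairS_rho i : pair (S i) r = 1.
Proof.
rewrite pair_sum (bigD1 i) //= omegaP eqxx big1 ?addr0 // => j ji.
by rewrite omegaP (negPf ji).
Qed.

Definition pos a := positive_root S a.

Lemma pair_comb a (c : 'I_n -> nat) x :
  root_of a = \sum_i root_of (S i) *+ c i ->
  pair a x = \sum_i (c i)%:R * pair (S i) x.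
Proof.
move=> h; rewrite /pair h /dot.
under eq_bigr do rewrite mxE summxE rmorph_sum /= mulr_suml.
rewrite exchange_big; apply: eq_bigr => i _; rewrite mulr_sumr.
by apply: eq_bigr => j _; rewrite !mxE mulmxnE rmorphMn /= -mulr_natl mulrA.
Qed.

Lemma pos_comb a : pos a ->
  exists c : 'I_n -> nat, forall x, pair a x = \sum_i (c i)%:R * pair (S i) x.
Proof. by move=> /asboolP[c h]; exists c => x; apply: pair_comb. Qed.

Lemma pair_omega_comb a (c : 'I_n -> nat) i :
  (forall x, pair a x = \sum_i (c i)%:R * pair (S i) x) ->
  pair a (omega i) = (c i)%:R.
Proof.
move=> h; rewrite h (bigD1 i) //= omegaP eqxx mulr1 big1 ?addr0 // => j ji.
by rewrite omegaP eq_sym (negPf ji) mulr0.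
Qed.

Lemma pos_or_opp a : pos a \/ pos (opp_root a).
Proof.
have [h|[c h]] := S_base.2 a; first by left.
right; apply/asboolP; exists c; apply/rowP => i.
apply: (@intr_inj R).
rewrite -pair_delta pair_opp pair_delta h !mxE rmorphN opprK; congr _%:~R.
Qed.

Lemma pos_ge0 a x : pos a -> Cplus S x -> 0 <= pair a x.
Proof.
by move=> /pos_comb[c ->] h; apply: sumr_ge0 => i _; rewrite mulr_ge0.
Qed.

Lemma omega_dom i : Cplus S (omega i).
Proof. by move=> j; rewrite omegaP ler0n. Qed.

Lemma rho_dom : Cplus S r.
Proof. by move=> j; rewrite pairS_rho. Qed.

Lemma pos_rho_gt0 a : pos a -> 0 < pair a r.
Proof.
move=> pa; rewrite lt_def pos_ge0 ?andbT //; last exact: rho_dom.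
have [c hc] := pos_comb pa.
apply/eqP => h0.
have c0 i : (c i)%:R = 0 :> R.
  have h : \sum_j (c j)%:R = 0 :> R.
    by rewrite -[RHS]h0 [RHS]hc; apply: eq_bigr => j _; rewrite pairS_rho mulr1.
  by apply/eqP; rewrite (psumr_eq0P _ h).
have := pair_coroot_diag R a; rewrite hc big1 => [|i _]; last by rewrite c0 mul0r.
by move=> /eqP; rewrite eq_sym pnatr_eq0.
Qed.

Lemma pos_opp a : pos (opp_root a) = ~~ pos a.
Proof.
apply/idP/idP => [/pos_rho_gt0|/negP h]; last by case: (pos_or_opp a).
rewrite pair_opp => h1; apply/negP => /pos_rho_gt0; lra.
Qed.

Lemma pos_rho a : pos a = (0 < pair a r).
Proof.
apply/idP/idP; first exact: pos_rho_gt0.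
move=> h; apply: contraT; rewrite -pos_opp => /pos_rho_gt0; rewrite pair_opp; lra.
Qed.

Lemma pair_rho_neq0 a : pair a r != 0.
Proof.
case: (pos_or_opp a) => /pos_rho_gt0; first by move=> /lt0r_neq0.
by rewrite pair_opp oppr_gt0 => /ltr0_neq0.
Qed.

Lemma posS i : pos (S i).
Proof. by rewrite pos_rho pairS_rho. Qed.

Lemma pair_omega_int a i : pair a (omega i) \is a Num.int.
Proof.
case: (pos_or_opp a) => /pos_comb[c hc]; have := pair_omega_comb i hc.
  by move=> ->; rewrite natr_int.
by rewrite pair_opp => /eqP; rewrite eqr_oppLR => /eqP ->; rewrite rpredN natr_int.
Qed.

Lemma pair_rho_nat a : pos a -> exists k : nat, pair a r = k%:R.
Proof.
move=> /pos_comb[c hc]; exists (\sum_i c i)%N.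
by rewrite hc natr_sum; apply: eq_bigr => i _; rewrite pairS_rho mulr1.
Qed.

(** A simple reflection only changes the coefficient of its own simple root, so
    another positive root keeps a positive coefficient; reducedness says that
    no other positive root is supported on that simple root. *)
Lemma pos_refl_simple i a : pos a -> a != S i -> pos (root_refl (S i) a).
Proof.
move=> pa ai; have [c hc] := pos_comb pa.
have [[j ji cj]|hn] : (exists2 j, j != i & c j != 0%N) \/
    (forall j, j != i -> c j = 0%N).
  case: (pselect (exists2 j, j != i & c j != 0%N)); first by left.
  move=> h; right=> j ji; apply/eqP; apply/negP => /negP cj.
  by apply: h; exists j.
  have h : pair (root_refl (S i) a) (omega j) = (c j)%:R.
    rewrite pair_root_refl refl_fix ?(pair_omega_comb j hc) //.
    by rewrite omegaP (negPf ji).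
  apply: contraT; rewrite -pos_opp => /pos_ge0 => /(_ _ (omega_dom j)).
  by rewrite pair_opp h oppr_ge0 lern0 (negPf cj).
have hx x : pair a x = (c i)%:R * pair (S i) x.
  by rewrite hc (bigD1 i) //= big1 ?addr0 // => j ji; rewrite hn ?mul0r.
have hr : root_of a = (c i)%:Z *: root_of (S i).
  apply/rowP => k; apply: (@intr_inj R).
  by rewrite -pair_delta hx pair_delta mxE rmorphM.
have [] := D_reduced (a := S i) (b := a) (p := 1) (q := (c i)%:Z) isT.
- by rewrite scale1r.
- by move=> /root_of_inj e; rewrite e eqxx in ai.
move=> e; have h : pair a r = - pair (S i) r.
  rewrite -pairN /pair e /dot; apply: eq_bigr => k _.
  by rewrite !mxE rmorphN mulrN mulNr.
by have := pos_rho_gt0 pa; rewrite h pairS_rho; lra.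
Qed.

Lemma form_eq0 x : form x x = 0 -> x = 0.
Proof.
move=> h; apply: pairS_inj => i; rewrite pair0.
have hge (a : Phi D) : true -> 0 <= pair a x * pair a x by rewrite -expr2 sqr_ge0.
by have /eqP := psumr_eq0P hge h (i := S i) isT; rewrite mulf_eq0 orbb => /eqP.
Qed.

Lemma form_inj x y : (forall z, form x z = form y z) -> x = y.
Proof.
move=> h; apply/eqP; rewrite -subr_eq0; apply/eqP/form_eq0.
by rewrite formBl h subrr.
Qed.

Lemma coroot_neq0 a : coroot a != 0 :> A.
Proof.
apply/eqP => h; have := pair_coroot_diag R a; rewrite h pair0 => /eqP.
by rewrite eq_sym pnatr_eq0.
Qed.

Lemma form_coroot_gt0 a : 0 < form (coroot a) (coroot a).
Proof.
rewrite lt_def form_ge0 andbT; apply/eqP => /form_eq0 /eqP.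
by rewrite (negPf (coroot_neq0 a)).
Qed.

Lemma coroot_root_refl a b : coroot (root_refl a b) = refl a (coroot b) :> A.
Proof.
set c := root_refl a b.
have h y : form (coroot b) (coroot b) * form (coroot c) y =
           form (coroot c) (coroot c) * form (refl a (coroot b)) y.
  have h1 := form_coroot c y.
  have h2 := form_coroot b (refl a y).
  rewrite -(form_refl a) reflK in h2; rewrite pair_root_refl in h1; nra.
have e : form (coroot b) (coroot b) *: coroot c =
         form (coroot c) (coroot c) *: refl a (coroot b) :> A.
  by apply: form_inj => y; rewrite !formZl h.
have := congr1 (pair c) e; rewrite !pairZ pair_coroot_diag pair_root_refl reflK.
rewrite pair_coroot_diag => h1.
have h2 : form (coroot b) (coroot b) = form (coroot c) (coroot c) by lra.
move/eqP: e; rewrite h2 -subr_eq0 -scalerBr scaler_eq0 subr_eq0.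
by have := form_coroot_gt0 c; rewrite lt0r => /andP[/negPf-> _] /eqP.
Qed.

Lemma coroot_opp a : coroot (opp_root a) = - coroot a :> A.
Proof.
rewrite coroot_root_refl /refl pair_coroot_diag scaler_nat mulr2n opprD addrA.
by rewrite subrr add0r.
Qed.

Lemma refl_opp a x : refl (opp_root a) x = refl a x.
Proof. by rewrite /refl pair_opp coroot_opp scaleNr scalerN opprK. Qed.

Lemma refl_root_refl a b x : refl (root_refl a b) x = refl a (refl b (refl a x)).
Proof.
by rewrite {1}/refl pair_root_refl coroot_root_refl [refl b _]/refl reflB reflZ reflK.
Qed.

Lemma form_simple_ge0 i x : Cplus S x -> 0 <= form (coroot (S i)) x.
Proof.
move=> hx; have := form_coroot (S i) x.
have := form_coroot_gt0 (S i); have := hx i; nra.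
Qed.

Lemma form_pos_ge0 a x : pos a -> Cplus S x -> 0 <= form (coroot a) x.
Proof.
move=> pa hx; have := form_coroot a x.
have := form_coroot_gt0 a; have := pos_ge0 pa hx; nra.
Qed.

(** Writing the coroot of [a] as a nonnegative real combination of simple
    coroots, <a, a^vee> = 2 > 0 forces <a, alpha_i^vee> > 0 for some i. *)
Lemma pos_simple_gt0 a : pos a -> exists i, 0 < pair a (coroot (S i) : A).
Proof.
move=> pa; have [c hc] := pos_comb pa.
case: (pselect (exists i, 0 < pair a (coroot (S i) : A))) => // hn; exfalso.
have hle i : pair a (coroot (S i) : A) <= 0.
  by rewrite leNgt; apply/negP => h; apply: hn; exists i.
have e := form_coroot a (coroot a : A).
have h : form (coroot a) (coroot a) * pair a (coroot a : A) <= 0.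
  rewrite (hc (coroot a)) mulr_sumr; apply: sumr_le0 => i _.
  have h1 := form_coroot (S i) (coroot a : A); rewrite formC in h1.
  have h2 := form_coroot a (coroot (S i) : A).
  have h3 := form_coroot_gt0 (S i); have h4 := form_coroot_gt0 a.
  have h5 := hle i.
  have : pair (S i) (coroot a : A) <= 0 by nra.
  move=> h6; rewrite mulrCA; apply: mulr_ge0_le0 => //; nra.
have := form_coroot_gt0 a; rewrite pair_coroot_diag in h; lra.
Qed.

(** Every positive root is reached from a simple one by simple reflections
    through positive roots. *)
Lemma pos_ind (P : Phi D -> Prop) :
  (forall i, P (S i)) ->
  (forall i a, pos a -> a != S i -> P a -> P (root_refl (S i) a)) ->
  forall a, pos a -> P a.
Proof.
move=> P0 P1 a pa; have [k] := pair_rho_nat pa.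
elim/ltn_ind: k a pa => k IH a pa hk.
have [i hi] := pos_simple_gt0 pa.
have [->//|ai] := eqVneq a (S i).
have pb := pos_refl_simple pa ai.
rewrite -(root_reflK R (S i) a); apply: P1 => //.
  apply: contra ai => /eqP h.
  by move: pa; rewrite -(root_reflK R (S i) a) h pos_opp posS.
have [l hl] := pair_rho_nat pb; apply: (IH l) => //.
rewrite -(ltr_nat R) -hl -hk pair_root_refl /refl pairB pairZ pairS_rho mul1r; lra.
Qed.

(** ** Words in the simple reflections *)

Lemma word_cons i s x : word S (i :: s) x = refl (S i) (word S s x) :> A.
Proof. by rewrite /= arefl0. Qed.

Lemma word_cat s t x : word S (s ++ t) x = word S s (word S t x) :> A.
Proof. by elim: s => // i s IH; rewrite cat_cons !word_cons IH. Qed.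

Lemma wordD s x y : word S s (x + y) = word S s x + word S s y :> A.
Proof. by elim: s => // i s IH; rewrite !word_cons IH reflD. Qed.

Lemma wordZ s c x : word S s (c *: x) = c *: word S s x :> A.
Proof. by elim: s => // i s IH; rewrite !word_cons IH reflZ. Qed.

Lemma word_revK s : cancel (word S s) (word S (rev s) : A -> A).
Proof.
elim: s => // i s IH x; rewrite rev_cons -cats1 word_cat /= !arefl0 reflK.
exact: IH.
Qed.

Lemma word_revKV s : cancel (word S (rev s)) (word S s : A -> A).
Proof. by move=> x; rewrite -{1}(revK s) word_revK. Qed.

Lemma form_word s x y : form (word S s x) (word S s y) = form x y.
Proof. by elim: s => // i s IH; rewrite !word_cons form_refl. Qed.

Lemma refl_word a : exists s, forall x, refl a x = word S s x :> A.
Proof.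
wlog pa : a / pos a.
  move=> h; case: (pos_or_opp a) => [/h //|/h [s hs]].
  by exists s => x; rewrite -hs refl_opp.
elim/pos_ind: a / pa => [i|i a _ _ [s hs]].
  by exists [:: i] => x; rewrite word_cons.
exists (i :: s ++ [:: i]) => x.
by rewrite refl_root_refl word_cons word_cat word_cons hs.
Qed.

Lemma weyl_word (w : A -> A) : weyl D w -> exists s, w = word S s.
Proof.
elim=> [|a w' _ [s ->]]; first by exists [::].
have [t ht] := refl_word a; exists (t ++ s).
by apply/funext => x; rewrite /= arefl0 ht word_cat.
Qed.

Lemma word_weyl s : weyl D (word S s : A -> A).
Proof. by elim: s => [|i s IH]; constructor. Qed.

(** Strong exchange property: following the root [a] backwards through the word,
    it becomes negative right after being the simple root of the letter that
    can be deleted. *)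
Lemma exchange s a : pos a -> pair a (word S s r) < 0 ->
  exists2 s', size s = (size s').+1 & forall x, refl a (word S s x) = word S s' x.
Proof.
elim: s a => [|j s IH] a pa /=; first by have := pos_rho_gt0 pa; lra.
rewrite arefl0 => hn.
have [e|aj] := eqVneq a (S j).
  by exists s => // x; rewrite arefl0 e reflK.
have [|s' hs' h] := IH _ (pos_refl_simple pa aj); first by rewrite pair_root_refl.
exists (j :: s'); first by rewrite hs'.
by move=> x; rewrite word_cons -h refl_root_refl !arefl0 reflK.
Qed.

Lemma word_root s a : exists b, forall x, pair b x = pair a (word S s x).
Proof.
elim: s a => [|i s IH] a; first by exists a.
have [b hb] := IH (root_refl (S i) a); exists b => x.
by rewrite hb pair_root_refl word_cons.
Qed.

(** Two dominant points in one Weyl orbit coincide: in a shortest word the first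
    letter must fix the point. *)
Lemma dominant_unique s x : Cplus S x -> Cplus S (word S s x) -> word S s x = x.
Proof.
have [k] := ubnP (size s); elim: k s => // k IH [|i s] //= hk hx.
rewrite arefl0 => hy.
have [b hb] := word_root s (S i).
have [hn|hp] := ltP (pair (S i) (word S s r)) 0.
  have [s' hs' h] := exchange (posS i) hn.
  rewrite h; apply: IH => //; last by rewrite -h.
  by rewrite hs' in hk; rewrite ltnS in hk *; apply: leq_trans hk; rewrite ltnW.
have pb : pos b.
  by rewrite pos_rho lt_def pair_rho_neq0 hb.
have h0 : pair (S i) (word S s x) = 0.
  have := pos_ge0 pb hx; rewrite hb; have := hy i; rewrite pair_refl; lra.
rewrite (refl_fix h0) in hy *; exact: IH.
Qed.

Lemma refl_simple_unneg i x :
  pair (S i) x < 0 ->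
  (#|[pred a | pos a && (pair a (refl (S i) x) < 0)%R]| <
   #|[pred a | pos a && (pair a x < 0)%R]|)%N.
Proof.
move=> hx; rewrite (cardD1 (S i) [pred a | pos a && (pair a x < 0)%R]).
rewrite !inE posS hx /= add1n ltnS.
rewrite -(fintype.card_image (inv_inj (root_reflK R (S i)))).
apply: subset_leq_card; apply/fintype.subsetP => b /fintype.imageP[a].
rewrite !inE => /andP[pa h] ->; rewrite pair_root_refl h andbT.
have ai : a != S i.
  by apply: contraTneq h => ->; rewrite pair_refl -leNgt; lra.
rewrite pos_refl_simple // andbT; apply/eqP => e.
by move: pa; rewrite -(root_reflK R (S i) a) e pos_opp posS.
Qed.

(** Reflecting a simple root that is negative on [x] adds a positive multiple of
    a simple coroot, so the climb to the dominant chamber is an ascent. *)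
Lemma dominant_conj_cone x : exists2 s, Cplus S (word S s x) & exists c : 'I_n -> R,
  (forall i, 0 <= c i) /\ word S s x = x + \sum_i c i *: coroot (S i).
Proof.
have [k] := ubnP #|[pred a | pos a && (pair a x < 0)%R]|.
elim: k x => // k IH x; rewrite ltnS => hk.
case: (pselect (Cplus S x)) => [|hx].
  exists [::] => //; exists (fun=> 0); split=> //.
  by rewrite big1 ?addr0 // => i _; rewrite scale0r.
have [i hi] : exists i, pair (S i) x < 0.
  case: (pselect (exists i, pair (S i) x < 0)) => // h; case: hx => i.
  by rewrite leNgt; apply/negP => h1; apply: h; exists i.
have [] := IH (refl (S i) x); first exact: leq_trans (refl_simple_unneg hi) hk.
move=> s hs [c [c0 e]]; exists (s ++ [:: i]); first by rewrite word_cat word_cons.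
exists (fun j => c j + (j == i)%:R * - pair (S i) x); split=> [j|].
  by rewrite addr_ge0 // mulr_ge0 ?ler0n // oppr_ge0 ltW.
rewrite word_cat word_cons e /refl -addrA; congr (_ + _).
under [RHS]eq_bigr do rewrite scalerDl; rewrite big_split /= addrC; congr (_ + _).
rewrite (bigD1 i) //= eqxx mul1r big1 ?addr0 ?scaleNr // => j ji.
by rewrite (negPf ji) mul0r scale0r.
Qed.

Lemma dominant_conj x : exists2 s, Cplus S (word S s x)
  & forall y, Cplus S y -> form x y <= form (word S s x) y.
Proof.
have [s hs [c [c0 e]]] := dominant_conj_cone x; exists s => // y hy.
have f0 : form 0 y = 0 by rewrite -(scale0r (0 : A)) formZl mul0r.
rewrite e formDl lerDl (big_morph (fun z => form z y) (fun z1 z2 => formDl z1 z2 y) f0).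
by apply: sumr_ge0 => i _; rewrite formZl mulr_ge0 // form_simple_ge0.
Qed.

End Roots.

(** * The Bruhat order *)

Section Bruhat.
Implicit Types (a b : Phi D) (x y z : A).
Local Notation r := (rho_v).
Implicit Types (u v w : A -> A).

Lemma word_root_pull s b : exists a, forall x,
  pair a x = pair b (word S s x) /\ word S s (refl a x) = refl b (word S s x).
Proof.
elim: s b => [|i s IH] b; first by exists b.
have [a ha] := IH (root_refl (S i) b); exists a => x; have [h1 h2] := ha x.
rewrite !word_cons h1 pair_root_refl; split=> //.
by rewrite h2 refl_root_refl reflK.
Qed.

Lemma word_root_push s a : exists b, forall x,
  pair a x = pair b (word S s x) /\ word S s (refl a x) = refl b (word S s x).
Proof.
elim: s a => [|i s IH] a; first by exists a.
have [b hb] := IH a; exists (root_refl (S i) b) => x; have [h1 h2] := hb x.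
by rewrite !word_cons h1 pair_root_refl refl_root_refl !reflK h2.
Qed.

Lemma pair_word_rho s a : pair a (word S s r) != 0.
Proof.
by have [b <-] := word_root s a; rewrite pair_rho_neq0.
Qed.

Lemma weyl_length_ex s : exists l, weyl_length S (word S s : A -> A) l.
Proof.
pose P k := `[< exists2 t, word S t = word S s :> (A -> A) & size t = k >].
have hP : exists k, P k by exists (size s); apply/asboolP; exists s.
case: (ex_minnP hP) => m /asboolP[t ht hm] hmin; exists m; split; first by exists t.
by move=> t' ht'; apply: hmin; apply/asboolP; exists t'.
Qed.

Lemma weyl_length_reflect s b l l' : pos b -> pair b (word S s r) < 0 ->
  weyl_length S (word S s : A -> A) l ->
  weyl_length S (refl b \o word S s : A -> A) l' -> (l' < l)%N.
Proof.
move=> pb hb [[t ht hl] _] [_ hmin].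
rewrite -ht in hb; have [t' hs h] := exchange pb hb.
by rewrite -hl hs ltnS; apply: hmin; apply/funext => x; rewrite -h /= -ht.
Qed.

(** In the other direction, from [s_b u] to [u], the root [b] is negative on [s_b u rho], so
    strong exchange deletes a letter of a shortest word. *)
Lemma bruhat_step_refl s b : pos b -> 0 < pair b (word S s r) ->
  bruhat_step S (word S s : A -> A) (refl b \o word S s).
Proof.
move=> pb hb; have [a ha] := word_root_pull s b.
have [t ht] := refl_word b.
have e : refl b \o word S s = word S (t ++ s) :> (A -> A).
  by apply/funext => x; rewrite word_cat /= ht.
have [l hl] := weyl_length_ex s; have [l' hl'] := weyl_length_ex (t ++ s).
exists a, l, l'; split => //; last 1 first.
- have e2 : word S s = refl b \o word S (t ++ s) :> (A -> A).
    by apply/funext => x; rewrite -e /= reflK.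
  apply: (weyl_length_reflect pb _ hl'); last by rewrite -e2.
  by rewrite -e /= pair_refl oppr_lt0.
- by apply/funext => x /=; rewrite arefl0; have [_ ->] := ha x.
by rewrite e.
Qed.

Lemma bruhat_stepP u v : bruhat_step S u v -> exists s b,
  [/\ u = word S s, pos b, 0 < pair b (u r) & v = refl b \o u].
Proof.
move=> [a [l [l' [hv hl hl' hlt]]]]; have [[s hs _] _] := hl.
have [b0 hb0] := word_root_push s a.
have [b pb hb] : exists2 b, pos b & forall x, word S s (refl a x) = refl b (word S s x).
  case: (pos_or_opp b0) => pb; first by exists b0 => // x; case: (hb0 x).
  exists (opp_root b0) => // x.
  by rewrite refl_opp; case: (hb0 x).
have e : v = refl b \o u.
  by rewrite hv -hs; apply/funext => x /=; rewrite arefl0 hb.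
exists s, b; split => //.
rewrite lt_def -hs pair_word_rho /= leNgt; apply/negP => hn.
rewrite e -hs in hl'; rewrite -hs in hl.
by have := weyl_length_reflect pb hn hl hl'; rewrite ltnNge ltnW.
Qed.

Lemma bruhat_refl u b : weyl D u -> pos b -> 0 < pair b (u r) ->
  bruhat S u (refl b \o u).
Proof.
move=> /(weyl_word)[s ->] pb h.
exact/rt_step/bruhat_step_refl.
Qed.

Lemma weyl_comp_refl u b : weyl D u -> weyl D (refl b \o u).
Proof. by move=> h; rewrite -arefl0E; constructor. Qed.

Lemma pair_weyl_rho u a : weyl D u -> pair a (u r) != 0.
Proof. by move=> /(weyl_word)[s ->]; apply: pair_word_rho. Qed.

Definition up_simple i u : A -> A :=
  if 0 < pair (S i) (u r) then refl (S i) \o u else u.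
Definition down_simple i u : A -> A :=
  if pair (S i) (u r) < 0 then refl (S i) \o u else u.

Lemma weyl_up i u : weyl D u -> weyl D (up_simple i u).
Proof. by rewrite /up_simple; case: ifP => // _; apply: weyl_comp_refl. Qed.

Lemma weyl_down i u : weyl D u -> weyl D (down_simple i u).
Proof. by rewrite /down_simple; case: ifP => // _; apply: weyl_comp_refl. Qed.

Lemma bruhat_up i u : weyl D u -> bruhat S u (up_simple i u).
Proof.
rewrite /up_simple; case: ifP => h hu; last exact: rt_refl.
exact/bruhat_refl/h/posS.
Qed.

Lemma refl_comp_cancel b u : refl b \o (refl b \o u) = u.
Proof. by apply/funext => x /=; rewrite reflK. Qed.

Lemma bruhat_refl_down i u : weyl D u -> pair (S i) (u r) < 0 ->
  bruhat S (refl (S i) \o u) u.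
Proof.
move=> hu h; rewrite -{2}(refl_comp_cancel (S i) u).
apply: bruhat_refl; first exact: weyl_comp_refl; first exact: posS.
by rewrite /= pair_refl oppr_gt0.
Qed.

Lemma bruhat_down i u : weyl D u -> bruhat S (down_simple i u) u.
Proof.
rewrite /down_simple; case: ifP => h hu; last exact: rt_refl.
exact: bruhat_refl_down.
Qed.

(** Lifting property.  If [v = s_b u] covers [u] and [b] is not the simple root
    [alpha], then [s_alpha v = s_b' (s_alpha u)] with [b' = s_alpha b] again
    positive, so the step survives the reflection. *)
Lemma bruhat_step_up_down i u v : bruhat_step S u v ->
  bruhat S (up_simple i u) (up_simple i v) /\
  bruhat S (down_simple i u) (down_simple i v).
Proof.
move=> /bruhat_stepP[s [b [hs pb hb hv]]].
have hu : weyl D u by rewrite hs; apply: word_weyl.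
have wv : weyl D v by rewrite hv; apply: weyl_comp_refl.
have nu := pair_weyl_rho (S i) hu; have nv := pair_weyl_rho (S i) wv.
have uv : bruhat S u v by rewrite hv; apply: bruhat_refl.
have [e|bi] := eqVneq b (S i).
  have e1 : pair (S i) (v r) = - pair (S i) (u r) by rewrite hv /= e pair_refl.
  rewrite /up_simple /down_simple e1 -e hb oppr_gt0 oppr_lt0 hb ltNge (ltW hb) /=.
  by rewrite hv refl_comp_cancel; split; apply: rt_refl.
have sv : bruhat S (refl (S i) \o u) (refl (S i) \o v).
  have -> : refl (S i) \o v = refl (root_refl (S i) b) \o (refl (S i) \o u).
    by apply/funext => x; rewrite hv /= refl_root_refl reflK.
  apply: bruhat_refl; first exact: weyl_comp_refl.
    exact: (pos_refl_simple).
  by rewrite /= pair_root_refl reflK.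
split.
  rewrite {1}/up_simple; case: ifP => h1; last exact/(rt_trans _ _ _ v)/bruhat_up.
  apply: (rt_trans _ _ _ _ _ sv); rewrite /up_simple; case: ifP => h2.
    exact: rt_refl.
  by apply: bruhat_refl_down => //; rewrite lt_def eq_sym nv leNgt h2.
rewrite {2}/down_simple; case: ifP => h2.
  apply: (rt_trans _ _ _ (refl (S i) \o u)) => //.
  rewrite /down_simple; case: ifP => h1; first exact: rt_refl.
  apply: bruhat_refl => //; first exact: posS.
  by rewrite lt_def nu leNgt h1.
exact/(rt_trans _ _ _ u)/uv/bruhat_down.
Qed.

Lemma bruhat_up_mono i u v : bruhat S u v -> bruhat S (up_simple i u) (up_simple i v).
Proof.
elim=> [x y /(bruhat_step_up_down i)[]|x|x y z _ h1 _ h2] //; first exact: rt_refl.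
exact: rt_trans h1 h2.
Qed.

Lemma bruhat_down_mono i u v :
  bruhat S u v -> bruhat S (down_simple i u) (down_simple i v).
Proof.
elim=> [x y /(bruhat_step_up_down i)[]|x|x y z _ h1 _ h2] //; first exact: rt_refl.
exact: rt_trans h1 h2.
Qed.

(** ** Parity of Weyl group elements *)

Definition nneg x := #|[pred a | pos a && (pair a x < 0)%R]|.

Lemma nneg_refl i x : 0 < pair (S i) x -> nneg (refl (S i) x) = (nneg x).+1.
Proof.
move=> hx; rewrite /nneg (cardD1 (S i)) !inE posS pair_refl oppr_lt0 hx.
rewrite add1n; congr _.+1; rewrite -(fintype.card_image (inv_inj (root_reflK R (S i)))).
apply: eq_card => b; apply/fintype.imageP/idP => [[a]|].
  rewrite !inE => /and3P[ai pa h] ->.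
  rewrite (pos_refl_simple pa ai).
  by rewrite pair_root_refl h.
rewrite !inE => /andP[pb h]; exists (root_refl (S i) b); last by rewrite (root_reflK R).
have bi : b != S i by apply: contraTneq h => ->; rewrite -leNgt ltW.
rewrite !inE pair_root_refl reflK h (pos_refl_simple) // !andbT.
apply/eqP => e; have := pos_refl_simple pb bi.
by move: pb; rewrite -(root_reflK R (S i) b) e pos_opp posS.
Qed.

Lemma nneg_word_odd s : odd (nneg (word S s r)) = odd (size s).
Proof.
elim: s => [|i s IH] /=.
  rewrite /nneg eq_card0 // => a; rewrite !inE.
  by apply/andP => -[/pos_rho_gt0]; lra.
rewrite arefl0 -IH; have := pair_word_rho s (S i).
rewrite neq_lt => /orP[] h; last by rewrite nneg_refl.
have := nneg_refl (i := i) (x := refl (S i) (word S s r)).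
by rewrite reflK pair_refl oppr_gt0 => /(_ h) -> /=; rewrite negbK.
Qed.

(** ** The Weyl group as a finite list of matrices *)

Definition refmx a : 'M[R]_n := 1%:M - (\col_j (root_of a 0 j)%:~R) *m coroot a.

Lemma mul_refmx x a : x *m refmx a = refl a x.
Proof.
rewrite mulmxBr mulmx1 mulmxA /refl; congr (_ - _).
have -> : x *m (\col_j (root_of a 0 j)%:~R) = (pair a x)%:M :> 'M[R]_1.
  apply/matrixP => i j; rewrite !ord1 !mxE /pair /dot mulr1n.
  by apply: eq_bigr => k _; rewrite !mxE mulrC.
by rewrite mul_scalar_mx.
Qed.

Definition wmx (s : seq 'I_n) : 'M[R]_n := foldr (fun i M => M *m refmx (S i)) 1%:M s.

Lemma mul_wmx x s : x *m wmx s = word S s x.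
Proof. by elim: s => [|i s IH] /=; rewrite ?mulmx1 // mulmxA IH mul_refmx arefl0. Qed.

Lemma wmx_inj s t : (forall x, word S s x = word S t x :> A) -> wmx s = wmx t.
Proof.
move=> h; apply/row_matrixP => i; rewrite !rowE !mul_wmx; exact: h.
Qed.

Lemma weyl_finite : exists Ws : seq 'M[R]_n,
  uniq Ws /\ forall M, M \in Ws <-> exists s, M = wmx s.
Proof.
pose Q (p : {ffun Phi D -> Phi D}) M :=
  (exists s, M = wmx s) /\ forall a x, pair (p a) x = pair a (x *m M).
have hQ p M M' : Q p M -> Q p M' -> M = M'.
  move=> [[s ->] h1] [[t ->] h2]; apply: wmx_inj => x.
  by apply: pairS_inj => i; rewrite -!mul_wmx -h1 -h2.
pose c p := if pselect (exists M, Q p M) is left h then Some (projT1 (cid h)) else None.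
exists (undup (pmap c (enum {ffun Phi D -> Phi D}))); split; first exact: undup_uniq.
move=> M; rewrite mem_undup mem_pmap; split.
  move=> /mapP[p _]; rewrite /c; case: pselect => // h [->].
  by case: (cid h) => M' [].
move=> [s hM]; have /choice[f hf] := word_root s.
have hq : Q (finfun f) M.
  split; first by exists s.
  by move=> a x; rewrite ffunE hM mul_wmx.
apply/mapP; exists (finfun f); first by rewrite mem_enum.
rewrite /c; case: pselect => [h|[]]; last by exists M.
by case: (cid h) => M' h' /=; congr Some; apply: hQ hq h'.
Qed.

(** * Local foldings *)

Implicit Types (nu : A) (t : R).

Definition frac t : R := t - (Num.floor t)%:~R.

Lemma frac_ge0 t : 0 <= frac t.
Proof. by rewrite subr_ge0 Num.Theory.floor_le. Qed.

Lemma frac_int t : t \is a Num.int -> frac t = 0.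
Proof. by move=> h; rewrite /frac floorK // subrr. Qed.

Lemma frac_eq0 t : frac t = 0 -> t \is a Num.int.
Proof. by move=> /eqP; rewrite subr_eq0 => /eqP ->; rewrite intr_int. Qed.

Lemma frac_eqmod t t' : t - t' \is a Num.int -> frac t = frac t'.
Proof.
move=> h; have e : t = t' + (Num.floor (t - t'))%:~R by rewrite floorK //; lra.
rewrite {1}/frac {2}e floorDrz ?intr_int // intrKfloor rmorphD /= /frac {1}e; lra.
Qed.

(** One positive folding of the direction [nu] at parameter [t]: [t b(nu)] is
    congruent to the value of [b] at the vertex, so its integrality says that a
    wall of direction [b] passes through the vertex. *)
Definition tstep t nu nu' := exists b,
  [/\ pos b, pair b nu < 0, t * pair b nu \is a Num.int & nu' = refl b nu].

Definition tchain t := clos_refl_trans A (tstep t).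

Lemma pair_refl_int t nu b a : t * pair b nu \is a Num.int ->
  t * pair a nu - t * pair a (refl b nu) \is a Num.int.
Proof.
move=> h; rewrite /refl pairB pairZ pair_coroot.
have -> : t * pair a nu - t * (pair a nu -
   pair b nu * (dot (root_of a) (coroot_of b))%:~R) =
   (t * pair b nu) * (dot (root_of a) (coroot_of b))%:~R by ring.
by rewrite rpredM ?intr_int.
Qed.

Lemma tchain_int t nu nu' a : tchain t nu nu' ->
  t * pair a nu - t * pair a nu' \is a Num.int.
Proof.
elim=> [x y [b [_ _ h ->]]|x|x y z _ h1 _ h2]; first exact: pair_refl_int.
  by rewrite subrr rpred0.
by rewrite -(subrK (t * pair a y) (t * pair a x)) -addrA rpredD.
Qed.

Lemma int_congr (x y : R) : x - y \is a Num.int ->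
  (x \is a Num.int) = (y \is a Num.int).
Proof.
move=> h; apply/idP/idP => h1; last by rewrite -(subrK y x) rpredD.
by rewrite -(subKr x y) rpredB.
Qed.

Lemma tchain_int_iff t nu nu' a : tchain t nu nu' ->
  (t * pair a nu \is a Num.int) = (t * pair a nu' \is a Num.int).
Proof. by move=> h; apply: int_congr; apply: tchain_int. Qed.

Definition vup i nu := if pair (S i) nu < 0 then refl (S i) nu else nu.
Definition vdown i nu := if 0 < pair (S i) nu then refl (S i) nu else nu.

Lemma tstep_refl i t nu nu' : t * pair (S i) nu \is a Num.int = false \/
    nu' <> refl (S i) nu ->
  tstep t nu nu' -> tstep t (refl (S i) nu) (refl (S i) nu').
Proof.
move=> hi [b [pb hb hint e]].
have bi : b != S i.
  by apply/eqP => h; rewrite h in hint e; case: hi => // /negP; rewrite hint.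
exists (root_refl (S i) b); rewrite pair_root_refl reflK; split=> //.
  exact: (pos_refl_simple).
by rewrite refl_root_refl reflK e.
Qed.

Lemma tchain_simple i t nu : t * pair (S i) nu \is a Num.int ->
  pair (S i) nu <= 0 -> tchain t nu (refl (S i) nu).
Proof.
move=> h; rewrite le_eqVlt => /orP[/eqP h0|h0].
  by rewrite refl_fix //; apply: rt_refl.
by apply: rt_step; exists (S i); split=> //; apply: posS.
Qed.

Lemma tchain_simple_down i t nu : t * pair (S i) nu \is a Num.int ->
  0 <= pair (S i) nu -> tchain t (refl (S i) nu) nu.
Proof.
move=> h h0; rewrite -{2}(reflK (S i) nu); apply: tchain_simple.
  by rewrite pair_refl mulrN rpredN.
by rewrite pair_refl oppr_le0.
Qed.

(** Lifting property for chains of foldings at a vertex on an [alpha]-wall. *)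
Lemma tstep_vup_vdown i t nu nu' : t * pair (S i) nu \is a Num.int ->
  tstep t nu nu' ->
  tchain t (vup i nu) (vup i nu') /\ tchain t (vdown i nu) (vdown i nu').
Proof.
move=> hi h; have hi' : t * pair (S i) nu' \is a Num.int.
  by rewrite -(tchain_int_iff _ (rt_step _ _ _ _ h)).
case: (pselect (nu' = refl (S i) nu)) => [e|ne].
  have hp : pair (S i) nu' = - pair (S i) nu by rewrite e pair_refl.
  rewrite /vup /vdown hp oppr_lt0 oppr_gt0.
  case: (ltgtP (pair (S i) nu) 0) => h0; rewrite e ?reflK; split; try exact: rt_refl.
  - by rewrite refl_fix //; apply: rt_refl.
  - by rewrite refl_fix //; apply: rt_refl.
have /(rt_step _ (tstep t)) hs := tstep_refl (or_intror ne) h.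
have {}h := rt_step _ _ _ _ h.
split.
  rewrite /vup; case: ltP => h1; case: ltP => h2 //.
  - exact: (rt_trans _ _ _ _ _ hs (tchain_simple_down hi' h2)).
  - exact: (rt_trans _ _ _ _ _ h (tchain_simple hi' (ltW h2))).
rewrite /vdown; case: ltP => h1; case: ltP => h2 //.
- exact: (rt_trans _ _ _ _ _ (tchain_simple_down hi (ltW h1)) h).
- exact: (rt_trans _ _ _ _ _ (tchain_simple hi h1) hs).
Qed.

Lemma tchain_vup_vdown i t nu nu' : tchain t nu nu' ->
  t * pair (S i) nu \is a Num.int ->
  tchain t (vup i nu) (vup i nu') /\ tchain t (vdown i nu) (vdown i nu').
Proof.
elim=> [x y h hi|x _|x y z h IH1 h2 IH2 hi].
- exact: tstep_vup_vdown.
- by split; apply: rt_refl.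
have [h3 h4] := IH1 hi.
have [|h5 h6] := IH2; first by rewrite -(tchain_int_iff _ h).
by split; [apply: rt_trans h3 h5 | apply: rt_trans h4 h6].
Qed.

(** The defect of the direction [nu] at parameter [t]: how far the number of
    positive crossings up to time [t] along [nu] exceeds its mean value. *)
Definition defect t nu : R :=
  \sum_(a | pos a && (0 < pair a nu)) frac (- (t * pair a nu)).

Lemma defectE t nu :
  defect t nu = \sum_(a | pos a) (0 < pair a nu)%R%:R * frac (- (t * pair a nu)).
Proof.
rewrite /defect big_mkcondr; apply: eq_bigr => a _.
by case: ifP; rewrite ?mul1r ?mul0r.
Qed.

(** [|s_b a|] for a positive root [a]. *)
Definition pos_refl b a := if pos (root_refl b a) then root_refl b a
                           else opp_root (root_refl b a).

Lemma pos_pos_refl b a : pos (pos_refl b a).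
Proof. by rewrite /pos_refl; case: ifP => // /negbT; rewrite -pos_opp. Qed.

Lemma pos_reflK b a : pos a -> pos_refl b (pos_refl b a) = a.
Proof.
move=> pa; rewrite {2}/pos_refl; case: ifP => h.
  by rewrite /pos_refl (root_reflK R) pa.
rewrite /pos_refl (root_refl_opp R) (root_reflK R) (opp_rootK R).
by rewrite pos_opp pa.
Qed.

Lemma pos_refl_neg b a : pos b -> pos a -> ~~ pos (root_refl b a) ->
  0 < pair a (coroot b : A).
Proof.
move=> pb pa; rewrite -pos_opp !pos_rho in pb pa *.
rewrite pair_opp pair_root_refl /refl pairB pairZ => h.
rewrite ltNge; apply/negP => h1; nra.
Qed.

Lemma frac_sum_gt0 (x : R) : x \isn't a Num.int -> 0 < frac x + frac (- x).
Proof.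
move=> h; rewrite lt_def addr_ge0 ?frac_ge0 // andbT.
apply: contra h => /eqP h; apply: frac_eq0.
have := frac_ge0 x; have := frac_ge0 (- x); lra.
Qed.

(** The contribution of the pair [a, |s_b a|] to twice the change of defect. *)
Definition dterm t nu b a : R :=
  ((0 < pair a (refl b nu))%R%:R - (0 < pair a nu)%R%:R) * frac (- (t * pair a nu)).

(** If [s_b a > 0] the two terms cancel.  Otherwise the signs of [a] on [nu] and on
    [s_b nu] decide; the term is positive when [a] changes from negative to positive,
    unless [t a(nu)] is an integer. *)
Lemma dterm_pair t nu b a : pos b -> pair b nu < 0 -> pos a ->
  t * pair b nu \is a Num.int ->
  0 <= dterm t nu b a + dterm t nu b (pos_refl b a) /\
  (dterm t nu b a + dterm t nu b (pos_refl b a) = 0 ->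
   ~~ pos (root_refl b a) -> pair a nu < 0 -> 0 < pair a (refl b nu) ->
   t * pair a nu \is a Num.int).
Proof.
move=> pb hb pa hint.
have hf (x : Phi D) : frac (- (t * pair x (refl b nu))) = frac (- (t * pair x nu)).
  by apply/esym/frac_eqmod; rewrite -opprD rpredN pair_refl_int.
rewrite /dterm /pos_refl; case: ifP => h.
  rewrite !pair_root_refl reflK hf -mulrDl.
  by rewrite [X in X * _](_ : _ = 0) ?mul0r //; last by ring.
have hc := pos_refl_neg pb pa (negbT h).
have hs : pair a (refl b nu) = pair a nu - pair b nu * pair a (coroot b).
  by rewrite /refl pairB pairZ.
rewrite !pair_opp !pair_root_refl reflK mulrN opprK.
have hf2 : frac (t * pair a (refl b nu)) = frac (t * pair a nu).
  by apply/esym/frac_eqmod; rewrite pair_refl_int.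
rewrite hf2 !oppr_gt0.
have hlt : pair a nu < pair a (refl b nu) by rewrite hs; nra.
set u := pair a nu in hlt *; set v := pair a (refl b nu) in hlt *.
have hv : v = 0 -> frac (t * u) = 0.
  by move=> h0; rewrite -hf2 -/v h0 mulr0 frac_int ?rpred0.
have hu : u = 0 -> frac (- (t * u)) = 0.
  by move=> h0; rewrite h0 mulr0 oppr0 frac_int ?rpred0.
have -> : ((0 < v)%R%:R - (0 < u)%R%:R) * frac (- (t * u)) +
  ((u < 0)%R%:R - (v < 0)%R%:R) * frac (t * u) =
  (if (u < 0) && (0 < v) then frac (t * u) + frac (- (t * u)) else 0).
  case: (ltgtP u 0) => hu0; case: (ltgtP v 0) => hv0 /=;
    rewrite ?(hv hv0) ?(hu hu0); try lra.
have p1 := frac_ge0 (t * u); have p2 := frac_ge0 (- (t * u)).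
case: ifP => [/andP[h1 h2]|hn]; split=> //; first exact: addr_ge0.
  by move=> e _ _ _; apply: contraT => /frac_sum_gt0; rewrite e ltxx.
by move=> _ _ h1 h2; rewrite h1 h2 in hn.
Qed.

Lemma sum_pos_refl (F : Phi D -> R) b :
  \sum_(a | pos a) F a = \sum_(a | pos a) F (pos_refl b a).
Proof.
rewrite (reindex_onto (pos_refl b) (pos_refl b)) /=; last by move=> a; apply: pos_reflK.
apply: eq_bigl => a; rewrite pos_pos_refl /=.
apply/eqP/idP => [<-|]; [exact: pos_pos_refl | exact: pos_reflK].
Qed.

Lemma defect_step t nu b : t * pair b nu \is a Num.int ->
  2 * (defect t (refl b nu) - defect t nu) =
  \sum_(a | pos a) (dterm t nu b a + dterm t nu b (pos_refl b a)).
Proof.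
move=> hint; rewrite big_split /= -(sum_pos_refl (dterm t nu b)) -mulr2n -[RHS]mulr_natl.
congr (_ * _).
rewrite !defectE -sumrB; apply: eq_bigr => a _; rewrite /dterm mulrBl; congr (_ * _ - _).
by apply/esym/frac_eqmod; rewrite -opprD rpredN pair_refl_int.
Qed.

(** Each pair of positive roots contributes a nonnegative amount, and a pair of
    roots both negative on [nu] contributes [frac x + frac (- x)]. *)
Lemma defect_mono t nu nu' : tstep t nu nu' -> defect t nu <= defect t nu'.
Proof.
move=> [b [pb hb hint ->]]; have := defect_step hint.
have : 0 <= \sum_(a | pos a) (dterm t nu b a + dterm t nu b (pos_refl b a)).
  by apply: sumr_ge0 => a pa; case: (dterm_pair pb hb pa hint).
lra.
Qed.

Lemma defect_tight t nu b a : pos b -> pair b nu < 0 -> pos a ->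
  t * pair b nu \is a Num.int -> defect t nu = defect t (refl b nu) ->
  ~~ pos (root_refl b a) -> pair a nu < 0 -> 0 < pair a (refl b nu) ->
  t * pair a nu \is a Num.int.
Proof.
move=> pb hb pa hint e; have := defect_step hint; rewrite e subrr mulr0 => /esym h.
have hge c : pos c -> 0 <= dterm t nu b c + dterm t nu b (pos_refl b c).
  by move=> pc; case: (dterm_pair pb hb pc hint).
by have := psumr_eq0P hge h pa; case: (dterm_pair pb hb pa hint) => _.
Qed.

Lemma defect_chain t nu nu' : tchain t nu nu' -> defect t nu <= defect t nu'.
Proof.
elim=> [x y /defect_mono|x|x y z _ h1 _ h2] //; exact: le_trans h1 h2.
Qed.

(** A positive folding never decreases the defect, and the gallery is LS exactly when no
    folding increases it. *)
Definition tfold t nu nu' := tchain t nu nu' /\ defect t nu = defect t nu'.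

Lemma tfold_rt t nu nu' : tfold t nu nu' ->
  clos_refl_trans_1n A (fun x y => tstep t x y /\ defect t x = defect t y) nu nu'.
Proof.
move=> [h e]; have h1 := Operators_Properties.clos_rt_rt1n _ _ _ _ h.
elim: h1 e {h} => [x _|x y z hs hr IH e]; first exact: rt1n_refl.
have h1 := defect_mono hs; have h2 := defect_chain (Operators_Properties.clos_rt1n_rt _ _ _ _ hr).
have e1 : defect t x = defect t y by apply/eqP; rewrite eq_le h1 e h2.
by apply: (rt1n_trans _ _ _ y) => //; apply: IH; rewrite -e1.
Qed.

Lemma refl_simple_neg i b : pos b -> b != S i -> 0 < pair (S i) (coroot b : A) ->
  ~~ pos (root_refl b (S i)).
Proof.
move=> pb bi hc; apply/negP => ps.
have hj j : j != i -> pair b (omega j) = 0.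
  move=> ji; apply/eqP; rewrite eq_le (pos_ge0 pb (omega_dom j)) andbT.
  have := pos_ge0 ps (omega_dom j).
  rewrite pair_root_refl /refl pairB pairZ omegaP (negPf ji) sub0r oppr_ge0.
  by rewrite pmulr_lle0.
have hx x : pair b x = pair b (omega i) * pair (S i) x.
  rewrite {1}(omega_decomp x) pair_sum (bigD1 i) //= pairZ mulrC.
  by rewrite big1 ?addr0 // => j ji; rewrite pairZ hj ?mulr0.
have := pos_ge0 (pos_refl_simple pb bi) (omega_dom i).
have := pos_rho_gt0 pb; rewrite hx pairS_rho mulr1 => h0.
rewrite pair_root_refl hx pair_refl omegaP eqxx mulrN mulr1; lra.
Qed.

(** In a tight chain the value of a simple root cannot become nonnegative away
    from its walls.  At the step [s_b] where the sign changes, the positive roots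
    [alpha] and [- s_b alpha] are both negative on the direction before the step, so
    tightness makes the value of [t alpha] an integer. *)
Lemma tfold_sign_int i t nu nu' : tfold t nu nu' -> pair (S i) nu < 0 ->
  0 <= pair (S i) nu' -> t * pair (S i) nu \is a Num.int.
Proof.
move=> /tfold_rt; elim=> [x|x y z [hs e] _ IH hx hz]; first by rewrite ltNge => /negPf->.
rewrite (tchain_int_iff _ (rt_step _ _ _ _ hs)).
case: (ltP (pair (S i) y) 0) => [hy|hy]; first exact: IH.
rewrite -(tchain_int_iff _ (rt_step _ _ _ _ hs)).
have [b [pb hb hint ey]] := hs; have [<-//|bi] := eqVneq b (S i).
rewrite ey in hy e; have pS := posS i.
have hc : 0 < pair (S i) (coroot b : A).
  move: hy; rewrite /refl pairB pairZ; nra.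
have hn := refl_simple_neg pb bi hc.
move: hy; rewrite le_eqVlt => /orP[/eqP h0|h0]; last exact: (defect_tight pb hb pS hint e).
by have := pair_refl_int (S i) hint; rewrite -h0 mulr0 subr0.
Qed.

Lemma defect_refl i t nu : defect t (refl (S i) nu) = defect t nu
  - (0 < pair (S i) nu)%R%:R * frac (- (t * pair (S i) nu))
  + (pair (S i) nu < 0)%R%:R * frac (t * pair (S i) nu).
Proof.
rewrite !defectE (bigD1 (S i)) ?posS //=.
rewrite [in RHS](bigD1 (S i)) ?posS //=.
rewrite pair_refl mulrN opprK oppr_gt0.
rewrite (reindex_inj (inv_inj (root_reflK R (S i)))) /=.
have -> : \sum_(a | pos (root_refl (S i) a) && (root_refl (S i) a != S i))
   (0 < pair (root_refl (S i) a) (refl (S i) nu))%R%:R *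
   frac (- (t * pair (root_refl (S i) a) (refl (S i) nu))) =
   \sum_(a | pos a && (a != S i)) (0 < pair a nu)%R%:R * frac (- (t * pair a nu)).
  apply: eq_big => [a|a _]; last by rewrite pair_root_refl reflK.
  apply/andP/andP => -[pa ai].
    have := pos_refl_simple pa ai.
    rewrite (root_reflK R) => pa'; split=> //; apply: contraTneq pa => ->.
    by rewrite pos_opp posS.
  split; first exact: (pos_refl_simple).
  apply/eqP => e; move: pa; rewrite -(root_reflK R (S i) a) e.
  by rewrite pos_opp posS.
lra.
Qed.

Lemma defect_refl_int i t nu : t * pair (S i) nu \is a Num.int ->
  defect t (refl (S i) nu) = defect t nu.
Proof. by move=> h; rewrite defect_refl !frac_int ?rpredN // !mulr0 subr0 addr0. Qed.

Lemma tfold_trans t x y z : tfold t x y -> tfold t y z -> tfold t x z.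
Proof.
by move=> [h1 e1] [h2 e2]; split; [apply: rt_trans h1 h2 | rewrite e1].
Qed.

Lemma tfold_simple i t nu : t * pair (S i) nu \is a Num.int ->
  pair (S i) nu <= 0 -> tfold t nu (refl (S i) nu).
Proof. by move=> h h0; split; [apply: tchain_simple | rewrite defect_refl_int]. Qed.

Lemma tfold_simple_down i t nu : t * pair (S i) nu \is a Num.int ->
  0 <= pair (S i) nu -> tfold t (refl (S i) nu) nu.
Proof. by move=> h h0; split; [apply: tchain_simple_down | rewrite defect_refl_int]. Qed.

Lemma tfold_lift_right i t nu nu' : tfold t nu nu' -> t * pair (S i) nu \is a Num.int ->
  pair (S i) nu <= 0 -> 0 < pair (S i) nu' -> tfold t nu (refl (S i) nu').
Proof.
move=> [h e] hi h1 h2; have [_] := tchain_vup_vdown h hi.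
rewrite /vdown ltNge h1 h2 /= => hc; split=> //; rewrite defect_refl_int //.
by rewrite -(tchain_int_iff _ h).
Qed.

Lemma tfold_lift_left i t nu nu' : tfold t nu nu' -> t * pair (S i) nu \is a Num.int ->
  pair (S i) nu < 0 -> 0 <= pair (S i) nu' -> tfold t (refl (S i) nu) nu'.
Proof.
move=> [h e] hi h1 h2; have [+ _] := tchain_vup_vdown h hi.
by rewrite /vup h1 [_ nu' < 0]ltNge h2 /= => hc; split=> //; rewrite defect_refl_int.
Qed.

Lemma tfold_conj i t nu nu' : tfold t nu nu' -> t * pair (S i) nu \isn't a Num.int ->
  0 < pair (S i) nu * pair (S i) nu' -> tfold t (refl (S i) nu) (refl (S i) nu').
Proof.
move=> [h e] hi hs; split.
  elim: h hi {e hs} => [x y h hi|x _|x y z h IH1 _ IH2 hi]; last 1 first.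
  - apply: rt_trans (IH1 hi) _; apply: IH2.
    by rewrite -(tchain_int_iff _ h).
  - by apply/rt_step/tstep_refl => //; left; apply/negbTE.
  exact: rt_refl.
have hf : frac (t * pair (S i) nu) = frac (t * pair (S i) nu').
  exact/frac_eqmod/tchain_int.
have hf2 : frac (- (t * pair (S i) nu)) = frac (- (t * pair (S i) nu')).
  by apply: frac_eqmod; rewrite -opprD rpredN tchain_int.
have h1 : (0 < pair (S i) nu) = (0 < pair (S i) nu') by apply/idP/idP => ?; nra.
have h2 : (pair (S i) nu < 0) = (pair (S i) nu' < 0) by apply/idP/idP => ?; nra.
by rewrite !defect_refl e hf hf2 h1 h2.
Qed.

End Bruhat.

(** * Folded paths and root operators *)

Section Paths.
Implicit Types (a b : Phi D) (x y z : A).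
Local Notation r := (rho_v).
Implicit Types (u v w : A -> A) (nu : A) (t : R).
Implicit Types (p : profile R n) (s : seq A).

Definition profile_ok p : Prop :=
  [/\ forall k, (k < psize p)%N -> exists i, pdir p k = omega i,
      forall k, (k < psize p)%N -> 0 < plen p k,
      ptime p 0 = 0,
      forall k, (k < psize p)%N ->
        (ptime p k.+1 = 0 /\ ptime p k + plen p k = 1) \/
        [/\ (k.+1 < psize p)%N, ptime p k.+1 = ptime p k + plen p k,
            pdir p k.+1 = pdir p k & 0 < ptime p k.+1 < 1]
    & forall k a t, (k < psize p)%N -> ptime p k < t < ptime p k + plen p k ->
        t * pair a (pdir p k) \is a Num.int -> pair a (pdir p k) = 0].

(** A folded path is recorded by the directions of its edges.  At a vertex interior to a
    fundamental gallery the directions must be linked by a tight chain of positive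
    foldings; at a junction, where [ptime] is zero, all walls through the vertex are
    available and only the Bruhat order of the sectors remains. *)
Definition model p s : Prop :=
  [/\ size s = psize p,
      forall k, (k.+1 < psize p)%N -> ptime p k.+1 != 0 ->
        tfold (ptime p k.+1) (nth 0 s k) (nth 0 s k.+1)
    & exists tau : nat -> A -> A,
        (forall k, (k < psize p)%N ->
           weyl D (tau k) /\ tau k (pdir p k) = nth 0 s k) /\
        (forall k, (k.+1 < psize p)%N -> bruhat S (tau k.+1) (tau k))].

Definition vert p s k : A := \sum_(j < k) plen p j *: nth 0 s j.
Definition height p i s k : R := pair (S i) (vert p s k).

Lemma vert0 p s : vert p s 0 = 0. Proof. exact: big_ord0. Qed.

Lemma vertS p s k : vert p s k.+1 = vert p s k + plen p k *: nth 0 s k.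
Proof. exact: big_ord_recr. Qed.

Lemma height0 p i s : height p i s 0 = 0.
Proof. by rewrite /height vert0 pair0. Qed.

Lemma heightS p i s k :
  height p i s k.+1 = height p i s k + plen p k * pair (S i) (nth 0 s k).
Proof. by rewrite /height vertS pairD pairZ. Qed.

Lemma weyl_dom_gt0 u a x : weyl D u -> Cplus S x -> 0 < pair a (u x) -> 0 < pair a (u r).
Proof.
move=> /weyl_word[w ->] hx; have [b hb] := word_root w a.
rewrite -!hb => h; rewrite -pos_rho; apply: contraT; rewrite -pos_opp => pb.
by have := pos_ge0 pb hx; rewrite pair_opp; lra.
Qed.

Lemma weyl_dom_lt0 u a x : weyl D u -> Cplus S x -> pair a (u x) < 0 -> pair a (u r) < 0.
Proof.
move=> hu hx; rewrite -oppr_gt0 -pair_opp => /(weyl_dom_gt0 hu hx).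
by rewrite pair_opp oppr_gt0.
Qed.

Section Heights.
Variables (p : profile R n) (i : 'I_n).
Hypothesis p_ok : profile_ok p.
Local Notation N := (psize p).
Local Notation t_ := (ptime p).

Section OnePath.
Variable s : seq A.
Hypothesis s_model : model p s.
Local Notation nu := (nth 0 s).
Local Notation h := (height p i s).

Lemma model_orbit k : (k < N)%N -> exists w : seq 'I_n, nu k = word S w (pdir p k).
Proof.
move=> kN; have [_ _ [tau [h1 _]]] := s_model; have [hw <-] := h1 _ kN.
by have [w ->] := weyl_word hw; exists w.
Qed.

Lemma model_pair_int k a : pair a (nu k) \is a Num.int.
Proof.
case: (ltnP k N) => kN.
  have [w ->] := model_orbit kN; have [b <-] := word_root w a.
  by case: p_ok => /(_ _ kN)[j ->] _ _ _ _; apply: pair_omega_int.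
by case: s_model => hs _ _; rewrite nth_default ?hs // pair0 rpred0.
Qed.

Lemma vert_int k a : (k <= N)%N -> pair a (vert p s k) - t_ k * pair a (nu k) \is a Num.int.
Proof.
case: p_ok => _ _ h0 ht _; elim: k => [_|k IH kN].
  by rewrite vert0 pair0 h0 mul0r subrr rpred0.
rewrite vertS pairD pairZ; have := IH (ltnW kN).
have [[h1 h2]|[h1 h2 _ /andP[h3 _]]] := ht _ kN.
  rewrite h1 mul0r subr0 => h4.
  have -> : pair a (vert p s k) + plen p k * pair a (nu k) =
    pair a (vert p s k) - t_ k * pair a (nu k) + (t_ k + plen p k) * pair a (nu k) by ring.
  by rewrite rpredD // h2 mul1r model_pair_int.
move=> h4; case: s_model => _ hf _; have [hc _] := hf _ h1 (lt0r_neq0 h3).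
have := tchain_int a hc => h5.
have -> : pair a (vert p s k) + plen p k * pair a (nu k) - t_ k.+1 * pair a (nu k.+1) =
  pair a (vert p s k) - t_ k * pair a (nu k) +
  (t_ k.+1 * pair a (nu k) - t_ k.+1 * pair a (nu k.+1)) by rewrite h2; ring.
exact: rpredD.
Qed.

Lemma height_int_iff k : (k <= N)%N ->
  (h k \is a Num.int) = (t_ k * pair (S i) (nu k) \is a Num.int).
Proof. by move=> kN; apply/int_congr/vert_int. Qed.

Lemma height_intS k : (k < N)%N -> t_ k.+1 != 0 ->
  (h k.+1 \is a Num.int) = (t_ k.+1 * pair (S i) (nu k) \is a Num.int).
Proof.
move=> kN hn; rewrite height_int_iff //; case: p_ok => _ _ _ ht _.
have [[h1 _]|[h1 _ _ _]] := ht _ kN; first by rewrite h1 eqxx in hn.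
case: s_model => _ hf _; have [hc _] := hf _ h1 hn.
by rewrite -(tchain_int_iff _ hc).
Qed.

Lemma height_end_int : h N \is a Num.int.
Proof.
rewrite height_int_iff // nth_default ?pair0 ?mulr0 ?rpred0 //.
by case: s_model => -> _ _.
Qed.

Lemma height_time0 k : (k <= N)%N -> t_ k = 0 -> h k \is a Num.int.
Proof. by move=> kN h0; rewrite height_int_iff // h0 mul0r rpred0. Qed.

(** On an edge a root takes integral values only at the end points: this is the property
    of the reference gallery in [profile_ok], transported by the Weyl group. *)
Lemma height_no_cross k m : (k < N)%N -> m \is a Num.int ->
  (h k < m < h k.+1) || (h k.+1 < m < h k) = false.
Proof.
move=> kN hm; apply/negP => hx.
case: p_ok => _ hlen _ _ hw.
set c := pair (S i) (nu k).
have hc : c != 0.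
  apply: contraTneq hx => h0; rewrite heightS -/c h0 mulr0 addr0.
  by apply/negP => /orP[] /andP[h1 h2]; have := lt_trans h1 h2; rewrite ltxx.
have [w hw1] := model_orbit kN; have [b hb] := word_root w (S i).
have hcb : c = pair b (pdir p k) by rewrite /c hw1 hb.
have c0 : (0 < c) || (c < 0) by rewrite orbC -neq_lt.
have [hl hi] := (hlen _ kN, vert_int (S i) (ltnW kN)).
have e : (m - h k) / c * c = m - h k by rewrite divfK.
set q := (m - h k) / c in e.
have hq : 0 < q < plen p k.
  move: hx; rewrite heightS -/c => /orP[] /andP[h1 h2];
    case/orP: c0 => c0; apply/andP; split; nra.
have := hw k b (t_ k + q) kN; rewrite -hcb ltrDl ltrD2l hq => /(_ isT).
move=> /(_ _)/eqP; rewrite (negPf hc) => h3.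
suff : false by []; apply: h3; rewrite mulrDl e.
have -> : t_ k * c + (m - h k) = m - (h k - t_ k * c) by ring.
exact: rpredB.
Qed.

Lemma height_neq0 k : (k <= N)%N -> h k \isn't a Num.int -> pair (S i) (nu k) != 0.
Proof.
by move=> kN; rewrite height_int_iff //; apply: contra => /eqP ->; rewrite mulr0 rpred0.
Qed.

Lemma height_neq0_prev k : (k < N)%N -> h k.+1 \isn't a Num.int ->
  t_ k.+1 != 0 /\ pair (S i) (nu k) != 0.
Proof.
move=> kN hn; have ht : t_ k.+1 != 0.
  by apply: contra hn => /eqP h0; apply: height_time0.
split=> //; move: hn; rewrite height_intS //.
by apply: contra => /eqP ->; rewrite mulr0 rpred0.
Qed.

(** A tight chain cannot turn a root from negative to nonnegative off its walls. *)
Lemma height_descend k : (k.+1 < N)%N -> h k.+1 \isn't a Num.int ->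
  pair (S i) (nu k) < 0 -> pair (S i) (nu k.+1) < 0.
Proof.
move=> kN hn hlt; have [ht _] := height_neq0_prev (ltnW kN) hn.
rewrite ltNge; apply: contra hn => hge; rewrite height_intS //; last exact: ltnW.
by case: s_model => _ hf _; apply: tfold_sign_int (hf _ kN ht) hlt hge.
Qed.

Lemma heightS_lt k : (k < N)%N -> (h k.+1 < h k) = (pair (S i) (nu k) < 0).
Proof.
move=> kN; case: p_ok => _ hlen _ _ _; have := hlen _ kN; rewrite heightS => hl.
by apply/idP/idP => ?; nra.
Qed.

Lemma heightS_gt k : (k < N)%N -> (h k < h k.+1) = (0 < pair (S i) (nu k)).
Proof.
move=> kN; case: p_ok => _ hlen _ _ _; have := hlen _ kN; rewrite heightS => hl.
by apply/idP/idP => ?; nra.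
Qed.

Lemma height_nonint_ends k : h k \isn't a Num.int -> (k <= N)%N -> (0 < k < N)%N.
Proof.
case: k => [|k]; first by rewrite height0 rpred0.
rewrite leq_eqVlt => hn /orP[/eqP e|//]; by rewrite e height_end_int in hn.
Qed.

(** Away from the walls a descent continues, so a minimum of the height that is not
    attained at an end of the stretch is attained on a wall. *)
Lemma height_seg_min k0 k1 q : (k0 <= k1 <= N)%N -> h k0 \is a Num.int ->
  h k1 \is a Num.int -> q \is a Num.int ->
  (forall k, (k0 <= k <= k1)%N -> q < h k) ->
  forall k, (k0 <= k <= k1)%N -> q + 1 <= h k.
Proof.
move=> /andP[h01 h1N] i0 i1 iq hq.
pose P (k : 'I_N.+1) := (k0 <= k <= k1)%N.
have hk0 : (k0 < N.+1)%N by rewrite ltnS (leq_trans h01).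
have P0 : P (Ordinal hk0) by rewrite /P /= leqnn.
case: (Order.TotalTheory.arg_minP (fun k : 'I_N.+1 => h k) P0) => m /andP[m0 m1] hmin.
have him : h m \is a Num.int.
  apply: contraT => hn.
  have hmN : (m <= N)%N by rewrite -ltnS.
  have /andP[] := height_nonint_ends hn hmN.
  have n0 : k0 != m by apply: contraNneq hn => <-.
  have n1 : m != k1 :> nat by apply: contraNneq hn => ->.
  have lt0 : (k0 < m)%N by rewrite ltn_neqAle n0.
  have lt1 : (m < k1)%N by rewrite ltn_neqAle n1.
  case em : (m : nat) lt0 => [//|j] lt0 _ jN.
  have j1N : (j < N.+1)%N by rewrite ltnS ltnW // ltnW.
  rewrite em in hn m1 lt1.
  have [_ hj] := height_neq0_prev (ltnW jN) hn.
  have := hmin (Ordinal j1N); rewrite /P /= em => hle.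
  have {}hle : h j.+1 <= h j by apply: hle; rewrite -ltnS lt0 ltnW // ltnW.
  have hneg : pair (S i) (nu j) < 0.
    by rewrite lt_neqAle hj leNgt -heightS_gt ?(ltnW jN) // -leNgt.
  have := height_descend jN hn hneg; rewrite -heightS_lt // => hlt2.
  have j2N : (j.+2 < N.+1)%N by [].
  have := hmin (Ordinal j2N); rewrite /P /= em leNgt hlt2; apply.
  by rewrite lt1 andbT (leq_trans (n := j.+1)) // ltnW.
move=> k /andP[hk hk'].
have kN1 : (k < N.+1)%N by rewrite ltnS (leq_trans hk').
have := hmin (Ordinal kN1); rewrite /P /= hk hk' => /(_ isT); apply: le_trans.
have /hq : (k0 <= m <= k1)%N by rewrite m0.
rewrite -(floorK iq) -(floorK him) ltr_int -lezD1 -(ler_int R) rmorphD /=.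
by [].
Qed.

Definition rise (a b : nat) := [/\ (a < b <= N)%N, h a \is a Num.int, h b = h a + 1
  & forall k, (a < k < b)%N -> h a < h k < h a + 1].
Definition fall (a b : nat) := [/\ (a < b <= N)%N, h a \is a Num.int, h b = h a - 1
  & forall k, (a < k < b)%N -> h a - 1 < h k < h a].

Lemma nonint_between (x m : R) : m \is a Num.int -> m < x < m + 1 -> x \isn't a Num.int.
Proof.
move=> hm /andP[h1 h2]; apply/negP => hx; move: h1 h2.
rewrite -(floorK hm) -(floorK hx) -(intrD _ _ 1) !ltr_int ltzD1 => h1.
by rewrite leNgt h1.
Qed.

Lemma rise_nonint (a b : nat) k : rise a b -> (a < k < b)%N -> h k \isn't a Num.int.
Proof. by move=> [_ hi _ hb] /hb; apply: nonint_between. Qed.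

Lemma fall_nonint (a b : nat) k : fall a b -> (a < k < b)%N -> h k \isn't a Num.int.
Proof.
move=> [_ hi _ hb] /hb h1; apply: (@nonint_between _ (h a - 1)); last by rewrite subrK.
by rewrite rpredB ?rpred1.
Qed.

Lemma rise_gt0 (a b : nat) k : rise a b -> (a <= k < b)%N -> 0 < pair (S i) (nu k).
Proof.
move=> hr /andP[ak kb]; have [/andP[ab bN] hi hb hbt] := hr.
have kN := leq_trans kb bN.
rewrite -heightS_gt //; move: ak; rewrite leq_eqVlt => /orP[/eqP e|ak].
  rewrite -e; case: (ltnP a.+1 b) => h1; first by move: (hbt a.+1); rewrite ltnSn h1 => /(_ isT)/andP[].
  have -> : a.+1 = b by apply/eqP; rewrite eqn_leq h1 andbT.
  by rewrite hb ltrDl.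
rewrite heightS_gt // lt_neqAle eq_sym height_neq0 ?(ltnW kN) ?(rise_nonint hr) ?ak //=.
rewrite leNgt; apply/negP => hneg.
have hall j : (k <= j)%N -> (j < b)%N -> pair (S i) (nu j) < 0.
  elim: j => [|j IH]; first by move=> k0 _; move: hneg; rewrite (_ : k = 0%N) //; lia.
  rewrite leq_eqVlt => /orP[/eqP <- //|kj] jb.
  apply: height_descend; [exact: leq_trans jb bN| |exact: IH (ltnW jb)].
  by apply: (rise_nonint hr); rewrite jb andbT (leq_trans ak) // ltnW.
case: b ab bN hb hbt kb hall {hr} => // b ab bN hb hbt kb hall.
have := hall b kb (ltnSn b); rewrite -heightS_lt // hb => h1.
by have := hbt b; rewrite ltnSn (leq_trans ak) // => /(_ isT)/andP[_]; lra.
Qed.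

Lemma fall_lt0 (a b : nat) k : fall a b -> (a <= k < b)%N -> pair (S i) (nu k) < 0.
Proof.
move=> hr /andP[ak kb]; have [/andP[ab bN] hi hb hbt] := hr.
have base : pair (S i) (nu a) < 0.
  rewrite -heightS_lt ?(leq_trans ab) //.
  case: (ltnP a.+1 b) => h1; first by move: (hbt a.+1); rewrite ltnSn h1 => /(_ isT)/andP[].
  have -> : a.+1 = b by apply/eqP; rewrite eqn_leq h1 andbT.
  by rewrite hb ltrBlDr ltrDl.
elim: k ak kb => [|k IH]; first by move=> a0 _; move: base; rewrite (_ : a = 0%N) //; lia.
rewrite leq_eqVlt => /orP[/eqP <- //|ak] kb.
apply: height_descend; [exact: leq_trans kb bN| |exact: IH (ltnW kb)].
by apply: (fall_nonint hr); rewrite ak.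
Qed.

End OnePath.

Definition reflect_seg (a b : nat) s : seq A :=
  mkseq (fun k => if (a <= k < b)%N then refl (S i) (nth 0 s k) else nth 0 s k) (size s).

Lemma nth_reflect_seg (a b : nat) s k : nth 0 (reflect_seg a b s) k =
  if (a <= k < b)%N then refl (S i) (nth 0 s k) else nth 0 s k.
Proof.
case: (ltnP k (size s)) => hk; first by rewrite nth_mkseq.
rewrite [LHS]nth_default ?size_mkseq // [nth 0 s k]nth_default // refl0.
by case: ifP.
Qed.

Lemma size_reflect_seg (a b : nat) s : size (reflect_seg a b s) = size s.
Proof. exact: size_mkseq. Qed.

Lemma reflect_segK (a b : nat) : involutive (reflect_seg a b).
Proof.
move=> s; apply: (@eq_from_nth _ 0); rewrite !size_reflect_seg // => k _.
by rewrite nth_reflect_seg; case: ifP => h; rewrite nth_reflect_seg h ?reflK.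
Qed.

Lemma vert_reflect_low (a b : nat) s k : (k <= a)%N ->
  vert p (reflect_seg a b s) k = vert p s k.
Proof.
move=> ka; apply: eq_bigr => j _; rewrite nth_reflect_seg.
by rewrite leqNgt (leq_trans (ltn_ord j) ka).
Qed.

Lemma vert_reflect_mid (a b : nat) s k : (a <= k <= b)%N ->
  vert p (reflect_seg a b s) k = vert p s k
    - (height p i s k - height p i s a) *: coroot (S i).
Proof.
elim: k => [|k IH].
  rewrite leqn0 => /andP[/eqP-> _]; by rewrite vert_reflect_low // subrr scale0r subr0.
rewrite leq_eqVlt => /andP[/orP[/eqP e|ak] kb].
  by rewrite -e vert_reflect_low // subrr scale0r subr0.
rewrite !vertS IH ?(ltnW kb) ?andbT // nth_reflect_seg kb -ltnS ak /= heightS.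
rewrite /refl; apply/rowP => j; rewrite !mxE; ring.
Qed.

Lemma vert_reflect_high (a b : nat) s k : (a <= b <= k)%N ->
  vert p (reflect_seg a b s) k = vert p s k
    - (height p i s b - height p i s a) *: coroot (S i).
Proof.
move=> /andP[ab]; elim: k => [|k IH] bk.
  by rewrite vert_reflect_mid // ?bk ?andbT; move: bk ab; rewrite leqn0 => /eqP->.
move: bk; rewrite leq_eqVlt => /orP[/eqP e|bk].
  by rewrite -e vert_reflect_mid // ab leqnn.
rewrite !vertS IH // nth_reflect_seg (_ : (a <= k < b)%N = false); last by lia.
by rewrite -!addrA; congr (_ + _); rewrite addrC.
Qed.

Lemma height_reflect_low (a b : nat) s k : (k <= a)%N ->
  height p i (reflect_seg a b s) k = height p i s k.
Proof. by move=> ka; rewrite /height vert_reflect_low. Qed.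

Lemma height_reflect_mid (a b : nat) s k : (a <= k <= b)%N ->
  height p i (reflect_seg a b s) k = 2 * height p i s a - height p i s k.
Proof.
move=> h; rewrite {1}/height vert_reflect_mid // pairB pairZ pair_coroot_diag.
rewrite -/(height p i s k); ring.
Qed.

Lemma height_reflect_high (a b : nat) s k : (a <= b <= k)%N ->
  height p i (reflect_seg a b s) k =
  height p i s k - 2 * (height p i s b - height p i s a).
Proof.
move=> h; rewrite {1}/height vert_reflect_high // pairB pairZ pair_coroot_diag.
rewrite -/(height p i s k); ring.
Qed.

Lemma pdir_dom k : (k < N)%N -> Cplus S (pdir p k).
Proof. by move=> kN; case: p_ok => /(_ _ kN)[j ->] _ _ _ _; apply: omega_dom. Qed.

(** A stretch that leaves the minimal wall for the last time can be reflected.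
    The chain of sectors is repaired by lifting the sectors of the stretch; the
    edges just before it that lie inside the wall may have to be lifted too. *)
Lemma model_reflect_rise (a b : nat) s : model p s -> rise s a b ->
  (forall k, (k <= a)%N -> height p i s a <= height p i s k) ->
  model p (reflect_seg a b s).
Proof.
move=> hm hr hmin; have [hs hf [tau [ht hb]]] := hm.
have [/andP[ab bN] hia hbE _] := hr.
have hib : height p i s b \is a Num.int by rewrite hbE rpredD ?rpred1.
split; first by rewrite size_reflect_seg.
- move=> k kN t0; have h1 := hf k kN t0; rewrite !nth_reflect_seg.
  case: (ltnP k a) => ka.
    rewrite /=; case: (ltnP k.+1 b) => kb; last by rewrite andbF.
    rewrite andbT; case: (leqP a k.+1) => ka' //.
    have e : k.+1 = a by apply/eqP; rewrite eqn_leq ka ka'.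
    apply: tfold_lift_right => //.
    + by rewrite -(height_intS hm) ?(ltnW kN) // e.
    + by rewrite leNgt -(heightS_gt s (ltnW kN)) -leNgt e hmin // -e.
    + by apply: (rise_gt0 hm hr); rewrite e leqnn.
  rewrite (leq_trans ka (leqnSn k)) /=; case: (ltnP k b) => kb; last first.
    by rewrite ltnNge (leq_trans kb (leqnSn k)).
  have gk : 0 < pair (S i) (nth 0 s k) by apply: (rise_gt0 hm hr); rewrite ka.
  case: (ltnP k.+1 b) => kb'.
    apply: tfold_conj => //.
      by rewrite -(height_intS hm) ?(ltnW kN) // (rise_nonint hr) // kb' andbT.
    apply: mulr_gt0 => //; apply: (rise_gt0 hm hr).
    by rewrite kb' andbT (leq_trans ka).
  have e : k.+1 = b by apply/eqP; rewrite eqn_leq kb kb'.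
  apply: tfold_trans h1; apply: tfold_simple_down (ltW gk).
  by rewrite -(height_intS hm) ?(ltnW kN) // e.
(* From [c] to [a] the path stays in the wall: there the sector may be replaced by its
   lift, and the edge before [c] has a sector that is already lifted. *)
have [c [ca hc0 hc1]] : exists c, [/\ (c <= a)%N,
    forall k, (c <= k < a)%N -> pair (S i) (nth 0 s k) = 0
  & c = 0%N \/ exists2 k, c = k.+1 & pair (S i) (nth 0 s k) < 0].
  have [c [ca hc0 hc1]] : exists c, [/\ (c <= a)%N,
      forall k, (c <= k < a)%N -> pair (S i) (nth 0 s k) = 0
    & c = 0%N \/ exists2 k, c = k.+1 & pair (S i) (nth 0 s k) != 0].
    elim: (a) => [|a' [c [ca hc0 hc1]]].
      by exists 0%N; split=> //; left.
    case: (eqVneq (pair (S i) (nth 0 s a')) 0) => h0.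
      exists c; split=> //; first exact: leqW.
      move=> k /andP[ck]; rewrite ltnS leq_eqVlt => /orP[/eqP->//|ka].
      by apply: hc0; rewrite ck.
    exists a'.+1; split=> //; last by right; exists a'.
    by move=> k /andP[h1 h2]; move: (leq_trans h1 h2); rewrite ltnn.
  exists c; split=> //; case: hc1 => [->|[k ck hk]]; first by left.
  right; exists k => //.
  have hca : forall j, (c <= j <= a)%N -> height p i s j = height p i s c.
    elim=> [|j IH]; first by move=> hj; congr height; lia.
    move=> /andP[]; rewrite leq_eqVlt => /orP[/eqP-> //|cj] ja.
    by rewrite heightS IH ?hc0 ?mulr0 ?addr0 //; lia.
  have kN : (k < N)%N by lia.
  rewrite lt_neqAle hk leNgt -(heightS_gt s) // -ck -leNgt -(hca a) ?ca ?leqnn //.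
  by apply: hmin; rewrite ltnW // -ck.
exists (fun k => if (c <= k < b)%N then up_simple i (tau k) else tau k); split.
  move=> k kN; have [hw he] := ht _ kN; rewrite nth_reflect_seg.
  have hd := pdir_dom kN.
  case: (ltnP k b) => kb; last by rewrite !andbF.
  rewrite !andbT; case: (leqP a k) => ka.
    rewrite (leq_trans ca ka); split; first exact: weyl_up.
    rewrite /up_simple (weyl_dom_gt0 hw hd) /= ?he //.
    by apply: (rise_gt0 hm hr); rewrite ka.
  case: (leqP c k) => ck //; split; first exact: weyl_up.
  by rewrite /up_simple; case: ifP => _ //=; rewrite he refl_fix // hc0 // ck.
move=> k kN; have h1 := hb _ kN; have [hw he] := ht _ (ltnW kN).
have [hw' _] := ht _ kN.
case: (leqP c k) => ck.
  rewrite (leqW ck) /=; case: (ltnP k.+1 b) => kb.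
    by rewrite (ltnW kb); apply: bruhat_up_mono.
  by case: ifP => // _; apply: rt_trans h1 (bruhat_up i hw).
rewrite /=; case: (ltnP k.+1 b) => kb; last by rewrite andbF.
rewrite andbT; case: (leqP c k.+1) => ck' //.
have e : c = k.+1 by apply/eqP; rewrite eqn_leq ck ck'.
case: hc1 => [h0|[k' ek hk']]; first by rewrite h0 in e.
move: ek hk'; rewrite e => -[<-] hk'.
have -> : tau k = up_simple i (tau k).
  rewrite /up_simple ltNge ltW //; apply: (weyl_dom_lt0 hw (pdir_dom (ltnW kN))).
  by rewrite he.
exact: bruhat_up_mono.
Qed.

(** Mirror image of [model_reflect_rise]: a stretch that reaches the minimal
    wall for the first time. *)
Lemma model_reflect_fall (a b : nat) s : model p s -> fall s a b ->
  (forall k, (b <= k <= N)%N -> height p i s b <= height p i s k) ->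
  model p (reflect_seg a b s).
Proof.
move=> hm hr hmin; have [hs hf [tau [ht hb]]] := hm.
have [/andP[ab bN] hia hbE _] := hr.
have hib : height p i s b \is a Num.int by rewrite hbE rpredB ?rpred1.
split; first by rewrite size_reflect_seg.
- move=> k kN t0; have h1 := hf k kN t0; rewrite !nth_reflect_seg.
  case: (ltnP k a) => ka.
    rewrite /=; case: (ltnP k.+1 b) => kb; last by rewrite andbF.
    rewrite andbT; case: (leqP a k.+1) => ka' //.
    have e : k.+1 = a by apply/eqP; rewrite eqn_leq ka ka'.
    apply: (tfold_trans h1); apply: tfold_simple.
      by rewrite -(height_int_iff hm) ?e // ltnW // -e.
    by rewrite ltW //; apply: (fall_lt0 hm hr); rewrite e leqnn.
  rewrite (leq_trans ka (leqnSn k)) /=; case: (ltnP k b) => kb; last first.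
    by rewrite ltnNge (leq_trans kb (leqnSn k)).
  have gk : pair (S i) (nth 0 s k) < 0 by apply: (fall_lt0 hm hr); rewrite ka.
  case: (ltnP k.+1 b) => kb'.
    apply: tfold_conj => //.
      by rewrite -(height_intS hm) ?(ltnW kN) // (fall_nonint hr) // kb' andbT.
    rewrite nmulr_rgt0 //; apply: (fall_lt0 hm hr).
    by rewrite kb' andbT (leq_trans ka).
  have e : k.+1 = b by apply/eqP; rewrite eqn_leq kb kb'.
  apply: tfold_lift_left => //; first by rewrite -(height_intS hm) ?(ltnW kN) // e.
  by rewrite e leNgt -(heightS_lt s) -?e // -leNgt e hmin // leqnSn /= -e.
have [c [bc cN hc0 hc1]] : exists c, [/\ (b <= c)%N, (c <= N)%N,
    forall k, (b <= k < c)%N -> pair (S i) (nth 0 s k) = 0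
  & (c < N)%N -> 0 < pair (S i) (nth 0 s c)].
  have [c [bc cN hc0 hc1]] : exists c, [/\ (b <= c)%N, (c <= N)%N,
      forall k, (b <= k < c)%N -> pair (S i) (nth 0 s k) = 0
    & (c < N)%N -> pair (S i) (nth 0 s c) != 0].
    have hP : exists c, (b <= c)%N && ((c == N) || (pair (S i) (nth 0 s c) != 0)).
      by exists N; rewrite bN eqxx.
    case: (ex_minnP hP) => c /andP[bc hc] hcm.
    have cN : (c <= N)%N by apply: hcm; rewrite bN eqxx.
    exists c; split=> //.
      move=> k /andP[bk kc]; apply/eqP; apply: contraT => hk.
      by have := hcm k; rewrite bk hk orbT leqNgt kc => /(_ isT).
    by rewrite ltn_neqAle => /andP[/negPf h1 _]; rewrite h1 in hc.
  exists c; split=> // cN'.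
  have hca : forall j, (b <= j <= c)%N -> height p i s j = height p i s b.
    elim=> [|j IH] hj; first by congr height; lia.
    move: hj.
    move=> /andP[]; rewrite leq_eqVlt => /orP[/eqP-> //|cj] ja.
    by rewrite heightS IH ?hc0 ?mulr0 ?addr0 //; lia.
  rewrite lt_neqAle eq_sym hc1 // leNgt -(heightS_lt s) // -leNgt hca ?bc ?leqnn //.
  by apply: hmin; rewrite cN' (leq_trans bc).
exists (fun k => if (a <= k < c)%N then down_simple i (tau k) else tau k); split.
  move=> k kN; have [hw he] := ht _ kN; rewrite nth_reflect_seg.
  have hd := pdir_dom kN.
  case: (leqP a k) => ka //=; case: (ltnP k b) => kb.
    rewrite (leq_trans kb bc); split; first exact: weyl_down.
    rewrite /down_simple (weyl_dom_lt0 hw hd) /= ?he //.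
    by apply: (fall_lt0 hm hr); rewrite ka.
  case: (ltnP k c) => ck //; split; first exact: weyl_down.
  by rewrite /down_simple; case: ifP => _ //=; rewrite he refl_fix // hc0 // ck kb.
move=> k kN; have h1 := hb _ kN; have [hw he] := ht _ (ltnW kN).
have [hw' he'] := ht _ kN.
case: (leqP a k) => ka.
  rewrite (leqW ka) /=; case: (ltnP k.+1 c) => kc.
    by rewrite (ltnW kc); apply: bruhat_down_mono.
  case: (ltnP k c) => kc' //.
  have e : k.+1 = c by apply/eqP; rewrite eqn_leq kc kc'.
  have -> : tau k.+1 = down_simple i (tau k.+1).
    rewrite /down_simple ltNge ltW //; apply: (weyl_dom_gt0 hw' (pdir_dom kN)).
    by rewrite he' e hc1 // -e.
  exact: bruhat_down_mono.
rewrite /=; case: ifP => // _.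
exact: rt_trans (bruhat_down i hw') h1.
Qed.

(** ** Root operators *)

Definition min_height s : R :=
  height p i s [arg min_(k < (ord0 : 'I_N.+1)) height p i s k]%O.

Lemma min_height_le s k : (k <= N)%N -> min_height s <= height p i s k.
Proof.
rewrite -ltnS => kN; rewrite /min_height; case: arg_minP => // m _ hm.
exact: (hm (Ordinal kN)).
Qed.

Lemma min_height_ex s : exists2 k, (k <= N)%N & height p i s k = min_height s.
Proof.
rewrite /min_height; case: arg_minP => // m _ _; exists m => //.
by rewrite -ltnS.
Qed.

Lemma min_heightE s q : (exists2 k, (k <= N)%N & height p i s k = q) ->
  (forall k, (k <= N)%N -> q <= height p i s k) -> min_height s = q.
Proof.
move=> [k kN hk] hq; apply/eqP; rewrite eq_le -{1}hk min_height_le //=.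
by have [j jN <-] := min_height_ex s; apply: hq.
Qed.

Lemma min_height_le0 s : min_height s <= 0.
Proof. by rewrite -(height0 p i s) min_height_le. Qed.

Lemma lt_int1 (x y : R) : x \is a Num.int -> y \is a Num.int -> x < y -> x + 1 <= y.
Proof.
move=> hx hy; rewrite -(floorK hx) -(floorK hy) ltr_int -lezD1 -(ler_int R).
by rewrite rmorphD.
Qed.

Lemma min_height_int s : model p s -> min_height s \is a Num.int.
Proof.
move=> hm; have hf := floor_le (min_height s).
rewrite le_eqVlt in hf; case/orP: hf => [/eqP <-|hf]; first exact: intr_int.
have h := @height_seg_min s hm 0 N (Num.floor (min_height s))%:~R.
have [k kN hk] := min_height_ex s.
have : (Num.floor (min_height s))%:~R + 1 <= height p i s k.
  apply: h; rewrite ?leqnn ?leq0n ?height0 ?rpred0 ?intr_int ?(height_end_int hm) //.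
  by move=> j /andP[_ jN]; apply: lt_le_trans hf (min_height_le s jN).
rewrite hk leNgt; have := floorD1_gt (min_height s); rewrite rmorphD /=.
by move=> ->.
Qed.

(** The root operators: they move the end point by a simple coroot, and they are partially
    inverse to each other. *)
Definition f_op s : seq A :=
  let a := last_index N (fun k => height p i s k == min_height s) in
  let b := first_index N (fun k => (a < k)%N && (min_height s + 1 <= height p i s k)) in
  reflect_seg a b s.

Definition e_op s : seq A :=
  let b := first_index N (fun k => height p i s k == min_height s) in
  let a := last_index N (fun k => (k < b)%N && (min_height s + 1 <= height p i s k)) in
  reflect_seg a b s.

Lemma f_opP s : model p s -> min_height s + 1 <= height p i s N ->
  exists a b : nat, [/\ rise s a b, height p i s a = min_height s,
    forall k, (a < k <= N)%N -> min_height s < height p i s k,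
    forall k, (b <= k <= N)%N -> min_height s + 1 <= height p i s k
    & f_op s = reflect_seg a b s].
Proof.
move=> hm hN; set q := min_height s in hN *.
have hq : q \is a Num.int by apply: min_height_int.
have [k0 k0N hk0] := min_height_ex s.
have [] := last_indexP (P := fun k => height p i s k == q) k0N; first by rewrite hk0.
set a := last_index _ _ => /andP[_ aN] /eqP ha hal.
have hgt k : (a < k <= N)%N -> q < height p i s k.
  move=> hk; rewrite lt_neqAle eq_sym hal //= min_height_le //.
  by case/andP: hk.
have aN' : (a < N)%N.
  by rewrite ltn_neqAle aN andbT; apply/eqP => e; move: hN; rewrite -e ha; lra.
have [] := first_indexP (P := fun k => (a < k)%N && (q + 1 <= height p i s k)) (leqnn N).
  by rewrite aN' hN.
set b := first_index _ _ => bN /andP[ab hb] hbl.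
have hlt k : (a < k < b)%N -> height p i s k < q + 1.
  by move=> /andP[h1 /hbl]; rewrite h1 /= -ltNge.
have hbE : height p i s b = q + 1.
  apply/eqP; rewrite eq_le hb andbT leNgt; apply/negP => hgt1.
  case: b ab hb hbl bN hlt hgt1 => // b ab hb hbl bN hlt hgt1.
  have := height_no_cross hm bN (rpredD hq (rpred1 _)).
  suff -> : height p i s b < q + 1 by rewrite hgt1.
  move: ab; rewrite ltnS leq_eqVlt => /orP[/eqP <-|ab]; first by rewrite ha ltrDl.
  by apply: hlt; rewrite ab /=.
exists a, b; split=> //.
- split=> //; [by rewrite ab | by rewrite ha | by rewrite hbE ha |].
  move=> k hk; rewrite ha hlt // andbT hgt //; lia.
- move=> k hk; apply: (height_seg_min hm (k0 := b) (k1 := N)) => //.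
  + by rewrite bN leqnn.
  + by rewrite hbE rpredD ?rpred1.
  + exact: height_end_int.
  + by move=> j hj; apply: hgt; lia.
Qed.

Lemma e_opP s : model p s -> min_height s + 1 <= 0 ->
  exists a b : nat, [/\ fall s a b, height p i s b = min_height s,
    forall k, (k < b)%N -> min_height s < height p i s k,
    forall k, (k <= a)%N -> min_height s + 1 <= height p i s k
    & e_op s = reflect_seg a b s].
Proof.
move=> hm h0; set q := min_height s in h0 *.
have hq : q \is a Num.int by apply: min_height_int.
have [k0 k0N hk0] := min_height_ex s.
have [] := first_indexP (P := fun k => height p i s k == q) k0N; first by rewrite hk0.
set b := first_index _ _ => bk0 /eqP hb hbl.
have bN : (b <= N)%N := leq_trans bk0 k0N.
have hgt k : (k < b)%N -> q < height p i s k.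
  move=> hk; rewrite lt_neqAle eq_sym hbl //= min_height_le //.
  by rewrite (leq_trans (ltnW hk)).
have b0 : (0 < b)%N.
  by rewrite lt0n; apply/eqP => e; move: h0; rewrite -hb e height0; lra.
have [] := last_indexP (P := fun k => (k < b)%N && (q + 1 <= height p i s k)) (leq0n N).
  by rewrite b0 height0.
set a := last_index _ _ => /andP[_ aN] /andP[ab ha] hal.
have hlt k : (a < k < b)%N -> height p i s k < q + 1.
  move=> /andP[h1 h2]; have := hal k; rewrite h1 h2 /= -ltNge; apply.
  by rewrite (leq_trans (ltnW h2)).
have haE : height p i s a = q + 1.
  apply/eqP; rewrite eq_le ha andbT leNgt; apply/negP => hgt1.
  have := height_no_cross hm (leq_trans ab bN) (rpredD hq (rpred1 _)).
  suff -> : height p i s a.+1 < q + 1 by rewrite hgt1 orbT.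
  move: ab; rewrite leq_eqVlt => /orP[/eqP ->|ab]; first by rewrite hb ltrDl.
  by apply: hlt; rewrite ab ltnSn.
exists a, b; split=> //.
- split=> //; [by rewrite ab | by rewrite haE rpredD ?rpred1 | by rewrite hb haE addrK |].
  move=> k hk; rewrite haE addrK hlt // andbT hgt //; lia.
- move=> k hk; apply: (height_seg_min hm (k0 := 0%N) (k1 := a)) => //.
  + by rewrite height0 rpred0.
  + by rewrite haE rpredD ?rpred1.
  + by move=> j hj; apply: hgt; lia.
Qed.

Lemma f_op_facts s : model p s -> min_height s + 1 <= height p i s N ->
  [/\ model p (f_op s), min_height (f_op s) = min_height s - 1,
      vert p (f_op s) N = vert p s N - coroot (S i) & e_op (f_op s) = s].
Proof.
move=> hm hN; have [a [b [hr ha hgt hge hf]]] := f_opP hm hN.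
have [/andP[ab bN] hia hb hbt] := hr.
have hm' : model p (f_op s).
  rewrite hf; apply: model_reflect_rise => // k ka; rewrite ha min_height_le //; lia.
have h1 k : (k <= a)%N -> height p i (f_op s) k = height p i s k.
  by move=> ka; rewrite hf height_reflect_low.
have h2 k : (a <= k <= b)%N -> height p i (f_op s) k = 2 * min_height s - height p i s k.
  by move=> hk; rewrite hf height_reflect_mid // ha.
have h3 k : (b <= k)%N -> height p i (f_op s) k = height p i s k - 2.
  by move=> hk; rewrite hf height_reflect_high ?hb ?(ltnW ab) //; lra.
have hq : min_height (f_op s) = min_height s - 1.
  apply: min_heightE => [|k kN].
    exists b => //; rewrite h2 ?leqnn ?(ltnW ab) // hb ha; lra.
  case: (leqP k a) => ka; first by rewrite h1 //; have := min_height_le s kN; lra.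
  case: (leqP k b) => kb.
    rewrite h2 ?kb ?(ltnW ka) //.
    move: kb; rewrite leq_eqVlt => /orP[/eqP->|kb]; first by rewrite hb ha; lra.
    by have := hbt k; rewrite ka kb => /(_ isT)/andP[_]; rewrite ha; lra.
  by rewrite h3 ?(ltnW kb) //; have := hge k; rewrite kN ltnW // => /(_ isT); lra.
split=> //.
  rewrite hf vert_reflect_high ?(ltnW ab) // hb [X in X *: _](_ : _ = 1) ?scale1r //.
  by rewrite addrAC subrr add0r.
rewrite /e_op hq.
have -> : first_index N (fun k => height p i (f_op s) k == min_height s - 1) = b.
  apply: first_indexE => //; first by rewrite h2 ?leqnn ?(ltnW ab) // hb ha; apply/eqP; lra.
  move=> j jb; apply/eqP; case: (leqP j a) => ja.
    rewrite h1 //; have := min_height_le s (k := j); rewrite (leq_trans (ltnW jb)) //.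
    by move=> /(_ isT); lra.
  rewrite h2 ?(ltnW ja) ?(ltnW jb) //; have := hbt j; rewrite ja jb => /(_ isT)/andP[].
  rewrite ha; lra.
have -> : last_index N (fun k => (k < b)%N &&
    (min_height s - 1 + 1 <= height p i (f_op s) k)) = a.
  rewrite subrK; apply: last_indexE; first by rewrite (leq_trans (ltnW ab)).
    by rewrite ab h1 // ha lexx.
  move=> j /andP[aj jN]; case: (ltnP j b) => //= jb; rewrite -ltNge.
  rewrite h2 ?(ltnW aj) ?(ltnW jb) //; have := hgt j; rewrite aj jN => /(_ isT); lra.
by rewrite hf reflect_segK.
Qed.

Lemma e_op_facts s : model p s -> min_height s + 1 <= 0 ->
  [/\ model p (e_op s), min_height (e_op s) = min_height s + 1,
      vert p (e_op s) N = vert p s N + coroot (S i) & f_op (e_op s) = s].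
Proof.
move=> hm h0; have [a [b [hr hb hgt hge hf]]] := e_opP hm h0.
have [/andP[ab bN] hia hb' hbt] := hr.
have ha : height p i s a = min_height s + 1 by rewrite -hb hb' subrK.
have hm' : model p (e_op s).
  by rewrite hf; apply: model_reflect_fall => // k /andP[_ kN]; rewrite hb min_height_le.
have h1 k : (k <= a)%N -> height p i (e_op s) k = height p i s k.
  by move=> ka; rewrite hf height_reflect_low.
have h2 k : (a <= k <= b)%N ->
    height p i (e_op s) k = 2 * min_height s + 2 - height p i s k.
  by move=> hk; rewrite hf height_reflect_mid // ha; lra.
have h3 k : (b <= k)%N -> height p i (e_op s) k = height p i s k + 2.
  by move=> hk; rewrite hf height_reflect_high ?hb' ?(ltnW ab) //; lra.
have hq : min_height (e_op s) = min_height s + 1.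
  apply: min_heightE => [|k kN].
    by exists a; rewrite ?h1 // (leq_trans (ltnW ab)).
  case: (leqP k a) => ka; first by rewrite h1 // hge.
  case: (leqP k b) => kb.
    rewrite h2 ?kb ?(ltnW ka) //.
    move: kb; rewrite leq_eqVlt => /orP[/eqP->|kb]; first by rewrite hb; lra.
    by have := hbt k; rewrite ka kb => /(_ isT)/andP[_]; rewrite ha; lra.
  by rewrite h3 ?(ltnW kb) //; have := min_height_le s kN; lra.
split=> //.
  rewrite hf vert_reflect_high ?(ltnW ab) // hb' addrAC subrr add0r scaleN1r opprK //.
rewrite /f_op hq.
have -> : last_index N (fun k => height p i (e_op s) k == min_height s + 1) = a.
  apply: last_indexE; first by rewrite (leq_trans (ltnW ab)).
    by rewrite h1 // ha.
  move=> j /andP[aj jN]; apply/eqP; case: (leqP j b) => jb.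
    rewrite h2 ?jb ?(ltnW aj) //.
    move: jb; rewrite leq_eqVlt => /orP[/eqP->|jb]; first by rewrite hb; lra.
    by have := hbt j; rewrite aj jb => /(_ isT)/andP[_]; rewrite ha; lra.
  by rewrite h3 ?(ltnW jb) //; have := min_height_le s jN; lra.
have -> : first_index N (fun k => (a < k)%N &&
    (min_height s + 1 + 1 <= height p i (e_op s) k)) = b.
  apply: first_indexE => //.
    by rewrite ab h2 ?leqnn ?(ltnW ab) // hb; lra.
  move=> j jb; case: (ltnP a j) => //= aj; rewrite -ltNge.
  by rewrite h2 ?(ltnW aj) ?(ltnW jb) //; have := hgt j jb; lra.
by rewrite hf reflect_segK.
Qed.

End Heights.

End Paths.

(** * The character of the folded paths *)

Section PathCharacter.
Implicit Types (a b : Phi D) (x y z : A).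
Local Notation r := (rho_v).
Implicit Types (u v : A -> A) (nu : A) (t : R).
Implicit Types (p : profile R n) (s : seq A).

Lemma bruhat_form u v y z : bruhat S u v -> Cplus S y -> Cplus S z ->
  form (v z) y <= form (u z) y.
Proof.
move=> h hy hz; elim: h => [u' v' /bruhat_stepP[w [b [hw pb hb ->]]]|//|x1 x2 x3 _ h1 _ h2].
  have wu : weyl D u' by rewrite hw; apply: word_weyl.
  have hge : 0 <= pair b (u' z).
    rewrite leNgt; apply/negP => /(weyl_dom_lt0 wu hz); lra.
  rewrite /= /refl formBl formZl; have := form_pos_ge0 pb hy; nra.
exact: le_trans h2 h1.
Qed.

Lemma weyl_form_le u y z : weyl D u -> Cplus S y -> Cplus S z ->
  form (u z) y <= form z y.
Proof.
move=> /weyl_word[w ->] hy hz; have [w' hd hle] := dominant_conj (word S w z).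
apply: le_trans (hle y hy) _; rewrite -word_cat in hd *.
by rewrite (dominant_unique hz hd).
Qed.

Lemma form_omega_inj x y : (forall i, form x (omega i) = form y (omega i)) -> x = y.
Proof.
move=> h; apply: form_inj => z.
have f0 x' : form x' 0 = 0 by rewrite -(scale0r (0 : A)) formZr mul0r.
have fs x' : form x' z = \sum_i pair (S i) z * form x' (omega i).
  rewrite {1}(omega_decomp z) (big_morph (form x') (fun x1 x2 => formDr x1 x2 x') (f0 x')).
  by apply: eq_bigr => i _; rewrite formZr.
by rewrite !fs; apply: eq_bigr => i _; rewrite h.
Qed.

(** The Bruhat-larger element moves a dominant point further down, so if it fixes
    the point then so does the smaller one. *)
Lemma bruhat_fix u v z : bruhat S u v -> weyl D u -> Cplus S z -> v z = z -> u z = z.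
Proof.
move=> huv hu hz hv; apply: form_omega_inj => i; apply: le_anti.
rewrite weyl_form_le //=; last exact: omega_dom.
by rewrite -{1}hv bruhat_form //; apply: omega_dom.
Qed.

Section Models.
Variable p : profile R n.
Hypothesis p_ok : profile_ok p.
Local Notation N := (psize p).
Local Notation end_of s := (vert p s N).

Lemma models_finite : exists L : seq (seq A), uniq L /\ forall s, s \in L <-> model p s.
Proof.
have [Ws [_ hWs]] := weyl_finite.
pose O k := [seq pdir p k *m M | M <- Ws].
have [L0 hL0] : exists L0 : seq (seq A), forall s, size s = N ->
    (forall k, (k < N)%N -> nth 0 s k \in O k) -> s \in L0.
  elim: N => [|m [L0 IH]]; first by exists [:: [::]] => s /size0nil ->; rewrite inE.
  exists [seq rcons s x | s <- L0, x <- O m] => s hs hO.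
  case: (lastP s) hs hO => // s' x; rewrite size_rcons => -[hs] hO.
  apply/allpairsP; exists (s', x); split => //=.
    apply: IH => // k km; have := hO k (ltnW km).
    by rewrite nth_rcons hs km.
  by have := hO m (ltnSn m); rewrite nth_rcons hs ltnn eqxx.
exists (undup [seq s <- L0 | `[< model p s >]]); split; first exact: undup_uniq.
move=> s; rewrite mem_undup mem_filter; split; first by case/andP => /asboolP.
move=> hm; apply/andP; split; first exact/asboolP.
apply: hL0 => [|k kN]; first by case: hm.
have [w ->] := model_orbit hm kN; apply/mapP; exists (wmx w).
  by apply/hWs; exists w.
by rewrite mul_wmx.
Qed.

Definition straight : seq A := mkseq (pdir p) N.

Lemma nth_straight k : (k < N)%N -> nth 0 straight k = pdir p k.
Proof. by move=> kN; rewrite nth_mkseq. Qed.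

Lemma model_straight : model p straight.
Proof.
split; first by rewrite size_mkseq.
  move=> k kN t0; rewrite !nth_straight // ?(ltnW kN) //.
  case: p_ok => _ _ _ ht _; have [[h1 _]|[_ _ -> _]] := ht _ (ltnW kN).
    by rewrite h1 eqxx in t0.
  by split=> //; apply: rt_refl.
exists (fun=> id); split=> [k kN|k _]; last exact: rt_refl.
by rewrite nth_straight //; split=> //; constructor.
Qed.

Lemma vert_straight_dom k : (k <= N)%N -> Cplus S (vert p straight k).
Proof.
move=> kN j; rewrite pair_sum; apply: sumr_ge0 => l _; rewrite pairZ.
have lN := leq_trans (ltn_ord l) kN.
rewrite nth_straight //; case: (p_ok) => _ hl _ _ _.
by rewrite mulr_ge0 ?(ltW (hl _ lN)) // pdir_dom.
Qed.

(** A path that stays in the dominant chamber is not folded at all: its sectors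
    fix the vertices reached so far. *)
Lemma model_dominant s : model p s ->
  (forall k, (k <= N)%N -> Cplus S (vert p s k)) -> s = straight.
Proof.
move=> hm hd; have [hs _ [tau [ht hb]]] := hm.
have key k : (k <= N)%N -> (forall l, (l < k)%N -> nth 0 s l = pdir p l) /\
    ((k < N)%N -> tau k (vert p s k) = vert p s k).
  elim: k => [_|k IH kN].
    split=> // h; have [/weyl_word[w ->] _] := ht _ h.
    by rewrite vert0 -(scale0r (0 : A)) wordZ !scale0r.
  have [h1 /(_ kN) h2] := IH (ltnW kN); have [hw he] := ht _ kN.
  have [w ew] := weyl_word hw.
  set z := vert p s k + plen p k *: pdir p k.
  have hz : Cplus S z.
    move=> j; rewrite pairD pairZ addr_ge0 ?hd ?(ltnW kN) //.
    case: p_ok => _ hl _ _ _; by rewrite mulr_ge0 ?(ltW (hl _ kN)) // pdir_dom.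
  have ez : vert p s k.+1 = word S w z by rewrite vertS -he -{1}h2 ew wordD wordZ.
  have e1 : word S w z = z by apply: dominant_unique => //; rewrite -ez; apply: hd.
  have e2 : nth 0 s k = pdir p k.
    move: ez; rewrite e1 vertS => /addrI /eqP; rewrite -subr_eq0 -scalerBr scaler_eq0.
    case: p_ok => _ hl _ _ _; have := hl _ kN; rewrite lt0r => /andP[/negPf -> _] /=.
    by rewrite subr_eq0 => /eqP.
  split; first by move=> l; rewrite ltnS leq_eqVlt => /orP[/eqP ->|/h1].
  move=> k1N; apply: (bruhat_fix (hb _ k1N)); [by case: (ht _ k1N)|exact: hd|].
  by rewrite ez e1 ew e1.
apply: (@eq_from_nth _ 0); rewrite ?size_mkseq // hs => k kN.
by have [h _] := key N (leqnn N); rewrite nth_straight // h.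
Qed.

(** ** The first exit from the dominant chamber *)

Definition exits s k := [exists j, height p j s k <= -1].
Definition exiting s := [exists k : 'I_N.+1, exits s k].
Definition exit_time s := first_index N (exits s).
Definition exit_root s := [pick j | height p j s (exit_time s) <= -1].

Lemma exit_timeP s : exiting s -> [/\ (exit_time s <= N)%N, exits s (exit_time s)
  & forall j k, (k < exit_time s)%N -> -1 < height p j s k].
Proof.
move=> /existsP[k hk]; have kN : (k <= N)%N by rewrite -ltnS.
have [h1 h2 h3] := first_indexP kN hk; split=> //; first exact: leq_trans h1 kN.
move=> j l /h3; rewrite negb_exists => /forallP/(_ j); by rewrite -ltNge.
Qed.

Lemma exit_stable s s' : exiting s ->
  (forall k, (k < exit_time s)%N -> nth 0 s' k = nth 0 s k) ->
  [/\ exiting s', exit_time s' = exit_time s & exit_root s' = exit_root s].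
Proof.
move=> hs hn; have [tN he hlt] := exit_timeP hs.
have hh j k : (k <= exit_time s)%N -> height p j s' k = height p j s k.
  move=> kt; congr (pair _ _); apply: eq_bigr => l _.
  by rewrite hn // (leq_trans (ltn_ord l)).
have he' : exits s' (exit_time s).
  by move: he => /existsP[j hj]; apply/existsP; exists j; rewrite hh.
have et : exit_time s' = exit_time s.
  apply: first_indexE => // k kt; rewrite negb_exists; apply/forallP => j.
  by rewrite hh ?(ltnW kt) // -ltNge hlt.
split=> //; last by rewrite /exit_root et; apply: eq_pick => j; rewrite hh.
have tN1 : (exit_time s < N.+1)%N by [].
by apply/existsP; exists (Ordinal tN1).
Qed.

Lemma not_exiting_dom s : model p s -> ~~ exiting s ->
  forall k, (k <= N)%N -> Cplus S (vert p s k).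
Proof.
move=> hm; rewrite negb_exists => /forallP hn k kN j.
have hmin : min_height p j s <= pair (S j) (vert p s k) by apply: min_height_le.
apply: le_trans hmin.
have [l lN hl] := min_height_ex p j s.
have lN1 : (l < N.+1)%N by [].
have := hn (Ordinal lN1); rewrite negb_exists => /forallP/(_ j); rewrite -ltNge /= hl.
move=> /(lt_int1 _ (min_height_int j p_ok hm)); rewrite rpredN rpred1 => /(_ isT).
by rewrite addNr.
Qed.

Lemma straight_not_exiting : ~~ exiting straight.
Proof.
rewrite negb_exists; apply/forallP => k; rewrite negb_exists; apply/forallP => j.
have kN : (k <= N)%N by rewrite -ltnS.
rewrite -ltNge; apply: lt_le_trans (vert_straight_dom kN j); lra.
Qed.

Lemma truncn_int (x : R) : x \is a Num.int -> 0 <= x -> (Num.truncn x)%:R = x.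
Proof. by move=> h1 h2; rewrite truncnK // natrEint h1. Qed.

Lemma truncn_eq (x : R) k : x = k%:R -> Num.truncn x = k.
Proof. by move=> ->; rewrite natrK. Qed.

Section Alternation.
Variables (L : seq (seq A)) (Ws : seq 'M[R]_n).
Hypothesis L_uniq : uniq L.
Hypothesis L_mem : forall s, s \in L <-> model p s.
Hypothesis Ws_uniq : uniq Ws.
Hypothesis Ws_mem : forall M, M \in Ws <-> exists w, M = wmx w.

Definition shifted_eps i s (d : R) := Num.truncn (- min_height p i s - d).
Definition phi i s := Num.truncn (height p i s N - min_height p i s).

(** With [d = 1] only the part of a string below its top is seen; this is the
    part whose weights are symmetric for the reflection shifted by [rho]. *)
Lemma string_class_sum (P : pred (seq A)) (d : R) i (V : zmodType) (F : A -> V) :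
  (d = 0 \/ d = 1) ->
  (forall s, s \in L -> P s -> min_height p i s + d <= 0) ->
  (forall s, s \in L -> P s -> min_height p i s + 1 <= height p i s N -> P (f_op p i s)) ->
  (forall s, s \in L -> P s -> min_height p i s + d + 1 <= 0 -> P (e_op p i s)) ->
  \sum_(s <- L | P s) F (end_of s + d *: r) =
  \sum_(s <- L | P s) F (refl (S i) (end_of s + d *: r)).
Proof.
move=> hd hP0 hPf hPe; rewrite -big_filter -[RHS]big_filter; set L' := filter P L.
have dint : d \is a Num.int by case: hd => ->; rewrite ?rpred0 ?rpred1.
have d0 : 0 <= d by case: hd => ->; rewrite ?ler01.
have facts s : s \in L' -> [/\ model p s, P s, s \in L,
    (shifted_eps i s d)%:R = - min_height p i s - d
  & (phi i s)%:R = height p i s N - min_height p i s].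
  rewrite mem_filter => /andP[Ps sL]; have hm : model p s by apply/L_mem.
  split=> //; apply: truncn_int.
  - by rewrite rpredB // rpredN (min_height_int i p_ok hm).
  - by have := hP0 _ sL Ps; lra.
  - by rewrite rpredB ?(min_height_int i p_ok hm) ?(height_end_int _ p_ok hm).
  - by rewrite subr_ge0 min_height_le.
apply: (@string_sum R n _ L' (f_op p i) (e_op p i) (fun s => shifted_eps i s d)
  (phi i) (fun s => end_of s + d *: r) (coroot (S i))).
- exact: filter_uniq.
- move=> s sL'; have [hm Ps sL he hp] := facts _ sL' => hpos.
  have h1 : min_height p i s + 1 <= height p i s N.
    by move: hpos; rewrite -(ler1n R) hp; lra.
  have [g1 g2 g3 g4] := f_op_facts p_ok hm h1.
  have fL : f_op p i s \in L' by rewrite mem_filter hPf //=; apply/L_mem.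
  have gh : height p i (f_op p i s) N = height p i s N - 2.
    by rewrite /height g3 pairB pair_coroot_diag.
  split=> //; last by rewrite g3 addrAC.
    by apply: truncn_eq; rewrite g2 -natr1 he; ring.
  apply: truncn_eq; rewrite g2 gh -subn1 natrB // hp; ring.
- move=> s sL'; have [hm Ps sL he hp] := facts _ sL' => hpos.
  have h1 : min_height p i s + d + 1 <= 0.
    by move: hpos; rewrite -(ler1n R) he; lra.
  have h2 : min_height p i s + 1 <= 0 by lra.
  have [g1 g2 g3 g4] := e_op_facts p_ok hm h2.
  have fL : e_op p i s \in L' by rewrite mem_filter hPe //=; apply/L_mem.
  have gh : height p i (e_op p i s) N = height p i s N + 2.
    by rewrite /height g3 pairD pair_coroot_diag.
  split=> //; last by rewrite g3 addrAC.
    apply: truncn_eq; rewrite g2 -subn1 natrB // he; ring.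
  by apply: truncn_eq; rewrite g2 gh -[(phi i s).+1%:R]natr1 hp; ring.
move=> s /facts[_ _ _ -> ->]; rewrite /refl pairD pairZ pairS_rho mulr1.
congr (_ - _ *: _); rewrite -/(height p i s N); ring.
Qed.

Definition sgn (M : 'M[R]_n) : int := (-1) ^+ nneg (r *m M).

Lemma sgn_wmx w : sgn (wmx w) = (-1) ^+ size w.
Proof. by rewrite /sgn mul_wmx -signr_odd nneg_word_odd signr_odd. Qed.

Lemma wmx_cat w w' : wmx (w ++ w') = wmx w' *m wmx w.
Proof.
by apply/row_matrixP => i; rewrite !rowE mulmxA !mul_wmx word_cat.
Qed.

Lemma wmx1 i : wmx [:: i] = refmx (S i).
Proof. by rewrite /= mul1mx. Qed.

Lemma sgn_refl_first i M : M \in Ws -> sgn (refmx (S i) *m M) = - sgn M.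
Proof.
by move=> /Ws_mem[w ->]; rewrite -wmx1 -wmx_cat !sgn_wmx size_cat addn1 exprS mulN1r.
Qed.

Lemma refmxK i : refmx (S i) *m refmx (S i) = 1%:M.
Proof.
apply/row_matrixP => j; rewrite !rowE mulmxA !mul_refmx reflK -rowE.
by rewrite rowE mulmx1.
Qed.

Lemma Ws_refl_first i : perm_eq [seq refmx (S i) *m M | M <- Ws] Ws.
Proof.
have inv : involutive (fun M => refmx (S i) *m M).
  by move=> m M; rewrite mulmxA refmxK mul1mx.
have hcl M : M \in Ws -> refmx (S i) *m M \in Ws.
  by move=> /Ws_mem[w ->]; apply/Ws_mem; exists (w ++ [:: i]); rewrite wmx_cat wmx1.
apply: uniq_perm => //; first by rewrite map_inj_uniq //; apply: inv_inj (inv n).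
move=> M; apply/mapP/idP => [[M' M'W ->]|MW]; first exact: hcl.
exists (refmx (S i) *m M); [exact: hcl | by rewrite inv].
Qed.

(** The coefficient of [e^y] in [sum_w sgn(w) e^{w z}]. *)
Definition alt_coef z y : int := \sum_(M <- Ws) sgn M * (z *m M == y)%:R.

Lemma alt_coef_refl i z y : alt_coef (refl (S i) z) y = - alt_coef z y.
Proof.
rewrite /alt_coef -(perm_big _ (Ws_refl_first i)) big_map /= -sumrN.
rewrite big_seq [RHS]big_seq; apply: eq_bigr => M MW.
by rewrite sgn_refl_first // mulNr mulmxA mul_refmx reflK.
Qed.

(** Group the paths by the time and the root of their first exit.  Root operators act
    after that time only, so they preserve each group, and reversing strings makes its
    contribution equal to its opposite. *)
Lemma alt_coef_exiting y :
  \sum_(s <- L | exiting s) alt_coef (end_of s + r) y = 0.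
Proof.
rewrite (partition_big (fun s => (inord (exit_time s) : 'I_N.+1, exit_root s)) predT) //=.
apply: big1 => -[k oj] _; case: oj => [i|]; last first.
  rewrite big_seq_cond big1 // => s /and3P[sL hs /eqP[_ hj]].
  have [_ /existsP[j0 hj0] _] := exit_timeP hs; move: hj; rewrite /exit_root.
  by case: pickP => // /(_ j0); rewrite hj0.
pose P s := exiting s &&
  ((inord (exit_time s) : 'I_N.+1, exit_root s) == (k, Some i)).
change (\sum_(s <- L | P s) alt_coef (end_of s + r) y = 0).
have PE s : P s -> [/\ exiting s, exit_time s = k & exit_root s = Some i].
  move=> /andP[hs /eqP[<- hj]]; split=> //; rewrite inordK // ltnS.
  by case: (exit_timeP hs).
have hmin s : P s -> [/\ (k <= N)%N, height p i s k <= -1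
    & forall l, (l < k)%N -> -1 < height p i s l].
  move=> /PE[hs ek hj]; have [h1 _ h3] := exit_timeP hs.
  split; [by rewrite -ltnS | | by move=> l; rewrite -ek; apply: h3].
  by move: hj; rewrite /exit_root ek; case: pickP => // j hj [<-].
have hstab s s' : P s -> (forall l, (l < k)%N -> nth 0 s' l = nth 0 s l) -> P s'.
  move=> hs hn; have [h1 h2 h3] := PE _ hs.
  have [|g1 g2 g3] := exit_stable h1 (s' := s'); first by rewrite h2.
  rewrite /P g1 g2 g3; by case/andP: hs => _ ->.
have := @string_class_sum P 1 i int (fun z => alt_coef z y) (or_intror erefl).
have -> : \sum_(s <- L | P s) alt_coef (refl (S i) (end_of s + 1 *: r)) y =
    - \sum_(s <- L | P s) alt_coef (end_of s + 1 *: r) y.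
  by rewrite -sumrN; apply: eq_bigr => s _; rewrite alt_coef_refl.
rewrite scale1r => h.
have {}h : \sum_(s <- L | P s) alt_coef (end_of s + r) y =
    - \sum_(s <- L | P s) alt_coef (end_of s + r) y.
  apply: h.
  - move=> s _ /hmin[kN hk _]; have := min_height_le i s kN; lra.
  - move=> s /L_mem hm hs h1; have [kN hk hlt] := hmin _ hs.
    have [a [b [hr ha hgt hge ->]]] := f_opP p_ok hm h1.
    apply: (hstab _ _ hs) => l lk; rewrite nth_reflect_seg.
    suff : (k <= a)%N by move=> ka; rewrite (_ : (a <= l < b)%N = false) //; lia.
    rewrite leqNgt; apply/negP => /hlt; rewrite ha.
    by have := min_height_le i s kN; lra.
  move=> s /L_mem hm hs h1; have [kN hk hlt] := hmin _ hs.
  have h2 : min_height p i s + 1 <= 0 by lra.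
  have [a [b [hr hb hgt hge ->]]] := e_opP p_ok hm h2.
  apply: (hstab _ _ hs) => l lk; rewrite nth_reflect_seg.
  suff : (k <= a)%N by move=> ka; rewrite (_ : (a <= l < b)%N = false) //; lia.
  have [_ _ hb' _] := hr.
  by rewrite leqNgt; apply/negP => /hlt; lra.
lia.
Qed.

Lemma alt_coef_sum y :
  \sum_(s <- L) alt_coef (end_of s + r) y = alt_coef (end_of straight + r) y.
Proof.
rewrite (bigID exiting) /= alt_coef_exiting add0r.
have sL : straight \in L by apply/L_mem/model_straight.
rewrite big_mkcond (bigD1_seq straight) //= straight_not_exiting.
rewrite big_seq_cond big1 ?addr0 // => s /andP[/L_mem hm /eqP ne].
case: ifP => // hs; case: ne.
by apply: model_dominant => // k kN; apply: not_exiting_dom.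
Qed.

Definition end_mult z : int := \sum_(s <- L) (end_of s == z)%:R.

Lemma end_mult_refl i z : end_mult (refl (S i) z) = end_mult z.
Proof.
have h := @string_class_sum predT 0 i int (fun x => (x == z)%:R) (or_introl erefl).
have e0 s : end_of s + 0 *: r = end_of s by rewrite scale0r addr0.
transitivity (\sum_(s <- L) (refl (S i) (end_of s + 0 *: r) == z)%:R : int).
  by apply: eq_bigr => s _; rewrite e0 (inv_eq (reflK (S i))).
rewrite -h //; first by apply: eq_bigr => s _; rewrite e0.
by move=> s _ _; rewrite addr0; apply: min_height_le0.
Qed.

Lemma end_mult_word w z : end_mult (word S w z) = end_mult z.
Proof. by elim: w => // i w IH; rewrite word_cons end_mult_refl. Qed.

(** Summed over all paths [s], the alternating sums of [end s + rho] reduce to that of the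
    straight path: the paths leaving the dominant chamber cancel, and those that stay in
    it are not folded.  Invariance of the endpoint multiplicities under the Weyl group
    turns this into the product with the denominator. *)
Theorem path_character y :
  \sum_(M <- Ws) sgn M * end_mult (y - r *m M) = alt_coef (end_of straight + r) y.
Proof.
rewrite -alt_coef_sum /alt_coef exchange_big /= big_seq [RHS]big_seq.
apply: eq_bigr => M /Ws_mem[w ->]; rewrite -mulr_sumr; congr (_ * _).
rewrite -(end_mult_word (rev w)) /end_mult; apply: eq_bigr => s _.
rewrite !mul_wmx wordD -(scaleN1r (word S w r)) wordZ word_revK scaleN1r.
rewrite eq_sym subr_eq eq_sym; congr (nat_of_bool _)%:R.
by apply/eqP/eqP => [->|<-]; rewrite ?word_revKV ?word_revK.
Qed.

End Alternation.
End Models.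

End PathCharacter.

(** * Faces, affine Weyl group and alcoves *)

Section Faces.
Implicit Types (a b : Phi D) (x y z : A).
Local Notation r := (rho_v).
Implicit Types (f g : A -> A).

Lemma closed_face_trans x y z : closed_face D x y -> closed_face D y z -> closed_face D x z.
Proof. by move=> h1 h2 a k; have [] := h1 a k; have [] := h2 a k; auto. Qed.

Lemma closed_face_eq x y : closed_face D x y -> closed_face D y x ->
  closed_face D x = closed_face D y.
Proof.
move=> h1 h2; apply/seteqP; split=> z; exact: closed_face_trans.
Qed.

Lemma closed_face_convex x y z t : 0 <= t <= 1 -> closed_face D x y ->
  closed_face D x z -> closed_face D x (y + t *: (z - y)).
Proof.
move=> /andP[t0 t1] h1 h2 a k; have [p1 n1] := h1 a k; have [p2 n2] := h2 a k.
rewrite /halfpos /halfneg /= in p1 n1 p2 n2 *.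
rewrite pairD pairZ pairB; split=> h; [have := p1 h; have := p2 h|have := n1 h; have := n2 h]; nra.
Qed.

Lemma vertexP v : is_vertex D v <-> forall y, closed_face D v y -> y = v.
Proof.
split=> [[x hx] y hy|h].
  have hxv : x = v.
    have : closed_face D x x by [].
    by rewrite -hx.
  by rewrite -hxv -hx in hy.
by exists v; apply/seteqP; split=> y /=; [move=> ->|apply: h].
Qed.

(** Points of one closed face lie weakly on the same side of each wall, so a wall through an
    interior point of a segment contains both of its ends. *)
Lemma closed_face_open x y z t a k : closed_face D x y -> closed_face D x z ->
  0 < t < 1 -> pair a (y + t *: (z - y)) + k%:~R = 0 ->
  pair a y + k%:~R = 0 /\ pair a z + k%:~R = 0.
Proof.
move=> h1 h2 /andP[t0 t1]; have [p1 n1] := h1 a k; have [p2 n2] := h2 a k.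
rewrite /halfpos /halfneg /= in p1 n1 p2 n2.
rewrite pairD pairZ pairB.
case: (lerP 0 (pair a x + k%:~R)) => hx.
  have := p1 hx; have := p2 hx; move=> g1 g2 e; split; nra.
have := n1 (ltW hx); have := n2 (ltW hx); move=> g1 g2 e; split; nra.
Qed.

Lemma edge_line E v w : is_edge D E -> E v -> E w -> v != w ->
  forall y, E y -> exists t, y = v + t *: (w - v).
Proof.
move=> [_ [U [dU hU _]]] Ev Ew vw y Ey.
have hvw : w - v != 0 by rewrite subr_eq0 eq_sym.
have eU : U = <[w - v]>%VS.
  apply/esym/eqP; rewrite eqEdim -memvE hU //= dim_vline hvw dU //.
have := hU y v Ey Ev; rewrite eU => /vlineP[t ht]; exists t.
by rewrite -ht addrC subrK.
Qed.

Lemma aff_dim1 (E : set A) v w : E v -> E w -> v != w ->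
  (forall y, E y -> exists t, y = v + t *: (w - v)) -> aff_dim E 1.
Proof.
move=> Ev Ew vw hl; exists <[w - v]>%VS; split.
- by rewrite dim_vline subr_eq0 eq_sym vw.
- move=> x y /hl[t ->] /hl[t' ->]; apply/vlineP; exists (t - t').
  by rewrite scalerBl opprD addrACA subrr add0r.
- by move=> U' hU'; rewrite -memvE; apply: hU'.
Qed.

Definition mid v w : A := v + 2^-1 *: (w - v).

Lemma edge_mid E v w : is_edge D E -> E v -> E w -> v != w ->
  E = closed_face D (mid v w).
Proof.
move=> hE Ev Ew vw; have hl := edge_line hE Ev Ew vw.
have [[x ex] _] := hE.
have hv : closed_face D x v by rewrite -ex.
have hw : closed_face D x w by rewrite -ex.
have hm : closed_face D x (mid v w).
  by apply: closed_face_convex => //; rewrite invr_ge0 ler0n invf_le1 ?ltr0n // ler1n.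
have half : 0 < (2^-1 : R) < 1 by rewrite invr_gt0 ltr0n invf_lt1 ?ltr0n // ltr1n.
have [t ht] : exists t, x = v + t *: (w - v) by apply: hl; rewrite ex.
rewrite ex; apply: closed_face_eq => // a k.
have [p1 n1] := hm a k; rewrite /halfpos /halfneg /= in p1 n1 *.
have z0 : pair a (mid v w) + k%:~R = 0 -> pair a x + k%:~R = 0.
  move=> /(closed_face_open hv hw half)[g1 g2].
  rewrite ht pairD pairZ pairB; have -> : pair a w - pair a v = 0 by lra.
  by rewrite mulr0 addr0.
split=> h.
  rewrite leNgt; apply/negP => h1; have := n1 (ltW h1) => h2.
  have /z0 : pair a (mid v w) + k%:~R = 0 by lra.
  lra.
rewrite leNgt; apply/negP => h1; have := p1 (ltW h1) => h2.
have /z0 : pair a (mid v w) + k%:~R = 0 by lra.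
lra.
Qed.

(** If the line of the edge continued beyond the vertex [v] inside the edge, the point [y]
    past [v] would satisfy all the conditions that define the face of [v]. *)
Lemma edge_ray E v w y : is_edge D E -> is_vertex D v -> E v -> E w -> v != w -> E y ->
  exists2 t, 0 <= t & y = v + t *: (w - v).
Proof.
move=> hE /vertexP hv Ev Ew vw Ey; have [t ht] := edge_line hE Ev Ew vw Ey.
exists t => //; rewrite leNgt; apply/negP => t0.
have [[x ex] _] := hE; rewrite ex in Ev Ew Ey.
have yv : y != v.
  rewrite ht addrC -subr_eq0 addrK scaler_eq0 subr_eq0 [w == v]eq_sym (negPf vw) orbF.
  by rewrite lt_eqF.
move/eqP: yv; apply; apply: hv => a k.
have [p1 n1] := Ev a k; have [p2 n2] := Ew a k; have [p3 n3] := Ey a k.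
rewrite /halfpos /halfneg /= in p1 n1 p2 n2 p3 n3 *.
have e : pair a y + k%:~R = (1 - t) * (pair a v + k%:~R) + t * (pair a w + k%:~R).
  rewrite ht pairD pairZ pairB; ring.
case: (lerP 0 (pair a x + k%:~R)) => hx.
  have g1 := p1 hx; have g2 := p2 hx; have g3 := p3 hx.
  split=> h //; nra.
have g1 := n1 (ltW hx); have g2 := n2 (ltW hx); have g3 := n3 (ltW hx).
split=> h //; nra.
Qed.

Lemma vertex0 : is_vertex D (0 : A).
Proof.
apply/vertexP => y hy; apply: pairS_inj => i; rewrite pair0.
have [] := hy (S i) 0; rewrite /halfpos /halfneg /= pair0 !addr0 lexx => h1 h2.
by apply/eqP; rewrite eq_le h1 // h2.
Qed.

(** ** Affine maps that permute the walls *)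

(** The affine Weyl group need not contain the translations by special vertices that the
    concatenation of galleries uses, but these too permute the walls. *)
Definition wall_aut f := exists w q,
  (forall b : Phi D, pair b q \is a Num.int) /\ forall x, f x = word S w x + q.

Lemma wall_aut_pull f a : wall_aut f ->
  exists b (j : int), forall x, pair a (f x) = pair b x + j%:~R.
Proof.
move=> [w [q [hq hf]]]; have [b hb] := word_root w a.
exists b, (Num.floor (pair a q)) => x; by rewrite hf pairD -hb floorK.
Qed.

Lemma wall_aut_inv f : wall_aut f ->
  exists f', [/\ wall_aut f', cancel f f' & cancel f' f].
Proof.
move=> [w [q [hq hf]]]; exists (fun x => word S (rev w) x + - word S (rev w) q); split.
- exists (rev w), (- word S (rev w) q); split=> // b.
  by rewrite pairN rpredN; have [c <-] := word_root (rev w) b.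
- by move=> x; rewrite hf wordD addrK word_revK.
- move=> x; rewrite hf wordD word_revKV -(scaleN1r (word _ _ q)) wordZ word_revKV.
  by rewrite scaleN1r subrK.
Qed.

Lemma closed_face_aut f x y : wall_aut f -> closed_face D x y -> closed_face D (f x) (f y).
Proof.
move=> hf h a k; have [b [j hb]] := wall_aut_pull a hf.
have [h1 h2] := h b (j + k).
by rewrite /halfpos /halfneg /= !hb -!addrA -!intrD.
Qed.

Lemma closed_face_aut_iff f x y : wall_aut f ->
  closed_face D (f x) (f y) <-> closed_face D x y.
Proof.
move=> hf; split; last exact: closed_face_aut.
have [f' [hf' fK _]] := wall_aut_inv hf.
by move=> /(closed_face_aut hf'); rewrite !fK.
Qed.

Lemma aut_face f x : wall_aut f -> f @` closed_face D x = closed_face D (f x).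
Proof.
move=> hf; have [f' [hf' fK f'K]] := wall_aut_inv hf.
apply/seteqP; split=> y; first by move=> [z hz <-]; apply: closed_face_aut.
by move=> hy; exists (f' y); rewrite ?f'K //; apply/(closed_face_aut_iff _ _ hf); rewrite f'K.
Qed.

Lemma aut_vertex f v : wall_aut f -> is_vertex D v -> is_vertex D (f v).
Proof.
move=> hf /vertexP hv; have [f' [hf' fK f'K]] := wall_aut_inv hf.
apply/vertexP => y hy; rewrite -(f'K y); congr f; apply: hv.
by apply/(closed_face_aut_iff _ _ hf); rewrite f'K.
Qed.

Lemma aut_line f v w t : wall_aut f -> f (v + t *: (w - v)) = f v + t *: (f w - f v).
Proof.
move=> [u [q [_ hf]]]; rewrite !hf wordD wordZ -(scaleN1r v) wordD wordZ scaleN1r.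
by apply/rowP => j; rewrite !mxE; ring.
Qed.

Lemma aut_mid f v w : wall_aut f -> f (mid v w) = mid (f v) (f w).
Proof. exact: aut_line. Qed.

Lemma aut_edge f v w : wall_aut f -> v != w ->
  is_edge D (closed_face D (mid v w)) -> closed_face D (mid v w) v ->
  closed_face D (mid v w) w -> is_edge D (closed_face D (mid (f v) (f w))).
Proof.
move=> hf vw hE Ev Ew; have [f' [hf' fK f'K]] := wall_aut_inv hf.
split; first by exists (mid (f v) (f w)).
apply: (aff_dim1 (v := f v) (w := f w)).
- by rewrite -aut_mid //; apply: closed_face_aut.
- by rewrite -aut_mid //; apply: closed_face_aut.
- by rewrite (can_eq fK).
move=> y; rewrite -aut_mid // -(f'K y) closed_face_aut_iff // => hy.
have [t ht] := edge_line hE Ev Ew vw hy; exists t.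
by rewrite {1}ht aut_line.
Qed.

(** ** The affine Weyl group *)

Lemma affine_weyl_word g : affine_weyl D g ->
  exists w (l : seq (Phi D)), forall x, g x = word S w x + \sum_(a <- l) coroot a.
Proof.
elim=> [|a k w _ [u [l h]]]; first by exists [::], [::] => x; rewrite big_nil addr0.
have [v hv] := refl_word a.
have hk : exists l' : seq (Phi D), - k%:~R *: coroot a = \sum_(b <- l') coroot b :> A.
  have hn m (b : Phi D) : m%:R *: coroot b = \sum_(c <- nseq m b) coroot c :> A.
    by rewrite big_nseq -Monoid.iteropE /= scaler_nat; elim: m => //= m IH;
       rewrite mulrS IH.
  case: k => m; first by exists (nseq m (opp_root a)); rewrite -hn coroot_opp scalerN scaleNr.
  by exists (nseq m.+1 a); rewrite -hn NegzE rmorphN opprK.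
have [l' hl'] := hk.
exists (v ++ u), ([seq root_refl a b | b <- l] ++ l') => x.
rewrite /arefl /= h big_cat big_map -hl' /= word_cat -hv addrA.
have -> : \sum_(j <- l) coroot (root_refl a j) = refl a (\sum_(j <- l) coroot j) :> A.
  by rewrite refl_sum; apply: eq_bigr => b _; rewrite coroot_root_refl.
by rewrite -reflD {1}/refl scalerDl opprD addrA scaleNr.
Qed.

Lemma affine_weyl_word_l w g : affine_weyl D g -> affine_weyl D (word S w \o g).
Proof. by move=> hg; elim: w => //= i w IH; constructor. Qed.

Lemma affine_weyl_comp f g : affine_weyl D f -> affine_weyl D g -> affine_weyl D (f \o g).
Proof. by move=> hf hg; elim: hf => //= a k w _ IH; constructor. Qed.

Lemma affine_weyl_transl a g : affine_weyl D g ->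
  affine_weyl D (fun x => g x + coroot a).
Proof.
move=> hg; have -> : (fun x => g x + coroot a) = arefl a (-1) \o (arefl a 0 \o g).
  apply/funext => x; rewrite /= arefl0 /arefl pair_refl.
  rewrite -[map_mx _ _]/(coroot a : A) rmorphN1 /refl.
  by apply/rowP => j; rewrite !mxE; ring.
by do 2!constructor.
Qed.

Lemma affine_weylI w (l : seq (Phi D)) :
  affine_weyl D (fun x => word S w x + \sum_(a <- l) coroot a).
Proof.
elim: l => [|a l IH].
  have -> : (fun x => word S w x + \sum_(a <- [::] : seq (Phi D)) coroot a) = word S w \o id.
    by apply/funext => x; rewrite big_nil addr0.
  by apply: affine_weyl_word_l; constructor.
have -> : (fun x => word S w x + \sum_(b <- a :: l) coroot b) =
    (fun x => (word S w x + \sum_(b <- l) coroot b) + coroot a).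
  by apply/funext => x; rewrite big_cons addrCA addrC.
exact: affine_weyl_transl.
Qed.

Lemma pair_coroots_int b (l : seq (Phi D)) :
  pair b (\sum_(a <- l) coroot a : A) \is a Num.int.
Proof. by rewrite pair_sum rpred_sum // => a _; rewrite pair_coroot intr_int. Qed.

Lemma affine_weyl_aut g : affine_weyl D g -> wall_aut g.
Proof.
move=> /affine_weyl_word[w [l h]]; exists w, (\sum_(a <- l) coroot a); split=> // b.
exact: pair_coroots_int.
Qed.

Lemma word_coroots w (l : seq (Phi D)) : exists l' : seq (Phi D),
  word S w (\sum_(a <- l) coroot a) = \sum_(a <- l') coroot a :> A.
Proof.
elim: w => [|i w [l' IH]]; first by exists l.
exists [seq root_refl (S i) a | a <- l']; rewrite word_cons IH big_map refl_sum.
by apply: eq_bigr => a _; rewrite coroot_root_refl.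
Qed.

Lemma affine_weyl_inv g : affine_weyl D g ->
  exists g', [/\ affine_weyl D g', cancel g g' & cancel g' g].
Proof.
move=> /affine_weyl_word[w [l h]].
have [l' hl'] := word_coroots (rev w) [seq opp_root a | a <- l].
have e : word S (rev w) (- \sum_(a <- l) coroot a) = \sum_(a <- l') coroot a :> A.
  by rewrite -hl' big_map -sumrN; congr word; apply: eq_bigr => a _; rewrite coroot_opp.
exists (fun x => word S (rev w) x + \sum_(a <- l') coroot a); split.
- exact: affine_weylI.
- by move=> x; rewrite h -e -wordD addrK word_revK.
- by move=> x; rewrite h -e -wordD word_revKV subrK.
Qed.

(** ** Folding into the fundamental alcove *)

Lemma fin_lower_bound (P : Phi D -> R -> Prop) :
  (forall a d d', P a d -> d' <= d -> P a d') ->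
  (forall a, exists2 d, 0 < d & P a d) -> exists2 d, 0 < d & forall a, P a d.
Proof.
move=> hP hex; have hex' a : exists d, 0 < d /\ P a d.
  by have [d h1 h2] := hex a; exists d.
have [d0 hd] := choice hex'.
exists (\big[Num.min/1]_a d0 a).
  by apply: lt_bigmin => // a _; case: (hd a).
by move=> a; have [_ h] := hd a; apply: (hP _ _ _ h); apply: bigmin_le_id || apply: bigmin_le.
Qed.

(** For each root the values at [x] on the walls form a translate of the integers. *)
Lemma wall_gap x : exists2 d, 0 < d & forall a (k : int),
  pair a x + k%:~R != 0 -> d <= `|pair a x + k%:~R|.
Proof.
apply: (fin_lower_bound (P := fun a d => forall k : int, pair a x + k%:~R != 0 ->
  d <= `|pair a x + k%:~R|)) => [a d d' h hd k /h|a]; first exact: le_trans.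
set y := pair a x; set m := Num.floor y.
have [h1 h2] : m%:~R <= y /\ y < m%:~R + 1.
  by rewrite Num.Theory.floor_le -(intrD _ _ 1) Num.Theory.floorD1_gt.
have [e|ne] := eqVneq y m%:~R.
  exists 1 => // k; rewrite e -intrD intr_eq0 -intr_norm ler1z => h3; lia.
have h3 : m%:~R < y by rewrite lt_def ne.
exists (Num.min (y - m%:~R) (m%:~R + 1 - y)); first by rewrite lt_min; lra.
move=> k _; case: (lerP m (- k)) => hk.
  case: (eqVneq m (- k)) => [e|ne'].
    rewrite ge_min; have -> : k = - m by rewrite e opprK.
    by rewrite rmorphN /= ger0_norm ?lexx //; lra.
  have h4 : (m + 1)%:~R <= (- k)%:~R :> R by rewrite ler_int lezD1 lt_def eq_sym ne'.
  rewrite rmorphD rmorphN /= in h4.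
  by rewrite ltr0_norm ?ge_min; [apply/orP; right; lra | lra].
have h4 : (1 - k)%:~R <= m%:~R :> R by rewrite ler_int; lia.
rewrite rmorphB /= in h4.
by rewrite gtr0_norm ?ge_min; [apply/orP; left; lra | lra].
Qed.

Lemma rho_bound : exists2 e, 0 < e & forall a, pos a -> e * pair a r < 1.
Proof.
apply: (fin_lower_bound (P := fun a d => pos a -> d * pair a r < 1)).
  move=> a d d' h hd pa; have := h pa; have := pos_rho_gt0 pa; nra.
move=> a; case: (boolP (pos a)) => pa; last by exists 1.
have h0 := pos_rho_gt0 pa.
exists ((pair a r + 1)^-1); first by rewrite invr_gt0; lra.
by move=> _; rewrite mulrC ltr_pdivrMr; lra.
Qed.

Section Alcove.
Variable e0 : R.
Hypothesis e0_gt0 : 0 < e0.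
Hypothesis e0_lt1 : forall a, pos a -> e0 * pair a r < 1.
Local Notation p0 := (e0 *: r).

Lemma pair_p0 a : pos a -> 0 < pair a p0 < 1.
Proof. by move=> pa; rewrite pairZ e0_lt1 // mulr_gt0 // pos_rho_gt0. Qed.

Lemma pair_p0_neq0 a (k : int) : pair a p0 + k%:~R != 0.
Proof.
apply/eqP => h.
have {}h : pair a p0 = (- k)%:~R by rewrite rmorphN /=; lra.
case: (pos_or_opp a) => /pair_p0/andP[]; rewrite ?pair_opp h -?rmorphN /=.
  rewrite ltr0z (ltrz1 R); lia.
rewrite ltr0z (ltrz1 R); lia.
Qed.

(** The added term is negative when the wall separates [y] from [p0]; this makes folding
    towards [p0] terminate. *)
Lemma arefl_dist a (k : int) y :
  form (arefl a k y - p0) (arefl a k y - p0) = form (y - p0) (y - p0)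
   + form (coroot a) (coroot a) * ((pair a y + k%:~R) * (pair a p0 + k%:~R)).
Proof.
set c := pair a y + k%:~R.
have -> : arefl a k y - p0 = (y - p0) - c *: coroot a by rewrite /arefl addrAC.
have hu (u v : A) : form (u - c *: v) (u - c *: v) =
    form u u - 2 * c * form v u + c ^+ 2 * form v v.
  rewrite formBl !formBr !formZl !formZr [form u v]formC; ring.
rewrite hu; have h := form_coroot a (y - p0); rewrite pairB in h.
have -> : form (coroot a) (y - p0) =
    form (coroot a) (coroot a) * (pair a y - pair a p0) / 2 by lra.
by rewrite /c; field.
Qed.

(** Each folding decreases the square distance to [p0] by at least the fixed amount [eta],
    since the walls keep a positive distance from [x] and from [p0].  The invariant [P]
    keeps track of what the reflections preserve. *)
Lemma fold_to_alcove x (P : (A -> A) -> Prop) g0 :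
  affine_weyl D g0 -> P g0 ->
  (forall g a (k : int), affine_weyl D g -> P g ->
     (pair a (g x) + k%:~R) * (pair a p0 + k%:~R) < 0 ->
     (k = 0 /\ pos a) \/ (k = -1 /\ pos a) -> P (arefl a k \o g)) ->
  exists g, [/\ affine_weyl D g, P g & fund_alcove S (g x)].
Proof.
move=> hg0 Pg0 hstep.
have [d d_gt0 hd] := wall_gap x; have [d' d'_gt0 hd'] := wall_gap p0.
have [m m_gt0 hm] : exists2 m : R, 0 < m & forall a, m <= form (coroot a) (coroot a).
  apply: (fin_lower_bound (P := fun a (m : R) => m <= form (coroot a) (coroot a))).
    by move=> a x1 x2 h1 h2; apply: le_trans h1.
  by move=> a; exists (form (coroot a) (coroot a)); rewrite ?form_coroot_gt0.
set eta := m * (d * d'); have eta_gt0 : 0 < eta by rewrite !mulr_gt0.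
have [K hK] : exists K : nat, form (g0 x - p0) (g0 x - p0) < K%:R * eta.
  exists (Num.bound (form (g0 x - p0) (g0 x - p0) / eta)).
  rewrite -ltr_pdivrMr //; apply: archi_boundP.
  by rewrite divr_ge0 ?form_ge0 // ltW.
elim: K g0 hg0 Pg0 hK => [|K IH] g0 hg0 Pg0 hK.
  by have := form_ge0 (D := D) (g0 x - p0); rewrite mul0r in hK; lra.
case: (pselect (fund_alcove S (g0 x))) => hin; first by exists g0.
have [a [k [hneg hk]]] : exists a (k : int),
    (pair a (g0 x) + k%:~R) * (pair a p0 + k%:~R) < 0 /\
    ((k = 0 /\ pos a) \/ (k = -1 /\ pos a)).
  case: (pselect (exists2 a, pos a & ~ (0 <= pair a (g0 x) <= 1))); last first.
    move=> hn; case: hin => a pa; apply: contrapT => h; apply: hn; by exists a.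
  move=> [a pa /negP]; rewrite negb_and -!ltNge => /orP[] h; exists a.
    exists 0; split; last by left.
    by have /andP[] := pair_p0 pa; rewrite !addr0; nra.
  exists (-1); split; last by right.
  by have /andP[] := pair_p0 pa; rewrite rmorphN1; nra.
apply: (IH (arefl a k \o g0)); [by constructor|exact: hstep|].
have [b [j hb]] := wall_aut_pull a (affine_weyl_aut hg0).
rewrite /= arefl_dist.
have h1 : d <= `|pair a (g0 x) + k%:~R|.
  rewrite hb -addrA -intrD; apply: hd; rewrite intrD addrA -hb.
  by apply: contraTneq hneg => ->; rewrite mul0r ltxx.
have h2 := hd' a k (pair_p0_neq0 a k).
have h3 := hm a.
have h4 : (pair a (g0 x) + k%:~R) * (pair a p0 + k%:~R) <= - (d * d').
  by rewrite -[X in X <= _]opprK -(ltr0_norm hneg) normrM lerN2 ler_pM // ltW.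
have h5 : form (coroot a) (coroot a) * ((pair a (g0 x) + k%:~R) * (pair a p0 + k%:~R))
    <= - eta.
  rewrite /eta -mulrN; have hdd : 0 < d * d' by rewrite mulr_gt0.
  by nra.
rewrite -natr1 mulrDl mul1r in hK; lra.
Qed.

(** If the sum [v] is nonzero, some summand [a] has [<a, v> > 0], hence [<a, v> = 1], and
    [s_a v] is a sum of fewer coroots, still with all pairings at most [1]. *)
Lemma minuscule_coroots (l : seq (Phi D)) :
  (forall b, `|pair b (\sum_(a <- l) coroot a : A)| <= 1) -> \sum_(a <- l) coroot a = 0 :> A.
Proof.
have [K] := ubnP (size l); elim: K l => // K IH l hl hb.
set v := \sum_(a <- l) coroot a in hb *.
apply: contrapT => /eqP v0.
have hvv : 0 < form v v.
  by rewrite lt_def form_ge0 andbT; apply: contra v0 => /eqP /form_eq0 ->.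
have [a al ha] : exists2 a, a \in l & 0 < pair a v.
  apply: contrapT => hn.
  have hle (a : Phi D) : a \in l -> pair a v <= 0.
    by move=> al; rewrite leNgt; apply/negP => h; apply: hn; exists a.
  have : form v v <= 0.
    have f0 : form 0 v = 0 by rewrite -(scale0r (0 : A)) formZl mul0r.
    rewrite {1}/v (big_morph (fun y => form y v) (fun y z => formDl y z v) f0) big_seq.
    apply: sumr_le0 => a al; have := form_coroot a v.
    have := form_coroot_gt0 a; have := hle _ al; nra.
  lra.
have ha1 : pair a v = 1.
  have := hb a; rewrite gtr0_norm // => h1.
  have hi := pair_coroots_int a l.
  by apply/eqP; rewrite eq_le h1 /=; have := lt_int1 (rpred0 _) hi ha; rewrite add0r.
have e : \sum_(c <- rem a l) coroot c = refl a v :> A.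
  by rewrite /refl ha1 scale1r /v (big_rem a al) /= addrAC subrr add0r.
have : refl a v = 0.
  rewrite -e; apply: IH; last by move=> b; rewrite e -pair_root_refl.
  rewrite size_rem //; move: hl al; case: (l) => //= c l'; by rewrite ltnS.
by move=> h; move/eqP: v0; apply; rewrite -(reflK a v) h refl0.
Qed.

(** The closed alcove meets every orbit of the affine Weyl group once.  As long
    as a wall separates [p0] from [g p0], it passes through the common point
    [g x = y] and can be used to shorten [g]; in the end [g] preserves the
    alcove, so [g 0] is a coroot lattice point of the alcove, hence [0]. *)
Lemma alcove_strict x y g : affine_weyl D g -> y = g x ->
  fund_alcove S x -> fund_alcove S y -> x = y.
Proof.
move=> hg hy hx hyA.
have gside (b : Phi D) (j : int) z : fund_alcove S z ->
    pair b p0 + j%:~R < 0 -> pair b z + j%:~R <= 0.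
  move=> hz; case: (pos_or_opp b) => pb.
    have /andP[h1 h2] := pair_p0 pb; have /andP[h3 h4] := hz _ pb => h5.
    have : (j%:~R : R) < 0 by lra.
    rewrite ltrz0 => hj; have : (j%:~R : R) <= (-1)%:~R by rewrite ler_int; lia.
    rewrite rmorphN1; lra.
  have /andP[h1 h2] := pair_p0 pb; have /andP[h3 h4] := hz _ pb => h5.
  rewrite pair_opp in h1 h2; rewrite pair_opp in h3 h4.
  have : (j%:~R : R) < 1%:~R by lra.
  rewrite ltr_int => hj; have : (j%:~R : R) <= 0%:~R by rewrite ler_int; lia.
  lra.
have [h [hh hhx hin]] : exists h, [/\ affine_weyl D h, h x = y & fund_alcove S (h p0)].
  apply: (@fold_to_alcove p0 (fun h => h x = y) g) => // h a k wh hxy hneg hk.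
  rewrite /= hxy; suff -> : arefl a k y = y by [].
  suff h0 : pair a y + k%:~R = 0 by rewrite /arefl h0 scale0r subr0.
  have [b [j hb]] := wall_aut_pull a (affine_weyl_aut wh).
  have hb2 z : pair a (h z) + k%:~R = pair b z + (j + k)%:~R by rewrite hb -addrA -intrD.
  have hb3 z : - (pair a (h z) + k%:~R) = pair (opp_root b) z + (- (j + k))%:~R.
    by rewrite hb2 opprD pair_opp rmorphN.
  rewrite -hxy in hyA *.
  case: hk => -[ek pa]; have /andP[h1 h2] := pair_p0 pa; have /andP[h3 h4] := hyA _ pa.
    have h5 : pair a (h p0) + k%:~R < 0 by move: hneg; rewrite ek !addr0; nra.
    rewrite hb2 in h5; have := gside _ _ _ hx h5; rewrite -hb2 ek !addr0; lra.
  have h5 : - (pair a (h p0) + k%:~R) < 0 by move: hneg; rewrite ek rmorphN1; nra.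
  rewrite hb3 in h5; have := gside _ _ _ hx h5; rewrite -hb3 ek rmorphN1; lra.
have [w [l hw]] := affine_weyl_word hh.
have hl0 b : pos b -> 0 <= pair b (\sum_(a <- l) coroot a : A) <= 1.
  move=> pb; have [c hc] := word_root w b.
  have e z : pair b (h z) = pair c z + pair b (\sum_(a <- l) coroot a : A).
    by rewrite hw pairD -hc.
  have /andP[h1 h2] := hin _ pb; rewrite e in h1 h2.
  have hi := pair_coroots_int b l; rewrite -(floorK hi) in h1 h2 *.
  set j := Num.floor _ in h1 h2 *.
  have hj : (j%:~R : R) < 2%:~R /\ ((-1)%:~R : R) < j%:~R.
    rewrite rmorphN1.
    case: (pos_or_opp c) => /pair_p0/andP[h3 h4]; rewrite ?pair_opp in h3 h4; lra.
  by move: hj; rewrite !ltr_int ler0z (lerz1 R) => -[h3 h4]; lia.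
have hl : \sum_(a <- l) coroot a = 0 :> A.
  apply: minuscule_coroots => b; rewrite ler_norml.
  case: (pos_or_opp b) => /hl0; rewrite ?pair_opp; lra.
rewrite -hhx hw hl addr0; apply/esym/dominant_unique.
  by move=> i; case/andP: (hx _ (posS i)).
move=> i; have := hyA _ (posS i); rewrite -hhx hw hl addr0.
by case/andP.
Qed.

End Alcove.

Lemma alcove_conj x : exists2 g, affine_weyl D g & fund_alcove S (g x).
Proof.
have [e0 e0_gt0 he0] := rho_bound.
have hid : affine_weyl D (id : A -> A) by constructor.
have [g [h1 _ h2]] := @fold_to_alcove e0 e0_gt0 he0 x (fun=> True) id hid I
  (fun _ _ _ _ _ _ _ => I).
by exists g.
Qed.

(** The midpoint can be moved to the fundamental alcove; since no wall separates the two
    points, they move into the closed alcove together, which meets each orbit once. *)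
Lemma conj_close_eq x y g : affine_weyl D g -> y = g x ->
  (forall a, exists k : int, [/\ k%:~R <= pair a x <= k%:~R + 1
     & k%:~R <= pair a y <= k%:~R + 1]) -> x = y.
Proof.
move=> hg hy hclose; have [e0 e0_gt0 he0] := rho_bound.
have [h hh hm] := alcove_conj (mid x y).
have [h' [hh' hK h'K]] := affine_weyl_inv hh.
have hA z : z = x \/ z = y -> fund_alcove S (h z).
  move=> hz a pa; have /andP[h1 h2] := hm _ pa.
  have [b [j hb]] := wall_aut_pull a (affine_weyl_aut hh).
  have [k [/andP[k1 k2] /andP[k3 k4]]] := hclose b.
  rewrite hb /mid pairD pairZ pairB in h1 h2; rewrite hb.
  have e : (k + j)%:~R = k%:~R + j%:~R :> R by rewrite intrD.
  have : [\/ k + j <= -1, k + j = 0 | 1 <= k + j] 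
    by case: (lerP (k + j) (-1)) => c0; [constructor 1 | case: (lerP 1 (k + j)) => c1;
       [constructor 3 | constructor 2; lia]].
  move=> [c1|c1|c1].
  - have : (k + j)%:~R <= (-1)%:~R :> R by rewrite ler_int.
    rewrite e rmorphN1 => c2; case: hz => ->; lra.
  - have : (k + j)%:~R = 0 :> R by rewrite c1.
    rewrite e => c2; case: hz => ->; lra.
  have : 1%:~R <= (k + j)%:~R :> R by rewrite ler_int.
  rewrite e => c2; case: hz => ->; lra.
have e : h x = h y.
  apply: (@alcove_strict e0 e0_gt0 he0 (h x) (h y) (h \o (g \o h'))).
  - by do 2!apply: affine_weyl_comp => //.
  - by rewrite /= hK hy.
  - by apply: hA; left.
  - by apply: hA; right.
by rewrite -(hK x) e hK.
Qed.

Lemma face_close x y z a : closed_face D x y -> closed_face D x z ->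
  exists k : int, [/\ k%:~R <= pair a y <= k%:~R + 1 & k%:~R <= pair a z <= k%:~R + 1].
Proof.
move=> hy hz; exists (Num.floor (pair a x)); set k := Num.floor _.
have h1 : k%:~R <= pair a x by apply: Num.Theory.floor_le.
have h2 : pair a x < k%:~R + 1 by rewrite -(intrD _ _ 1) Num.Theory.floorD1_gt.
have hh z' : closed_face D x z' -> k%:~R <= pair a z' <= k%:~R + 1.
  move=> h; have [p _] := h a (- k); have [_ q] := h a (- k - 1).
  rewrite /halfpos /halfneg /= in p q.
  rewrite rmorphN /= in p; rewrite rmorphB rmorphN /= in q.
  have h3 : 0 <= pair a x - k%:~R by lra.
  have h4 : pair a x + (- k%:~R - 1%:~R) <= 0 by lra.
  have := p h3; have := q h4; lra.
by split; apply: hh.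
Qed.

Lemma aff_image_id g g' (F : set A) : cancel g g' -> g' @` (g @` F) = F :> set A.
Proof.
move=> gK; apply/seteqP; split=> x; first by move=> [y [z Fz <-] <-]; rewrite gK.
by move=> Fx; exists (g x); [exists x|rewrite gK].
Qed.

(** Faces of equal type are conjugate, since every face has a representative in
    the fundamental alcove. *)
Lemma face_type_conj (F F' : set A) : is_face D F -> is_face D F' ->
  face_type S F = face_type S F' <-> exists2 g, affine_weyl D g & g @` F = F'.
Proof.
move=> hF hF'; split=> [|[g hg <-]].
  have hex (E : set A) : is_face D E -> exists T : set A, [/\ is_face D T, T `<=` fund_alcove S
      & exists2 w, affine_weyl D w & w @` E = T].
    move=> [x ->]; have [g hg hA] := alcove_conj x; exists (g @` closed_face D x).
    rewrite aut_face; last exact: affine_weyl_aut.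
    split; [by exists (g x)| |by exists g; rewrite ?aut_face //; apply: affine_weyl_aut].
    move=> y hy a pa; have /andP[h1 h2] := hA _ pa.
    have [p _] := hy a 0; have [_ q] := hy a (-1).
    rewrite /halfpos /halfneg /= ?addr0 rmorphN1 in p q.
    by rewrite p //=; have := q _; rewrite !subr_le0; apply.
  have hft (E : set A) : is_face D E -> exists2 w, affine_weyl D w & w @` E = face_type S E.
    move=> /hex[T hT].
    have /(xgetPex set0) : exists T, [set T' | [/\ is_face D T', T' `<=` fund_alcove S
      & exists2 w, affine_weyl D w & w @` E = T']] T by exists T.
    by case.
  have [w hw ew] := hft _ hF; have [w' hw' ew'] := hft _ hF'.
  move=> e; have [w'' [hw'' wK w'K]] := affine_weyl_inv hw'.
  exists (w'' \o w); first exact: affine_weyl_comp.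
  rewrite -image_comp ew e -ew'.
  exact: aff_image_id.
rewrite /face_type; congr xget; apply/seteqP; split=> T /= [h1 h2 [w hw e]]; split=> //.
  have [g' [hg' gK g'K]] := affine_weyl_inv hg; exists (w \o g').
    exact: affine_weyl_comp.
  by rewrite -image_comp (aff_image_id _ gK).
exists (w \o g); first exact: affine_weyl_comp.
by rewrite -image_comp.
Qed.

End Faces.

(** * The shape of the reference gallery *)

Section Galleries.
Implicit Types (a b : Phi D) (x y z : A).
Local Notation r := (rho_v).
Implicit Types (f g : A -> A).

Lemma aut_edge_image f (E : set A) v w : wall_aut f -> is_edge D E -> E v -> E w -> v != w ->
  is_edge D (f @` E).
Proof.
move=> hf hE Ev Ew vw; have eE := edge_mid hE Ev Ew vw.
rewrite eE in hE Ev Ew *; rewrite (aut_face _ hf) (aut_mid _ _ hf).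
exact: (aut_edge hf vw hE Ev Ew).
Qed.

(** The components are the fundamental coweight, the starting parameter and the length. *)
Definition step : Type := (A * R * R)%type.
Implicit Types (l : seq step).
Definition step0 : step := (0, 0, 0).
Local Notation st l k := (nth step0 l k).

Definition profile_of l : profile R n :=
  Profile (size l) (fun k => (st l k).1.1) (fun k => (st l k).1.2) (fun k => (st l k).2).

Definition steps_ok l := forall k, (k < size l)%N ->
  [/\ exists i, (st l k).1.1 = omega i, 0 < (st l k).2,
      ((st l k.+1).1.2 = 0 /\ (st l k).1.2 + (st l k).2 = 1) \/
      [/\ (k.+1 < size l)%N, (st l k.+1).1.2 = (st l k).1.2 + (st l k).2,
          (st l k.+1).1.1 = (st l k).1.1 & 0 < (st l k.+1).1.2 < 1]
    & forall a t, (st l k).1.2 < t < (st l k).1.2 + (st l k).2 ->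
        t * pair a (st l k).1.1 \is a Num.int -> pair a (st l k).1.1 = 0].

Lemma steps_profile_ok l : steps_ok l -> (st l 0).1.2 = 0 -> profile_ok (profile_of l).
Proof.
move=> h h0; split=> //= k.
- by move=> /h[].
- by move=> /h[].
- by move=> /h[].
- by move=> a t kl; have [_ _ _ h1] := h _ kl; apply: h1.
Qed.

Lemma steps_ok_cat l1 l2 : steps_ok l1 -> steps_ok l2 -> (st l2 0).1.2 = 0 ->
  steps_ok (l1 ++ l2).
Proof.
move=> h1 h2 h0 k; rewrite size_cat !nth_cat => hk.
case: (ltnP k (size l1)) => kl.
  have [g1 g2 g3 g4] := h1 _ kl; split=> //.
  case: (ltnP k.+1 (size l1)) => kl'.
    case: g3 => [|[q1 q2 q3 q4]]; [by left|right]; split=> //; exact: ltn_addr.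
  have -> : (k.+1 - size l1 = 0)%N by apply/eqP; rewrite subn_eq0.
  by case: g3 => [[_ q]|[q _ _ _]]; [left | rewrite ltnNge kl' in q].
have hk2 : (k - size l1 < size l2)%N by lia.
have [g1 g2 g3 g4] := h2 _ hk2; split=> //.
rewrite ltnNge (leqW kl) /= subSn //.
case: g3 => [|[q1 q2 q3 q4]]; [by left|right]; split=> //; lia.
Qed.

Definition point l k : A := \sum_(j < k) (st l j).2 *: (st l j).1.1.

Lemma pointS l k : point l k.+1 = point l k + (st l k).2 *: (st l k).1.1.
Proof. exact: big_ord_recr. Qed.

Definition shape l (g : gallery R n) :=
  [/\ size g.2 = size l, g.1 = 0,
      forall k, (k <= size l)%N -> vtx g k = point l k /\ is_vertex D (vtx g k)
    & forall k, (k < size l)%N -> [/\ is_edge D (edg g k), edg g k (vtx g k)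
        & edg g k (vtx g k.+1)]].

Lemma omega_neq0 i : omega i != 0.
Proof.
apply/eqP => h; have := omegaP i i; rewrite h pair0 eqxx => /eqP.
by rewrite eq_sym oner_eq0.
Qed.

Lemma step_neq0 l k : steps_ok l -> (k < size l)%N -> point l k != point l k.+1.
Proof.
move=> hl /hl[[i hi] h0 _ _]; rewrite pointS -subr_eq0 opprD addrA subrr add0r oppr_eq0.
by rewrite scaler_eq0 hi (negPf (omega_neq0 i)) orbF gt_eqF.
Qed.

Lemma target_vtx (g : gallery R n) : target g = vtx g (size g.2).
Proof. by rewrite /target /vtx /vertices -[size g.2](size_map snd) (last_nth 0). Qed.

Lemma wall_aut_transl q : (forall b : Phi D, pair b q \is a Num.int) ->
  wall_aut (fun x => x + q).
Proof. by move=> h; exists [::], q. Qed.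

Lemma shape_cat l1 l2 (g1 g2 : gallery R n) : steps_ok l2 -> shape l1 g1 -> shape l2 g2 ->
  (forall b : Phi D, pair b (point l1 (size l1)) \is a Num.int) ->
  shape (l1 ++ l2) (gal_cat g1 g2).
Proof.
move=> ok2 [s1 o1 v1 e1] [s2 o2 v2 e2] hint.
have ht : target g1 = point l1 (size l1) by rewrite target_vtx s1; case: (v1 _ (leqnn _)).
set q := point l1 (size l1) in hint ht.
have e : gal_cat g1 g2 = (g1.1, g1.2 ++ [seq ([set x + q | x in p.1], p.2 + q) | p <- g2.2]).
  by rewrite /gal_cat /translate /source o2 subr0 ht.
rewrite e; set g := (_, _).
have hq := wall_aut_transl hint.
have vl k : (k <= size l1)%N -> vtx g k = vtx g1 k.
  move=> kl; rewrite /vtx /vertices /= map_cat -cat_cons nth_cat /= size_map s1 ltnS kl.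
  by [].
have vh k : (k <= size l2)%N -> vtx g (size l1 + k) = vtx g2 k + q.
  case: k => [|k] kl.
    by rewrite addn0 vl // /vtx /vertices /= o2 add0r -ht target_vtx s1.
  rewrite /vtx /vertices /= map_cat -cat_cons nth_cat /= size_map s1 ltnNge.
  rewrite addnS ltnS leq_addr /= subSS addKn -map_comp.
  by rewrite (nth_map (set0, 0)) ?s2 //= (nth_map (set0, 0)) ?s2.
have el k : (k < size l1)%N -> edg g k = edg g1 k.
  by move=> kl; rewrite /edg /edges /= map_cat nth_cat size_map s1 kl.
have eh k : (k < size l2)%N -> edg g (size l1 + k) = [set x + q | x in edg g2 k].
  move=> kl; rewrite /edg /edges /= map_cat nth_cat size_map s1 ltnNge leq_addr /= addKn.
  by rewrite -map_comp (nth_map (set0, 0)) ?s2 //= (nth_map (set0, 0)) ?s2.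
have pl k : (k <= size l1)%N -> point (l1 ++ l2) k = point l1 k.
  move=> kl; apply: eq_bigr => j _; rewrite nth_cat (leq_trans (ltn_ord j)) //.
have ph k : point (l1 ++ l2) (size l1 + k) = point l2 k + q.
  elim: k => [|k IH]; first by rewrite addn0 pl // [point l2 0]big_ord0 add0r.
  by rewrite addnS !pointS IH nth_cat ltnNge leq_addr /= addKn addrAC.
split=> //.
- by rewrite /= size_cat size_map s1 s2 size_cat.
- move=> k; rewrite size_cat; case: (leqP k (size l1)) => kl.
    by rewrite vl // pl // => _; apply: v1.
  move=> kl2; have -> : k = (size l1 + (k - size l1))%N by lia.
  have hk : (k - size l1 <= size l2)%N by lia.
  have [h1 h2] := v2 _ hk; rewrite vh // ph h1; split=> //.
  by rewrite -h1; apply: (aut_vertex hq).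
move=> k; rewrite size_cat; case: (ltnP k (size l1)) => kl.
  by move=> _; rewrite el // (vl k (ltnW kl)) (vl k.+1 kl); apply: e1.
move=> kl2; have -> : k = (size l1 + (k - size l1))%N by lia.
have hk : (k - size l1 < size l2)%N by lia.
have [h1 h2 h3] := e2 _ hk; rewrite -addnS !vh ?(ltnW hk) // eh //; split.
- apply: (aut_edge_image hq h1 h2 h3).
  have [-> _] := v2 _ (ltnW hk); have [-> _] := v2 _ hk; exact: step_neq0.
- by exists (vtx g2 (k - size l1)).
- by exists (vtx g2 (k - size l1).+1).
Qed.

Lemma shape_fundamental i (g : gallery R n) : fundamental_gallery D (omega i) g ->
  exists l, [/\ steps_ok l, (st l 0).1.2 = 0, shape l g & point l (size l) = omega i].
Proof.
move=> [[_ _ hv he] h0 ht hseg [t [htv hti]]]; set m := size g.2 in hv he hseg htv hti.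
have w0 := omega_neq0 i.
have t0 : t 0%N = 0.
  have := htv 0%N (leq0n _); rewrite /vtx /= -/(source g) h0 => /esym/eqP.
  by rewrite scaler_eq0 (negPf w0) orbF => /eqP.
have tm : t m = 1.
  have := htv m (leqnn _); rewrite -target_vtx ht => /eqP.
  rewrite -{1}[omega i]scale1r -subr_eq0 -scalerBl scaler_eq0 (negPf w0) orbF subr_eq0.
  by move=> /eqP.
pose l := [seq (omega i, t k, t k.+1 - t k) : step | k <- iota 0 m].
have sl : size l = m by rewrite size_map size_iota.
have nl k : (k < m)%N -> st l k = (omega i, t k, t k.+1 - t k).
  by move=> km; rewrite (nth_map 0%N) ?size_iota // nth_iota.
have pl k : (k <= m)%N -> point l k = t k *: omega i.
  elim: k => [_|k IH km]; first by rewrite /point big_ord0 t0 scale0r.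
  by rewrite pointS nl // IH ?(ltnW km) //= -scalerDl addrC subrK.
have tmono j k : (j < k <= m)%N -> t j < t k.
  elim: k => [|k IH]; first by rewrite ltn0.
  rewrite ltnS leq_eqVlt => /andP[/orP[/eqP ->|jk] km]; first exact: hti.
  by apply: lt_trans (IH _) (hti _ km); rewrite jk ltnW.
exists l; split.
- move=> k; rewrite sl => km; rewrite nl //=; split.
  + by exists i.
  + by rewrite subr_gt0 hti.
  + case: (ltnP k.+1 m) => km'.
      right; rewrite nl //= addrC subrK; split=> //.
      by rewrite -tm -{1}t0 !tmono // km' /=.
    have e : k.+1 = m by apply/eqP; rewrite eqn_leq km km'.
    left; rewrite nth_default ?sl //=; split=> //.
    by rewrite addrC subrK e.
  + move=> a u; rewrite addrC subrK => /andP[u1 u2] hu.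
    have [[[x ex] _] ev ev'] := he _ km.
    rewrite htv ?(ltnW km) // htv // ex in ev ev'.
    have [p1 q1] := ev a (- Num.floor (u * pair a (omega i))).
    have [p2 q2] := ev' a (- Num.floor (u * pair a (omega i))).
    rewrite /halfpos /halfneg /= rmorphN /= floorK // !pairZ in p1 q1 p2 q2.
    have e1 (z : R) : z * pair a (omega i) - u * pair a (omega i) =
       (z - u) * pair a (omega i) by ring.
    rewrite !e1 in p1 q1 p2 q2.
    apply/eqP; case: (ltgtP (pair a (omega i)) 0) => // hs.
      case: (lerP 0 (pair a x - u * pair a (omega i))) => hx.
        have := p2 hx; nra.
      have := q1 (ltW hx); nra.
    case: (lerP 0 (pair a x - u * pair a (omega i))) => hx.
      have := p1 hx; nra.
    have := q2 (ltW hx); nra.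
- case em : m => [|m']; first by rewrite nth_default ?sl ?em.
  by rewrite nl ?em //= t0.
- split=> //; rewrite sl // => k km.
  by rewrite pl // htv //; split=> //; rewrite -htv //; apply: hv.
by rewrite sl pl // tm scale1r.
Qed.

Lemma shape_concat (gam : 'I_n -> gallery R n) (js : seq 'I_n) :
  (forall i, fundamental_gallery D (omega i) (gam i)) ->
  exists l, [/\ steps_ok l, (st l 0).1.2 = 0, shape l (gal_concat [seq gam j | j <- js])
    & point l (size l) = \sum_(j <- js) omega j].
Proof.
move=> hgam; elim/last_ind: js => [|js i [l [h1 h2 h3 h4]]].
  exists [::]; split=> //; last by rewrite big_nil [LHS]big_ord0.
  split=> // k; rewrite leqn0 => /eqP ->; rewrite /vtx /= [point _ _]big_ord0.
  by split=> //; apply: vertex0.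
have [l' [g1 g2 g3 g4]] := shape_fundamental (hgam i).
exists (l ++ l'); split.
- exact: steps_ok_cat.
- rewrite nth_cat; case: l h2 {h1 h3 h4} => //=; by rewrite subn0.
- rewrite map_rcons /gal_concat foldl_rcons; apply: shape_cat => // b.
  by rewrite h4 pair_sum rpred_sum // => j _; apply: pair_omega_int.
rewrite -cats1 big_cat big_seq1 /= -h4 -g4 size_cat /point big_split_ord /=.
congr (_ + _); apply: eq_bigr => j _; rewrite nth_cat /=; first by rewrite ltn_ord.
by rewrite ltnNge leq_addr /= addKn.
Qed.

End Galleries.

(** * LS galleries and folded paths *)

Section LSGalleries.
Implicit Types (a b : Phi D) (x y z : A).
Local Notation r := (rho_v).
Implicit Types (f g : A -> A) (u v nu : A) (t : R) (s : seq A).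

(** Along a Bruhat chain starting at the smaller element, each reflection moves a dominant
    direction weakly down; read backwards it is a positive folding, and at parameter [0]
    integrality is automatic. *)
Lemma bruhat_tchain (u v : A -> A) z : bruhat S u v -> Cplus S z -> tchain 0 (v z) (u z).
Proof.
move=> h hz; elim: h => [u' v' /bruhat_stepP[w [b [hw pb hb ->]]]|x|x1 x2 x3 _ h1 _ h2].
- have wu : weyl D u' by rewrite hw; apply: word_weyl.
  have hge : 0 <= pair b (u' z).
    rewrite leNgt; apply/negP => /(weyl_dom_lt0 wu hz); lra.
  move: hge; rewrite le_eqVlt => /orP[/eqP h0|h0].
    by rewrite /= refl_fix //; apply: rt_refl.
  apply: rt_step; exists b; rewrite /= pair_refl oppr_lt0 reflK mul0r rpred0.
  by split.
- exact: rt_refl.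
exact: rt_trans h2 h1.
Qed.

(** ** Counting crossings *)

(** With no integer strictly between [x] and [y], the distance [y - x] is a difference of
    distances to the next integer, except for the jump when [x] itself is an integer. *)
Lemma ceil_count (x y : R) : x < y -> (forall z : R, x < z < y -> z \isn't a Num.int) ->
  y - x + frac (- y) - frac (- x) = (x \is a Num.int)%:R.
Proof.
move=> xy hz; set m : int := - Num.floor (- x).
have hm : x <= m%:~R /\ m%:~R < x + 1.
  have h1 := Num.Theory.floor_le (- x); have h2 := Num.Theory.floorD1_gt (- x).
  by rewrite rmorphD /= in h2; rewrite /m rmorphN /=; lra.
have [hm1 hm2] := hm.
have e0 : frac (- x) = m%:~R - x by rewrite /frac /m rmorphN /=; lra.
have fE (j : int) : y <= j%:~R -> j%:~R < y + 1 -> frac (- y) = j%:~R - y.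
  move=> h1 h2; have e : Num.floor (- y) = - j.
    by apply: Num.Theory.floor_def; rewrite rmorphD rmorphN /=; lra.
  by rewrite /frac e rmorphN /=; lra.
case: (boolP (x \is a Num.int)) => hx.
  have ex : x = m%:~R.
    have hx2 : Num.floor (- x) = - Num.floor x by rewrite -(floorK hx) -rmorphN /= !intrKfloor.
    by rewrite /m hx2 opprK floorK.
  have hy : y <= m%:~R + 1.
    rewrite leNgt; apply/negP => h; have := hz (m%:~R + 1); rewrite h ex.
    by rewrite rpredD ?intr_int ?rpred1 // andbT ltrDl ltr01 => /(_ isT).
  have := fE (m + 1); rewrite rmorphD /= => -> //; rewrite ?e0; lra.
have hy : y <= m%:~R.
  rewrite leNgt; apply/negP => h; have := hz m%:~R; rewrite h intr_int andbT.
  suff -> : x < m%:~R by move=> /(_ isT).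
  by rewrite lt_def hm1 andbT; apply: contraNneq hx => <-; apply: intr_int.
rewrite (fE m) ?e0 //; last by lra.
by rewrite /=; ring.
Qed.

Lemma sum_pos_abs (F : Phi D -> R) : (forall a, F (opp_root a) = F a) ->
  \sum_a F a = 2 * \sum_(a | pos a) F a.
Proof.
move=> hF; rewrite (bigID pos) /= mulr2n mulrDl !mul1r; congr (_ + _).
rewrite (reindex_inj (inv_inj (opp_rootK R (D := D)))) /=.
by apply: eq_big => [a|a _]; rewrite ?hF // pos_opp negbK.
Qed.

Lemma sum_abs_refl b x :
  \sum_(a : Phi D) `|pair a (refl b x)| = \sum_(a : Phi D) `|pair a x|.
Proof.
rewrite (reindex_inj (inv_inj (root_reflK R b))) /=.
by apply: eq_bigr => a _; rewrite pair_root_refl reflK.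
Qed.

Lemma sum_abs_word (w : seq 'I_n) x :
  \sum_(a : Phi D) `|pair a (word S w x)| = \sum_(a : Phi D) `|pair a x|.
Proof. by elim: w => // i w IH; rewrite word_cons sum_abs_refl. Qed.

(** The sum of the absolute values of the positive roots is constant on an orbit, and adding
    [|<a, y>|] to [<a, y>] leaves twice the positive part. *)
Lemma half_sum_orbit (w : seq 'I_n) x : Cplus S x ->
  dot (half_sum R S) (x + word S w x) =
  \sum_(a | pos a && (0 < pair a (word S w x))) pair a (word S w x).
Proof.
move=> hx; set y := word S w x.
have hd z : dot (half_sum R S) z = 2^-1 * \sum_(a | pos a) pair a z.
  rewrite /half_sum /dot mulr_sumr.
  under eq_bigr do rewrite !mxE summxE mulr_sumr mulr_suml.
  rewrite exchange_big /=; apply: eq_bigr => a _; rewrite /pair /dot mulr_sumr.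
  by apply: eq_bigr => i _; rewrite mulrA.
have e1 : \sum_(a | pos a) pair a x = \sum_(a | pos a) `|pair a y|.
  have abso (z : A) a : `|pair (opp_root a) z| = `|pair a z| by rewrite pair_opp normrN.
  have h := sum_abs_word w x; rewrite (sum_pos_abs (abso _)) (sum_pos_abs (abso x)) in h.
  transitivity (\sum_(a | pos a) `|pair a x|); last by rewrite -/y in h; lra.
  by apply: eq_bigr => a pa; rewrite ger0_norm //; exact: (pos_ge0 pa hx).
rewrite hd (eq_bigr (fun a => pair a x + pair a y)) => [|a _]; last by rewrite pairD.
rewrite big_split /= e1 -big_split /= mulr_sumr [RHS]big_mkcondr; apply: eq_bigr => a _.
by case: (ltrP 0 (pair a y)) => h; [rewrite gtr0_norm | rewrite ler0_norm]; rewrite //; lra.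
Qed.

Section Correspondence.
Variables (p : profile R n) (gla : gallery R n).
Hypothesis p_ok : profile_ok p.
Local Notation N := (psize p).
Local Notation t_ := (ptime p).
Local Notation om := (pdir p).
Local Notation c_ := (plen p).
Local Notation P k := (vert p (straight p) k).
Hypothesis gla_size : size gla.2 = N.
Hypothesis gla_source : gla.1 = 0.
Hypothesis gla_vtx : forall k, (k <= N)%N -> vtx gla k = P k.
Hypothesis gla_vertex : forall k, (k <= N)%N -> is_vertex D (P k).
Hypothesis gla_edge : forall k, (k < N)%N -> is_edge D (edg gla k).
Hypothesis gla_edge0 : forall k, (k < N)%N -> edg gla k (P k).
Hypothesis gla_edge1 : forall k, (k < N)%N -> edg gla k (P k.+1).

Lemma len_gt0 k : (k < N)%N -> 0 < c_ k.
Proof. by case: p_ok => _ h _ _ _; apply: h. Qed.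

Lemma PS k : (k < N)%N -> P k.+1 = P k + c_ k *: om k.
Proof. by move=> kN; rewrite vertS nth_straight. Qed.

Lemma om_neq0 k : (k < N)%N -> om k != 0.
Proof. by move=> kN; case: p_ok => /(_ _ kN)[i ->] _ _ _ _; apply: omega_neq0. Qed.

Lemma P_neq k : (k < N)%N -> P k != P k.+1.
Proof.
move=> kN; rewrite PS // -subr_eq0 opprD addrA subrr add0r oppr_eq0 scaler_eq0.
by rewrite (negPf (om_neq0 kN)) orbF gt_eqF ?len_gt0.
Qed.

Lemma gla_edgeE k : (k < N)%N -> edg gla k = closed_face D (mid (P k) (P k.+1)).
Proof.
by move=> kN; apply: edge_mid; [exact: gla_edge|exact: gla_edge0|exact: gla_edge1|exact: P_neq].
Qed.

Lemma P_int k a : (k <= N)%N -> pair a (P k) - t_ k * pair a (nth 0 (straight p) k) \is a Num.int.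
Proof. exact: (vert_int p_ok (model_straight p_ok)). Qed.

Definition edge_at (v u : A) : set A := closed_face D (mid v (v + u)).

Definition good_edge (v u : A) := [/\ is_vertex D v, u != 0, is_edge D (edge_at v u),
  edge_at v u v & edge_at v u (v + u)].

Lemma good_edge_gla k : (k < N)%N -> good_edge (P k) (c_ k *: om k).
Proof.
move=> kN; rewrite /good_edge /edge_at -PS // -gla_edgeE //.
rewrite scaler_eq0 (negPf (om_neq0 kN)) orbF gt_eqF ?len_gt0 //.
by split=> //; [apply: gla_vertex; apply: ltnW|apply: gla_edge|apply: gla_edge0|apply: gla_edge1].
Qed.

Lemma aut_good_edge f x u : wall_aut f -> good_edge x u ->
  good_edge (f x) (f (x + u) - f x) /\ f @` edge_at x u = edge_at (f x) (f (x + u) - f x).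
Proof.
move=> hf [h1 h2 h3 h4 h5]; have e0 : f x + (f (x + u) - f x) = f (x + u).
  by rewrite addrC subrK.
have e : f @` edge_at x u = edge_at (f x) (f (x + u) - f x).
  by rewrite /edge_at (aut_face _ hf) (aut_mid _ _ hf) e0.
have [f' [_ fK _]] := wall_aut_inv hf.
have ne : x != x + u by rewrite -subr_eq0 opprD addrA subrr add0r oppr_eq0.
split=> //; split.
- exact: (aut_vertex hf).
- by rewrite subr_eq0 (can_eq fK) eq_sym.
- by rewrite -e; apply: (aut_edge_image hf h3 h4 h5 ne).
- by rewrite -e; exists x.
- by rewrite e0 -e; exists (x + u).
Qed.

Lemma good_edge_ray v u y : good_edge v u -> edge_at v u y -> exists2 t, 0 <= t & y = v + t *: u.
Proof.
move=> [h1 h2 h3 h4 h5] hy.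
have ne : v != v + u by rewrite -subr_eq0 opprD addrA subrr add0r oppr_eq0.
by have [t t0 ->] := edge_ray h3 h1 h4 h5 ne hy; exists t; rewrite // addrAC subrr add0r.
Qed.

Lemma arefl_at v b (k : int) x : pair b v + k%:~R = 0 -> arefl b k (v + x) = v + refl b x.
Proof.
move=> h; rewrite /arefl pairD (_ : _ + k%:~R = pair b x); last by lra.
by rewrite -addrA.
Qed.

Lemma word_opp w x : word S w (- x) = - word S w x :> A.
Proof. by rewrite -scaleN1r wordZ scaleN1r. Qed.

Lemma good_edge_refl v u b (k : int) : wall b k v -> good_edge v u ->
  good_edge v (refl b u) /\ arefl b k @` edge_at v u = edge_at v (refl b u).
Proof.
move=> hw hg; have ha : wall_aut (arefl b k : A -> A).
  have -> : arefl b k = arefl b k \o id :> (A -> A) by [].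
  by apply: affine_weyl_aut; do 2!constructor.
have e0 : arefl b k v = v by rewrite /arefl hw scale0r subr0.
have e1 : arefl b k (v + u) - arefl b k v = refl b u.
  by rewrite e0 arefl_at // addrAC subrr add0r.
by have := aut_good_edge ha hg; rewrite e1 e0.
Qed.

Lemma positive_folding_step v u b (k : int) : pos b -> wall b k v -> pair b u < 0 ->
  good_edge v u -> positive_folding S v (edge_at v u) (edge_at v (refl b u)).
Proof.
move=> pb hw hneg hg; have [hg' e] := good_edge_refl hw hg.
exists b, k; split=> //; right; split.
  move=> y [/(good_edge_ray hg)[t t0 ->]|[x hx <-]].
    rewrite /halfneg /= pairD pairZ; have : pair b v + k%:~R = 0 := hw; nra.
  rewrite /halfneg /= pairB; have : pair b v + k%:~R = 0 := hw.
  have := pos_ge0 pb hx; lra.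
move=> x hx; have hxx : closed_face D x = edge_at v (refl b u) := hx.
have hxe : edge_at v (refl b u) x by rewrite -hxx.
have [t t0 ht] := good_edge_ray hg' hxe.
have : t != 0.
  apply/eqP => tz; rewrite tz scale0r addr0 in ht.
  have [/vertexP h1 h2 _ _ h5] := hg'; rewrite -hxx ht in h5.
  by move/eqP: h2; apply; apply: (addrI v); rewrite (h1 _ h5) addr0.
move=> tn; have {}t0 : 0 < t by rewrite lt_def tn.
rewrite /halfneg /= ht pairD pairZ pair_refl => h.
have : pair b v + k%:~R = 0 := hw; nra.
Qed.

Lemma tchain_folding v t nu nu' c : 0 < c ->
  (forall b, pair b v - t * pair b nu \is a Num.int) -> tchain t nu nu' ->
  good_edge v (c *: nu) ->
  clos_refl_trans _ (positive_folding S v) (edge_at v (c *: nu)) (edge_at v (c *: nu')).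
Proof.
move=> c0 hint h; suff: good_edge v (c *: nu) -> good_edge v (c *: nu') /\
    clos_refl_trans _ (positive_folding S v) (edge_at v (c *: nu)) (edge_at v (c *: nu')).
  by move=> h1 /h1[].
elim: h hint => [x y [b [pb hb hi ->]] hint hg|x _ hg|x y z hxy IH1 _ IH2 hint hg].
- have hv : pair b v \is a Num.int by rewrite -(subrK (t * pair b x) (pair b v)) rpredD.
  have hw : wall b (- Num.floor (pair b v)) v by rewrite /wall /= rmorphN /= floorK // subrr.
  have [h1 h2] := good_edge_refl hw hg; rewrite reflZ in h1 *; split=> //.
  rewrite -reflZ; apply: rt_step; apply: (positive_folding_step pb hw) => //.
  by rewrite pairZ pmulr_rlt0.
- by split=> //; apply: rt_refl.
have [h1 h2] := IH1 hint hg.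
have [|h3 h4] := IH2 _ h1; last by split=> //; apply: rt_trans h2 h4.
move=> b; have := tchain_int b hxy => h5.
have -> : pair b v - t * pair b y = pair b v - t * pair b x + (t * pair b x - t * pair b y) by ring.
exact: rpredD.
Qed.

(** A reflection of a positive folding separates [v + C^-] from the folded edge, so the
    positive root of the wall increases from negative to positive along the direction. *)
Lemma folding_tchain v u (F F' : set A) : good_edge v u -> F = edge_at v u ->
  clos_refl_trans _ (positive_folding S v) F F' ->
  exists u' (L : seq 'I_n), [/\ good_edge v u', F' = edge_at v u', u' = word S L u
    & clos_refl_trans A (fun x y => exists b, [/\ pos b, pair b x < 0,
        pair b v \is a Num.int & y = refl b x]) u u'].
Proof.
move=> hg hF h; elim: h u hg hF => [F1 F2 [b [k [hw e hsep]]]|F1|F1 F2 F3 _ IH1 _ IH2] u hg hF.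
- have [hg' e'] := good_edge_refl hw hg.
  have eF : F2 = edge_at v (refl b u) by rewrite e hF e'.
  have hv : pair b v + k%:~R = 0 := hw.
  have hvi : pair b v \is a Num.int.
    have -> : pair b v = (- k)%:~R by rewrite rmorphN /=; lra.
    exact: intr_int.
  have hmid : open_face D F2 (mid v (v + refl b u)) by rewrite eF.
  have em : pair b (mid v (v + refl b u)) = pair b v - 2^-1 * pair b u.
    by rewrite /mid addrAC subrr add0r pairD pairZ pair_refl mulrN.
  have hC : opp_sector S v id (v - r) by exists r => //; apply: rho_dom.
  have [L hL] := refl_word b.
  exists (refl b u), L; split=> //; apply: rt_step.
  case: hsep => -[h1 h2].
    have := h1 _ (or_intror hC); rewrite /halfpos /= pairB => h3.
    have := h2 _ hmid; rewrite /halfpos /= em => /negP; rewrite -ltNge => h4.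
    exists (opp_root b); rewrite refl_opp !pair_opp pos_opp rpredN; split=> //.
      rewrite pos_rho; lra.
    lra.
  have := h1 _ (or_intror hC); rewrite /halfneg /= pairB => h3.
  have := h2 _ hmid; rewrite /halfneg /= em => /negP; rewrite -ltNge => h4.
  exists b; split=> //; last by lra.
  rewrite pos_rho lt_def pair_rho_neq0; lra.
- by exists u, [::]; split=> //; apply: rt_refl.
have [u1 [L1 [g1 g2 g3 g4]]] := IH1 _ hg hF; have [u2 [L2 [k1 k2 k3 k4]]] := IH2 _ g1 g2.
exists u2, (L2 ++ L1); split=> //; first by rewrite word_cat -g3.
exact: rt_trans g4 k4.
Qed.

Definition gal_of s : gallery R n :=
  (0, [seq (edge_at (vert p s k) (c_ k *: nth 0 s k), vert p s k.+1) | k <- iota 0 N]).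

Lemma size_gal_of s : size (gal_of s).2 = N.
Proof. by rewrite size_map size_iota. Qed.

Lemma vtx_gal_of s k : (k <= N)%N -> vtx (gal_of s) k = vert p s k.
Proof.
case: k => [|k] kN; first by rewrite vert0.
rewrite /vtx /vertices /= -map_comp (nth_map 0%N) ?size_iota // nth_iota //.
Qed.

Lemma edg_gal_of s k : (k < N)%N -> edg (gal_of s) k = edge_at (vert p s k) (c_ k *: nth 0 s k).
Proof.
by move=> kN; rewrite /edg /edges -map_comp (nth_map 0%N) ?size_iota // nth_iota.
Qed.

Lemma target_gal_of s : target (gal_of s) = vert p s N.
Proof. by rewrite target_vtx size_gal_of vtx_gal_of. Qed.

Lemma gal_eq (d d' : gallery R n) : d.1 = d'.1 -> size d.2 = size d'.2 ->
  (forall k, (k < size d.2)%N -> edg d k = edg d' k /\ vtx d k.+1 = vtx d' k.+1) -> d = d'.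
Proof.
case: d d' => [x l] [x' l'] /= <- hs h; congr (_, _).
apply: (@eq_from_nth _ (set0, 0)) => // k kl; have [] := h k kl.
rewrite /edg /vtx /= !(nth_map (set0, 0)) -?hs // => e1 e2.
by rewrite [LHS]surjective_pairing [RHS]surjective_pairing e1 e2.
Qed.

(** Galleries of one type are exactly those whose edges, with their end points, are
    conjugate to the edges of the reference gallery. *)
Definition carries s k g := [/\ affine_weyl D g, g (P k) = vert p s k
  & g (P k.+1) = vert p s k.+1].

Lemma carries_facts s k g : (k < N)%N -> carries s k g ->
  [/\ good_edge (vert p s k) (c_ k *: nth 0 s k),
      g @` edg gla k = edge_at (vert p s k) (c_ k *: nth 0 s k)
    & is_vertex D (vert p s k.+1)].
Proof.
move=> kN [hg h0 h1]; have ha := affine_weyl_aut hg.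
have := aut_good_edge ha (good_edge_gla kN).
rewrite /edge_at -PS // h1 h0 vertS [_ + _ - _]addrAC subrr add0r => -[g1 g2].
split=> //; first by rewrite gla_edgeE.
by rewrite -vertS -h1; apply: (aut_vertex ha); apply: gla_vertex.
Qed.

Lemma carries_line s k g c : (k < N)%N -> carries s k g ->
  g (P k + c *: om k) = vert p s k + c *: nth 0 s k /\
  g (P k.+1 + c *: om k) = vert p s k.+1 + c *: nth 0 s k.
Proof.
move=> kN [/affine_weyl_aut[w [q [_ hg]]] h0 h1].
have e : nth 0 s k = word S w (om k).
  have : c_ k *: nth 0 s k = c_ k *: word S w (om k).
    apply: (addrI (vert p s k)); rewrite -vertS -h1 -h0 PS // !hg wordD wordZ.
    by rewrite addrAC.
  by move/(scalerI (lt0r_neq0 (len_gt0 kN))).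
by split; rewrite e hg wordD wordZ addrAC -hg ?h0 ?h1.
Qed.

Lemma carries_pull s k g a : (k < N)%N -> carries s k g ->
  exists b (j : int), [/\ pair a (vert p s k) = pair b (P k) + j%:~R,
    pair a (vert p s k.+1) = pair b (P k.+1) + j%:~R
    & pair a (nth 0 s k) = pair b (om k)].
Proof.
move=> kN hc; have [/affine_weyl_aut/(wall_aut_pull a)[b [j hb]] h0 h1] := hc.
exists b, j; rewrite -h0 -h1 !hb; split=> //.
have [h _] := carries_line 1 kN hc; have := congr1 (pair a) h; rewrite hb !scale1r !pairD -h0 hb; lra.
Qed.

Lemma carries_int s k a : (k < N)%N -> (exists g, carries s k g) ->
  pair a (vert p s k) - t_ k * pair a (nth 0 s k) \is a Num.int.
Proof.
move=> kN [g hg]; have [b [j [-> _ ->]]] := carries_pull a kN hg.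
have := P_int b (ltnW kN); rewrite nth_straight // => h.
by rewrite addrAC rpredD // intr_int.
Qed.

Lemma carries_int_next s k a : (k.+1 < N)%N -> t_ k.+1 != 0 -> (exists g, carries s k g) ->
  pair a (vert p s k.+1) - t_ k.+1 * pair a (nth 0 s k) \is a Num.int.
Proof.
move=> kN t0 [g hg]; have [b [j [_ -> ->]]] := carries_pull a (ltnW kN) hg.
have := P_int b (ltnW kN); rewrite nth_straight //.
have [_ _ _ /(_ _ (ltnW kN)) h _] := p_ok.
case: h => [[e]|[_ _ -> _] h]; first by rewrite e eqxx in t0.
by rewrite addrAC rpredD // intr_int.
Qed.

Lemma cross_edge v u a : good_edge v u ->
  `[< exists k, wall a k v /\ ~ (edge_at v u `<=` halfneg a k) >] =
  (pair a v \is a Num.int) && (0 < pair a u).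
Proof.
move=> hg; apply/asboolP/andP => [[k [hw hn]]|[hv hu]].
  have hw' : pair a v + k%:~R = 0 := hw; split.
    have -> : pair a v = (- k)%:~R by rewrite rmorphN /=; lra.
    exact: intr_int.
  rewrite ltNge; apply/negP => hu; apply: hn => y /(good_edge_ray hg)[t t0 ->].
  rewrite /halfneg /= pairD pairZ; nra.
exists (- Num.floor (pair a v)); rewrite /wall /= rmorphN /= floorK // subrr; split=> // h.
have [_ _ _ _ /h] := hg; rewrite /halfneg /= rmorphN /= floorK // pairD; lra.
Qed.

Lemma defect_at_int t nu : (forall a, t * pair a nu \is a Num.int) -> defect t nu = 0.
Proof. by move=> h; apply: big1 => a _; apply: frac_int; rewrite rpredN. Qed.

Lemma time_end : t_ N = 0.
Proof.
case: p_ok => _ _ t0 h _; case e : N => [//|k].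
have kN : (k < N)%N by rewrite e.
by case: (h _ kN) => [[]|[]]; rewrite ?e // ltnn.
Qed.

Section Count.
Variable s : seq A.
Hypothesis s_orbit : forall k, (k < N)%N -> exists w, nth 0 s k = word S w (om k).
Hypothesis s_carries : forall k, (k < N)%N -> exists g, carries s k g.
Local Notation nu := (nth 0 s).

(** A root positive on the direction changes by its value times the length of the edge; the
    fractional parts, that is the defects, correct this to the number of walls crossed. *)
Lemma crossings_step k : (k < N)%N ->
  (#|[pred a : Phi D | pos a && `[< exists j, wall a j (vert p s k) /\
      ~ (edge_at (vert p s k) (c_ k *: nu k) `<=` halfneg a j) >]]|)%:R =
  dot (half_sum R S) (c_ k *: om k + c_ k *: nu k)
   + (defect (t_ k + c_ k) (nu k) - defect (t_ k) (nu k)).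
Proof.
move=> kN; have [g hg] := s_carries kN; have [w hw] := s_orbit kN.
have [hge _ _] := carries_facts kN hg; have c0 := len_gt0 kN.
have hdom : Cplus S (om k) by apply: (pdir_dom p_ok).
have e1 : dot (half_sum R S) (c_ k *: om k + c_ k *: nu k) =
   \sum_(a | pos a && (0 < pair a (nu k))) c_ k * pair a (nu k).
  rewrite hw -wordZ half_sum_orbit; last by move=> i; rewrite pairZ; apply: mulr_ge0 (ltW c0) _; apply: hdom.
  rewrite wordZ -hw; apply: eq_big => [a|a _]; by rewrite pairZ ?pmulr_rgt0.
rewrite e1 /defect -sumrB -big_split /= -sum1_card natr_sum [RHS]big_mkcondr big_mkcond /=.
rewrite [LHS]big_mkcond [RHS]big_mkcond; apply: eq_bigr => a _.
rewrite !inE cross_edge // pairZ pmulr_rgt0 //; case: (pos a) => //=.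
case: (ltrP 0 (pair a (nu k))) => hx; last by rewrite andbF.
rewrite andbT (int_congr (carries_int a kN (s_carries kN))).
set xx := pair a (nu k) in hx *.
have h1 : t_ k * xx < (t_ k + c_ k) * xx by rewrite ltr_pM2r // ltrDl.
have h2 : forall z : R, t_ k * xx < z < (t_ k + c_ k) * xx -> z \isn't a Num.int.
  move=> z hz; apply/negP => zi; have [b hb] := word_root w a.
  have [_ _ _ _ /(_ k b (z / xx) kN)] := p_ok.
  rewrite hb -hw -/xx mulfVK ?gt_eqF // ltr_pdivlMr // ltr_pdivrMr // => /(_ hz zi) e.
  by rewrite e ltxx in hx.
have hc := ceil_count h1 h2; transitivity ((t_ k * xx \is a Num.int)%:R : R); first by case: (_ \is a _).
by rewrite -hc; ring.
Qed.

(** The defects at the two ends vanish, so the contributions of the edges telescope to one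
    difference of defects at each bend.  As a folding never decreases the defect, the
    galleries with the extreme number of crossings are those whose bends are all tight. *)
Lemma crossings_excess : (crossings S (gal_of s))%:R =
  dot (half_sum R S) (P N + vert p s N)
   + \sum_(k < N) (defect (t_ k.+1) (nu k) - defect (t_ k.+1) (nu k.+1)).
Proof.
rewrite /crossings size_gal_of natr_sum.
rewrite (eq_bigr (fun k : 'I_N => dot (half_sum R S) (c_ k *: om k + c_ k *: nu k)
   + (defect (t_ k + c_ k) (nu k) - defect (t_ k) (nu k)))) => [|k _]; last first.
  rewrite -crossings_step //; congr (_%:R); apply: eq_card => a.
  by rewrite !inE vtx_gal_of 1?ltnW // edg_gal_of.
rewrite big_split /=; congr (_ + _).
  have -> : P N + vert p s N = \sum_(k < N) (c_ k *: om k + c_ k *: nu k).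
    by rewrite big_split /=; congr (_ + _); apply: eq_bigr => k _; rewrite nth_straight.
  rewrite /dot exchange_big /=; apply: eq_bigr => i _.
  by rewrite summxE mulr_sumr.
have int_nu k a : (k < N)%N -> pair a (nu k) \is a Num.int.
  move=> kN; have [w ->] := s_orbit kN; have [b hb] := word_root w a; rewrite -hb.
  by have [/(_ _ kN)[i ->] _ _ _ _] := p_ok; apply: pair_omega_int.
have d0 x : defect 0 x = 0 by apply: defect_at_int => a; rewrite mul0r rpred0.
have e : \sum_(k < N) defect (t_ k) (nu k) = \sum_(k < N) defect (t_ k.+1) (nu k.+1).
  apply/eqP; rewrite -subr_eq0 -sumrB.
  rewrite -(big_mkord xpredT (fun k => defect (t_ k) (nu k) - defect (t_ k.+1) (nu k.+1))).
  rewrite -oppr_eq0 -sumrN (eq_bigr (fun k => defect (t_ k.+1) (nu k.+1) - defect (t_ k) (nu k))).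
    rewrite (telescope_sumr (fun k => defect (t_ k) (nu k))) // time_end d0.
    by case: p_ok => _ _ -> _ _; rewrite d0 subrr.
  by move=> k _; rewrite opprB.
rewrite !sumrB e; congr (_ - _); apply: eq_bigr => k _.
have kN := ltn_ord k; case: p_ok => _ _ _ /(_ _ kN) h _.
case: h => [[-> ->]|[_ -> _ _]] //; rewrite d0; apply: defect_at_int => a.
by rewrite mul1r int_nu.
Qed.

End Count.

(** Each fold is a reflection in a wall through [v], so it can be composed with [g]. *)
Lemma tchain_carry t nu nu' v (g : A -> A) x c u : affine_weyl D g -> g x = v ->
  g (x + c *: u) = v + c *: nu -> (forall b, pair b v - t * pair b nu \is a Num.int) ->
  tchain t nu nu' -> exists g', [/\ affine_weyl D g', g' x = v & g' (x + c *: u) = v + c *: nu'].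
Proof.
move=> hg h0 h1 hint h; elim: h g hg h0 h1 hint => [y z [b [pb hb hi ->]]|y|y z w hyz IH1 _ IH2] g hg h0 h1 hint.
- have hv : pair b v \is a Num.int by rewrite -(subrK (t * pair b y) (pair b v)) rpredD.
  exists (arefl b (- Num.floor (pair b v)) \o g).
  have e0 : pair b v + (- Num.floor (pair b v))%:~R = 0 by rewrite rmorphN /= floorK // subrr.
  split; [by constructor|by rewrite /= h0 /arefl e0 scale0r subr0|].
  by rewrite /= h1 arefl_at // reflZ.
- by exists g.
have [g1 [k1 k2 k3]] := IH1 _ hg h0 h1 hint.
apply: (IH2 g1) => // b; have := tchain_int b hyz => h5.
have -> : pair b v - t * pair b z = pair b v - t * pair b y + (t * pair b y - t * pair b z) by ring.
exact: rpredD.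
Qed.

Lemma special_carry (g : A -> A) x v (L : seq 'I_n) : affine_weyl D g -> g x = v ->
  (forall b : Phi D, pair b v \is a Num.int) ->
  exists2 g', affine_weyl D g' & g' x = v /\ forall y, g' (x + y) = v + word S L y.
Proof.
move=> hg h0 hv; have [w [q [_ hw]]] := affine_weyl_aut hg.
suff [g' k1 k2] : exists2 g', affine_weyl D g' & forall y, g' y = v + word S (L ++ rev w) (g y - v).
  have e y : g' (x + y) = v + word S L y.
    rewrite k2 word_cat (_ : g (x + y) - v = word S w y) ?word_revK //.
    by rewrite -h0 !hw wordD; apply/rowP => j; rewrite !mxE; ring.
  by exists g' => //; split=> //; have := e 0; rewrite addr0 => ->; rewrite -[X in word S L X](scale0r 0) wordZ scale0r addr0.
elim: (L ++ rev w) => [|i L' [g' k1 k2]].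
  by exists g => // y; rewrite /= addrC subrK.
exists (arefl (S i) (- Num.floor (pair (S i) v)) \o g'); first by constructor.
have e0 : pair (S i) v + (- Num.floor (pair (S i) v))%:~R = 0 by rewrite rmorphN /= floorK // subrr.
by move=> y; rewrite /= k2 arefl_at // arefl0.
Qed.

Lemma opposition : exists m : seq 'I_n, forall x, Cplus S x -> Cplus S (word S m (- x)).
Proof.
have [m hm _] := dominant_conj (- r); exists m => x hx i.
have [b hb] := word_root m (S i); have := hm i; rewrite -!hb !pairN oppr_ge0 => h.
have nb : ~~ pos b by rewrite pos_rho -leNgt.
by rewrite -(pair_opp b); apply: pos_ge0 hx; rewrite pos_opp.
Qed.

Lemma minimal_opposite (tau : A -> A) (E : set A) v x u : weyl D tau ->
  Cplus S x -> Cplus S u ->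
  (forall y, E y -> exists2 t, 0 <= t & y = v - t *: tau x) ->
  good_edge v (tau u) -> minimal_at S E v (edge_at v (tau u)).
Proof.
move=> htau hx hu hE hg; have [m hm] := opposition; have [w hw] := weyl_word htau.
have dom t z : 0 <= t -> Cplus S z -> Cplus S (t *: z).
  by move=> t0 hz i; rewrite pairZ; apply: mulr_ge0 => //; apply: hz.
exists (word S (w ++ rev m)); first exact: word_weyl.
split=> y.
  move=> /hE[t t0 ->]; exists (word S m (- (t *: x))); first by apply: hm; apply: dom.
  by rewrite word_cat word_revK hw word_opp wordZ.
move=> /(good_edge_ray hg)[t t0 ->]; exists (word S m (- (t *: u))); first by apply: hm; apply: dom.
by rewrite word_cat word_revK hw word_opp opprK wordZ.
Qed.

Lemma edge_at_opposite v u y : good_edge v u -> is_vertex D (v + u) -> edge_at v u y ->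
  exists2 t, 0 <= t & y = (v + u) - t *: u.
Proof.
move=> [h1 h2 h3 h4 h5] h6 hy.
have ne : v + u != v by rewrite -subr_eq0 addrAC subrr add0r.
have [t t0 ->] := edge_ray h3 h6 h5 h4 ne hy; exists t => //.
by rewrite opprD addrA subrr add0r scalerN.
Qed.

Lemma weyl_scale (tau : A -> A) c x : weyl D tau -> tau (c *: x) = c *: tau x.
Proof. by move=> /weyl_word[w ->]; apply: wordZ. Qed.

(** The edge before the bend, folded at the bend, and the image of the reference gallery
    both give the next direction: the first shows that the bend is positively folded, the
    second that the type is preserved. *)
Lemma model_bend s k (tau : nat -> A -> A) : model p s -> (k.+1 < N)%N ->
  (forall k, (k < N)%N -> weyl D (tau k) /\ tau k (om k) = nth 0 s k) ->
  (forall k, (k.+1 < N)%N -> bruhat S (tau k.+1) (tau k)) ->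
  (exists g, carries s k g) ->
  [/\ good_edge (vert p s k.+1) (c_ k.+1 *: tau k (om k.+1)),
      tchain (t_ k.+1) (tau k (om k.+1)) (nth 0 s k.+1),
      forall b, pair b (vert p s k.+1) - t_ k.+1 * pair b (tau k (om k.+1)) \is a Num.int
    & exists g, carries s k.+1 g].
Proof.
move=> hm kN htau hbr [g hg]; have [hs hf _] := hm; have k1 := ltnW kN.
have hch : tchain (t_ k.+1) (tau k (om k.+1)) (nth 0 s k.+1).
  have [_ _ _ /(_ _ k1) h _] := p_ok; case: h => [[-> _]|[_ _ e /andP[h0 _]]].
    have [_ <-] := htau _ kN; apply: bruhat_tchain; first exact: hbr.
    exact: (pdir_dom p_ok).
  have [_ e1] := htau _ k1; rewrite e e1.
  by have [] := hf _ kN (lt0r_neq0 h0).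
have hint b : pair b (vert p s k.+1) - t_ k.+1 * pair b (tau k (om k.+1)) \is a Num.int.
  have h1 := vert_int p_ok hm b k1; have h2 := tchain_int b hch.
  have -> : pair b (vert p s k.+1) - t_ k.+1 * pair b (tau k (om k.+1)) =
    (pair b (vert p s k.+1) - t_ k.+1 * pair b (nth 0 s k.+1)) -
    (t_ k.+1 * pair b (tau k (om k.+1)) - t_ k.+1 * pair b (nth 0 s k.+1)) by ring.
  exact: rpredB.
have [g1 [a1 a2 a3]] : exists g1, [/\ affine_weyl D g1, g1 (P k.+1) = vert p s k.+1 &
    g1 (P k.+1 + c_ k.+1 *: om k.+1) = vert p s k.+1 + c_ k.+1 *: tau k (om k.+1)].
  have [_ _ _ /(_ _ k1) h _] := p_ok; case: h => [[e _]|[_ _ e _]].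
    have [/weyl_word[L hL] _] := htau _ k1; have [ag _ g0] := hg.
    have hv b : pair b (vert p s k.+1) \is a Num.int by have := hint b; rewrite e mul0r subr0.
    have [g1 a1 [a2 a3]] := special_carry L ag g0 hv; exists g1; split=> //.
    by rewrite a3 hL wordZ.
  have [_ e1] := htau _ k1; have [ag _ g0] := hg; exists g; split=> //.
  by have [_] := carries_line (c_ k.+1) k1 hg; rewrite e e1.
split=> //.
  have [h _] := aut_good_edge (affine_weyl_aut a1) (good_edge_gla kN).
  by move: h; rewrite a3 a2 addrAC subrr add0r.
have [g2 [b1 b2 b3]] := tchain_carry a1 a2 a3 hint hch; exists g2; split=> //.
by rewrite (PS kN) b3 -vertS.
Qed.

Lemma model_carries s k : model p s -> (k < N)%N -> exists g, carries s k g.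
Proof.
move=> hm; have [_ _ [tau [htau hbr]]] := hm; elim: k => [|k IH] kN; last first.
  by have [] := model_bend hm kN htau hbr (IH (ltnW kN)).
have [w hw] := model_orbit hm kN; exists (word S w); split.
- by elim: w {hw} => [|i w IH]; constructor.
- by rewrite !vert0; have := wordZ w (0 : R) (0 : A); rewrite !scale0r.
by rewrite PS // !vert0 vertS vert0 !add0r wordZ hw.
Qed.

Lemma vtx_conj s k : (forall k, (k < N)%N -> exists g, carries s k g) -> (k <= N)%N ->
  exists2 g, affine_weyl D g & g (P k) = vert p s k.
Proof.
move=> h; rewrite leq_eqVlt => /orP[/eqP->|/h[g []]]; last by exists g.
case e : N => [|m]; first by exists id; [constructor|rewrite !vert0].
have mN : (m < N)%N by rewrite e.
by have [g [h1 _ h2]] := h _ mN; exists g; rewrite -?e // e.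
Qed.

Lemma gallery_typeP (d : gallery R n) :
  gallery_type S d = gallery_type S gla <->
  [/\ size d.2 = N, forall k, (k <= N)%N -> face_type S [set vtx d k] = face_type S [set P k]
    & forall k, (k < N)%N -> face_type S (edg d k) = face_type S (edg gla k)].
Proof.
split=> [h|[hs hv he]].
  have hv := congr1 fst h; have he := congr1 snd h.
  have hs : size d.2 = N by have := congr1 size he; rewrite !size_map gla_size.
  split=> // k kN.
    have := congr1 (fun l => nth set0 l k) hv; rewrite !(nth_map 0) /= ?size_map ?hs ?gla_size //.
    by rewrite -gla_vtx.
  have := congr1 (fun l => nth set0 l k) he.
  by rewrite !(nth_map set0) ?size_map ?hs ?gla_size.
congr (_, _); apply: (@eq_from_nth _ set0); rewrite ?size_map /= ?size_map ?hs ?gla_size //.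
  move=> [|k] kN; first by have := hv 0 isT; rewrite -gla_vtx.
  rewrite /= !(nth_map 0) ?size_map ?hs ?gla_size //.
  by have := hv k.+1 kN; rewrite -gla_vtx.
by move=> k kN; rewrite !(nth_map set0) ?size_map ?hs ?gla_size //; apply: he.
Qed.

Lemma image_set1 (g : A -> A) x : g @` [set x] = [set g x].
Proof. by apply/seteqP; split=> [y [z -> <-]|y ->] //; exists x. Qed.

Lemma carries_vertex s k : (forall k, (k < N)%N -> exists g, carries s k g) -> (k <= N)%N ->
  is_vertex D (vert p s k).
Proof.
move=> h kN; have [g hg <-] := vtx_conj h kN.
by apply: (aut_vertex (affine_weyl_aut hg)); apply: gla_vertex.
Qed.

Lemma gal_of_LS s : model p s -> LS_galleries S (P N) gla (gal_of s).
Proof.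
move=> hm; have hc k : (k < N)%N -> exists g, carries s k g by exact: model_carries.
have [hs hf [tau [htau hbr]]] := hm.
have hspec : special D (vert p s N).
  split; first exact: (carries_vertex hc).
  move=> a; have := vert_int p_ok hm a (leqnn N); rewrite time_end mul0r subr0 => h.
  by exists (- Num.floor (pair a (vert p s N))); rewrite /wall /= rmorphN /= floorK // subrr.
split=> //.
- split.
  + split; first exact: vertex0.
    by move=> a; exists 0; rewrite /wall /= pair0 add0r.
  + by rewrite target_gal_of.
  + by rewrite size_gal_of => k kN; rewrite vtx_gal_of //; apply: carries_vertex.
  rewrite size_gal_of => k kN; rewrite edg_gal_of // !vtx_gal_of // 1?ltnW // vertS.
  by have [g hg] := hc k kN; have [[_ _ h1 h2 h3] _ _] := carries_facts kN hg.
- apply/gallery_typeP; split=> [|k kN|k kN]; first exact: size_gal_of.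
    rewrite vtx_gal_of //; have [g hg e] := vtx_conj hc kN; apply/esym/face_type_conj.
    - exact: gla_vertex.
    - exact: (carries_vertex hc).
    by exists g; rewrite // image_set1 e.
  have [g hg] := hc k kN; have [_ h1 _] := carries_facts kN hg.
  rewrite edg_gal_of //; apply/esym/face_type_conj; first by have [] := gla_edge kN.
    by eexists.
  by exists g => //; case: hg.
- split.
    rewrite size_gal_of => k kN; rewrite !edg_gal_of // 1?ltnW // vtx_gal_of 1?ltnW //.
    have k1 := ltnW kN; have [g hg] := hc k k1; have [hge _ hv] := carries_facts k1 hg.
    have [b1 b2 b3 _] := model_bend hm kN htau hbr (hc k k1).
    exists (edge_at (vert p s k.+1) (c_ k.+1 *: tau k (om k.+1))).
    have [_ _ b4 b5 _] := b1; split=> //; last by apply: tchain_folding b2 b1 => //; apply: len_gt0.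
    have [ht e] := htau _ k1.
    rewrite -(weyl_scale _ _ ht); apply: (minimal_opposite (x := om k)) => //.
    - exact: (pdir_dom p_ok).
    - by move=> i; rewrite pairZ; apply: mulr_ge0; [exact: ltW (len_gt0 kN)|exact: (pdir_dom p_ok)].
    - move=> y hy; rewrite vertS in hv; have [t t0 ->] := edge_at_opposite hge hv hy.
      exists (t * c_ k); first by apply: mulr_ge0 => //; apply: ltW (len_gt0 k1).
      by rewrite e vertS scalerA.
    by rewrite (weyl_scale _ _ ht).
  exists tau; rewrite size_gal_of; split=> k kN; last exact: hbr.
  have [ht e] := htau _ kN; split=> //; rewrite edg_gal_of // vtx_gal_of 1?ltnW //.
  have [g hg] := hc k kN; have [hge _ _] := carries_facts kN hg.
  move=> y /(good_edge_ray hge)[t t0 ->]; exists ((t * c_ k) *: om k).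
    move=> i; rewrite pairZ; apply: mulr_ge0; last exact: (pdir_dom p_ok).
    by apply: mulr_ge0 => //; apply: ltW (len_gt0 kN).
  by rewrite (weyl_scale _ _ ht) e scalerA.
rewrite crossings_excess // => [|k kN]; last exact: (model_orbit hm).
rewrite target_gal_of big1 ?addr0 // => k _; have kN := ltn_ord k.
case: (eqVneq (t_ k.+1) 0) => [->|t0].
  by rewrite !defect_at_int ?subrr // => a; rewrite mul0r rpred0.
have kN' : (k.+1 < N)%N.
  by rewrite ltn_neqAle kN andbT; apply: contraNneq t0 => ->; rewrite time_end.
by have [_ ->] := hf _ kN' t0; rewrite subrr.
Qed.

Lemma gal_of_inj s s' : model p s -> model p s' -> gal_of s = gal_of s' -> s = s'.
Proof.
move=> [hs _ _] [hs' _ _] e; apply: (@eq_from_nth _ 0); rewrite hs ?hs' // => k kN.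
have h j : (j <= N)%N -> vert p s j = vert p s' j by move=> jN; rewrite -!vtx_gal_of // e.
have := h _ kN; rewrite !vertS h 1?ltnW // => /addrI /(scalerI (lt0r_neq0 (len_gt0 kN))).
by [].
Qed.

(** ** From galleries to folded paths *)

Lemma edge_point F v : is_edge D F -> exists2 y, F y & y != v.
Proof.
move=> [_ [U [hd _ hU]]]; apply: contrapT => h.
have e y : F y -> y = v by move=> Fy; apply/eqP/negPn/negP => ne; apply: h; exists y.
have := hU 0%VS; rewrite subv0 => h0; have /eqP e0 : U == 0%VS.
  by apply: h0 => x y /e -> /e ->; rewrite subrr mem0v.
by rewrite e0 dimv0 in hd.
Qed.

Lemma edge_good F v : is_edge D F -> F v -> is_vertex D v ->
  exists2 u, good_edge v u & F = edge_at v u.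
Proof.
move=> hF hv vv; have [y Fy yv] := edge_point v hF.
have e0 : v + (y - v) = y by rewrite addrC subrK.
have e : F = edge_at v (y - v).
  by rewrite /edge_at e0; apply: edge_mid => //; rewrite eq_sym.
exists (y - v) => //; split=> //; rewrite -?e ?e0 //.
by rewrite subr_eq0.
Qed.

Lemma sector_dir (tau : A -> A) (w : seq 'I_n) z x : weyl D tau ->
  Cplus S x -> Cplus S z -> tau x = word S w z -> x = z.
Proof.
move=> /weyl_word[L ->] hx hz e; have e1 : x = word S (rev L ++ w) z.
  by rewrite word_cat -e word_revK.
by rewrite e1; apply: dominant_unique => //; rewrite -e1.
Qed.

Section FromGallery.
Variable d : gallery R n.
Hypothesis d_LS : LS_galleries S (P N) gla d.

Lemma LS_size : size d.2 = N.
Proof. by case: d_LS => _ _ /gallery_typeP[]. Qed.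

Lemma LS_edge_carry k : (k < N)%N -> exists g, [/\ affine_weyl D g,
  g (P k) = vtx d k, g (P k.+1) = vtx d k.+1 & g @` edg gla k = edg d k].
Proof.
move=> kN; have [[_ _ hv he] _ /gallery_typeP[hs tv te] _ _] := d_LS.
rewrite hs in hv he; have [e1 e2 e3] := he k kN.
have fe : is_face D (edg gla k) by have [] := gla_edge kN.
have fd : is_face D (edg d k) by have [] := e1.
have [g hg eg] := (face_type_conj fe fd).1 (esym (te k kN)).
have [g' [hg' gK g'K]] := affine_weyl_inv hg.
have key j : (j <= N)%N -> edg gla k (P j) -> edg d k (vtx d j) -> g (P j) = vtx d j.
  move=> jN h1; rewrite -eg => -[x hx ex].
  have [u hu eu] := (face_type_conj (gla_vertex jN) (hv j jN)).1 (esym (tv j jN)).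
  rewrite image_set1 in eu.
  have eu' : u (P j) = vtx d j by have : [set u (P j)] (u (P j)) by []; rewrite eu.
  have := @conj_close_eq (P j) x (g' \o u).
  rewrite -ex => -> //; first by apply: affine_weyl_comp.
    by rewrite /= eu' -ex gK.
  by move=> a; rewrite gla_edgeE // in h1 hx; apply: face_close h1 hx.
exists g; split=> //; first by apply: key; [apply: ltnW|apply: gla_edge0|].
by apply: key => //; apply: gla_edge1.
Qed.

Definition LS_dirs : seq A :=
  mkseq (fun k => (c_ k)^-1 *: (vtx d k.+1 - vtx d k)) N.

Lemma LS_dirs_vert k : (k <= N)%N -> vert p LS_dirs k = vtx d k.
Proof.
elim: k => [_|k IH kN]; first by rewrite vert0; case: d_LS => _ <-.
rewrite vertS IH 1?ltnW // nth_mkseq // scalerA mulfV ?scale1r; first by rewrite addrC subrK.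
by rewrite gt_eqF ?len_gt0.
Qed.

Lemma LS_dirs_carries k : (k < N)%N ->
  exists2 g, carries LS_dirs k g & g @` edg gla k = edg d k.
Proof.
move=> kN; have [g [h1 h2 h3 h4]] := LS_edge_carry kN; exists g => //.
by split; rewrite ?LS_dirs_vert // ltnW.
Qed.

Lemma LS_gal_of : d = gal_of LS_dirs.
Proof.
apply: gal_eq; rewrite ?size_gal_of ?LS_size //; first by case: d_LS.
move=> k kN; rewrite vtx_gal_of // edg_gal_of // [vert _ _ k.+1]LS_dirs_vert //; split=> //.
by have [g hg <-] := LS_dirs_carries kN; have [_ -> _] := carries_facts kN hg.
Qed.

Local Notation s := LS_dirs.
Local Notation nu := (nth 0 LS_dirs).

Lemma LS_carries k : (k < N)%N -> exists g, carries s k g.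
Proof. by move=> kN; have [g hg _] := LS_dirs_carries kN; exists g. Qed.

Lemma LS_orbit k : (k < N)%N -> exists w, nu k = word S w (om k).
Proof.
move=> kN; have [g hg] := LS_carries kN; have [h1 _] := carries_line 1 kN hg.
have [/affine_weyl_aut[w [q [_ hw]]] h0 _] := hg; exists w; apply: (addrI (vert p s k)).
by rewrite -[nu k]scale1r -h1 -h0 !hw scale1r wordD addrAC.
Qed.

(** The sector containing an edge determines its dominant representative, so the sectors of
    the gallery already carry the fundamental coweights to the directions. *)
Lemma LS_tau : exists tau : nat -> A -> A,
  (forall k, (k < N)%N -> weyl D (tau k) /\ tau k (om k) = nu k) /\
  (forall k, (k.+1 < N)%N -> bruhat S (tau k.+1) (tau k)).
Proof.
have [_ _ _ [_ [tau [htau hbr]]] _] := d_LS; rewrite LS_size in htau hbr.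
exists tau; split=> // k kN; have [ht hE] := htau k kN; split=> //.
have [g hg] := LS_carries kN; have [hge _ _] := carries_facts kN hg.
have hv : edg d k (vert p s k.+1).
  by rewrite LS_gal_of edg_gal_of // vertS; case: hge.
have [x hx] := hE _ hv; rewrite -LS_dirs_vert 1?ltnW // vertS => /addrI ex.
have [w hw] := LS_orbit kN; have hd : Cplus S (om k) by apply: (pdir_dom p_ok).
have hc : Cplus S (c_ k *: om k).
  by move=> i; rewrite pairZ; apply: mulr_ge0 => //; apply: ltW (len_gt0 kN).
have e : x = c_ k *: om k by apply: (@sector_dir (tau k) w) => //; rewrite ex hw wordZ.
have := ex; rewrite e (weyl_scale _ _ ht) => /(scalerI (lt0r_neq0 (len_gt0 kN))).
by [].
Qed.

Lemma scaled_chain v t (y z : A) c : 0 < c ->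
  (forall b, pair b v - t * pair b (c *: y) \is a Num.int) ->
  clos_refl_trans A (fun x x' => exists b, [/\ pos b, pair b x < 0,
        pair b v \is a Num.int & x' = refl b x]) y z ->
  tchain t (c *: y) (c *: z) /\ forall b, pair b v - t * pair b (c *: z) \is a Num.int.
Proof.
move=> c0 hi h; elim: h hi => [x x' [b [pb hb hv ->]]|x|x1 x2 x3 _ IH1 _ IH2] hi.
- have hbi : t * pair b (c *: x) \is a Num.int.
    have -> : t * pair b (c *: x) = pair b v - (pair b v - t * pair b (c *: x)) by ring.
    exact: rpredB.
  have ch : tchain t (c *: x) (c *: refl b x).
    by apply: rt_step; exists b; split=> //; rewrite ?pairZ ?pmulr_rlt0 // -?pairZ // reflZ.
  split=> // a; have := tchain_int a ch => h5.
  have -> : pair a v - t * pair a (c *: refl b x) = pair a v - t * pair a (c *: x) +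
     (t * pair a (c *: x) - t * pair a (c *: refl b x)) by ring.
  exact: rpredD.
- by split=> //; apply: rt_refl.
have [h1 h2] := IH1 hi; have [h3 h4] := IH2 h2; split=> //; exact: rt_trans h1 h3.
Qed.

(** At an interior vertex of a fundamental gallery the unfolded edge of a minimal pair
    continues the incoming one, by dominance. *)
Lemma LS_chain k : (k.+1 < N)%N -> t_ k.+1 != 0 -> tchain (t_ k.+1) (nu k) (nu k.+1).
Proof.
move=> kN t0; have k1 := ltnW kN; have [_ _ _ [hpf _] _] := d_LS.
have [F0 [hF0 F0v [tau ht [hE hF]] hfold]] : positively_folded_at S (edg d k) (vtx d k.+1) (edg d k.+1).
  by apply: hpf; rewrite LS_size.
rewrite -LS_dirs_vert // in hF0 F0v hE hF hfold; set v := vert p s k.+1 in F0v hE hF hfold.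
have hv : is_vertex D v by apply: (carries_vertex LS_carries).
have [u0 g0 eF0] := edge_good hF0 F0v hv.
have [u' [L [g1 eF' eu' hch]]] := folding_tchain g0 eF0 hfold.
have [gk hgk] := LS_carries kN; have [hge1 _ _] := carries_facts kN hgk.
have [c0 c1] : 0 < c_ k /\ 0 < c_ k.+1 by split; apply: len_gt0.
have e1 : edg d k.+1 = edge_at v (c_ k.+1 *: nu k.+1) by rewrite {1}LS_gal_of edg_gal_of.
have hd j : (j < N)%N -> Cplus S (om j) by move=> jN; apply: (pdir_dom p_ok).
have [_ _ _ /(_ _ k1) hp _] := p_ok.
have eom : om k.+1 = om k by case: hp => [[e]|[]] //; rewrite e eqxx in t0.
have [w1 hw1] := LS_orbit kN; have [w0 hw0] := LS_orbit k1; rewrite eom in hw1.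
(* The outgoing direction is a positive multiple of the fully folded edge. *)
have [kap kap0 ekap] : exists2 kap, 0 < kap & nu k.+1 = kap *: u'.
  have : edge_at v u' (v + c_ k.+1 *: nu k.+1) by rewrite -eF' e1; case: hge1.
  move=> /(good_edge_ray g1)[t t_ge /addrI et].
  have tn : t != 0.
    apply/eqP => tz; rewrite tz scale0r in et; have [_] := hge1.
    by rewrite et eqxx.
  exists ((c_ k.+1)^-1 * t); first by rewrite mulr_gt0 ?invr_gt0 // lt_def tn.
  by rewrite -scalerA -et scalerA mulVf ?scale1r ?gt_eqF.
(* The reversed incoming edge and the unfolded outgoing edge have opposite sectors, and
   their directions are conjugate up to scaling, so they are proportional. *)
have [z0 dz0 ez0] : exists2 z0, Cplus S z0 & u0 = - tau z0.
  have := hF (v + u0); rewrite eF0; have [_ _ _ _ h] := g0 => /(_ h)[z0 dz0 /addrI <-].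
  by exists z0.
have [z1 dz1 ez1] : exists2 z1, Cplus S z1 & c_ k *: nu k = - tau z1.
  have : edg d k (vtx d k).
    by have [[_ _ _ he] _ _ _ _] := d_LS; have [] := he k; rewrite ?LS_size.
  rewrite -LS_dirs_vert 1?ltnW // => /hE[z1 dz1]; rewrite /v vertS -addrA => e2.
  exists z1 => //; apply/eqP; rewrite -addr_eq0; apply/eqP/(addrI (vert p s k)).
  by rewrite e2 addr0.
have [L0 hL0] := weyl_word ht.
have ez : (c_ k * kap) *: z0 = z1.
  apply: (@sector_dir tau (rev L ++ w1 ++ rev w0 ++ L0)) => //.
    by move=> i; rewrite pairZ; apply: mulr_ge0; [apply: ltW; apply: mulr_gt0|apply: dz0].
  have eA : tau z1 = - (c_ k *: word S w0 (om k)) by rewrite -hw0 ez1 opprK.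
  have eB : tau ((c_ k * kap) *: z0) = - (c_ k *: word S (rev L) (nu k.+1)).
    by rewrite ekap eu' wordZ word_revK ez0 (weyl_scale _ _ ht) !scalerN opprK scalerA.
  rewrite eB !word_cat -hL0 eA !word_opp !wordZ word_revK -hw1.
  by [].
have enu : nu k = kap *: u0.
  apply: (scalerI (lt0r_neq0 c0)); rewrite ez1 -ez (weyl_scale _ _ ht) ez0 !scalerN.
  by rewrite scalerA.
rewrite ekap enu; apply: (proj1 (@scaled_chain v _ _ _ _ kap0 _ hch)) => b.
rewrite -enu; exact: (carries_int_next _ kN t0 (LS_carries k1)).
Qed.

Lemma LS_model : model p s.
Proof.
split; [exact: size_mkseq| |exact: LS_tau].
have hterm (k : 'I_N) : defect (t_ k.+1) (nu k) - defect (t_ k.+1) (nu k.+1) <= 0.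
  have kN := ltn_ord k; rewrite subr_le0; case: (eqVneq (t_ k.+1) 0) => [->|t0].
    by rewrite !defect_at_int // => a; rewrite mul0r rpred0.
  apply: defect_chain; apply: LS_chain => //.
  by rewrite ltn_neqAle kN andbT; apply: contraNneq t0 => ->; rewrite time_end.
have [_ _ _ _ hcr] := d_LS; have := crossings_excess LS_orbit LS_carries.
rewrite -LS_gal_of hcr target_vtx LS_size LS_dirs_vert // => /esym/eqP.
rewrite -subr_eq0 addrAC subrr add0r -oppr_eq0 -sumrN psumr_eq0 => [|k _]; last first.
  by rewrite oppr_ge0.
move=> /allP h k kN t0; have k1 := ltnW kN; split; first exact: LS_chain.
have := h (Ordinal k1) (mem_index_enum _); rewrite /= oppr_eq0 subr_eq0 => /eqP.
by [].
Qed.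

End FromGallery.

Lemma LS_galleriesE : LS_galleries S (P N) gla = gal_of @` [set s | model p s].
Proof.
apply/seteqP; split=> [d hd|_ [s hs <-]]; last exact: gal_of_LS.
by exists (LS_dirs d); [exact: LS_model|rewrite -LS_gal_of].
Qed.

End Correspondence.

End LSGalleries.

(** * From the Casimir equation to the character formula *)

Section CharacterFormula.
Implicit Types (a b : Phi D) (x y z : A).
Local Notation r := (rho_v).
Implicit Types (F G : A -> R) (l : seq (Phi D)).

(** Multiplication by [1 - e^(-a)], on functions of the exponent. *)
Definition diff a F : A -> R := fun y => F y - F (y + coroot a).
Definition diffs l F : A -> R := foldr diff F l.

Lemma diffs_lin l c F G x :
  diffs l (fun y => c * F y + G y) x = c * diffs l F x + diffs l G x.
Proof. by elim: l x => // a l IH x; rewrite /= /diff !IH; ring. Qed.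

Lemma diffs_ext l F G : F =1 G -> diffs l F =1 diffs l G.
Proof. by move=> /funext ->. Qed.

Lemma diffsD l F G x : diffs l (fun y => F y + G y) x = diffs l F x + diffs l G x.
Proof. by rewrite -[in RHS](mul1r (diffs l F x)) -diffs_lin; apply: diffs_ext => y; rewrite mul1r. Qed.

Lemma diffs0 l x : diffs l (fun=> 0) x = 0.
Proof. by elim: l x => // a l IH x; rewrite /= /diff !IH subrr. Qed.

Lemma diffsZ l c F x : diffs l (fun y => c * F y) x = c * diffs l F x.
Proof.
rewrite -[RHS]addr0 -(diffs0 l x) -diffs_lin; apply: diffs_ext => y.
by rewrite addr0.
Qed.

Lemma diffsB l F G x : diffs l (fun y => F y - G y) x = diffs l F x - diffs l G x.
Proof.
rewrite addrC -[X in X + _]mulN1r -diffs_lin; apply: diffs_ext => y.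
by rewrite mulN1r addrC.
Qed.

Lemma diffs_sum l (I : Type) (s : seq I) (P : pred I) (F : I -> A -> R) x :
  diffs l (fun y => \sum_(i <- s | P i) F i y) x = \sum_(i <- s | P i) diffs l (F i) x.
Proof.
elim: s => [|i s IH].
  by rewrite big_nil -[RHS](diffs0 l x); apply: diffs_ext => y; rewrite big_nil.
rewrite big_cons -IH; case: ifP => h; last by apply: diffs_ext => y; rewrite big_cons h.
by rewrite -diffsD; apply: diffs_ext => y; rewrite big_cons h.
Qed.

Lemma diffs_shift l F z x : diffs l (fun y => F (y + z)) x = diffs l F (x + z).
Proof. by elim: l x => // a l IH x; rewrite /= /diff !IH addrAC. Qed.

Lemma diffs_diff l a F x : diffs l (diff a F) x = diff a (diffs l F) x.
Proof.
rewrite /diff diffsB; congr (_ - _).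
by rewrite -(diffs_shift l F (coroot a)).
Qed.

Lemma diffs_cat l l' F x : diffs (l ++ l') F x = diffs l (diffs l' F) x.
Proof. by elim: l x => //= a l IH x; rewrite /diff !IH. Qed.

Lemma diffs_catC l l' F x : diffs (l ++ l') F x = diffs (l' ++ l) F x.
Proof.
elim: l' x => [|a l' IH] x; first by rewrite cats0.
rewrite diffs_cat /= (_ : diffs l _ x = diff a (diffs l (diffs l' F)) x); last exact: diffs_diff.
by rewrite /diff -!diffs_cat !IH.
Qed.

Lemma diffs_perm l l' F x : perm_eq l l' -> diffs l F x = diffs l' F x.
Proof.
elim: l l' x => [|a l IH] l' x h; first by have /nilP -> : nilp l' by rewrite /nilp -(perm_size h).
have al : a \in l' by rewrite -(perm_mem h) inE eqxx.
move: h; case/splitPr: al => l1 l2; rewrite perm_sym perm_catC /= perm_cons perm_catC => h.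
have e y : diffs l F y = diffs (l1 ++ l2) F y by apply: IH; rewrite perm_sym.
transitivity (diff a (diffs (l2 ++ l1) F) x); last by rewrite diffs_catC.
by rewrite /= /diff !e !(diffs_catC l1).
Qed.

Lemma diffs_refl b l F x : diffs l (fun y => F (refl b y)) x =
  diffs [seq root_refl b a | a <- l] F (refl b x).
Proof.
by elim: l x => // a l IH x; rewrite /= /diff !IH reflD coroot_root_refl.
Qed.

Lemma form_coroot_rho a : pos a -> 0 < form (coroot a) r.
Proof.
move=> pa; have := form_coroot a r; have := form_coroot_gt0 a; have := pos_rho_gt0 pa; nra.
Qed.

Lemma diffs_vanish l F h : all pos l -> (forall y, h <= form y r -> F y = 0) ->
  forall x, h <= form x r -> diffs l F x = 0.
Proof.
move=> + hF; elim: l => [|a l IH] /=; first by move=> _; apply: hF.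
move=> /andP[pa pl] x hx; rewrite /diff !IH ?subrr // formDl.
by apply: le_trans hx _; rewrite lerDl ltW // form_coroot_rho.
Qed.

(** All other terms of the product are taken at strictly higher points. *)
Lemma diffs_top l F x : all pos l -> (forall y, form x r < form y r -> F y = 0) ->
  diffs l F x = F x.
Proof.
move=> + hF; elim: l => [|a l IH] //= /andP[pa pl]; rewrite /diff IH //.
have ha := form_coroot_rho pa; rewrite (@diffs_vanish l F (form (x + coroot a) r)) ?subr0 //.
by move=> y; rewrite formDl => h; apply: hF; lra.
Qed.

Lemma diffs_support l F x : all pos l -> diffs l F x != 0 ->
  exists2 l', all pos l' & F (x + \sum_(a <- l') coroot a) != 0.
Proof.
elim: l x => [|a l IH] x /=; first by exists [::]; rewrite ?big_nil ?addr0.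
move=> /andP[pa pl]; rewrite /diff subr_eq0; case: (eqVneq (diffs l F x) 0) => [-> h|h _].
  rewrite eq_sym in h; have [l' h1 h2] := IH _ pl h; exists (a :: l'); rewrite /= ?pa //.
  by rewrite big_cons addrA.
exact: IH.
Qed.

Definition posl : seq (Phi D) := [seq a <- enum (Phi D) | pos a].

Lemma all_posl : all pos posl.
Proof. exact: filter_all. Qed.

Lemma mem_posl a : (a \in posl) = pos a.
Proof. by rewrite mem_filter mem_enum andbT. Qed.

Lemma posl_uniq : uniq posl.
Proof. by rewrite filter_uniq // enum_uniq. Qed.

Lemma posl_simple i : exists2 l, perm_eq posl (S i :: l) &
  perm_eq [seq root_refl (S i) a | a <- l] l.
Proof.
have h : perm_eq posl (S i :: rem (S i) posl) by apply: perm_to_rem; rewrite mem_posl posS.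
exists (rem (S i) posl) => //.
have inj : injective (root_refl (S i)) := inv_inj (root_reflK R (S i)).
have ml a : (a \in rem (S i) posl) = (a != S i) && pos a.
  by rewrite mem_rem_uniq ?posl_uniq // inE mem_posl.
apply: uniq_perm; rewrite ?map_inj_uniq ?rem_uniq ?posl_uniq // => a.
have key c : c \in rem (S i) posl -> root_refl (S i) c \in rem (S i) posl.
  rewrite !ml => /andP[ci pc]; rewrite pos_refl_simple // andbT.
  apply/eqP => e; move: pc; rewrite -(root_reflK R (S i) c) e root_refl_diag pos_opp posS.
  by [].
apply/seq.mapP/idP => [[c hc ->]|ha]; first exact: key.
by exists (root_refl (S i) a); [exact: key|rewrite root_reflK].
Qed.

(** The Weyl denominator [e^rho prod (1 - e^(-a))], paired with a function. *)
Definition denom F : R := diffs posl F (- r).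

Lemma refl_rho i : refl (S i) r = r - coroot (S i).
Proof. by rewrite /refl pairS_rho scale1r. Qed.

Lemma denom_refl i F : denom (fun x => F (refl (S i) x)) = - denom F.
Proof.
have [l h1 h2] := posl_simple i; rewrite /denom !(diffs_perm _ _ h1) /= /diff.
rewrite !diffs_refl !(diffs_perm _ _ h2) reflD reflN refl_rho opprB opprB.
rewrite (_ : refl (S i) (coroot (S i)) = - coroot (S i)); last first.
  by rewrite /refl pair_coroot_diag; apply/rowP => j; rewrite !mxE; ring.
rewrite [coroot (S i) - r]addrC addrK.
by [].
Qed.

Lemma sum_posl : \sum_(a <- posl) coroot a = 2 *: r.
Proof.
apply: pairS_inj => i; rewrite pairZ pairS_rho mulr1.
have [l h1 h2] := posl_simple i; rewrite (perm_big _ h1) big_cons pairD pair_coroot_diag.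
set z := \sum_(a <- l) _; suff e : refl (S i) z = z.
  by have := pair_refl (S i) z; rewrite e; lra.
rewrite refl_sum /z -[RHS](perm_big _ h2) big_map; apply: eq_bigr => a _.
by rewrite coroot_root_refl.
Qed.

Lemma rho_stab w : word S w r = r -> wmx w = 1%:M.
Proof.
move=> hw; apply: (wmx_inj (t := [::])); have [k] := ubnP (size w).
elim: k w hw => // k IH [|i w] // hw; rewrite ltnS /= => hs x.
have e : word S w r = refl (S i) r by have := congr1 (refl (S i)) hw; rewrite word_cons reflK.
have hneg : pair (S i) (word S w r) < 0 by rewrite e pair_refl pairS_rho; lra.
have [w' hs' hw'] := exchange (posS i) hneg.
rewrite -[LHS]/(word S (i :: w) x) word_cons hw'; apply: IH; last by rewrite hs' in hs; apply: ltnW.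
by rewrite -hw' -word_cons.
Qed.

Definition regular x := forall i, 0 < pair (S i) x.

Lemma regular_dom x : regular x -> Cplus S x.
Proof. by move=> h i; apply: ltW. Qed.

Lemma rho_regular : regular r.
Proof. by move=> i; rewrite pairS_rho. Qed.

Lemma regular_pos x a : regular x -> pos a = (0 < pair a x).
Proof.
move=> hx; have key c : pos c -> 0 < pair c x.
  move=> pc; have [d hd] := pos_comb pc; have := pos_rho_gt0 pc; rewrite !hd => h.
  rewrite lt_def sumr_ge0 ?andbT => [|i _]; last by rewrite mulr_ge0 ?ler0n // ltW.
  rewrite psumr_eq0 => [|i _]; last by rewrite mulr_ge0 ?ler0n // ltW.
  apply/negP => /allP h0; have : \sum_i (d i)%:R * pair (S i) r = 0.
    apply: big1 => i _; have := h0 i (mem_index_enum _).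
    by rewrite /= mulf_eq0 [pair _ x == 0]gt_eqF // orbF => /eqP ->; rewrite mul0r.
  by move=> e; rewrite e ltxx in h.
apply/idP/idP => [/key //|h]; apply/negPn/negP => na.
by have := key (opp_root a); rewrite pos_opp na pair_opp => /(_ isT); lra.
Qed.

Lemma regular_stab w x : regular x -> word S w x = x -> wmx w = 1%:M.
Proof.
move=> hx hw; apply: rho_stab; apply: dominant_unique; first exact: rho_dom.
move=> i; have [b hb] := word_root w (S i); rewrite -hb.
by apply: ltW; rewrite -pos_rho (regular_pos b hx) hb hw; apply: hx.
Qed.

Lemma antisymmetric_eq0 F : (forall i y, F (refl (S i) y) = - F y) ->
  (forall y, regular y -> F y = 0) -> forall y, F y = 0.
Proof.
move=> hF h0 y; have [w hw _] := dominant_conj y.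
have e : F (word S w y) = 0.
  case: (pselect (regular (word S w y))) => [/h0 //|nr].
  have [i hi] : exists i, pair (S i) (word S w y) = 0.
    apply: contrapT => h; apply: nr => i; rewrite lt_def hw andbT.
    by apply/eqP => e; apply: h; exists i.
  by have := hF i (word S w y); rewrite refl_fix //; lra.
have h w' z : F (word S w' z) = 0 -> F z = 0.
  by elim: w' => // i w' IH; rewrite word_cons hF => /eqP; rewrite oppr_eq0 => /eqP /IH.
exact: h e.
Qed.

Section WeylGroup.
Variable Ws : seq 'M[R]_n.
Hypothesis Ws_uniq : uniq Ws.
Hypothesis Ws_mem : forall M, M \in Ws <-> exists w, M = wmx w.

Lemma Ws_refl_last i : perm_eq [seq M *m refmx (S i) | M <- Ws] Ws.
Proof.
have inv : involutive (fun M : 'M[R]_n => M *m refmx (S i)).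
  by move=> M; rewrite -mulmxA refmxK mulmx1.
have hcl M : M \in Ws -> M *m refmx (S i) \in Ws.
  by move=> /Ws_mem[w ->]; apply/Ws_mem; exists (i :: w).
apply: uniq_perm => //; first by rewrite map_inj_uniq //; apply: inv_inj inv.
move=> M; apply/seq.mapP/idP => [[M' M'W ->]|MW]; first exact: hcl.
by exists (M *m refmx (S i)); [exact: hcl | rewrite inv].
Qed.

Lemma sgn_refl_last i M : M \in Ws -> sgn (M *m refmx (S i)) = - sgn M.
Proof.
by move=> /Ws_mem[w ->]; rewrite -[_ *m _]/(wmx (i :: w)) !sgn_wmx exprS mulN1r.
Qed.

(** The alternating sum over the Weyl group, paired with a function. *)
Definition alt z F : R := \sum_(M <- Ws) (sgn M)%:~R * F (- (z *m M)).

Lemma alt_refl i z F : alt z (fun x => F (refl (S i) x)) = - alt z F.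
Proof.
rewrite /alt -[in RHS](perm_big _ (Ws_refl_last i)) big_map /= -sumrN.
rewrite big_seq [RHS]big_seq; apply: eq_bigr => M MW.
by rewrite sgn_refl_last // rmorphN mulNr opprK mulmxA mul_refmx reflN.
Qed.

Lemma alt_regular z y F : regular z -> regular y ->
  alt z (fun x => (x == - y)%:R) = (y == z)%:R.
Proof.
move=> hz hy; case: (eqVneq y z) => [->|ne].
  have W1 : 1%:M \in Ws by apply/Ws_mem; exists [::].
  rewrite /alt (bigD1_seq 1%:M) //= mulmx1 eqxx mulr1 big_seq_cond big1 => [|M]; last first.
    move=> /andP[/Ws_mem[w ->] ne]; rewrite mul_wmx eqr_opp; case: eqP => [e|_]; last by rewrite mulr0.
    by rewrite (regular_stab hz e) eqxx in ne.
  by rewrite addr0 -[1%:M]/(wmx [::]) sgn_wmx.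
rewrite /alt big_seq big1 // => M /Ws_mem[w ->]; rewrite mul_wmx eqr_opp.
case: eqP => [e|_]; last by rewrite mulr0.
case/eqP: ne; rewrite -e; apply/dominant_unique; first exact: regular_dom.
by rewrite e; apply: regular_dom.
Qed.

Definition delta z : A -> R := fun x => (x == z)%:R.

Lemma delta_refl i z : delta (- refl (S i) z) = fun x => delta (- z) (refl (S i) x).
Proof.
apply/funext => x; rewrite /delta -reflN -(inj_eq (inv_inj (reflK (S i)))) reflK.
by [].
Qed.

Lemma denom_delta z : regular z -> denom (delta (- z)) = (z == r)%:R.
Proof.
move=> hz; case: (eqVneq z r) => [->|ne].
  rewrite /denom diffs_top ?all_posl // /delta ?eqxx // => y; case: eqP => // ->.
  by rewrite ltxx.
apply/eqP/negPn/negP => /(diffs_support all_posl)[l hl].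
rewrite /delta; case: (eqVneq (- r + _) (- z)) => [e _|_]; last by rewrite eqxx.
set be := \sum_(a <- l) coroot a in e; have ez : z = r - be.
  by rewrite -[z]opprK -e opprD opprK.
have hd : Cplus S (z - r).
  move=> i; rewrite pairB pairS_rho subr_ge0.
  have zi : pair (S i) z \is a Num.int.
    by rewrite ez pairB pairS_rho rpredB ?rpred1 // pair_coroots_int.
  by have := lt_int1 (rpred0 _) zi (hz i); rewrite add0r.
have h0 : 0 <= form be (z - r).
  have f0 : form 0 (z - r) = 0 by rewrite -(scale0r (0 : A)) formZl mul0r.
  rewrite /be (big_morph (fun u => form u (z - r)) (fun z1 z2 => formDl z1 z2 _) f0).
  rewrite big_seq sumr_ge0 // => a al; apply: form_pos_ge0 => //.
  by have /allP := hl; apply.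
have e2 : z - r = - be by rewrite ez addrAC subrr add0r.
have : form be be = 0.
  by apply: le_anti; rewrite form_ge0 andbT; move: h0; rewrite e2 formC formNl; lra.
by move=> /form_eq0 b0; case/eqP: ne; rewrite ez b0 subr0.
Qed.

Lemma fin_expand (s : seq A) F : uniq s -> (forall x, F x != 0 -> x \in s) ->
  F = fun x => \sum_(z <- s) F z * delta z x.
Proof.
move=> us hs; apply/funext => x; case: (boolP (x \in s)) => xs.
  rewrite (bigD1_seq x) //= /delta eqxx mulr1 big1 ?addr0 // => z zx.
  by rewrite eq_sym (negPf zx) mulr0.
rewrite big_seq big1 => [|z zs]; first by apply/eqP/negPn/negP => /hs; rewrite (negPf xs).
by rewrite /delta; case: eqP => [e|_]; [rewrite e zs in xs|rewrite mulr0].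
Qed.

(** Weyl's denominator formula: both sides are antisymmetric, and they agree on
    regular dominant exponents. *)
Lemma denominator F : (exists s : seq A, forall x, F x != 0 -> x \in s) -> denom F = alt r F.
Proof.
have base z : denom (delta (- z)) = alt r (delta (- z)).
  apply/eqP; rewrite -subr_eq0; apply/eqP; move: z; apply: antisymmetric_eq0 => [i z|z hz].
    by rewrite delta_refl denom_refl alt_refl opprB opprK addrC.
  by rewrite denom_delta // alt_regular ?subrr //; apply: rho_regular.
move=> [s hs]; have hu : forall x, F x != 0 -> x \in undup s by move=> x /hs; rewrite mem_undup.
rewrite (fin_expand (undup_uniq s) hu) /denom diffs_sum /alt.
under [RHS]eq_bigr do rewrite mulr_sumr.
rewrite exchange_big; apply: eq_bigr => z _; rewrite diffsZ.
have := base (- z); rewrite opprK /denom => ->; rewrite /alt mulr_sumr.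
by apply: eq_bigr => M _; rewrite mulrCA.
Qed.

Lemma alt_diffs F y : (exists s : seq A, forall x, F x != 0 -> x \in s) ->
  alt r (fun x => F (x + y)) = diffs posl F (y - r).
Proof.
move=> [s hs]; rewrite -denominator; first by rewrite /denom diffs_shift addrC.
exists [seq z - y | z <- s] => x /hs h; apply/seq.mapP.
by exists (x + y); rewrite // addrK.
Qed.

(** ** The character formula *)

Section Character.
Variables (B : A -> A -> R) (kap : Phi D -> R).
Hypothesis B_sym : forall x y, B x y = B y x.
Hypothesis B_lin : forall c x y z, B (c *: x + y) z = c * B x z + B y z.
Hypothesis B_def : forall x, B x x = 0 -> x = 0.
Hypothesis kap_gt0 : forall a, 0 < kap a.
Hypothesis B_coroot : forall x a, B x (coroot a) = kap a * pair a x.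
Variables (F : A -> R) (T : Phi D -> A -> R) (la : A).
Hypothesis la_dom : Cplus S la.
Hypothesis F_la : F la = 1.
Hypothesis F_le : forall x, F x != 0 -> exists2 l, all pos l & x = la - \sum_(a <- l) coroot a.
Hypothesis F_refl : forall a x, F (refl a x) = F x.
Hypothesis F_fin : exists s : seq A, forall x, F x != 0 -> x \in s.
Hypothesis F_casimir : forall x, (B la la + \sum_(a | pos a) B la (coroot a)) * F x =
  B x x * F x + \sum_(a | pos a) (T a x *+ 2 + B x (coroot a) * F x).
Hypothesis T_shift : forall a x,
  T a x = T a (x + coroot a) + B (x + coroot a) (coroot a) * F (x + coroot a).

Lemma BDl x y z : B (x + y) z = B x z + B y z.
Proof. by rewrite -{1}(scale1r x) B_lin mul1r. Qed.
Lemma B0l z : B 0 z = 0.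
Proof. by have := BDl 0 0 z; rewrite addr0; lra. Qed.
Lemma BZl c x z : B (c *: x) z = c * B x z.
Proof. by rewrite -[c *: x]addr0 B_lin B0l addr0. Qed.
Lemma BNl x z : B (- x) z = - B x z.
Proof. by rewrite -scaleN1r BZl mulN1r. Qed.
Lemma BBl x y z : B (x - y) z = B x z - B y z.
Proof. by rewrite BDl BNl. Qed.
Lemma BBr x y z : B z (x - y) = B z x - B z y.
Proof. by rewrite B_sym BBl !(B_sym z). Qed.
Lemma BDr x y z : B z (x + y) = B z x + B z y.
Proof. by rewrite B_sym BDl !(B_sym z). Qed.
Lemma BZr c x z : B z (c *: x) = c * B z x.
Proof. by rewrite B_sym BZl B_sym. Qed.
Lemma B_suml (I : Type) (s : seq I) (P : pred I) (f : I -> A) z :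
  B (\sum_(i <- s | P i) f i) z = \sum_(i <- s | P i) B (f i) z.
Proof. exact: (big_morph (fun x => B x z) (fun x y => BDl x y z) (B0l z)). Qed.

Lemma B_refl a x y : B (refl a x) (refl a y) = B x y.
Proof.
rewrite /refl !BBl !BBr !BZl !BZr !(B_sym (coroot a)) !B_coroot pair_coroot_diag.
ring.
Qed.

Lemma B_word w x y : B (word S w x) (word S w y) = B x y.
Proof. by elim: w => // i w IH; rewrite !word_cons B_refl. Qed.

(** The mixed term of the Leibniz rule for the Laplacian, computed one factor of the
    product at a time. *)
Lemma mixed_term l x :
  diffs l (fun z => B x z * F z) x - diffs l (fun z => B z z * F z) x =
  \sum_(a <- l) diffs l (T a) x.
Proof.
elim: l x => [|a l IH] x; first by rewrite big_nil subrr.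
have e1 : diffs l (fun z => B x z * F z) (x + coroot a) =
    diffs l (fun z => B (x + coroot a) z * F z) (x + coroot a)
    - diffs l (fun z => B (coroot a) z * F z) (x + coroot a).
  rewrite -diffsB; apply: diffs_ext => z; rewrite BDl; ring.
have e2 : diffs l (fun z => B (coroot a) z * F z) (x + coroot a) = diff a (diffs l (T a)) x.
  rewrite -diffs_diff -diffs_shift; apply: diffs_ext => z.
  by rewrite /diff {1}T_shift [B (coroot a) _]B_sym; ring.
rewrite big_cons /= /diff e1 e2 -/(diff a (diffs l (T a)) x) sumrB.
rewrite /diff -!IH; ring.
Qed.

Definition weyl_sum y : R := alt r (fun x => F (x + y)).

Lemma weyl_sum_diffs y : weyl_sum y = diffs posl F (y - r).
Proof. exact: alt_diffs. Qed.

Lemma rho_B x : \sum_(a | pos a) B x (coroot a) = 2 * B x r.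
Proof.
rewrite -BZr -sum_posl B_sym B_suml big_filter big_enum_cond.
by apply: eq_bigr => a _; rewrite B_sym.
Qed.

(** The Casimir equation says that the multiplicity function is an eigenfunction of a second
    order operator.  Multiplied by the denominator, its first order part is absorbed in
    the shift by [rho], and what remains is the Laplacian. *)
Lemma weyl_sum_eigen y : B y y * weyl_sum y = B (la + r) (la + r) * weyl_sum y.
Proof.
pose G z := (- B z z + 2 * B y z + B r r) * F z.
have e1 : B y y * weyl_sum y = alt r (fun x => G (x + y)).
  rewrite /weyl_sum /alt mulr_sumr big_seq [RHS]big_seq; apply: eq_bigr => M /Ws_mem[w ->].
  rewrite mulrCA; congr (_ * _); rewrite /G mul_wmx; congr (_ * _).
  set z := - word S w r + y; have h : B (y - z) (y - z) = B r r.
    by rewrite (_ : y - z = word S w r) ?B_word // /z opprD opprK addrCA subrr addr0.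
  by rewrite BBl !BBr (B_sym z y) in h; lra.
rewrite e1 alt_diffs; last first.
  have [s hs] := F_fin; exists s => z hz; apply: hs; apply: contraNneq hz => e.
  by rewrite /G e mulr0.
rewrite weyl_sum_diffs; set x := y - r.
have eG : diffs posl G x = - diffs posl (fun z => B z z * F z) x
   + 2 * diffs posl (fun z => B x z * F z) x + 2 * diffs posl (fun z => B r z * F z) x
   + B r r * diffs posl F x.
  rewrite -[X in X + _ + _ + _]mulN1r -!diffsZ -!diffsD; apply: diffs_ext => z.
  have ey : B y z = B x z + B r z by rewrite -BDl /x subrK.
  by rewrite /G ey; ring.
have eC : (B la la + 2 * B la r) * diffs posl F x = diffs posl (fun z => B z z * F z) x +
    2 * \sum_(a <- posl) diffs posl (T a) x + 2 * diffs posl (fun z => B r z * F z) x.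
  rewrite -!diffsZ -diffs_sum -diffsZ -!diffsD; apply: diffs_ext => z.
  rewrite -rho_B F_casimir big_split /= -mulr_suml rho_B.
  rewrite [\sum_(i <- posl) _]big_filter big_enum_cond /= (B_sym z r) mulr_sumr.
  have -> : \sum_(i | pos i) T i z *+ 2 = \sum_(i | pos i) 2 * T i z.
    by apply: eq_bigr => a _; rewrite mulr_natl.
  ring.
have := mixed_term posl x; rewrite eG => hm.
rewrite !BDl !BDr (B_sym r la); nra.
Qed.

Lemma weyl_sum_refl i y : weyl_sum (refl (S i) y) = - weyl_sum y.
Proof.
rewrite /weyl_sum -(alt_refl i); congr (alt r _); apply/funext => x.
by rewrite -[in LHS](F_refl (S i)) reflD reflK.
Qed.

Lemma B_cone_ge0 (c : 'I_n -> R) l y : (forall i, 0 <= c i) -> all pos l -> Cplus S y ->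
  0 <= B (\sum_(a <- l) coroot a) y /\ 0 <= B (\sum_i c i *: coroot (S i)) y.
Proof.
move=> c0 hl hy; split; rewrite B_suml.
  rewrite big_seq sumr_ge0 // => a al; rewrite B_sym B_coroot; have /allP/(_ _ al) pa := hl.
  by apply: mulr_ge0; [exact: ltW|exact: (pos_ge0 pa hy)].
apply: sumr_ge0 => i _; rewrite BZl B_sym B_coroot; apply: mulr_ge0 => //.
by apply: mulr_ge0; [exact: ltW|exact: hy].
Qed.

Lemma rho_word_cone w : exists c : 'I_n -> R, (forall i, 0 <= c i) /\
  r = word S w r + \sum_i c i *: coroot (S i).
Proof.
have [s hs [c [c0 e]]] := dominant_conj_cone (word S w r); exists c; split=> //.
rewrite -e -word_cat; apply/esym/dominant_unique; first exact: rho_dom.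
by rewrite word_cat.
Qed.

Lemma weyl_sum_support y : weyl_sum y != 0 -> exists (l : seq (Phi D)) (w : seq 'I_n) (c : 'I_n -> R),
  [/\ all pos l, forall i, 0 <= c i, r = word S w r + \sum_i c i *: coroot (S i)
    & la + r - y = \sum_(a <- l) coroot a + \sum_i c i *: coroot (S i)].
Proof.
move=> h; have [M MW hM] : exists2 M, M \in Ws & F (- (r *m M) + y) != 0.
  apply: contrapT => hn; move/eqP: h; apply; rewrite /weyl_sum /alt big_seq big1 // => M MW.
  case: (eqVneq (F (- (r *m M) + y)) 0) => [->|ne]; first by rewrite mulr0.
  by case: hn; exists M.
have [w eM] := (Ws_mem M).1 MW; have [l hl el] := F_le hM; have [c [c0 ec]] := rho_word_cone w.
exists l, w, c; split=> //; rewrite eM mul_wmx in el.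
have -> : \sum_(a <- l) coroot a = la - (- word S w r + y) by rewrite el; apply/rowP => j; rewrite !mxE; ring.
rewrite {1}ec; apply/rowP => j; rewrite !mxE; ring.
Qed.

(** If [y] is regular dominant and occurs, then [d = la + rho - y] is a nonnegative
    combination of positive coroots, so [B d y] and [B d (la + rho)] are nonnegative; the
    eigenvalue equation says that they add up to zero. *)
Lemma weyl_sum_regular y : regular y -> weyl_sum y = (y == la + r)%:R.
Proof.
move=> hy; have lar : Cplus S (la + r) by move=> i; rewrite pairD; apply: addr_ge0; [apply: la_dom|apply: rho_dom].
have key z : regular z -> weyl_sum z != 0 -> z = la + r.
  move=> hz nz; have [l [w [c [hl c0 _ e]]]] := weyl_sum_support nz.
  have eB : B z z = B (la + r) (la + r) by apply: (mulIf nz); apply: weyl_sum_eigen.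
  set d := la + r - z in e; have ez : z = la + r - d by rewrite /d opprB addrC subrK.
  have h1 : 0 <= B d z.
    by rewrite e BDl; have [? ?] := B_cone_ge0 c0 hl (regular_dom hz); apply: addr_ge0.
  have h2 : 0 <= B d (la + r).
    by rewrite e BDl; have [? ?] := B_cone_ge0 c0 hl lar; apply: addr_ge0.
  have e3 : B d z + B d (la + r) = B (la + r) (la + r) - B z z.
    by rewrite /d !BBl (B_sym _ z); ring.
  have d0 : B d d = 0 by rewrite {2}/d BBr; lra.
  by rewrite ez (B_def d0) subr0.
case: (eqVneq y (la + r)) => [->|ne]; last first.
  by apply/eqP/negPn/negP => /(key _ hy) /eqP; rewrite (negPf ne).
have W1 : 1%:M \in Ws by apply/Ws_mem; exists [::].
rewrite /weyl_sum /alt (bigD1_seq 1%:M) //= mulmx1 -[1%:M]/(wmx [::]) sgn_wmx mul1r.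
rewrite [- r + _]addrC addrK F_la big_seq_cond big1 ?addr0 // => M /andP[MW ne1].
case: (eqVneq (F (- (r *m M) + (la + r))) 0) => [->|/F_le[l hl el]]; first by rewrite mulr0.
have [w eM] := (Ws_mem M).1 MW; have [c [c0 ec]] := rho_word_cone w.
rewrite eM mul_wmx in el; set be := \sum_(a <- l) coroot a in el; set ga := \sum_i _ in ec.
have e0 : be + ga = 0.
  have eb : be = la - (- word S w r + (la + r)) by rewrite el; apply/rowP => j; rewrite !mxE; ring.
  have eg : ga = r - word S w r by rewrite [X in X - _]ec addrAC subrr add0r.
  by rewrite eb eg; apply/rowP => j; rewrite !mxE; ring.
have [h1 h2] := B_cone_ge0 c0 hl rho_dom.
have e4 : B be r + B ga r = 0 by rewrite -BDl e0 B0l.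
have g0 : B ga r = 0 by move: h1 h2; rewrite -/be -/ga; lra.
have eg : B ga ga = 0.
  have : B (word S w r) (word S w r) = B r r := B_word w r r.
  have -> : word S w r = r - ga by rewrite {2}ec addrK.
  rewrite !BBl !BBr (B_sym r ga) g0; lra.
have er : word S w r = r by rewrite [RHS]ec (B_def eg) addr0.
by rewrite eM (rho_stab er) eqxx in ne1.
Qed.

(** Both sides are antisymmetric and supported on regular orbits, where the eigenvalue
    equation leaves only [la + rho]. *)
Theorem weyl_character y : weyl_sum y = alt (la + r) (delta (- y)).
Proof.
apply/eqP; rewrite -subr_eq0; apply/eqP; move: y; apply: antisymmetric_eq0 => [i y|y hy].
  by rewrite weyl_sum_refl delta_refl alt_refl opprB opprK addrC.
rewrite weyl_sum_regular // alt_regular ?subrr // => i.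
by rewrite pairD pairS_rho ltr_wpDl ?la_dom.
Qed.

End Character.

(** At a point where [F] is nonzero and the height is maximal, the leading term of the
    denominator is not cancelled. *)
Lemma alt_rho_inj F : (exists s : seq A, forall x, F x != 0 -> x \in s) ->
  (forall y, alt r (fun x => F (x + y)) = 0) -> forall x, F x = 0.
Proof.
move=> [s hs] h0 x; apply/eqP/negPn/negP => hx.
have [z hz zmax] : exists2 z, F z != 0 & forall y, F y != 0 -> form y r <= form z r.
  have : [seq y <- s | F y != 0] != [::].
    have h : x \in [seq y <- s | F y != 0] by rewrite mem_filter hx hs.
    by apply/eqP => e; rewrite e in h.
  have mem y : (F y != 0) = (y \in [seq y <- s | F y != 0]).
    by rewrite mem_filter; case: (boolP (F y != 0)) => // /hs ->.
  move: mem; case: [seq y <- s | F y != 0] => // z0 l mem _.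
  have : exists2 z, z \in z0 :: l & forall y, y \in z0 :: l -> form y r <= form z r.
    elim: l z0 {mem} => [|z1 l IH] z0; first by exists z0; rewrite ?mem_head // => y; rewrite inE => /eqP ->.
    have [z zl hz] := IH z1; case: (lerP (form z r) (form z0 r)) => hle.
      exists z0; rewrite ?mem_head // => y; rewrite inE => /predU1P[-> //|/hz h].
      exact: le_trans h hle.
    exists z; first by rewrite inE zl orbT.
    by move=> y; rewrite inE => /predU1P[->|/hz //]; apply: ltW.
  by case=> z hz1 hz2; exists z; rewrite ?mem // => y; rewrite mem; apply: hz2.
have W1 : 1%:M \in Ws by apply/Ws_mem; exists [::].
have := h0 (z + r); rewrite /alt (bigD1_seq 1%:M) //= mulmx1 -[1%:M]/(wmx [::]) sgn_wmx mul1r.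
rewrite [- r + _]addrC addrK big_seq_cond big1 ?addr0 => [e|M /andP[MW ne1]]; first by rewrite e eqxx in hz.
have [w eM] := (Ws_mem M).1 MW; rewrite eM mul_wmx.
case: (eqVneq (F (- word S w r + (z + r))) 0) => [->|/zmax]; first by rewrite mulr0.
rewrite !formDl formNl => hle.
have e : form (r - word S w r) (r - word S w r) = 0.
  have := weyl_form_le (word_weyl w) rho_dom rho_dom; have := form_word w r r.
  by rewrite !formBl !formBr (formC r (word S w r)); lra.
have er : word S w r = r by apply/esym/eqP; rewrite -subr_eq0; apply/eqP/form_eq0.
by rewrite eM (rho_stab er) eqxx in ne1.
Qed.

End WeylGroup.

End CharacterFormula.

(** * Comparison of the two characters *)

Section Comparison.
Implicit Types (a b : Phi D) (x y z : A).
Local Notation r := (rho_v).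
Local Notation K := (R[i]).

(** The sum of a Weyl group orbit is invariant under all reflections, hence zero; if [x] is
    orthogonal to the coroots, every point of the orbit has the same product with [x]. *)
Lemma coroots_separate (x : A) : (forall b : Phi D, dot (coroot b) x = 0) -> x = 0.
Proof.
move=> hx; have [Ws [Ws_uniq Ws_mem]] := weyl_finite.
have hw w z : dot (word S w z) x = dot z x.
  elim: w => // i w IH; rewrite word_cons /refl dotBl dotZl hx mulr0 subr0.
  exact: IH.
suff h z : dot z x = 0 by apply: dot_inj => z; rewrite dot_sym h dot0l.
pose Z := \sum_(M <- Ws) z *m M.
have Z0 : Z = 0.
  apply: pairS_inj => i; rewrite pair0; have e : refl (S i) Z = Z.
    rewrite /Z refl_sum -[RHS](perm_big _ (Ws_refl_last Ws_uniq Ws_mem i)) big_map.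
    by apply: eq_bigr => M _; rewrite mulmxA mul_refmx.
  by have := pair_refl (S i) Z; rewrite e; lra.
have : dot Z x = (size Ws)%:R * dot z x.
  rewrite /Z dot_suml big_seq (eq_bigr (fun=> dot z x)) => [|M /Ws_mem[w ->]]; last by rewrite mul_wmx hw.
  by rewrite -big_seq big_const_seq count_predT iter_addr_0 mulr_natl.
rewrite Z0 dot0l => /esym/eqP; rewrite mulf_eq0 pnatr_eq0 => /orP[/nilP e|/eqP //].
by have : 1%:M \in Ws by [apply/Ws_mem; exists [::]]; rewrite e.
Qed.

Lemma coroots_separateC (x : 'rV[K]_n) :
  (forall b : Phi D, dot (map_mx intr (coroot_of b)) x = 0) -> x = 0.
Proof.
have real_part (f : K -> R) (y : 'rV[K]_n) : (forall u v, f (u + v) = f u + f v) ->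
    (forall (k : int) u, f (k%:~R * u) = k%:~R * f u) ->
    (forall b : Phi D, dot (map_mx intr (coroot_of b)) y = 0) -> map_mx f y = 0.
  move=> fD fZ hy; have f0 : f 0 = 0 by have := fD 0 0; rewrite addr0; lra.
  apply: coroots_separate => b; rewrite -f0 -(hy b) /dot (big_morph f fD f0).
  by apply: eq_bigr => i _; rewrite !mxE fZ.
have fz (k : int) (u : K) : k%:~R * u = (k%:~R : R)%:C%C * u by rewrite rmorph_int.
move=> hx; have hr : map_mx (@complex.Re R) x = 0.
  apply: real_part hx => [[? ?] [? ?] //|k [a b]].
  by rewrite fz /= mul0r subr0.
have hi : map_mx (@complex.Im R) x = 0.
  apply: real_part hx => [[? ?] [? ?] //|k [a b]].
  by rewrite fz /= mul0r addr0.
apply/rowP => i; move/rowP/(_ i): hr; move/rowP/(_ i): hi; rewrite !mxE.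
by case: (x 0 i) => a b /= -> ->.
Qed.

Lemma coroot_of_opp (b : Phi D) : coroot_of (opp_root b) = - coroot_of b.
Proof.
have /rowP h := coroot_opp b; apply/rowP => i; have := h i.
by rewrite !mxE -rmorphN => /intr_inj.
Qed.

(** The coroots of positive roots are positive: integrality of the coefficients is
    inherited along simple reflections, and their sign is that of the coefficients
    of the root. *)
Lemma pos_dual a : pos a -> positive_root (D := dual_datum D) S a.
Proof.
move=> pa; have [c hc] : exists c : 'I_n -> int, coroot_of a = \sum_i coroot_of (S i) *~ c i.
  move: a pa; apply: pos_ind => [i|i a pa ai [c hc]].
    exists (fun j => (j == i)%:Z); rewrite (bigD1 i) //= eqxx mulr1z big1 ?addr0 // => j ji.
    by rewrite (negPf ji) mulr0z.
  pose k := dot (root_of (S i)) (coroot_of a).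
  have e : coroot_of (root_refl (S i) a) = coroot_of a - k *: coroot_of (S i).
    apply/rowP => j; have /rowP/(_ j) := coroot_root_refl (S i) a.
    rewrite /refl pair_coroot -/k !mxE -rmorphM -rmorphB => /intr_inj ->.
    by [].
  exists (fun j => c j - (j == i)%:Z * k); rewrite e hc.
  under [RHS]eq_bigr do rewrite mulrzBr; rewrite sumrB; congr (_ - _).
  rewrite (bigD1 i) //= eqxx mul1r big1 ?addr0 => [|j ji]; last by rewrite (negPf ji) mul0r mulr0z.
  by rewrite -scaler_int intz.
have hcR : coroot a = \sum_i (c i)%:~R *: coroot (S i) :> A.
  rewrite /coroot hc; apply/rowP => j; rewrite !mxE !summxE rmorph_sum; apply: eq_bigr => i _.
  by rewrite -scaler_int intz !mxE rmorphM.
have c0 i : 0 <= c i.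
  rewrite -(ler0z R); have h1 := form_coroot a (omega i).
  have h2 : form (coroot a) (omega i) = (c i)%:~R * form (coroot (S i)) (omega i).
    have f0 : form 0 (omega i) = 0 by rewrite -(scale0r (0 : A)) formZl mul0r.
    rewrite hcR (big_morph (fun u => form u (omega i)) (fun z1 z2 => formDl z1 z2 _) f0).
    rewrite (bigD1 i) //= big1 ?addr0 ?formZl // => j ji.
    have := form_coroot (S j) (omega i); rewrite omegaP eq_sym (negPf ji) mulr0 formZl => h.
    by rewrite (_ : form _ _ = 0) ?mulr0 //; lra.
  have h3 := form_coroot (S i) (omega i); rewrite omegaP eqxx mulr1 in h3.
  have h4 := form_coroot_gt0 a; have h5 := form_coroot_gt0 (S i).
  have h6 : 0 <= pair a (omega i) := pos_ge0 pa (omega_dom i).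
  have h7 : 0 <= form (coroot a) (omega i) by nra.
  by rewrite h2 in h7; rewrite -(pmulr_lge0 _ (_ : 0 < form (coroot (S i)) (omega i))) //; lra.
apply/asboolP; exists (fun i => `|c i|%N); rewrite [LHS]hc; apply: eq_bigr => i _.
by rewrite -{1}(gez0_abs (c0 i)) pmulrn.
Qed.

(** ** Both characters satisfy Weyl's formula *)

Section Multiplicities.
Variables (g : lieAlgebra K) (io : 'Hom('rV[K]_n, g)).
Hypothesis gP : is_lie_algebra_of io (dual_datum D).
Variables (V : vectType K) (rho : 'Hom(g, 'End(V))).
Hypothesis V_rep : is_rep rho.
Hypothesis V_irr : irreducible_rep rho.
Variable la : A.
Hypothesis la_dominant : dominant_coweight S la.
Hypothesis V_hw : has_highest_weight io (D := dual_datum D) S rho (complexify la).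
Variable p : profile R n.
Hypothesis p_ok : profile_ok p.
Hypothesis p_end : vert p (straight p) (psize p) = la.
Local Notation N := (psize p).

(** Both multiplicity functions have the same product with the Weyl denominator. *)
Lemma path_multiplicities : exists L : seq (seq A),
  [/\ uniq L, forall s, s \in L <-> model p s,
      forall mu, (\dim (weight_space io rho (complexify mu)))%:Z = end_mult p L mu,
      forall M, weight_space io rho M != 0%VS -> exists mu, M = complexify mu
    & exists U : seq A, forall mu, weight_space io rho (complexify mu) != 0%VS -> mu \in U].
Proof.
have [L [L_uniq L_mem]] := models_finite p; exists L.
have [Ws [Ws_uniq Ws_mem]] := weyl_finite.
have [la_dom la_int] := la_dominant; have [v [v0 v_wt v_hw]] := V_hw.
pose hgt : A := \sum_(a : Phi D) pair a r *: map_mx intr (root_of a).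
have hgt_gt0 b : pos b -> 0 < dot (map_mx intr (coroot_of b)) hgt.
  move=> pb; rewrite dot_sym /hgt dot_suml; have := form_coroot_rho pb.
  by congr (0 < _); apply: eq_bigr => a _; rewrite dotZl mulrC.
have v_hw' b (x : g) : pos b -> x \in weight_space io (ad g) (map_mx intr (coroot_of b)) -> rho x v = 0.
  by move=> pb; apply: v_hw; apply: pos_dual.
have la_int' b : dot la (map_mx intr (root_of b)) \is a Num.int by rewrite dot_sym; apply: la_int.
have [m [T [[m_dim m_real] [m_la m_le] [m_refl [U hU]] m_cas T_shift]]] :=
  multiplicities_exist gP coroots_separateC coroot_of_opp V_rep V_irr pos_opp la_int' v0 v_wt v_hw' hgt_gt0.
pose B := wform coroots_separateC.
pose kap b := 2 / @rnorm R n D b.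
have B_sym x y : B x y = B y x by rewrite /B /wform formC.
have B_lin c x y z : B (c *: x + y) z = c * B x z + B y z.
  by rewrite /B /wform mulmxDl -scalemxAl formDl formZl.
have B_def x : B x x = 0 -> x = 0.
  move=> /(rdot_eq0 coroots_separateC) h; apply: dot_inj => z.
  rewrite dot0l -(inv_gramP coroots_separateC x z) h.
  by apply: big1 => b _; rewrite pair0 mul0r.
have kap_gt0 b : 0 < kap b by rewrite divr_gt0 // rnorm_gt0 //; apply: coroots_separateC.
have B_coroot x a : B x (coroot a) = kap a * pair a x.
  by rewrite /B wform_rcr dot_sym.
pose F x : R := (m x)%:R.
have F_fin : exists s : seq A, forall x, F x != 0 -> x \in s.
  by exists U => x; rewrite pnatr_eq0; apply: hU.
have char y := @weyl_character Ws Ws_uniq Ws_mem B kap B_sym B_lin B_def kap_gt0 B_coroot F T la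
   la_dom (congr1 _ m_la) _ _ F_fin m_cas T_shift y.
have {}char y : alt Ws r (fun x => F (x + y)) = alt Ws (la + r) (delta (- y)).
  apply: char => [x|a x]; first by rewrite pnatr_eq0; apply: m_le.
  by rewrite /F /refl -[pair a x]dot_sym m_refl.
have paths y : alt Ws r (fun x => (end_mult p L (x + y))%:~R) = alt Ws (la + r) (delta (- y)).
  have := congr1 (fun k : int => k%:~R : R) (path_character p_ok L_uniq L_mem Ws_uniq Ws_mem y).
  rewrite p_end => h; transitivity ((alt_coef Ws (la + r) y)%:~R : R).
    by rewrite -h rmorph_sum; apply: eq_bigr => M _; rewrite rmorphM /= addrC.
  rewrite /alt_coef rmorph_sum.
  by apply: eq_bigr => M _; rewrite rmorphM /delta eqr_opp rmorph_nat.
have em_fin x : end_mult p L x != 0 -> x \in [seq vert p s N | s <- L].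
  apply: contraNT => hx; rewrite /end_mult big_seq big1 // => s sL.
  by case: eqP => // e; case/negP: hx; rewrite -e; apply: map_f.
have eq_mult x : F x = (end_mult p L x)%:~R.
  apply/eqP; rewrite -subr_eq0; apply/eqP; move: x.
  apply: (@alt_rho_inj Ws Ws_uniq Ws_mem (fun x => F x - (end_mult p L x)%:~R)).
    exists (U ++ [seq vert p s N | s <- L]) => x; rewrite mem_cat.
    case: (eqVneq (m x) 0%N) => [mx|/hU -> //]; rewrite /F mx sub0r oppr_eq0 intr_eq0 => /em_fin ->.
    by rewrite orbT.
  move=> y; transitivity (alt Ws r (fun x => F (x + y)) - alt Ws r (fun x => (end_mult p L (x + y))%:~R)).
    by rewrite /alt -sumrB; apply: eq_bigr => M _; rewrite mulrBr.
  by rewrite char paths subrr.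
split=> //.
  by move=> mu; apply: (@intr_inj R); rewrite -eq_mult /F -m_dim.
by exists U => mu; rewrite -dimv_eq0 m_dim; apply: hU.
Qed.

End Multiplicities.

(** The reference gallery only enters through the lengths and the directions of its edges. *)
Lemma path_galleries (gam : 'I_n -> gallery R n) (js : seq 'I_n) :
  (forall i, fundamental_gallery D (omega i) (gam i)) ->
  let gla := gal_concat [seq gam j | j <- js] in let la := \sum_(j <- js) omega j in
  exists p, [/\ profile_ok p, vert p (straight p) (psize p) = la
    & LS_galleries S la gla = gal_of p @` [set s | model p s]].
Proof.
move=> gamP gla la; have [l [l_ok l0 [gs g0 gv ge] pe]] := shape_concat js gamP.
pose p := profile_of l; have p_ok := steps_profile_ok l_ok l0.
have hP k : (k <= psize p)%N -> vert p (straight p) k = point l k.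
  move=> kN; apply: eq_bigr => j _; rewrite nth_straight //.
  exact: leq_trans (ltn_ord j) kN.
have p_end : vert p (straight p) (psize p) = la by rewrite hP.
exists p; split=> //; rewrite -p_end; apply: LS_galleriesE => //.
- by move=> k kN; rewrite hP //; have [] := gv k kN.
- by move=> k kN; rewrite hP //; have [<-] := gv k kN.
- by move=> k kN; have [] := ge k kN.
- by move=> k kN; rewrite hP 1?ltnW //; have [<- _] := gv k (ltnW kN); have [] := ge k kN.
by move=> k kN; rewrite hP //; have [<- _] := gv k.+1 kN; have [] := ge k kN.
Qed.

End Comparison.

End Apartment.

Lemma malgU_sum (T : choiceType) (k : T) (I : Type) (s : seq I) (F : I -> int) :
  << \sum_(i <- s) F i *g k >> = \sum_(i <- s) << F i *g k >>.
Proof. exact: (big_morph (mkmalgU k) (monalgUD k) (monalgU0 k)). Qed.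

Theorem corollary4 (R : realType) (n : nat) (D : rootDatum n)
  (D_reduced : reduced_datum D) (D_semisimple : semisimple_datum D)
  (S : 'I_n -> Phi D) (S_base : is_base S)
  (omega : 'I_n -> 'rV[R]_n)
  (omegaP : forall i j, pair (S j) (omega i) = (i == j)%:R)
  (la : 'rV[R]_n) (la_dominant : dominant_coweight S la)
  (s : seq 'I_n) (la_sum : \sum_(j <- s) omega j = la)
  (gam : 'I_n -> gallery R n)
  (gamP : forall i, fundamental_gallery D (omega i) (gam i))
  (g : lieAlgebra R[i]) (iota : 'Hom('rV[R[i]]_n, g))
  (gP : is_lie_algebra_of iota (dual_datum D))
  (V : vectType R[i]) (rho : 'Hom(g, 'End(V)))
  (V_rep : is_rep rho) (V_irr : irreducible_rep rho)
  (V_hw : has_highest_weight iota (D := dual_datum D) S rho (complexify la)) :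
  let LS := LS_galleries S la (gal_concat [seq gam j | j <- s]) in
  finite_set LS /\
  character iota rho = \sum_(d \in LS) << 1%:Z *g complexify (target d) >>.
Proof.
move=> LS; have [p [p_ok p_end]] := path_galleries D_reduced S_base omegaP s gamP.
rewrite la_sum -/LS in p_end * => eLS.
have [L [L_uniq L_mem m_eq m_real [U hU]]] :=
  path_multiplicities D_reduced S_base omegaP gP V_rep V_irr la_dominant V_hw p_ok p_end.
have eL : [set t | model S p t] = [set` L].
  by apply/seteqP; split=> t /L_mem.
have inj : set_inj [set` L] (gal_of D p).
  by move=> t t'; rewrite !inE /= => /L_mem h /L_mem h'; exact: (gal_of_inj p_ok h h').
have fin : finite_set LS by rewrite eLS eL; apply: finite_image; apply: finite_seq.
split=> //; rewrite eLS eL fsbig_image // -fsbig_seq // /character.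
pose W := undup (U ++ [seq vert p t (psize p) | t <- L]).
have cx_inj : injective (@complexify R n).
  by move=> u v /rowP h; apply/rowP => i; have := h i; rewrite !mxE => /complexI.
rewrite -(fsbig_widen [set` [seq complexify mu | mu <- W]]) => [|//|M [_ /= hM]]; last first.
  have -> : weight_space iota rho M = 0%VS; last by rewrite dimv0 monalgU0.
  apply/eqP/negPn/negP => h0; have [mu eM] := m_real _ h0; apply: hM; rewrite eM map_f //.
  by have muU : mu \in U; [apply: hU; rewrite -eM|rewrite mem_undup mem_cat muU].
rewrite -fsbig_seq ?map_inj_uniq ?undup_uniq // big_map.
transitivity (\sum_(mu <- W) \sum_(t <- L) << (vert p t (psize p) == mu)%:Z *g complexify mu >>).
  apply: eq_bigr => mu _; rewrite m_eq /end_mult.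
  rewrite malgU_sum; apply: eq_bigr => t _; congr (<< _ *g _ >>).
  by case: (_ == _).
rewrite exchange_big /= big_seq [RHS]big_seq; apply: eq_bigr => t tL.
have tW : vert p t (psize p) \in W by rewrite mem_undup mem_cat; apply/orP; right; apply: map_f.
rewrite (bigD1_seq (vert p t (psize p))) ?undup_uniq //= eqxx big1 ?addr0 => [|mu ne].
  by rewrite (target_gal_of).
by rewrite eq_sym (negPf ne) monalgU0.
Qed.
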